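(* Let $\alpha,\nu>0$ and, for $N\in\mathbb N$, let $G(N;\alpha,\nu)$ be the KPKVB random graph described in the context. Let $\mathcal C_{(1)}$ and $\mathcal C_{(2)}$ denote the largest and second largest connected components of $G(N;\alpha,\nu)$ (ties broken lexicographically). For every $\nu,\alpha>0$ there exists a constant $c=c(\alpha,\nu)$ such that \[ \frac{|\mathcal C_{(1)}|}{N}\to c \quad\text{and}\quad \frac{|\mathcal C_{(2)}|}{N}\to 0 \quad\text{in probability as } N\to\infty. \] Moreover the function $c(\alpha,\nu)$ has the following properties: (i) if $\alpha>1$ and $\nu$ is arbitrary then $c=0$; (ii) if $\alpha<1$ and $\nu$ is arbitrary then $c>0$; (iii) there exists a critical value $0<\nu_c<\infty$ such that, for $\alpha=1$: if $\nu<\nu_c$ then $c=0$, and if $\nu>\nu_c$ then $c>0$; (iv) $c=1$ if and only if $\alpha\le \frac12$; (v) $c$ is continuous on $(0,\infty)^2\setminus\big(\{1\}\times[\nu_c,\infty)\big)$, and every point of $\{1\}\times(\nu_c,\infty)$ is a point of discontinuity of $c$; (vi) $c$ is strictly decreasing in $\alpha$ on $(\frac12,1)\times(0,\infty)$ and strictly increasing in $\nu$ on $\big((\frac12,1)\times(0,\infty)\big)\cup\big(\{1\}\times(\nu_c,\infty)\big)$.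
   Context: The KPKVB model $G(N;\alpha,\nu)$: given $N\in\mathbb N$ and $\alpha,\nu>0$, set $R:=2\log(N/\nu)$. In the hyperbolic plane of curvature $-1$ (e.g. the Poincaré disk), consider the disk $\mathcal D_R$ of hyperbolic radius $R$ centred at the origin $O$. Choose $N$ points independently, each with polar coordinates $(r,\vartheta)$ where $r$ and $\vartheta$ are independent, $\vartheta$ is uniform on $(0,2\pi]$, and $r$ has cumulative distribution function $F(r)=\frac{\cosh(\alpha r)-1}{\cosh(\alpha R)-1}$ for $0\le r\le R$ (and $0$ for $r<0$, $1$ for $r>R$). The graph has these $N$ points as vertices, two vertices being adjacent if and only if their hyperbolic distance is at most $R$. *)

(* Defs.v *)
From HB Require Import structures.
From mathcomp Require Import all_boot all_order all_algebra.
From mathcomp Require Import all_classical all_reals all_analysis.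
Set Implicit Arguments. Unset Strict Implicit. Unset Printing Implicit Defensive.
Import Order.TTheory GRing.Theory Num.Theory.
Import numFieldNormedType.Exports.
Local Open Scope classical_set_scope.
Local Open Scope ring_scope.

Section KPKVB.
Variable R : realType.

Definition rcosh (x : R) : R := (expR x + expR (- x)) / 2.
Definition rsinh (x : R) : R := (expR x - expR (- x)) / 2.
Definition rarcosh (x : R) : R := ln (x + Num.sqrt (x ^+ 2 - 1)).

(* hyperbolic distance (curvature -1) between points given in polar
   coordinates (r, theta) around the origin O: hyperbolic law of cosines *)
Definition hdist (p q : R * R) : R :=
  rarcosh (rcosh p.1 * rcosh q.1 - rsinh p.1 * rsinh q.1 * cos (p.2 - q.2)).

Definition kpkvb_radius (N : nat) (nu : R) : R := 2 * ln (N%:R / nu).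

Definition radial_cdf (alpha Rad t : R) : R :=
  if t < 0 then 0
  else if Rad < t then 1
  else (rcosh (alpha * t) - 1) / (rcosh (alpha * Rad) - 1).

Definition angle_cdf (t : R) : R :=
  if t <= 0 then 0 else if 2 * pi < t then 1 else t / (2 * pi).

Definition kpkvb_adj (N : nat) (nu : R) (pts : 'I_N -> R * R) : rel 'I_N :=
  fun i j => (i != j) && (hdist (pts i) (pts j) <= kpkvb_radius N nu).

End KPKVB.

Definition comp_size (T : finType) (e : rel T) (i : T) : nat :=
  #|[set j | connect e i j]|.

Definition largest_comp_size (T : finType) (e : rel T) : nat :=
  (\max_(i : T) comp_size e i)%N.

(* size of the second largest component: the largest component among those
   different from a chosen largest one (the choice does not affect the size) *)
Definition second_comp_size (T : finType) (e : rel T) : nat :=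
  match [pick v | comp_size e v == largest_comp_size e] with
  | Some v => (\max_(i | ~~ connect e v i) comp_size e i)%N
  | None => 0%N
  end.

(* The random positions (rad N i, ang N i), i < N, are those of G(N;alpha,nu):
   the 2N random variables are measurable and mutually independent, with
   rad N i having cdf F and ang N i uniform on (0,2pi] (joint cdf = product). *)
Definition kpkvb_sample (R : realType) (d : measure_display) (T : measurableType d)
    (P : probability T R) (alpha nu : R)
    (rad ang : forall N : nat, 'I_N -> T -> R) : Prop :=
  forall N : nat, nu < N%:R ->
    (forall i, measurable_fun setT (rad N i)) /\
    (forall i, measurable_fun setT (ang N i)) /\
    (forall a b : 'I_N -> R,
       P (\bigcap_(i in [set: 'I_N]) ([set w | rad N i w <= a i] `&` [set w | ang N i w <= b i]))
       = (\prod_(i < N) (radial_cdf alpha (kpkvb_radius N nu) (a i) * angle_cdf (b i)))%:E).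

Definition kpkvb_graph (R : realType) (T : Type) (nu : R)
    (rad ang : forall N : nat, 'I_N -> T -> R) (N : nat) (w : T) : rel 'I_N :=
  kpkvb_adj nu (fun i => (rad N i w, ang N i w)).
Arguments kpkvb_graph {R T} nu rad ang N w.

(* Main.v *)
(* With the angle measured in units of 2 pi / N and the radius replaced by its distribution
   function u, vertices (x, u) and (x', u') are adjacent, up to vanishing errors, when
   |x - x'| <= k (u u')^(-b), where k = nu / pi and b = 1 / (2 alpha). A mesh of side 1/m turns
   the limiting Poisson graph into Bernoulli site percolation on grids, and an ultrafilter
   in m replaces the limit m -> oo. The constant c is the probability that a vertex of uniform
   height is connected to points at distance l or of height at most 1/l, as l -> oo, and c = 1
   for alpha <= 1/2.
   Vertices in small components are counted by a second moment argument, which bounds the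
   giant from above. From below: for b > 1/2 a dyadic ladder of heights joins all low vertices;
   for b = 1/2, if c > 0, windows of every scale are crossed, and crossings glue the vertices
   reaching small heights; for alpha <= 1/2 the low vertices form a clique seen by almost every
   point. If b < 1/2 empty wedges cut the line, hence c = 0; at b = 1/2 a recursion over scales
   shows that c = 0 for small k, and one over blocks that c > 0 for large k. Strict monotonicity
   comes from inserting a vertex which is adjacent to the root in the larger graph only.
   Monotone events are transferred from Bernoulli samples to N uniform points by comparing
   their densities on the slices of the cube. *)
Require Import Defs.
From HB Require Import structures.
From mathcomp Require Import all_boot all_order all_algebra.
From mathcomp Require Import all_classical all_reals all_analysis measurable_realfun.
From mathcomp Require Import ring lra zify.
Set Implicit Arguments. Unset Strict Implicit. Unset Printing Implicit Defensive.
Import Order.TTheory GRing.Theory Num.Theory.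
Import numFieldNormedType.Exports.
Local Open Scope ring_scope.

(** Everything random is a finite sum: [wt], [Ex] and [Pr] run over the subsets of a finite grid.
    The mesh is never sent to a limit: an estimate holds for ultrafilter-many m or its negation
    does, so [cc] behaves as a limit without any convergence in m, and at the very end a single good
    mesh is picked. The order of choices is accuracy, then N, then m.

    The obstacle is the loss of translation invariance: lines are finite and may end near the vertex
    under study. So [cc] is built from a bound valid on all lines and columns, and [DL_transfer]
    carries probabilities restricted to a window from one line to another. Windows cost little
    because vertices reaching far are low, hence few ([tail_mass]). This uses b < 1; at alpha <= 1/2
    the value 1 is set by definition, and continuity at alpha = 1/2 rests on [cc_near1].

    The hyperbolic graph is enclosed between two grid graphs: [eplus] contains every edge possible
    for points known only up to their cells, [eminus] only the edges that are certain. *)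

Module Fin.
Export mathcomp.boot.fintype mathcomp.boot.finset.
End Fin.

Definition tails (UF : set_system nat) : Prop := forall m0, UF (fun m => (m0 <= m)%N).

(** * Independent occupation of finitely many sites *)

Section Bernoulli.
Import Fin.
Variables (R : realType) (V : finType).
Implicit Types (p : V -> R) (f g : {set V} -> R) (w S : {set V}) (A B : {set V} -> bool).

Definition wt p w : R := \prod_v (if v \in w then p v else 1 - p v).
Definition Ex p f : R := \sum_w wt p w * f w.
Definition Pr p A : R := Ex p (fun w => (A w)%:R).
Definition prob p := forall v, 0 <= p v <= 1.
(** Measurability with respect to the sites of [S]; disjoint supports give independence ([ExM]). *)
Definition dep (T : Type) S (f : {set V} -> T) := forall w, f (w :&: S) = f w.

Lemma wt_ge0 p w : prob p -> 0 <= wt p w.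
Proof.
by move=> hp; apply: prodr_ge0 => v _; have := hp v; case: ifP; lra.
Qed.

Lemma wt_sum p : \sum_w wt p w = 1.
Proof.
rewrite /wt -(bigA_distr _ _ (fun v => p v) (fun v => 1 - p v)) /=.
by apply: big1 => v _; rewrite addrCA subrr addr0.
Qed.

Lemma Ex_cst p c : Ex p (fun _ => c) = c.
Proof. by rewrite /Ex -big_distrl /= wt_sum mul1r. Qed.

Lemma eq_Ex p f g : f =1 g -> Ex p f = Ex p g.
Proof. by move=> e; apply: eq_bigr => w _; rewrite e. Qed.

Lemma Ex_le p f g : prob p -> (forall w, f w <= g w) -> Ex p f <= Ex p g.
Proof. by move=> hp e; apply: ler_sum => w _; rewrite ler_wpM2l ?wt_ge0. Qed.

Lemma Ex_ge0 p f : prob p -> (forall w, 0 <= f w) -> 0 <= Ex p f.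
Proof. by move=> hp e; apply: sumr_ge0 => w _; rewrite mulr_ge0 ?wt_ge0. Qed.

Lemma ExD p f g : Ex p (fun w => f w + g w) = Ex p f + Ex p g.
Proof. by rewrite /Ex -big_split /=; apply: eq_bigr => w _; rewrite mulrDr. Qed.

Lemma ExZ p c f : Ex p (fun w => c * f w) = c * Ex p f.
Proof. by rewrite /Ex big_distrr /=; apply: eq_bigr => w _; rewrite mulrCA. Qed.

Lemma Ex_sum (I : Type) (r : seq I) (Q : pred I) p (F : I -> {set V} -> R) :
  Ex p (fun w => \sum_(i <- r | Q i) F i w) = \sum_(i <- r | Q i) Ex p (F i).
Proof.
rewrite /Ex exchange_big /=; apply: eq_bigr => w _.
by rewrite big_distrr.
Qed.

Lemma Pr_ge0 p A : prob p -> 0 <= Pr p A.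
Proof. by move=> hp; apply: Ex_ge0 => // w; rewrite ler0n. Qed.

Lemma Pr_le p A B : prob p -> (forall w, A w -> B w) -> Pr p A <= Pr p B.
Proof.
move=> hp h; apply: Ex_le => // w; rewrite ler_nat.
by move: (h w); case: (A w) => // ->.
Qed.

Lemma eq_Pr p A B : A =1 B -> Pr p A = Pr p B.
Proof. by move=> e; apply: eq_Ex => w; rewrite e. Qed.

Lemma Pr_le1 p A : prob p -> Pr p A <= 1.
Proof.
move=> hp; rewrite -(Ex_cst p 1); apply: Ex_le => // w.
by rewrite lern1 leq_b1.
Qed.

Lemma PrC p A : Pr p (fun w => ~~ A w) = 1 - Pr p A.
Proof.
apply: (addIr (Pr p A)); rewrite subrK -ExD -[RHS](Ex_cst p); apply: eq_Ex => w.
by case: (A w); rewrite ?addr0 ?add0r.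
Qed.

Lemma Pr_or p A B : prob p -> Pr p (fun w => A w || B w) <= Pr p A + Pr p B.
Proof.
move=> hp; rewrite /Pr -ExD; apply: Ex_le => // w.
by case: (A w); case: (B w); rewrite /= ?addr0 ?add0r ?lexx // lerDl ler01.
Qed.

Lemma Pr_le_or p A B C : prob p -> (forall w, A w -> B w || C w) ->
  Pr p A <= Pr p B + Pr p C.
Proof. by move=> hp h; apply: le_trans (Pr_or _ _ hp); apply: Pr_le. Qed.

Lemma Pr_exists (I : finType) (Q : pred I) p (F : I -> {set V} -> bool) : prob p ->
  Pr p (fun w => [exists (i | Q i), F i w]) <= \sum_(i | Q i) Pr p (F i).
Proof.
move=> hp; have := @Ex_sum I (index_enum I) Q p (fun i w => (F i w)%:R).
rewrite /Pr => <-; apply: Ex_le => // w.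
case: existsP => [[i /andP[Qi Fi]]|_]; last by apply: sumr_ge0.
by rewrite (bigD1 i) //= Fi lerDl sumr_ge0.
Qed.

Lemma markov p f t : prob p -> (forall w, 0 <= f w) -> 0 < t ->
  Pr p (fun w => t <= f w) <= Ex p f / t.
Proof.
move=> hp h t0; rewrite mulrC -ExZ /Pr; apply: Ex_le => // w.
rewrite mulrC ler_pdivlMr //; case: (boolP (t <= f w)) => [|_]; first by rewrite mul1r.
by rewrite mul0r.
Qed.

Lemma chebyshev p f t (mu := Ex p f) : prob p -> 0 < t ->
  Pr p (fun w => t <= `|f w - mu|) <= (Ex p (fun w => f w ^+ 2) - mu ^+ 2) / t ^+ 2.
Proof.
move=> hp t0.
have -> : Ex p (fun w => f w ^+ 2) - mu ^+ 2 = Ex p (fun w => (f w - mu) ^+ 2).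
  have -> : Ex p (fun w => (f w - mu) ^+ 2) =
    Ex p (fun w => f w ^+ 2 + ((-2 * mu) * f w + mu ^+ 2)).
    by apply: eq_Ex => w; ring.
  by rewrite ExD ExD ExZ Ex_cst -/mu; ring.
apply: le_trans (markov _ _ _) => //; last by rewrite exprn_gt0.
  apply: Pr_le => // w h; rewrite -(real_normK (num_real (f w - mu))).
  by rewrite ler_sqr ?nnegrE ?normr_ge0 // ltW.
by move=> w; rewrite sqr_ge0.
Qed.

Definition swp S w w' : {set V} := (w :\: S) :|: (w' :&: S).

Lemma in_swp S w w' v : (v \in swp S w w') = if v \in S then v \in w' else v \in w.
Proof. by rewrite !inE; case: (v \in S); rewrite ?andbT ?andbF ?orbF. Qed.

(* Exchanging the restrictions to [S] of two independent samples preserves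
   their joint law; independence and marginalization both follow from it. *)
Lemma swap_sum p p' S (F : {set V} -> {set V} -> R) :
  (forall v, v \in S -> p v = p' v) ->
  \sum_w \sum_w' wt p w * wt p' w' * F w w' =
  \sum_w \sum_w' wt p w * wt p' w' * F (swp S w w') (swp S w' w).
Proof.
move=> e; rewrite !pair_big /=.
have K : involutive (fun q : {set V} * {set V} => (swp S q.1 q.2, swp S q.2 q.1)).
  by case=> w w' /=; congr (_, _); apply/setP => v; rewrite !in_swp; case: (v \in S).
rewrite (reindex_inj (inv_inj K)) /=; apply: eq_bigr => -[w w'] _ /=; congr (_ * _).
rewrite /wt -!big_split /=; apply: eq_bigr => v _; rewrite !in_swp.
by case: (boolP (v \in S)) => // /e ->; rewrite mulrC.
Qed.

Lemma dep_swp (T : Type) S (f : {set V} -> T) w w' : dep S f ->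
  f (swp S w w') = f w'.
Proof.
move=> h; rewrite -h -[RHS]h; congr f; apply/setP => v.
by rewrite !inE; case: (v \in S); rewrite ?andbT ?andbF ?orbF.
Qed.

Lemma dep_swpC (T : Type) S (f : {set V} -> T) w w' : dep (~: S) f ->
  f (swp S w w') = f w.
Proof.
move=> h; rewrite -h -[RHS]h; congr f; apply/setP => v.
by rewrite !inE; case: (v \in S); rewrite ?andbT ?andbF ?orbF.
Qed.

Lemma dep_sub (T : Type) S S' (f : {set V} -> T) : S \subset S' -> dep S f -> dep S' f.
Proof. by move=> ss h w; rewrite -h -[RHS]h -setIA (setIidPr ss). Qed.

Lemma ExM p f g S S' : [disjoint S & S'] -> dep S f -> dep S' g ->
  Ex p (fun w => f w * g w) = Ex p f * Ex p g.
Proof.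
move=> dS df dg.
have dg' : dep (~: S) g by apply: dep_sub dg; rewrite -disjoints_subset disjoint_sym.
have -> : Ex p (fun w => f w * g w) = \sum_w \sum_w' wt p w * wt p w' * (f w * g w).
  apply: eq_bigr => w _; rewrite -big_distrl -big_distrr /= wt_sum mulr1; ring.
(* After the exchange [f] sees only [w'] and [g] only [w], so the double sum factors. *)
rewrite (@swap_sum p p S (fun w _ => f w * g w)) // /Ex mulrC big_distrlr /=.
apply: eq_bigr => w _; apply: eq_bigr => w' _.
by rewrite (dep_swp _ _ df) (dep_swpC _ _ dg'); ring.
Qed.

Lemma PrI p A B S S' : [disjoint S & S'] -> dep S A -> dep S' B ->
  Pr p (fun w => A w && B w) = Pr p A * Pr p B.
Proof.
move=> dS dA dB; rewrite -(@ExM p _ _ S S') //.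
- by apply: eq_Ex => w; rewrite -natrM mulnb.
- by move=> w; rewrite dA.
- by move=> w; rewrite dB.
Qed.

Definition vac S : {set V} -> bool := fun w => w :&: S == set0.

Lemma dep_vac S : dep S (vac S).
Proof. by move=> w; rewrite /vac -setIA setIid. Qed.

Lemma Pr_vac p S : Pr p (vac S) = \prod_(v in S) (1 - p v).
Proof.
rewrite /Pr /Ex /wt.
rewrite (eq_bigr (fun w : {set V} =>
   \prod_v (if v \in w then (if v \in S then 0 else p v) else 1 - p v))).
  rewrite -(bigA_distr _ _ (fun v => if v \in S then 0 else p v) (fun v => 1 - p v)) /=.
  rewrite [RHS]big_mkcond; apply: eq_bigr => v _.
  by case: ifP => _; rewrite ?add0r // addrCA subrr addr0.
move=> w _; have [h|] := boolP (vac S w).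
  rewrite mulr1; apply: eq_bigr => v _; case: ifP => // vw; case: ifP => // vS.
  by move/eqP/setP/(_ v): h; rewrite !inE vw vS.
rewrite mulr0 => /set0Pn[v]; rewrite inE => /andP[vw vS].
by rewrite (bigD1 v) //= vw vS mul0r.
Qed.

Lemma Pr_in p v : Pr p (fun w => v \in w) = p v.
Proof.
have -> : Pr p (fun w => v \in w) = 1 - Pr p (vac [set v]).
  rewrite -PrC; apply: eq_Pr => w; rewrite /vac.
  apply/idP/set0Pn => [vw|[u]]; first by exists v; rewrite !inE vw eqxx.
  by rewrite !inE => /andP[uw /eqP <-].
by rewrite Pr_vac big_set1; ring.
Qed.

(** The discrete Mecke formula: [f (v |: w)] does not look at the state of [v], so it is independent
    of the indicator of [v \in w], and on that event it agrees with [f w]. *)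
Lemma mecke p v f : Ex p (fun w => (v \in w)%:R * f w) = p v * Ex p (fun w => f (v |: w)).
Proof.
rewrite -(Pr_in p v) -(@ExM p _ _ [set v] (~: [set v])).
- apply: eq_Ex => w; case: (boolP (v \in w)) => vw; last by rewrite !mul0r.
  by rewrite (setUidPr _) // sub1set.
- by rewrite disjoints_subset setCK.
- by move=> w; rewrite !inE eqxx andbT.
- move=> w; congr f; apply/setP => u; rewrite !inE; case: eqP => //= _; exact: andbT.
Qed.

Lemma Pr_mecke p v A : Pr p (fun w => (v \in w) && A w) = p v * Pr p (fun w => A (v |: w)).
Proof.
by rewrite -(mecke p v (fun w => (A w)%:R)); apply: eq_Ex => w; rewrite -natrM mulnb.
Qed.

Lemma Pr_hit p S : prob p -> Pr p (fun w => ~~ vac S w) <= \sum_(v in S) p v.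
Proof.
move=> hp; rewrite -(eq_bigr _ (fun v _ => Pr_in p v)).
apply: le_trans (Pr_exists _ (fun v w => v \in w) hp); apply: Pr_le => // w.
by case/set0Pn => v; rewrite inE => /andP[vw vS]; apply/existsP; exists v; rewrite vw vS.
Qed.

End Bernoulli.

(** * Marginals along an injection *)

Section Transfer.
Import Fin.
Variables (R : realType) (V W : finType) (f : W -> V).
Hypothesis finj : injective f.

Lemma Ex_preim (p : V -> R) (F : {set W} -> R) :
  Ex p (fun w => F (f @^-1: w)) = Ex (p \o f) F.
Proof.
rewrite /Ex (partition_big (fun w : {set V} => f @^-1: w) xpredT) //=.
apply: eq_bigr => u _.
rewrite (eq_bigr (fun w : {set V} => wt p w * F u)); last by move=> w /eqP ->.
rewrite -big_distrl /=; congr (_ * _); rewrite /wt.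
(* Occupation weights in which the states forbidden by [f @^-1: w = u] get weight 0: the sum over
   the fibre becomes a sum over all sets, hence a product over sites. *)
pose P1 v := if v \in f @: setT then (if v \in f @: u then p v else 0) else p v.
pose P2 v := if v \in f @: setT then (if v \in f @: u then 0 else 1 - p v) else 1 - p v.
transitivity (\sum_(w : {set V}) \prod_v (if v \in w then P1 v else P2 v)); last first.
  rewrite -(bigA_distr _ _ P1 P2) /= (bigID (mem (f @: setT))) /= [X in _ * X]big1 ?mulr1.
    rewrite big_imset /=; last by move=> ? ? _ _ /finj.
    rewrite (eq_bigl xpredT) //; last by move=> i; rewrite inE.
    apply: eq_bigr => i _; rewrite /P1 /P2 (imset_f _ (in_setT i)) mem_imset //.
    by case: (i \in u); rewrite ?addr0 ?add0r.
  by move=> v /negbTE h; rewrite /P1 /P2 h addrCA subrr addr0.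
rewrite [LHS]big_mkcond; apply: eq_bigr => w _; case: eqP => [e|ne].
  apply: eq_bigr => v _; rewrite /P1 /P2; case: (boolP (v \in f @: setT)) => [/imsetP[i _ ->]|//].
  by rewrite (mem_imset _ _ finj) -e inE; case: (f i \in w).
have /existsP[i hi] : [exists i, (f i \in w) != (i \in u)].
  apply/contraT; rewrite negb_exists => /forallP h; case: ne; apply/setP => i.
  by rewrite inE; apply/eqP; move: (h i); rewrite negbK.
rewrite (bigD1 (f i)) //= /P1 /P2 (imset_f _ (in_setT i)) (mem_imset _ _ finj).
by move: hi; case: (f i \in w); case: (i \in u); rewrite // mul0r.
Qed.

Lemma Pr_preim (p : V -> R) (A : {set W} -> bool) :
  Pr p (fun w => A (f @^-1: w)) = Pr (p \o f) A.
Proof. exact: Ex_preim (fun w => (A w)%:R). Qed.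

End Transfer.

(** * Paths through occupied sites *)

Section Graph.
Import Fin.
Variable V : finType.
Implicit Types (e : rel V) (w : {set V}) (O K : pred V).

Definition gr e w : rel V := fun x y => [&& x \in w, y \in w & e x y].
(** [connect] is reflexive, so a root satisfying [O] reaches [O] even when it is not in [w]. *)
Definition reach e w v O := [exists z, O z && connect (gr e w) v z].

Lemma gr_sym e w : symmetric e -> symmetric (gr e w).
Proof. by move=> s x y; rewrite /gr s andbCA. Qed.

Lemma gr_mono e e' w w' : (forall x y, x \in w -> y \in w -> e x y -> e' x y) -> w \subset w' ->
  forall x y, gr e w x y -> gr e' w' x y.
Proof.
by move=> h /subsetP s x y /and3P[xw yw exy]; rewrite /gr !s //= h.
Qed.

Lemma conn_mono e e' w w' x y :
  (forall x y, x \in w -> y \in w -> e x y -> e' x y) -> w \subset w' ->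
  connect (gr e w) x y -> connect (gr e' w') x y.
Proof.
move=> h s; apply: connect_sub => a b ab; apply: connect1; exact: gr_mono ab.
Qed.

Lemma reach_mono e e' w w' v O O' :
  (forall x y, x \in w -> y \in w -> e x y -> e' x y) -> w \subset w' ->
  (forall z, z \in v |: w -> O z -> O' z) -> reach e w v O -> reach e' w' v O'.
Proof.
move=> h s hO /existsP[z /andP[Oz c]]; apply/existsP; exists z.
rewrite (conn_mono h s c) andbT hO //.
case/connectP: c => q; case/lastP: q => [|q y] /=; first by move=> _ ->; rewrite !inE eqxx.
by rewrite rcons_path last_rcons => /andP[_ /and3P[_ yw _]] ->; rewrite !inE yw orbT.
Qed.

Lemma conn_in e w x y : connect (gr e w) x y -> x != y -> (x \in w) && (y \in w).
Proof.
case/connectP => q; case: q => [/= _ -> |z q /= /andP[/and3P[-> zw _] h] ->]; first by rewrite eqxx.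
move=> _ /=; elim: q z zw h => //= a q IH z zw /andP[/and3P[_ aw _] h]; exact: IH.
Qed.

(* A path leaving the complement of [O] uses, up to its first point in [O],
   only vertices outside [O]. *)
Lemma conn_exit e w O v z : connect (gr e w) v z -> ~~ O v -> O z ->
  exists x y, [/\ connect (gr e [set u in w | ~~ O u]) v x, ~~ O x, O y & gr e w x y].
Proof.
case/connectP => q; elim: q v => [|y q IH] v /= => [_ -> /negP //|].
case/andP=> gvy h hz nv Oz; have [Oy|nOy] := boolP (O y).
  by exists v, y; split.
have [x [y' [c nx Oy' g]]] := IH y h hz nOy Oz; exists x, y'; split=> //.
apply: connect_trans c; apply: connect1.
by case/and3P: gvy => vw yw evy; rewrite /gr !inE vw yw nv nOy.
Qed.

Lemma reach_exit e w v O : reach e w v O -> ~~ O v ->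
  exists x y, [/\ connect (gr e [set u in w | ~~ O u]) v x, ~~ O x, O y & gr e w x y].
Proof. by case/existsP => z /andP[Oz c] nv; apply: conn_exit c nv Oz. Qed.

(** [conn_exit] for the reversed path: after its last visit to [K] the path stays outside [K]. *)
Lemma conn_last e w K v z : symmetric e -> connect (gr e w) v z -> K v -> ~~ K z ->
  exists x y, [/\ K x, ~~ K y, gr e w x y & connect (gr e [set u in w | ~~ K u]) y z].
Proof.
move=> se c Kv nz; have cs : connect_sym (gr e w) by apply/sym_connect_sym/gr_sym.
have cs' : connect_sym (gr e [set u in w | ~~ K u]) by apply/sym_connect_sym/gr_sym.
rewrite cs in c; have [x [y [c' nx Ky g]]] := conn_exit c nz Kv.
by exists y, x; split=> //; [rewrite gr_sym | rewrite cs'].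
Qed.

End Graph.

(** * Paths passing over a site *)

Section Cover.
Import Fin.
Variables (R : realType) (V : finType) (e : rel V) (X U : V -> R).
Hypothesis e_refl : forall x z, X x = X z -> e x z.
Hypothesis e_mon : forall x y z, e x y -> X x <= X z <= X y \/ X y <= X z <= X x ->
  U z <= U y -> e x z.

(* A connected set passing over the abscissa of [z] and lying entirely below [z]
   (larger [U] means lower) is adjacent to [z]: apply monotonicity to an edge spanning [X z]. *)
Lemma span_cover w a b z : connect (gr e w) a b -> (forall y, y \in a |: w -> U z <= U y) ->
  X a <= X z <= X b \/ X b <= X z <= X a -> exists2 q, connect (gr e w) a q & e q z.
Proof.
case/connectP => q; elim: q a => [|y q IH] a /= => [_ -> _|].
  by case=> /andP[h1 h2]; exists a => //; apply: e_refl; apply/eqP; rewrite eq_le h1 h2.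
case/andP => g h hb hU hX; case/and3P: (g) => aw yw eay.
have hyU : U z <= U y by apply: hU; rewrite !inE yw orbT.
have [cr|ncr] := boolP ((X a <= X z <= X y) || (X y <= X z <= X a)).
  by exists a => //; apply: e_mon eay _ hyU; apply/orP.
have [||x c exz] := IH y h hb.
- by move=> u; rewrite !inE => /orP[/eqP->//|uw]; apply: hU; rewrite !inE uw orbT.
- move: ncr hX; rewrite negb_or !negb_and -!ltNge.
  by case: (leP (X y) (X z)) => // h1; case: (leP (X a) (X z)) => // h2 /=;
    rewrite ?(ltW h1) ?(ltW h2) /= ?andbT ?andbF ?orbF => ? [] //; lra.
by exists x => //; apply: connect_trans c; apply: connect1.
Qed.

End Cover.

(** * Integer points of intervals *)

Section Counting.
Import Fin.
Variable R : realType.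
Implicit Types (lo hi : R) (n : nat).

Lemma count_le n lo hi : 0 <= hi - lo + 1 ->
  (#|[pred i : 'I_n | lo <= i%:R <= hi]|)%:R <= hi - lo + 1 :> R.
Proof.
move=> h; set P := [pred i : 'I_n | _].
case: (pickP P) => [i1 Pi1|h0]; last by rewrite eq_card0.
have [i0 Pi0 hmin] := @arg_minnP _ i1 P (fun i => val i) Pi1.
have hh : 0 <= hi - lo by move: Pi1; rewrite inE => /andP[]; lra.
have hk : forall i : 'I_n, P i -> (i - i0 < (Num.truncn (hi - lo)).+1)%N.
  move=> i Pi; rewrite ltnS truncn_ge_nat // natrB ?hmin //.
  by move: Pi Pi0; rewrite !inE => /andP[? ?] /andP[? ?]; lra.
have inj : {in P &, injective (fun i : 'I_n => inord (i - i0) : 'I_(Num.truncn (hi - lo)).+1)}.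
  move=> i j Pi Pj /(congr1 val) /=; rewrite !inordK ?hk // => e; apply: val_inj => /=.
  by have h1 : (i0 <= i)%N := hmin i Pi; have h2 : (i0 <= j)%N := hmin j Pj; lia.
rewrite -(card_in_image inj).
apply: le_trans (_ : (Num.truncn (hi - lo)).+1%:R <= _).
  by rewrite ler_nat -[leqRHS]card_ord max_card.
by rewrite -natr1 lerD2r truncn_le.
Qed.

Lemma count_ge n lo hi : 0 <= lo -> hi < n%:R ->
  hi - lo - 1 <= (#|[pred i : 'I_n | lo <= i%:R <= hi]|)%:R :> R.
Proof.
move=> h0 hn; set P := [pred i : 'I_n | _].
have [hl|hl] := ltP hi lo; first by apply: le_trans (ler0n _ _); lra.
have hi0 : 0 <= hi by lra.
set a := Num.truncn lo; set c := Num.truncn hi.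
have ha : lo < a.+1%:R by rewrite truncnS_gt.
have hc : c%:R <= hi < c.+1%:R by rewrite truncn_le hi0 truncnS_gt.
have cn : (c < n)%N by rewrite -(ltr_nat R); lra.
have n0 : (0 < n)%N by lia.
have inP : forall k : 'I_(c - a), (a.+1 + k < n)%N by move=> k; have := ltn_ord k; lia.
pose f (k : 'I_(c - a)) := Ordinal (inP k).
have finj : injective f by move=> k l /(congr1 val) /= h; apply: val_inj => /=; lia.
apply: le_trans (_ : (c - a)%:R <= _).
  have : (c%:R : R) <= (c - a)%:R + a%:R by rewrite -natrD ler_nat; lia.
  have : (a%:R : R) <= lo by rewrite truncn_le.
  rewrite -[c.+1%:R]natr1 in hc; lra.
rewrite ler_nat -[leqLHS]card_ord -(fintype.card_image finj); apply: subset_leq_card.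
apply/subsetP => i /imageP[k _ ->]; rewrite inE /=.
apply/andP; split; first by apply: le_trans (ltW ha) _; rewrite ler_nat; lia.
apply: le_trans (_ : c%:R <= _); last by lra.
by rewrite ler_nat; have := ltn_ord k; lia.
Qed.

End Counting.

(** * Riemann sums of negative powers *)

Section RowSums.
Variable R : realType.
Implicit Types (x y s u : R).

Lemma weighted_amgm x y s : 0 <= x -> 0 <= y -> 0 <= s < 1 ->
  y `^ (1 - s) * x `^ s <= (1 - s) * y + s * x.
Proof.
move=> x0 y0 /andP[s0 s1]; have [->|sn] := eqVneq s 0.
  by rewrite subr0 powRr0 mulr1 powRr1 //; lra.
have sp : 0 < s by rewrite lt_def sn.
have := @conjugate_powR R (y `^ (1 - s)) (x `^ s) (1 - s)^-1 s^-1.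
rewrite !powR_ge0 !invr_gt0 subr_gt0 s1 sp !invrK => /(_ isT isT isT isT).
rewrite subrK => /(_ erefl) /le_trans; apply.
rewrite -!powRrM divff ?divff ?powRr1 //; last by rewrite gt_eqF // subr_gt0.
by rewrite le_eqVlt; apply/orP; left; apply/eqP; ring.
Qed.

(** The tangent inequality at x for the concave function x^(1-s); multiplied by x^s it is the
    weighted arithmetic-geometric mean inequality. *)
Lemma powR_incr x y s : 0 < x -> 0 <= y -> 0 <= s < 1 ->
  y `^ (1 - s) + (1 - s) * x `^ (- s) * (x - y) <= x `^ (1 - s).
Proof.
move=> x0 y0 hs; have xs : 0 < x `^ s by apply: powR_gt0.
have h := weighted_amgm (ltW x0) y0 hs.
have e : x `^ (1 - s) = x * x `^ (- s).
  by rewrite powRD ?powRr1 ?(ltW x0) //; apply/implyP => _; rewrite gt_eqF.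
rewrite e powRN -(ler_pM2r xs) mulrDl.
have -> : x / x `^ s * x `^ s = x by rewrite mulfVK // gt_eqF.
have -> : (1 - s) * (x `^ s)^-1 * (x - y) * x `^ s = (1 - s) * (x - y).
  by field; rewrite gt_eqF.
lra.
Qed.

(** Comparison with the integral of x^(-s), one row at a time through [powR_incr]. The minimum with
    [u] keeps the induction valid for the rows above [u], which contribute nothing. *)
Lemma row_sum (M k : nat) s u : (0 < M)%N -> 0 <= s < 1 -> 0 <= u ->
  \sum_(j < k | j.+1%:R / M%:R <= u) (j.+1%:R / M%:R) `^ (- s) / M%:R
    <= (Num.min (k%:R / M%:R) u) `^ (1 - s) / (1 - s).
Proof.
move=> M0 hs u0; case/andP: (hs) => s0 s1; have s1' : 0 < 1 - s by lra.
have Mp : 0 < M%:R :> R by rewrite ltr0n.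
elim: k => [|k IH].
  by rewrite big_ord0 divr_ge0 ?powR_ge0 ?ltW.
rewrite big_mkcond big_ord_recr /= -big_mkcond /=.
have kk : k%:R / M%:R <= k.+1%:R / M%:R :> R.
  by rewrite ler_pM2r ?invr_gt0 // ler_nat.
case: ifPn => [h|]; last first.
  rewrite -ltNge addr0 => h; apply: le_trans IH _.
  rewrite ler_pM2r ?invr_gt0 //; apply: ge0_ler_powR; rewrite ?nnegrE; first by lra.
  - by rewrite le_min u0 divr_ge0.
  - by rewrite le_min u0 divr_ge0.
  - by rewrite le_min !ge_min kk lexx orbT.
rewrite (min_idPl h); apply: le_trans (lerD IH (lexx _)) _.
have -> : Num.min (k%:R / M%:R) u = k%:R / M%:R by apply/min_idPl; apply: le_trans h.
have := @powR_incr (k.+1%:R / M%:R) (k%:R / M%:R) s.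
rewrite divr_gt0 ?ltr0n // divr_ge0 // hs => /(_ isT isT isT) hh.
rewrite -(ler_pM2r s1') mulrDl !divfK ?gt_eqF //; apply: le_trans hh.
rewrite lerD2l -natr1; set q := powR _ _.
by rewrite le_eqVlt; apply/orP; left; apply/eqP; field; rewrite gt_eqF.
Qed.

End RowSums.

(** * Expected numbers of points in regions of the grid *)

Section Grid.
Import Fin.
Variable R : realType.

Definition gX (n m : nat) (v : 'I_n * 'I_m) : R := v.1%:R / m%:R.
(** The successor keeps heights in (0, 1], where negative powers are well behaved. *)
Definition gU (n m : nat) (v : 'I_n * 'I_m) : R := v.2.+1%:R / m%:R.
Definition pm (m : nat) (V : Type) (_ : V) : R := m%:R ^- 2.
(** Under [pm] this is the expected number of occupied sites of [S]. *)
Definition mass (m : nat) (V : finType) (S : {set V}) : R := #|S|%:R * m%:R ^- 2.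

Lemma gU_gt0 n m (v : 'I_n * 'I_m) : 0 < gU v.
Proof. by rewrite divr_gt0 ?ltr0n //; case: v => ? []; case: m. Qed.

Lemma gU_le1 n m (v : 'I_n * 'I_m) : gU v <= 1.
Proof.
have m0 : (0 < m)%N by case: v => ? []; case: m.
by rewrite ler_pdivrMr ?ltr0n // mul1r ler_nat; case: v.
Qed.

Lemma gX_ge0 n m (v : 'I_n * 'I_m) : 0 <= gX v.
Proof. by rewrite divr_ge0. Qed.

Lemma prob_pm m (V : finType) : prob (@pm m V).
Proof.
move=> v; rewrite /pm invr_ge0 exprn_ge0 //=; case: m => [|m].
  by rewrite expr0n invr0 ler01.
by rewrite invf_le1 ?exprn_gt0 ?ltr0n // exprn_ege1 // ler1n.
Qed.

Lemma mass_mono m (V : finType) (S S' : {set V}) : S \subset S' -> mass m S <= mass m S'.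
Proof.
by move=> h; rewrite ler_wpM2r ?invr_ge0 ?exprn_ge0 // ler_nat subset_leq_card.
Qed.

Lemma massU m (V : finType) (S S' : {set V}) : mass m (S :|: S') <= mass m S + mass m S'.
Proof.
rewrite -mulrDl ler_wpM2r ?invr_ge0 ?exprn_ge0 // -natrD ler_nat.
by rewrite -cardsUI leq_addr.
Qed.

Lemma hit_le m (V : finType) (S : {set V}) : Pr (@pm m V) (fun w => ~~ vac S w) <= mass m S.
Proof.
apply: le_trans (Pr_hit _ (@prob_pm m V)) _.
by rewrite sumr_const /mass mulr_natl.
Qed.

Lemma vac_le m (V : finType) (S : {set V}) : Pr (@pm m V) (vac S) <= expR (- mass m S).
Proof.
rewrite Pr_vac (eq_bigr (fun=> 1 - m%:R ^- 2)) // prodr_const /mass mulrC -mulNr expRM_natr.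
have /andP[_ h1] := @prob_pm m bool true.
by rewrite lerXn2r ?nnegrE ?expR_ge0 ?expR_ge1Dx // subr_ge0.
Qed.

Lemma vac_ge m (V : finType) (S : {set V}) : (1 < m)%N ->
  expR (- (2 * mass m S)) <= Pr (@pm m V) (vac S).
Proof.
move=> m1; rewrite Pr_vac (eq_bigr (fun=> 1 - m%:R ^- 2)) // prodr_const /mass.
have p2 : m%:R ^- 2 <= 2^-1 :> R.
  rewrite lef_pV2 ?posrE ?exprn_gt0 ?ltr0n ?(ltnW m1) // -natrX ler_nat; nia.
have p0 : 0 < m%:R ^- 2 :> R by rewrite invr_gt0 exprn_gt0 // ltr0n ltnW.
rewrite /pm; move: p2 p0; set p := m%:R ^- 2 => p2 p0.
have -> : - (2 * (#|S|%:R * p)) = (- (2 * p)) * #|S|%:R by ring.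
rewrite expRM_natr lerXn2r ?nnegrE ?expR_ge0 //; first by lra.
rewrite expRN -[leRHS]invrK lef_pV2 ?posrE ?expR_gt0 ?invr_gt0 //; last by lra.
apply: le_trans (expR_ge1Dx _); rewrite -[leLHS]mul1r ler_pdivrMr; last by lra.
nra.
Qed.

Lemma mass_rows n m (S : {set 'I_n * 'I_m}) :
  mass m S = \sum_(j < m) (#|[pred i | (i, j) \in S]|)%:R * m%:R ^- 2.
Proof.
rewrite /mass -big_distrl /= -natr_sum; congr (_%:R * _).
rewrite -sum1_card (eq_bigr (fun j : 'I_m => \sum_(i | (i, j) \in S) 1)%N).
  by rewrite (exchange_big_dep xpredT) //= pair_big_dep; apply: eq_bigl => -[i j].
by move=> j _; rewrite sum1_card.
Qed.

(** Rows are treated separately, so the curve [a] is arbitrary: in each row the band lies in two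
    intervals of length 2d, and rounding adds one column to each. *)
Lemma mass_band n m (a : 'I_m -> R) (d x0 : R) (S : {set 'I_n * 'I_m}) : (0 < m)%N -> 0 <= d ->
  (forall v, v \in S -> a v.2 - d <= `|gX v - x0| <= a v.2 + d) ->
  mass m S <= 4 * d + 2 / m%:R.
Proof.
move=> m0 d0 hS; have mp : 0 < m%:R :> R by rewrite ltr0n.
have md : 0 <= m%:R * d by rewrite mulr_ge0 // ltW.
rewrite mass_rows; apply: le_trans (_ : \sum_(j < m) (2 * (2 * m%:R * d + 1)) * m%:R ^- 2 <= _).
  apply: ler_sum => j _; rewrite ler_wpM2r ?invr_ge0 ?exprn_ge0 //.
  pose P c := [pred i : 'I_n | m%:R * (x0 + c - d) <= i%:R <= m%:R * (x0 + c + d)].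
  apply: le_trans (_ : (#|P (a j)| + #|P (- a j)|)%:R <= _).
    rewrite ler_nat -cardUI; apply: leq_trans (leq_addr _ _).
    apply: subset_leq_card; apply/subsetP => i; rewrite !inE => /hS /= /andP[h1 h2].
    have -> : i%:R = m%:R * (i%:R / m%:R) :> R by field; rewrite gt_eqF.
    rewrite !ler_pM2l //; move: h1 h2; rewrite /gX /=.
    case: (ger0P (i%:R / m%:R - x0)) => hx h1 h2; apply/orP; [left|right]; apply/andP; split; lra.
  rewrite natrD mulrDl mul1r; apply: lerD; apply: le_trans (count_le _ _) _; lra.
rewrite big_const_ord iter_addr_0 le_eqVlt; apply/orP; left; apply/eqP.
by rewrite -[LHS]mulr_natr; field; rewrite gt_eqF.
Qed.

(** The region has width 2 (A u^(-s) + B) at height u; the bound is the integral of this up to [u1],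
    rounding adding 1/m to each width. The constant part is the case s = 0 of [row_sum]. *)
Lemma mass_shape n m (A B s u1 x0 : R) (S : {set 'I_n * 'I_m}) : (0 < m)%N ->
  0 <= A -> 0 <= B -> 0 <= s < 1 -> 0 <= u1 ->
  (forall v, v \in S -> gU v <= u1 /\ `|gX v - x0| <= A * gU v `^ (- s) + B) ->
  mass m S <= 2 * A * (u1 `^ (1 - s) / (1 - s)) + (2 * B + m%:R^-1) * u1.
Proof.
move=> m0 A0 B0 hs u0 hS; have mp : 0 < m%:R :> R by rewrite ltr0n.
have s1 : 0 < 1 - s by case/andP: hs; lra.
pose r (j : 'I_m) : R := j.+1%:R / m%:R.
have cj (j : 'I_m) : (#|[pred i | (i, j) \in S]|)%:R <=
    (if r j <= u1 then 2 * m%:R * (A * r j `^ (- s) + B) + 1 else 0) :> R.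
  case: ifPn => [h|h]; last first.
    rewrite eq_card0 // => i; rewrite inE; apply: contraNF h => /hS[].
    by rewrite /gU.
  have w0 : 0 <= A * r j `^ (- s) + B by rewrite addr_ge0 // mulr_ge0 // powR_ge0.
  pose D := A * r j `^ (- s) + B.
  apply: le_trans (_ : (#|[pred i : 'I_n | m%:R * (x0 - D) <= i%:R <= m%:R * (x0 + D)]|)%:R <= _).
    rewrite ler_nat subset_leq_card //; apply/subsetP => i; rewrite !inE => /hS[_].
    rewrite /gX /gU /= ler_norml -/(r j) -/D => /andP[h1 h2].
    have -> : i%:R = m%:R * (i%:R / m%:R) :> R by field; rewrite gt_eqF.
    by rewrite !ler_pM2l //; apply/andP; split; lra.
  apply: le_trans (count_le _ _) _; rewrite -/D in w0 *; first by nra.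
  by rewrite le_eqVlt; apply/orP; left; apply/eqP; ring.
rewrite mass_rows.
apply: le_trans (_ : \sum_(j < m | r j <= u1) (2 * A * (r j `^ (- s) / m%:R)
    + (2 * B + m%:R^-1) * (r j `^ (- 0) / m%:R)) <= _).
  rewrite [leRHS]big_mkcond; apply: ler_sum => j _.
  have := cj j; case: ifPn => h hc.
    apply: le_trans (_ : (2 * m%:R * (A * r j `^ (- s) + B) + 1) * m%:R ^- 2 <= _).
    by rewrite ler_wpM2r // invr_ge0 exprn_ge0.
    rewrite oppr0 powRr0 le_eqVlt; apply/orP; left; apply/eqP; field.
    by rewrite gt_eqF.
  by rewrite mulr_le0_ge0 // invr_ge0 exprn_ge0.
rewrite big_split /= -!big_distrr /=; apply: lerD.
  rewrite ler_wpM2l ?mulr_ge0 //.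
  apply: le_trans (row_sum m m0 hs u0) _.
  rewrite ler_pM2r ?invr_gt0 //; apply: ge0_ler_powR; rewrite ?nnegrE //; first by lra.
    by rewrite le_min u0 divr_ge0.
  by rewrite ge_min lexx orbT.
rewrite ler_wpM2l //; first by rewrite addr_ge0 ?mulr_ge0.
have h01 : (0 <= (0 : R)) && ((0 : R) < 1) by rewrite lexx /= ltr01.
apply: le_trans (row_sum m m0 h01 u0) _.
by rewrite subr0 divr1 powRr1 ?ge_min ?lexx ?orbT // le_min u0 divr_ge0.
Qed.

Lemma mass_rect n m (x1 x2 u1 u2 : R) (S : {set 'I_n * 'I_m}) : (0 < m)%N ->
  0 <= x1 -> x2 * m%:R < n%:R -> 0 <= u1 -> u2 <= 1 ->
  0 <= u2 - u1 - 2 / m%:R -> 0 <= x2 - x1 - m%:R^-1 ->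
  (forall v, u1 < gU v <= u2 -> x1 <= gX v <= x2 -> v \in S) ->
  (u2 - u1 - 2 / m%:R) * (x2 - x1 - m%:R^-1) <= mass m S.
Proof.
move=> m0 h1 h2 h3 h4 hu hx hS; have mp : 0 < m%:R :> R by rewrite ltr0n.
pose CI := [set i : 'I_n | m%:R * x1 <= i%:R <= m%:R * x2].
pose RJ := [set j : 'I_m | m%:R * u1 <= j%:R <= m%:R * u2 - 1].
have sub : setX CI RJ \subset S.
  apply/subsetP => -[i j]; rewrite !inE /= => /andP[/andP[a1 a2] /andP[b1 b2]].
  apply: hS; rewrite /gX /gU /=.
    by rewrite ltr_pdivlMr // ler_pdivrMr // -natr1; apply/andP; split; lra.
  by rewrite ler_pdivlMr // ler_pdivrMr //; apply/andP; split; lra.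
apply: le_trans (mass_mono m sub); rewrite /mass cardsX natrM.
have c1 : m%:R * x2 - m%:R * x1 - 1 <= #|CI|%:R.
  have := @count_ge R n (m%:R * x1) (m%:R * x2); rewrite cardsE; apply.
    by rewrite mulr_ge0 // ltW.
  by rewrite mulrC.
have c2 : m%:R * u2 - 1 - m%:R * u1 - 1 <= #|RJ|%:R.
  have := @count_ge R m (m%:R * u1) (m%:R * u2 - 1); rewrite cardsE; apply.
    by rewrite mulr_ge0 // ltW.
  by nra.
have -> : (u2 - u1 - 2 / m%:R) * (x2 - x1 - m%:R^-1) =
  (m%:R * (x2 - x1 - m%:R^-1)) * (m%:R * (u2 - u1 - 2 / m%:R)) * m%:R ^- 2.
  by field; rewrite gt_eqF.
rewrite ler_wpM2r ?invr_ge0 ?exprn_ge0 // ler_pM //; try by rewrite mulr_ge0 // ltW.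
  by apply: le_trans c1; rewrite !mulrBr mulfV ?gt_eqF //; lra.
apply: le_trans c2; rewrite !mulrBr.
have -> : m%:R * (2 / m%:R) = 2 :> R by field; rewrite gt_eqF.
lra.
Qed.

End Grid.

(** * Induced subgraphs under an embedding *)

Section Embedding.
Import Fin.
Variables (V W : finType) (f : W -> V) (eV : rel V) (eW : rel W).
Hypothesis finj : injective f.
Hypothesis fe : forall x y, eW x y = eV (f x) (f y).

Lemma conn_img (u : {set W}) x y :
  connect (gr eV (f @: u)) (f x) (f y) = connect (gr eW u) x y.
Proof.
apply/idP/idP; last first.
  case/connectP => q; elim: q x => [|z q IH] x /= => [_ ->|] //.
  case/andP => /and3P[xu zu exz] h hl; apply: connect_trans (IH z h hl).
  by apply: connect1; rewrite /gr !mem_imset // xu zu -fe.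
case/connectP => q; elim: q x => [|z q IH] x /= => [_ /finj -> //|].
case/andP => /and3P[]; rewrite mem_imset // => xu /imsetP[z' zu ->] exz h hl.
apply: connect_trans (IH z' h hl); apply: connect1.
by rewrite /gr xu zu fe.
Qed.

Lemma reach_img (u : {set W}) x (O : pred V) :
  x \in u -> reach eV (f @: u) (f x) O = reach eW u x (fun y => O (f y)).
Proof.
move=> xu; apply/existsP/existsP => -[z /andP[Oz c]]; last first.
  by exists (f z); rewrite Oz conn_img.
have [e|ne] := eqVneq (f x) z; first by exists x; rewrite e Oz connect0.
have /andP[_ /imsetP[y yu ez]] := conn_in c ne.
by exists y; rewrite -ez Oz -conn_img -ez.
Qed.

Lemma imset_preim (w : {set V}) : f @: (f @^-1: w) = w :&: f @: setT.
Proof.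
apply/setP => v; rewrite inE; apply/imsetP/andP => [[x]|[vw /imsetP[x _ e]]].
  by rewrite inE => h ->; rewrite h imset_f.
by exists x; rewrite // inE -e.
Qed.

Lemma Pr_reach_img (R : realType) (p : V -> R) x (O : pred V) :
  Pr p (fun w => reach eV ((f x |: w) :&: f @: setT) (f x) O) =
  Pr (p \o f) (fun u => reach eW (x |: u) x (fun y => O (f y))).
Proof.
rewrite -(Pr_preim finj p (fun u => reach eW (x |: u) x (fun y => O (f y)))).
apply: eq_Pr => w; rewrite -reach_img ?setU11 //; congr reach.
by rewrite imsetU1 imset_preim setIUl (setIidPl _) // sub1set imset_f.
Qed.

End Embedding.

(** * Threshold graphs on finite lines of cells *)

Section Lines.
Import Fin.
Variable R : realType.
Implicit Types (T : R -> R -> R) (l L : R).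

Definition adj T n m : rel ('I_n * 'I_m) :=
  fun v w => `|gX R v - gX R w| <= T (gU R v) (gU R w).
Arguments adj T {n m}.

(** Escape from the root at scale l. Very low sites count as escaped, so a site that has not escaped
    has bounded range, and its edges out of a window end in the thin set [tailS]. *)
Definition Out l n m (v : 'I_n * 'I_m) : pred ('I_n * 'I_m) :=
  fun w => (l < `|gX R w - gX R v|) || (gU R w <= l^-1).
Definition win n m (x0 : R) L : {set 'I_n * 'I_m} := [set w | `|gX R w - x0| <= L].
Definition winv L n m (v : 'I_n * 'I_m) : {set 'I_n * 'I_m} := win n m (gX R v) L.

(** Monotonicity is stated in the first argument, symmetry gives it in the second; together they
    make [span_cover] applicable. *)
Definition thr T := [/\ forall u u', T u u' = T u' u,
  forall u u' : R, 0 < u -> 0 < u' -> 0 <= T u u' &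
  forall u u1 u' : R, 0 < u -> u <= u1 -> 0 < u' -> T u1 u' <= T u u'].

Lemma adj_sym T n m : thr T -> symmetric (@adj T n m).
Proof. by case=> s _ _ v w; rewrite /adj distrC s. Qed.

Lemma adj_refl T n m (x z : 'I_n * 'I_m) : thr T -> gX R x = gX R z -> adj T x z.
Proof. by case=> _ h _ e; rewrite /adj e subrr normr0 h ?gU_gt0. Qed.

Lemma adj_mon T n m (x y z : 'I_n * 'I_m) : thr T -> adj T x y ->
  gX R x <= gX R z <= gX R y \/ gX R y <= gX R z <= gX R x ->
  gU R z <= gU R y -> adj T x z.
Proof.
case=> s _ h; rewrite /adj => a hX hU.
apply: le_trans (_ : T (gU R x) (gU R y) <= _); last first.
  by rewrite s [leRHS]s; apply: h; rewrite ?gU_gt0.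
apply: le_trans a; case: hX => /andP[h1 h2].
  by rewrite !ler0_norm ?subr_le0 //; lra.
by rewrite !ger0_norm ?subr_ge0 //; lra.
Qed.

Lemma adj_cover T n m (w : {set 'I_n * 'I_m}) a b z : thr T ->
  connect (gr (adj T) w) a b -> (forall y, y \in a |: w -> gU R z <= gU R y) ->
  gX R a <= gX R z <= gX R b \/ gX R b <= gX R z <= gX R a ->
  exists2 q, connect (gr (adj T) w) a q & adj T q z.
Proof.
move=> hT; refine (@span_cover R _ (adj T) (@gX R n m) (@gU R n m) _ _ w a b z).
  by move=> x y; exact: adj_refl.
by move=> x y t; exact: adj_mon.
Qed.

Lemma shift_lt k n s (i : 'I_k) : (s + k <= n)%N -> (s + i < n)%N.
Proof. by have := ltn_ord i; lia. Qed.

Definition emb k n m s (h : (s + k <= n)%N) (v : 'I_k * 'I_m) : 'I_n * 'I_m :=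
  (Ordinal (shift_lt v.1 h), v.2).

Lemma shift_inj k n m s (h : (s + k <= n)%N) : injective (@emb k n m s h).
Proof.
move=> [i j] [i' j'] [/= e ->]; congr (_, _); apply: val_inj => /=.
by move/eqP: e; rewrite eqn_add2l => /eqP.
Qed.

Lemma shift_U k n m s (h : (s + k <= n)%N) (v : 'I_k * 'I_m) : gU R (emb h v) = gU R v.
Proof. by []. Qed.

Lemma shift_X k n m s (h : (s + k <= n)%N) (v : 'I_k * 'I_m) :
  gX R (emb h v) = s%:R / m%:R + gX R v.
Proof. by rewrite /gX /= natrD mulrDl. Qed.

Lemma shift_dX k n m s (h : (s + k <= n)%N) (v w : 'I_k * 'I_m) :
  gX R (emb h v) - gX R (emb h w) = gX R v - gX R w.
Proof. by rewrite !shift_X opprD addrACA subrr add0r. Qed.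

Lemma shift_adj T k n m s (h : (s + k <= n)%N) (v w : 'I_k * 'I_m) :
  adj T v w = adj T (emb h v) (emb h w).
Proof. by rewrite /adj shift_dX !shift_U. Qed.

Lemma shift_Out l k n m s (h : (s + k <= n)%N) (v w : 'I_k * 'I_m) :
  Out l (emb h v) (emb h w) = Out l v w.
Proof. by rewrite /Out shift_dX shift_U. Qed.

Definition Dr T l n m (v : 'I_n * 'I_m) : R :=
  Pr (@pm R m _) (fun w => reach (adj T) (v |: w) v (Out l v)).
Definition DL T l L n m (v : 'I_n * 'I_m) : R :=
  Pr (@pm R m _) (fun w => reach (adj T) ((v |: w) :&: winv L v) v (Out l v)).
Definition Dn T l n m (i : 'I_n) : R := (\sum_(j < m) Dr T l (i, j)) / m%:R.

Lemma Pr_shift T l k n m s (h : (s + k <= n)%N) (v : 'I_k * 'I_m) :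
  Pr (@pm R m _) (fun w => reach (adj T)
    ((emb h v |: w) :&: (emb h @: setT)) (emb h v) (Out l (emb h v))) = Dr T l v.
Proof.
rewrite (@Pr_reach_img _ _ (@emb k n m s h) (@adj T n m) (@adj T k m) _ _ R (@pm R m _) v).
- apply: eq_Pr => w; rewrite /reach; apply: eq_existsb => z.
  by rewrite shift_Out.
- exact: shift_inj.
- by move=> x y; rewrite -shift_adj.
Qed.

Lemma Dr_shift T l k n m s (h : (s + k <= n)%N) (v : 'I_k * 'I_m) :
  Dr T l v <= Dr T l (emb h v).
Proof.
rewrite -(Pr_shift T l h); apply: Pr_le; first exact: prob_pm.
by move=> w; apply: reach_mono => //; exact: subsetIl.
Qed.

Lemma DL_le T l L n m (v : 'I_n * 'I_m) : DL T l L v <= Dr T l v.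
Proof.
apply: Pr_le; first exact: prob_pm.
by move=> w; apply: reach_mono => //; exact: subsetIl.
Qed.

Lemma gX_leK n m (i i' : 'I_n) (j j' : 'I_m) L (K : nat) : (0 < m)%N -> K%:R <= L * m%:R < K.+1%:R ->
  (`|gX R (i, j) - gX R (i', j')| <= L) = (i <= i' + K)%N && (i' <= i + K)%N.
Proof.
move=> m0 /andP[h1 h2]; have mp : 0 < m%:R :> R by rewrite ltr0n.
rewrite /gX /= -mulrBl normrM normfV [`|m%:R|]ger0_norm // ler_pdivrMr //.
apply/idP/andP => [|[a1 a2]].
  rewrite ler_norml => /andP[a1 a2].
  have b1 : i%:R < i'%:R + K.+1%:R :> R by lra.
  have b2 : i'%:R < i%:R + K.+1%:R :> R by lra.
  by move: b1 b2; rewrite -!natrD !ltr_nat !addnS !ltnS => -> ->.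
rewrite ler_norml; move: a1 a2; rewrite -!(ler_nat R) !natrD => a1 a2.
by apply/andP; split; lra.
Qed.

(** The window of [v], possibly cut by an end of its line, is a translate of a part of the full
    window of [v']. Translates have the same law, and a larger window only helps. *)
Lemma DL_transfer T l L n n' m (v : 'I_n * 'I_m) (v' : 'I_n' * 'I_m) (K : nat) :
  K%:R <= L * m%:R < K.+1%:R -> v.2 = v'.2 -> (K <= v'.1)%N -> (v'.1 + K < n')%N ->
  DL T l L v <= DL T l L v'.
Proof.
case: v v' => [i j] [i' j'] hK /= <- r1 r2 {j'}.
have m0 : (0 < m)%N by have := ltn_ord j; lia.
have ltin := ltn_ord i.
pose a := (i - K)%N; pose k := (minn n (i + K).+1 - a)%N.
have hak : (a + k <= n)%N by rewrite /k; lia.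
have hak' : ((i' - (i - a)) + k <= n')%N by rewrite /k /a; lia.
have lik : (i - a < k)%N by rewrite /k /a; lia.
pose c : 'I_k * 'I_m := (Ordinal lik, j).
have e1 : emb hak c = (i, j).
  by rewrite /emb /=; congr (_, _); apply: val_inj => /=; rewrite /a; lia.
have e2 : emb hak' c = (i', j).
  by rewrite /emb /=; congr (_, _); apply: val_inj => /=; rewrite /a; lia.
apply: le_trans (_ : Dr T l c <= _).
  rewrite -(Pr_shift T l hak) e1; apply: Pr_le; first exact: prob_pm.
  move=> w; apply: reach_mono => //; apply: setIS; apply/subsetP => -[x y].
  rewrite !inE (gX_leK _ _ _ _ m0 hK) => /andP[x1 x2].
  have hx : (x - a < k)%N by have := ltn_ord x; rewrite /k /a; lia.
  apply/imsetP; exists (Ordinal hx, y) => //; rewrite /emb /=; congr (_, _).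
  by apply: val_inj => /=; rewrite /a; lia.
rewrite -(Pr_shift T l hak') e2; apply: Pr_le; first exact: prob_pm.
move=> w; apply: reach_mono => //; apply: setIS; apply/subsetP => _ /imsetP[[x y] _ ->].
rewrite !inE /emb /= (gX_leK _ _ _ _ m0 hK) /=.
by have := ltn_ord x; rewrite /k /a; lia.
Qed.

(** Up to its first escaped site the path runs through sites that have not escaped, all inside the
    window; the edge into the escaped site can leave the window only by ending in [S]. *)
Lemma reach_local n m (e : rel ('I_n * 'I_m)) l L (v : 'I_n * 'I_m)
    (w S : {set 'I_n * 'I_m}) : l <= L ->
  (forall y z, ~~ Out l v y -> L < `|gX R z - gX R v| -> e y z -> z \in S) ->
  vac S w -> v \notin S ->
  reach e (v |: w) v (Out l v) -> reach e ((v |: w) :&: winv L v) v (Out l v).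
Proof.
move=> lL hS vS vnS; have [ov|nov] := boolP (Out l v v).
  by move=> _; apply/existsP; exists v; rewrite ov connect0.
case/reach_exit => // x [y [c nx oy /and3P[xw yw exy]]].
have inw u : ~~ Out l v u -> u \in winv L v.
  by rewrite negb_or -leNgt inE => /andP[h _]; apply: le_trans h lL.
have yL : y \in winv L v.
  rewrite inE leNgt; apply/negP => h; have yS := hS x y nx h exy.
  have yw' : y \in w by move: yw; rewrite !inE; case: eqP yS vnS => // -> ->.
  by move/eqP/setP/(_ y): vS; rewrite !inE yw' yS.
apply/existsP; exists y; rewrite oy /=.
apply: (@connect_trans _ _ x); last first.
  by apply: connect1; rewrite /gr inE xw inw //= inE yw yL exy.
apply: conn_mono c => //; apply/subsetP => u; rewrite inE => /andP[uw nu].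
by rewrite inE uw inw.
Qed.

End Lines.

Arguments adj {R} T {n m}.

(** * Stability of escape under small changes of the graph *)

Section Compare.
Import Fin.
Variable R : realType.
Implicit Types (T : R -> R -> R) (l L : R).

Lemma cell_m0 n m : 'I_n * 'I_m -> (0 < m)%N.
Proof. by case=> _ j; have := ltn_ord j; lia. Qed.

Lemma Pr_pair m (V : finType) (y z : V) : y != z ->
  Pr (@pm R m V) (fun w => (y \in w) && (z \in w)) = m%:R ^- 2 * m%:R ^- 2.
Proof.
move=> ne; rewrite Pr_mecke; congr (_ * _).
rewrite -[RHS](Pr_in (@pm R m V) z).
by apply: eq_Pr => w; rewrite !inE eq_sym (negbTE ne).
Qed.

Lemma mass_win n m (x0 L : R) : (0 < m)%N -> 0 <= L ->
  mass R m (@win R n m x0 L) <= 2 * L + m%:R^-1.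
Proof.
move=> m0 L0; apply: le_trans (@mass_shape R n m 0 L 0 1 x0 _ m0 _ _ _ _ _) _ => //.
- by rewrite lexx ltr01.
- by move=> v; rewrite inE gU_le1 mul0r add0r.
by rewrite mulr0 mul0r add0r mulr1.
Qed.

Lemma mass_low n m (x0 L u : R) (S : {set 'I_n * 'I_m}) : (0 < m)%N -> 0 <= L -> 0 <= u ->
  (forall v, v \in S -> gU R v <= u /\ `|gX R v - x0| <= L) ->
  mass R m S <= (2 * L + m%:R^-1) * u.
Proof.
move=> m0 L0 u0 hS; apply: le_trans (@mass_shape R n m 0 L 0 u x0 _ m0 _ _ _ _ _) _ => //.
- by rewrite lexx ltr01.
- by move=> v /hS; rewrite mul0r add0r.
by rewrite mulr0 mul0r add0r.
Qed.

(** Union bound over pairs of distinct sites, each pair being occupied with probability m^(-4). *)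
Lemma Pr_amb n m (W : {set 'I_n * 'I_m}) (A : 'I_n * 'I_m -> {set 'I_n * 'I_m}) (C : R) :
  (forall y, y \in W -> mass R m (A y) <= C) ->
  Pr (@pm R m _) (fun w => [exists y, exists z,
    [&& y \in W, z \in A y, y != z, y \in w & z \in w]]) <= mass R m W * C.
Proof.
move=> hA; set p := @pm R m _.
have hp : prob p by exact: prob_pm.
apply: le_trans (_ : \sum_(y in W) Pr p (fun w => [exists (z | (z \in A y) && (y != z)),
    (y \in w) && (z \in w)]) <= _).
  apply: le_trans (Pr_exists _ _ hp); apply: Pr_le => // w.
  case/existsP => y /existsP[z /and5P[h1 h2 h3 h4 h5]]; apply/existsP; exists y; rewrite h1 /=.
  by apply/existsP; exists z; rewrite h2 h3 h4 h5.
rewrite /mass mulrAC mulr_natl mulrnAl -sumr_const; apply: ler_sum => y yW.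
apply: le_trans (Pr_exists _ _ hp) _.
apply: le_trans (_ : \sum_(z in A y) m%:R ^- 2 * m%:R ^- 2 <= _).
  rewrite [leRHS]big_mkcond [leLHS]big_mkcond; apply: ler_sum => z _.
  case: (boolP (z \in A y)) => //= _; case: (eqVneq y z) => //= ne; by rewrite Pr_pair.
rewrite sumr_const -[leLHS]mulr_natl mulrA ler_wpM2r ?invr_ge0 ?exprn_ge0 //.
exact: hA.
Qed.

(** Inside the window and above height [h], an edge of [e1] missing in [e2] joins two sites whose
    distance is within [d] of the threshold. The errors are: an occupied site in [S], an occupied
    site below height [h], and an occupied ambiguous pair. Pairs containing [v] are counted apart
    because [v] is present with certainty. *)
Lemma compare n m (e1 e2 : rel ('I_n * 'I_m)) T (v : 'I_n * 'I_m) l L h d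
    (S : {set 'I_n * 'I_m}) :
  (forall u u', T u u' = T u' u) -> 0 <= L -> l <= L -> 0 <= d -> 0 <= h <= gU R v -> v \notin S ->
  (forall y, e2 y y) ->
  (forall y z, ~~ Out l v y -> L < `|gX R z - gX R v| -> e1 y z -> z \in S) ->
  (forall y z, y \in winv L v -> z \in winv L v -> h <= gU R y -> h <= gU R z ->
    e1 y z -> ~~ e2 y z ->
    T (gU R y) (gU R z) - d <= `|gX R y - gX R z| <= T (gU R y) (gU R z) + d) ->
  Pr (@pm R m _) (fun w => reach e1 (v |: w) v (Out l v)) <=
  Pr (@pm R m _) (fun w => reach e2 ((v |: w) :&: winv L v) v (Out l v)) +
  (mass R m S + (2 * L + 1) * h + (2 * L + 3) * (4 * d + 2 / m%:R)).
Proof.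
move=> Ts L0 lL d0 /andP[h0 hv] vS e2r hS hA.
have m0 := cell_m0 v.
have mp : 0 < m%:R :> R by rewrite ltr0n.
have m1 : m%:R^-1 <= 1 :> R by rewrite invf_le1 // ler1n.
set p := @pm R m _; have hp : prob p by exact: prob_pm.
pose A (y : 'I_n * 'I_m) : {set 'I_n * 'I_m} := [set z |
  T (gU R y) (gU R z) - d <= `|gX R y - gX R z| <= T (gU R y) (gU R z) + d].
have As y z : (z \in A y) = (y \in A z) by rewrite !inE Ts distrC.
have mA y : mass R m (A y) <= 4 * d + 2 / m%:R.
  apply: (@mass_band R n m (fun j => T (gU R y) (j.+1%:R / m%:R)) d (gX R y)) => // z.
  by rewrite inE distrC.
pose LW := [set z | (gU R z <= h) && (z \in winv L v) && (z != v)].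
have mLW : mass R m LW <= (2 * L + 1) * h.
  apply: le_trans (@mass_low n m (gX R v) L h LW m0 L0 h0 _) _.
    by move=> z; rewrite !inE => /andP[/andP[-> ->]].
  by rewrite ler_wpM2r // lerD2l.
pose amb := fun w : {set 'I_n * 'I_m} => [exists y, exists z,
    [&& y \in winv L v, z \in A y, y != z, y \in w & z \in w]].
apply: (@le_trans _ _ (Pr p (fun w => reach e2 ((v |: w) :&: winv L v) v (Out l v) ||
   (~~ vac S w || (~~ vac LW w || (~~ vac (A v) w || amb w)))))).
  apply: Pr_le => // w hr.
  have [//|nr] := boolP (reach e2 ((v |: w) :&: winv L v) v (Out l v)).
    rewrite /=; case: (boolP (amb w)) => [_|nam]; first by rewrite !orbT.
    apply: contraT; rewrite orbF !negb_or !negbK => /and3P[vs vl va].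
    case/negP: nr; apply: reach_mono (reach_local lL hS vs vS hr) => // y z.
    rewrite !in_setI => /andP[yw yL] /andP[zw zL] e12.
    apply: contraT => ne2.
    have nyz : y != z by apply: contra ne2 => /eqP ->.
    have hU u : u \in v |: w -> u \in winv L v -> h <= gU R u.
    rewrite !inE => /orP[/eqP -> //|uw] uL; rewrite leNgt; apply/negP => hu.
    have uv : u != v by apply: contraTneq hu => ->; rewrite -leNgt.
    move/eqP/setP/(_ u): vl; by rewrite !inE uw uv (ltW hu) uL.
    have zA : z \in A y by rewrite inE; apply: hA; rewrite ?hU.
    have [ey|nyv] := eqVneq y v.
    have zw' : z \in w by move: zw nyz; rewrite ey !inE => /orP[/eqP->|//]; rewrite eqxx.
    by move/eqP/setP/(_ z): va; rewrite in_setI in_set0 zw' -ey zA.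
    have yw' : y \in w by move: yw; rewrite !inE (negbTE nyv).
    have [ez|nzv] := eqVneq z v.
    by move/eqP/setP/(_ y): va; rewrite in_setI in_set0 yw' -ez -As zA.
    have zw' : z \in w by move: zw; rewrite !inE (negbTE nzv).
    by case/negP: nam; rewrite /amb; apply/existsP; exists y; apply/existsP; exists z; rewrite yL zA nyz yw' zw'.
have Lm : mass R m (winv L v) <= 2 * L + 1.
  by apply: le_trans (mass_win _ _ m0 L0) _; rewrite lerD2l.
have C0 : 0 <= 4 * d + 2 / m%:R by rewrite addr_ge0 ?mulr_ge0 ?divr_ge0.
apply: le_trans (Pr_or _ _ hp) _; rewrite lerD2l.
apply: le_trans (Pr_or _ _ hp) _.
rewrite -addrA; apply: lerD; first exact: hit_le.
apply: le_trans (Pr_or _ _ hp) _.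
apply: lerD; first by apply: le_trans (hit_le _ _ _) mLW.
apply: le_trans (Pr_or _ _ hp) _.
apply: le_trans (_ : (4 * d + 2 / m%:R) + (2 * L + 1) * (4 * d + 2 / m%:R) <= _).
  apply: lerD; first by apply: le_trans (hit_le _ _ _) (mA v).
  apply: le_trans (Pr_amb (fun y _ => mA y)) _.
  by rewrite ler_wpM2r.
by move: C0; set C := 4 * d + _ => C0; nra.
Qed.

End Compare.

(** * The limiting kernel and the constant c *)

Section Ideal.
Import Fin.
Variable R : realType.
Implicit Types (T : R -> R -> R) (l L k b q : R).

Definition kT k b (u u' : R) : R := k * (u * u') `^ (- b).

Lemma powR_anti (x y b : R) : 0 <= b -> 0 < x -> x <= y -> y `^ (- b) <= x `^ (- b).
Proof.
move=> b0 x0 xy; have y0 : 0 < y by apply: lt_le_trans xy.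
rewrite !powRN lef_pV2 ?posrE ?powR_gt0 //.
by apply: ge0_ler_powR; rewrite ?nnegrE ?(ltW x0) ?(ltW y0).
Qed.

Lemma thr_kT k b : 0 <= k -> 0 <= b -> thr (kT k b).
Proof.
move=> k0 b0; split=> [u u'|u u' _ _|u u1 u' u0 uu u'0]; rewrite /kT.
- by rewrite mulrC [u * u']mulrC mulrC.
- by rewrite mulr_ge0 // powR_ge0.
by rewrite ler_wpM2l // powR_anti ?mulr_gt0 // ler_pM2r.
Qed.

Lemma kT_mono k k' b b' u u' : 0 <= k <= k' -> b <= b' -> 0 < u <= 1 -> 0 < u' <= 1 ->
  kT k b u u' <= kT k' b' u u'.
Proof.
move=> /andP[k0 kk] bb /andP[u0 u1] /andP[u0' u1']; rewrite /kT ler_pM ?powR_ge0 //.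
apply: ger_powR; rewrite ?lerN2 // mulr_gt0 //=.
by apply: le_trans (ler_pM (ltW u0) (ltW u0') u1 u1') _; rewrite mulr1.
Qed.

Lemma Dn_le T T' l n m (i : 'I_n) :
  (forall u u', 0 < u <= 1 -> 0 < u' <= 1 -> T u u' <= T' u u') -> Dn T l m i <= Dn T' l m i.
Proof.
move=> h; rewrite /Dn ler_wpM2r ?invr_ge0 //; apply: ler_sum => j _.
apply: Pr_le; first exact: prob_pm.
move=> w; apply: reach_mono => // x y _ _; rewrite /adj => hx; apply: le_trans hx _.
by apply: h; rewrite gU_gt0 gU_le1.
Qed.

Lemma Out_anti l l' n m (v z : 'I_n * 'I_m) : 0 < l -> l <= l' -> Out l' v z -> Out l v z.
Proof.
move=> l0 ll /orP[h|h]; apply/orP; [left; exact: le_lt_trans h|right].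
by apply: le_trans h _; rewrite lef_pV2 ?posrE //; apply: lt_le_trans ll.
Qed.

Lemma Dn_anti T l l' n m (i : 'I_n) : 0 < l -> l <= l' -> Dn T l' m i <= Dn T l m i.
Proof.
move=> l0 ll; rewrite /Dn ler_wpM2r ?invr_ge0 //; apply: ler_sum => j _.
apply: Pr_le; first exact: prob_pm.
by move=> w; apply: reach_mono => // z _; apply: Out_anti.
Qed.

Lemma avg_le1 (m : nat) (F : 'I_m -> R) c : 0 <= c -> (forall j, F j <= c) ->
  (\sum_(j < m) F j) / m%:R <= c.
Proof.
case: m F => [|m] F c0 h; first by rewrite big_ord0 mul0r.
rewrite ler_pdivrMr ?ltr0n //; apply: le_trans (_ : \sum_(j < m.+1) c <= _).
  by apply: ler_sum.
by rewrite big_const_ord iter_addr_0 mulr_natr.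
Qed.

Lemma Dn_le1 T l n m (i : 'I_n) : Dn T l m i <= 1.
Proof. by apply: avg_le1 => // j; apply: Pr_le1; exact: prob_pm. Qed.

(* Points at distance more than [L] from [x0] possibly adjacent to a point which is at distance
   at most [l] from [x0] and has [gU] at least [1/l]. *)
Definition tailS T l L n m (x0 : R) : {set 'I_n * 'I_m} :=
  [set z | (L < `|gX R z - x0|) && (`|gX R z - x0| <= l + T (gU R z) l^-1)].

(** The bound of [mass_shape] for the sites of height at most u whose range to height 1/l touches an
    interval of radius l, with 1/m replaced by 1. *)
Definition tau k b l u : R := 2 * (k * l `^ b) * (u `^ (1 - b) / (1 - b)) + (2 * l + 1) * u.

(** By the choice of [L], a site beyond [L] that is still within range has height at most [u]. *)
Lemma tail_mass T k b l L u n m x0 : 0 <= k -> 0 <= b < 1 -> 0 < l -> 0 < u -> (0 < m)%N ->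
  (forall u, 0 < u <= 1 -> T u l^-1 <= kT k b u l^-1) ->
  l + k * l `^ b * u `^ (- b) <= L -> mass R m (@tailS T l L n m x0) <= tau k b l u.
Proof.
move=> k0 hb l0 u0 m0 hT hL; case/andP: (hb) => b0 b1; have ku : 0 <= k * l `^ b by rewrite mulr_ge0 ?powR_ge0.
apply: le_trans (@mass_shape R n m (k * l `^ b) l b u x0 _ m0 ku (ltW l0) hb (ltW u0) _) _.
  move=> z; rewrite inE => /andP[h1 h2].
  have h3 : `|gX R z - x0| <= k * l `^ b * gU R z `^ (- b) + l.
    apply: le_trans h2 _; rewrite addrC lerD2r; apply: le_trans (hT _ _) _.
    by rewrite gU_gt0 gU_le1.
    rewrite /kT powRM ?invr_ge0 ?(ltW l0) ?(ltW (gU_gt0 _ _)) //.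
    have -> : l^-1 `^ (- b) = l `^ b by rewrite -powR_inv1 ?(ltW l0) // -powRrM mulN1r opprK.
    by rewrite mulrA mulrAC.
  split=> //; rewrite leNgt; apply/negP => hu.
  have := @powR_anti u (gU R z) b b0 u0 (ltW hu) => /(ler_wpM2l ku); lra.
rewrite /tau lerD2l ler_wpM2r ?(ltW u0) // lerD2l invf_le1 ?ltr0n //.
by rewrite ler1n.
Qed.

Lemma small_powR (s C e : R) : 0 < s -> 0 <= C -> 0 < e -> exists2 u, 0 < u <= 1 & C * u `^ s <= e.
Proof.
move=> s0 C0 e0; have q0 : 0 < e / (C + 1) by rewrite divr_gt0 //; lra.
exists (Num.min 1 ((e / (C + 1)) `^ s^-1)).
  by rewrite lt_min ltr01 powR_gt0 //= ge_min lexx.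
apply: le_trans (_ : C * (e / (C + 1)) <= _).
  rewrite ler_wpM2l //.
  apply: le_trans (_ : ((e / (C + 1)) `^ s^-1) `^ s <= _).
    apply: ge0_ler_powR; rewrite ?nnegrE ?(ltW s0) ?powR_ge0 //.
    by rewrite le_min ler01 powR_ge0.
    by rewrite ge_min lexx orbT.
  by rewrite -powRrM mulVf ?gt_eqF // powRr1 ?(ltW q0).
by rewrite mulrA ler_pdivrMr; [nra|lra].
Qed.

Lemma small_tau k b l e : 0 <= k -> 0 <= b < 1 -> 0 < l -> 0 < e ->
  exists2 u, 0 < u <= 1 & tau k b l u <= e.
Proof.
move=> k0 /andP[b0 b1] l0 e0.
have s0 : 0 < 1 - b by lra.
pose C := 2 * (k * l `^ b) / (1 - b) + (2 * l + 1).
have A0 : 0 <= 2 * (k * l `^ b) / (1 - b) by rewrite divr_ge0 ?(ltW s0) // !mulr_ge0 ?powR_ge0.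
have C0 : 0 <= C by rewrite /C addr_ge0 // addr_ge0 // mulr_ge0 // ltW.
have [u /andP[u0 u1] hu] := small_powR s0 C0 e0.
exists u; first by rewrite u0 u1.
apply: le_trans hu; rewrite /tau /C [leRHS]mulrDl; apply: lerD.
  by rewrite le_eqVlt; apply/orP; left; apply/eqP; field; rewrite gt_eqF.
rewrite ler_wpM2l //; first by lra.
rewrite -{1}(powRr1 (ltW u0)); apply: ger_powR; rewrite ?u0 ?u1 //; lra.
Qed.

Lemma Dr_DL T l L n m (v : 'I_n * 'I_m) : thr T -> 0 < l -> l <= L ->
  Dr T l v <= DL T l L v + mass R m (tailS T l L n m (gX R v)).
Proof.
move=> hT l0 lL; case: (hT) => Ts _ Ta.
pose S := tailS T l L n m (gX R v).
have H : Dr T l v <= DL T l L v + Pr (@pm R m _) (fun w => ~~ vac S w).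
  apply: Pr_le_or; first exact: prob_pm.
  move=> w hr; have [vs|] := boolP (vac S w); last by rewrite orbT.
  rewrite orbF; apply: (reach_local lL _ vs _ hr); last first.
    by rewrite inE subrr normr0 ltNge (le_trans (ltW l0) lL).
  move=> y z; rewrite negb_or -leNgt -ltNge => /andP[y1 y2] z1 a; rewrite inE z1 /=.
  have -> : gX R z - gX R v = (gX R y - gX R v) - (gX R y - gX R z) by ring.
  apply: le_trans (ler_normB _ _) _; apply: lerD => //.
  apply: le_trans a _; rewrite [leRHS]Ts; apply: Ta; rewrite ?gU_gt0 ?invr_gt0 //.
  exact: ltW.
apply: le_trans H _; rewrite lerD2l; exact: hit_le.
Qed.

Variable UF : set_system nat.
Hypotheses (UFu : UltraFilter UF) (UFoo : tails UF).

Lemma UF_and (P Q : nat -> Prop) : UF P -> UF Q -> UF (fun m => P m /\ Q m).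
Proof. exact: filterI. Qed.

Lemma UF_imp (P Q : nat -> Prop) : (forall m, P m -> Q m) -> UF P -> UF Q.
Proof. by move=> h; apply: filterS. Qed.

Lemma UF_not (P : nat -> Prop) : ~ UF P -> UF (fun m => ~ P m).
Proof. by move=> h; case: (in_ultra_setVsetC P UFu). Qed.

Lemma UF_ex (P : nat -> Prop) : UF P -> exists m, P m.
Proof. by move/filter_ex. Qed.

(** The bound is asked on every line and column, so that it can be used at any position. The scale l
    is existential because [Dn] decreases in l ([Dn_anti]): the infimum [cc] is a supremum over
    positions followed by limits in m and then in l. *)
Definition cset k b q := 0 <= q /\ exists2 l, 1 <= l &
  UF (fun m => forall n (i : 'I_n), Dn (kT k b) l m i <= q).
Definition cc k b : R := inf (cset k b).

Lemma cset1 k b : cset k b 1.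
Proof.
split=> //; exists 1 => //; apply: UF_imp (UFoo 0) => m _ n i; exact: Dn_le1.
Qed.

Lemma cc_le k b q : cset k b q -> cc k b <= q.
Proof. by move=> h; apply: ge_inf => //; exists 0 => x []. Qed.

Lemma cc_ge0 k b : 0 <= cc k b.
Proof. by apply: lb_le_inf; [exists 1; exact: cset1|move=> x []]. Qed.

Lemma cc_le1 k b : cc k b <= 1.
Proof. by apply: cc_le; exact: cset1. Qed.

Lemma cset_up k b q q' : q <= q' -> cset k b q -> cset k b q'.
Proof.
move=> qq [q0 [l l1 h]]; split; first exact: le_trans qq.
by exists l => //; apply: UF_imp h => m h n i; apply: le_trans qq.
Qed.

Lemma cc_lt k b q : cc k b < q -> cset k b q.
Proof.
move=> h; have [x hx xq] := inf_lt (ex_intro _ 1 (cset1 k b)) h.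
exact: cset_up (ltW xq) hx.
Qed.

(** Maximality of the filter: if the uniform bound does not hold for filter-many m, then for
    filter-many m some line violates it. *)
Lemma cc_gt k b q l : 0 <= q -> q < cc k b -> 1 <= l ->
  UF (fun m => exists n (i : 'I_n), q < Dn (kT k b) l m i).
Proof.
move=> q0 qc l1.
have : ~ UF (fun m => forall n (i : 'I_n), Dn (kT k b) l m i <= q).
  move=> h; have : cc k b <= q by apply: cc_le; split=> //; exists l.
  by rewrite leNgt qc.
move/UF_not; apply: UF_imp => m; apply: contra_notP => h n i.
by rewrite leNgt; apply/negP => hh; apply: h; exists n, i.
Qed.

Lemma cc_mono k k' b b' : 0 <= k <= k' -> b <= b' -> cc k b <= cc k' b'.
Proof.
move=> hk hb; apply: lb_le_inf; first by exists 1; exact: cset1.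
move=> q [q0 [l l1 h]]; apply: cc_le; split; first by [].
exists l; first by [].
apply: UF_imp h => m h n i; apply: le_trans (h n i); apply: Dn_le => u u' hu hu'.
exact: kT_mono.
Qed.

(* The value of [cc] bounds from below the local connection probabilities of any
   sufficiently long line, whatever the line that nearly achieves the supremum. *)
Lemma cc_local k b q l L u : 0 <= k -> 0 <= b < 1 -> 0 <= q -> q < cc k b -> 1 <= l -> 0 < u ->
  l + k * l `^ b * u `^ (- b) <= L ->
  UF (fun m => forall n (i : 'I_n), L * m%:R <= i%:R -> i%:R + L * m%:R + 1 <= n%:R ->
    q - tau k b l u <= (\sum_(j < m) DL (kT k b) l L (i, j)) / m%:R).
Proof.
move=> k0 hb q0 qc l1 u0 hL; case/andP: (hb) => b0 b1.
have l0 : 0 < l by lra.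
have lL : l <= L by apply: le_trans hL; rewrite lerDl !mulr_ge0 ?powR_ge0.
apply: UF_imp (UF_and (cc_gt q0 qc l1) (UFoo 1)) => m [[n [i hi]] m0] n' i' r1 r2.
pose K := Num.truncn (L * m%:R).
have hK : K%:R <= L * m%:R < K.+1%:R.
  by rewrite truncnS_gt truncn_le mulr_ge0 //; lra.
rewrite lerBlDr; apply: le_trans (ltW hi) _; rewrite /Dn.
have mp : 0 < m%:R :> R by rewrite ltr0n.
rewrite ler_pdivrMr // mulrDl divfK ?gt_eqF //.
have -> : tau k b l u * m%:R = \sum_(j < m) tau k b l u.
  by rewrite big_const_ord iter_addr_0 mulr_natr.
rewrite -big_split; apply: ler_sum => j _ /=.
apply: le_trans (Dr_DL _ (thr_kT k0 b0) l0 lL) _; apply: lerD.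
  apply: (DL_transfer _ _ hK) => //=.
    by rewrite -(ler_nat R); case/andP: hK => hK _; apply: le_trans hK r1.
  by rewrite -(ltr_nat R) natrD; case/andP: hK => hK _; lra.
by apply: tail_mass => //.
Qed.

End Ideal.

(** * The ladder of dyadic heights *)

Section Ladder.
Import Fin.
Variable R : realType.
Implicit Types (T : R -> R -> R) (l L k b q h : R).

(** The vertices of long range: the range grows as [gU] decreases. *)
Definition high n m h : pred ('I_n * 'I_m) := fun z => gU R z <= h.
Arguments high {n m}.

Lemma conn_avoid (V : finType) (e : rel V) (w : {set V}) (O : pred V) v z :
  connect (gr e w) v z -> (forall y, connect (gr e w) v y -> ~~ O y) ->
  connect (gr e [set u in w | ~~ O u]) v z.
Proof.
case/connectP => s; elim: s v => [|y s IH] v /= => [_ -> _|]; first exact: connect0.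
case/andP => g hs hz hO; have gy : connect (gr e w) v y by apply: connect1.
apply: connect_trans (IH y hs hz _); last by move=> y' c; apply: hO; apply: connect_trans c.
apply: connect1; case/and3P: g => vw yw evy.
by rewrite /gr !inE vw yw !hO // connect0.
Qed.

(** If the cluster of [v] has no site of height at most [h], it can escape only by travelling
    farther than [l], hence over [x1] or [x2]. These are lower than the whole path, so [adj_cover]
    joins one of them to the cluster, a contradiction. *)
Lemma cover_exit T n m (w : {set 'I_n * 'I_m}) (v x1 x2 : 'I_n * 'I_m) l h : thr T ->
  v \in w -> x1 \in w -> x2 \in w -> high h x1 -> high h x2 -> l^-1 <= h ->
  gX R v <= gX R x1 <= gX R v + l -> gX R v - l <= gX R x2 <= gX R v ->
  reach (adj T) w v (Out l v) -> reach (adj T) w v (high h).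
Proof.
move=> hT vw x1w x2w hx1 hx2 lh X1 X2 /existsP[z /andP[oz c]].
apply: contraT; rewrite negb_exists => /forallP hn.
have hO y : connect (gr (adj T) w) v y -> ~~ high h y.
  by move=> cy; move: (hn y); rewrite cy andbT.
have c' := conn_avoid c hO.
have zx : l < `|gX R z - gX R v|.
  case/orP: oz => // h1; have := hO z c; rewrite /high (le_trans h1 lh); by [].
suff [x xw [hx bx]] : exists2 x, x \in w & high h x /\
    (gX R v <= gX R x <= gX R z \/ gX R z <= gX R x <= gX R v).
  have [|p cp ap] := adj_cover hT c' (z := x) _ bx.
    move=> y; rewrite !inE => /orP[/eqP ->|/andP[_ hy]].
    by apply: le_trans hx _; rewrite ltW // ltNge; apply: hO.
    by apply: le_trans hx _; rewrite ltW // ltNge.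
  have cpw : connect (gr (adj T) w) v p.
    by apply: conn_mono cp => //; apply/subsetP => y; rewrite inE => /andP[].
  have pw : p \in w.
    by have [<-//|ne] := eqVneq v p; case/andP: (conn_in cpw ne).
  have := hO x; rewrite hx => /(_ _) hf; apply: hf.
  by apply: connect_trans cpw _; apply: connect1; rewrite /gr pw xw ap.
move: zx; case: (ger0P (gX R z - gX R v)) => h0 zx.
  by exists x1 => //; split=> //; left; apply/andP; lra.
by exists x2 => //; split=> //; right; apply/andP; lra.
Qed.

(* Reveal the rows above [h'] first: the rows below are then independent of the first point
   [z] found in the rows up to [h], so a neighbour of [z] in [Q z] exists with
   conditional probability at least [1 - expR (- c)]. *)
Lemma ladder_step n m (e : rel ('I_n * 'I_m)) (v : 'I_n * 'I_m) h h' (c : R)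
    (Q : 'I_n * 'I_m -> {set 'I_n * 'I_m}) :
  (forall z x, h' < gU R z <= h -> x \in Q z -> high h' x /\ e z x) ->
  (forall z, h' < gU R z <= h -> c <= mass R m (Q z)) ->
  Pr (@pm R m _) (fun w => reach e (v |: w) v (high h) && ~~ reach e (v |: w) v (high h'))
    <= expR (- c).
Proof.
move=> hQ hm; set p := @pm R m _; have hp : prob p by exact: prob_pm.
pose S := [set z : 'I_n * 'I_m | h' < gU R z].
pose pk (w : {set 'I_n * 'I_m}) :=
  [pick z | [&& h' < gU R z, high h z & connect (gr e (v |: (w :&: S))) v z]].
apply: (@le_trans _ _ (\sum_z Pr p (fun w => (pk w == Some z) && vac (Q z) w))).
  apply: le_trans (Pr_exists _ _ hp); apply: Pr_le => // w /andP[r nr].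
  have hO y : connect (gr e (v |: w)) v y -> ~~ high h' y.
    by move=> cy; apply: contra nr => hy; apply/existsP; exists y; rewrite hy.
  case/existsP: r => z /andP[hz cz].
  have hsub : [set u in v |: w | ~~ high h' u] \subset v |: (w :&: S).
    apply/subsetP => u; rewrite !inE -ltNge => /andP[/orP[->//|->] ->].
    by rewrite orbT.
  have cz' := conn_mono (fun _ _ _ _ e1 => e1) hsub (conn_avoid cz hO).
  rewrite /pk; case: pickP => [z'|/(_ z)]; last first.
    by rewrite hz cz' andbT /= ltNge hO.
  case/and3P => z1 z2 z3; apply/existsP; exists z'; rewrite /= eqxx /=.
  apply/negPn/negP => /set0Pn[x]; rewrite inE => /andP[xw xQ].
  have [|xh ezx] := hQ z' x _ xQ; first by rewrite z1; exact: z2.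
  have cz3 : connect (gr e (v |: w)) v z'.
    by apply: conn_mono z3 => //; rewrite setUS // subsetIl.
  have z'w : z' \in v |: w.
    have [<-|ne] := eqVneq v z'; first by rewrite setU11.
    by case/andP: (conn_in cz3 ne).
  have := hO x; rewrite xh => hf; have : false; last by [].
  apply: hf; apply: connect_trans cz3 _; apply: connect1.
  by rewrite /gr z'w ezx andbT /= !inE xw orbT.
apply: le_trans (_ : \sum_z Pr p (fun w => pk w == Some z) * expR (- c) <= _).
  apply: ler_sum => z _.
  have [hz|nhz] := boolP ((h' < gU R z) && high h z); last first.
    rewrite (_ : Pr p _ = 0) ?mulr_ge0 ?Pr_ge0 ?expR_ge0 //.
    rewrite /Pr /Ex big1 // => w _; rewrite /pk; case: pickP => [z' /and3P[z1 z2 _]|_] /=.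
    case: eqP => [[e1]|_]; last by rewrite mulr0.
    by move: nhz; rewrite -e1 z1 z2.
    by rewrite mulr0.
  rewrite (@PrI R _ p (fun w => pk w == Some z) (vac (Q z)) S (Q z)).
  - rewrite ler_wpM2l ?Pr_ge0 //; apply: le_trans (vac_le _ _ _) _.
    by rewrite ler_expR lerN2 hm.
  - rewrite disjoint_subset; apply/subsetP => x; rewrite !inE => xS.
    by apply/negP => xQ; have [] := hQ z x hz xQ; rewrite /high leNgt xS.
  - by move=> w; rewrite /pk -setIA setIid.
  - exact: dep_vac.
rewrite -big_distrl /= -[leRHS]mul1r ler_wpM2r ?expR_ge0 //.
rewrite -(Ex_cst p 1) /Pr -(Ex_sum _ _ p (fun z w => (pk w == Some z)%:R)).
apply: Ex_le => // w; case: (pk w) => [z|].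
  rewrite (bigD1 z) //= eqxx big1 ?addr0 // => y ny.
  by case: eqP => // -[e1]; rewrite e1 eqxx in ny.
by rewrite big1.
Qed.

(** The geometric series of the costs of all rungs below h; its ratio 4^(1-2b) is less than 1
    exactly when b > 1/2. *)
Definition ladder_cost k b h : R := 16 / k * (h `^ (2 * b - 1) / (1 - 4 `^ (1 - 2 * b))).

Lemma expN_le (x : R) : 0 < x -> expR (- x) <= x^-1.
Proof.
move=> x0; rewrite expRN lef_pV2 ?posrE ?expR_gt0 //.
by apply: le_trans (expR_ge1Dx x); lra.
Qed.

(** A site of height in (h/4, h] is adjacent to all sites of heights in (h/16, h/4] within k
    h^(-2b), and on the roomier side of the line these have mass at least k h^(1-2b) / 16. Stopping
    at h/16 leaves the graph free below that height. *)
Lemma rung n m (e : rel ('I_n * 'I_m)) k b (v : 'I_n * 'I_m) h : 0 < k -> 0 < b -> 0 < h <= 1 ->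
  64 / h <= m%:R -> 64 * h `^ (2 * b) <= k * m%:R ->
  2 * (k * h `^ (- (2 * b))) * m%:R + 2 <= n%:R ->
  (forall z x, h / 16 < gU R z -> h / 16 < gU R x ->
    `|gX R z - gX R x| <= kT k b (gU R z) (gU R x) -> e z x) ->
  Pr (@pm R m _) (fun w => reach e (v |: w) v (high h) && ~~ reach e (v |: w) v (high (h / 4)))
   <= 16 / k * h `^ (2 * b - 1).
Proof.
move=> k0 b0 /andP[h0 h1] m1 m2 m3 he.
have m0 : (0 < m)%N by exact: cell_m0 v.
have mp : 0 < m%:R :> R by rewrite ltr0n.
pose s := k * h `^ (- (2 * b)).
have hb0 : 0 < h `^ (2 * b) by rewrite powR_gt0.
have s0 : 0 < s by rewrite mulr_gt0 // powR_gt0.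
have sm : 64 <= s * m%:R.
  by rewrite /s powRN mulrAC ler_pdivlMr.
pose Q (z : 'I_n * 'I_m) := [set x : 'I_n * 'I_m | (h / 16 < gU R x <= h / 4) &&
   (`|gX R z - gX R x| <= s)].
have c0 : 0 < k / 16 * h `^ (1 - 2 * b) by rewrite mulr_gt0 ?powR_gt0 ?divr_gt0.
apply: le_trans (@ladder_step n m e v h (h / 4) (k / 16 * h `^ (1 - 2 * b)) Q _ _) _.
- move=> z x /andP[z1 z2]; rewrite inE => /andP[/andP[x1 x2] x3]; split=> //.
  apply: he => //; first by lra.
  apply: le_trans x3 _; rewrite /s /kT ler_pM2l //.
  have -> : h `^ (- (2 * b)) = (h * h) `^ (- b).
    rewrite powRM ?ltW // -powRD; last by apply/implyP => _; rewrite gt_eqF.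
    by congr powR; ring.
  apply: powR_anti; [exact: ltW|by rewrite mulr_gt0 ?gU_gt0|].
  by apply: ler_pM => //; [apply: ltW; exact: gU_gt0|apply: ltW; exact: gU_gt0|lra].
- move=> z /andP[z1 z2].
  have im : m%:R^-1 <= h / 64.
    by rewrite -[leRHS]invrK lef_pV2 ?posrE ?invr_gt0 ?divr_gt0 // invf_div.
  have im2 : m%:R^-1 <= s / 64.
    rewrite -[leRHS]invrK lef_pV2 ?posrE ?invr_gt0 ?divr_gt0 // invf_div.
    by rewrite ler_pdivrMr // mulrC.
  have im0 : 0 < m%:R^-1 :> R by rewrite invr_gt0.
  have hxm : gX R z * m%:R = z.1%:R by rewrite divfK // gt_eqF.
  have hz1 : z.1%:R + 1 <= n%:R :> R by rewrite natr1 ler_nat.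
  have hs : h `^ (1 - 2 * b) = h * h `^ (- (2 * b)).
    by rewrite powRD ?powRr1 ?ltW //; apply/implyP => _; rewrite gt_eqF.
  have -> : k / 16 * h `^ (1 - 2 * b) = h * s / 16 by rewrite hs /s; field.
  have [hl|hl] := lerP (2 * z.1%:R) (n%:R : R).
    apply: le_trans (@mass_rect R n m (gX R z) (gX R z + s) (h / 16) (h / 4) (Q z) m0 _ _ _ _ _ _ _).
    + by nra.
    + exact: gX_ge0.
    + by rewrite mulrDl hxm; move: m3; rewrite -/s; nra.
    + by lra.
    + by lra.
    + by lra.
    + by lra.
    by move=> x hx /andP[a1 a2]; rewrite inE hx ler_norml; apply/andP; split; lra.
  apply: le_trans (@mass_rect R n m (gX R z - s) (gX R z) (h / 16) (h / 4) (Q z) m0 _ _ _ _ _ _ _).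
  + by nra.
  + by rewrite subr_ge0 -(ler_pM2r mp) hxm; move: m3; rewrite -/s; nra.
  + by rewrite hxm; lra.
  + by lra.
  + by lra.
  + by lra.
  + by lra.
  by move=> x hx /andP[a1 a2]; rewrite inE hx ler_norml; apply/andP; split; lra.
apply: le_trans (expN_le c0) _.
rewrite invfM invf_div -powRN opprB; exact: lexx.
Qed.

Lemma ladder n m (e : rel ('I_n * 'I_m)) k b (v : 'I_n * 'I_m) h (K : nat) :
  0 < k -> 2^-1 < b -> 0 < h <= 1 ->
  64 * 4 ^+ K / h <= m%:R -> 64 <= k * m%:R ->
  2 * (k * (h / 4 ^+ K) `^ (- (2 * b))) * m%:R + 2 <= n%:R ->
  (forall z x, h / 4 ^+ K / 16 < gU R z -> h / 4 ^+ K / 16 < gU R x ->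
    `|gX R z - gX R x| <= kT k b (gU R z) (gU R x) -> e z x) ->
  Pr (@pm R m _) (fun w => reach e (v |: w) v (high h) &&
    ~~ reach e (v |: w) v (high (h / 4 ^+ K))) <= ladder_cost k b h.
Proof.
move=> k0 b2 /andP[h0 h1] m1 m2 m3 he; set p := @pm R m _; have hp : prob p by exact: prob_pm.
have mp : 0 < m%:R :> R by rewrite ltr0n; exact: cell_m0 v.
pose r : R := 4 `^ (1 - 2 * b).
have r0 : 0 < r by rewrite powR_gt0.
have r1 : r < 1.
  rewrite /r /powR ifF ?gt_eqF // -[ltRHS]expR0 ltr_expR.
  by have : 0 < ln 4 :> R; [rewrite ln_gt0 // ltr1n|nra].
pose c : R := 16 / k * h `^ (2 * b - 1).
have c0 : 0 <= c by rewrite mulr_ge0 ?powR_ge0 ?divr_ge0 ?ltW.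
have step i : (i < K)%N -> Pr p (fun w => reach e (v |: w) v (high (h / 4 ^+ i)) &&
    ~~ reach e (v |: w) v (high (h / 4 ^+ i.+1))) <= c * r ^+ i.
  move=> iK; have p4 j : 0 < 4 ^+ j :> R by rewrite exprn_gt0.
  have iK4 : 4 ^+ i.+1 <= 4 ^+ K :> R by rewrite ler_eXn2l // ltr1n.
  have hiK : h / 4 ^+ K <= h / 4 ^+ i.+1 by rewrite ler_pM2l // lef_pV2 ?posrE.
  have hi0 : 0 < h / 4 ^+ i by rewrite divr_gt0.
  have hi1 : h / 4 ^+ i <= 1.
    by rewrite ler_pdivrMr // mul1r; apply: le_trans h1 _; rewrite exprn_ege1 // ler1n.
  have hi4 : h / 4 ^+ i.+1 = h / 4 ^+ i / 4 by rewrite exprSr invfM mulrA.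
  rewrite hi4; apply: le_trans (@rung n m e k b v (h / 4 ^+ i) k0 _ _ _ _ _ _) _.
  - lra.
  - by rewrite hi0 hi1.
  - rewrite invf_div mulrA; apply: le_trans m1; rewrite ler_pM2r ?invr_gt0 // ler_pM2l //.
    by apply: le_trans iK4; rewrite ler_eXn2l // ltr1n.
  - apply: le_trans m2; rewrite -[leRHS]mulr1 ler_pM2l //.
    have h10 : (h / 4 ^+ i) `^ (2 * b) <= 1 `^ (2 * b).
    by apply: ge0_ler_powR; rewrite ?nnegrE // ?ltW //; lra.
    by rewrite powR1 in h10.
  - apply: le_trans m3; rewrite lerD2r ler_pM2r // ler_pM2l // ler_pM2l //.
    apply: powR_anti; [lra|by rewrite divr_gt0|].
    by apply: le_trans hiK _; rewrite hi4; lra.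
  - have hh : h / 4 ^+ K / 16 <= h / 4 ^+ i / 16 by move: hiK; rewrite hi4; lra.
    by move=> z x hz hx; apply: he; [exact: le_lt_trans hz|exact: le_lt_trans hx].
  have -> : (h / 4 ^+ i) `^ (2 * b - 1) = h `^ (2 * b - 1) * r ^+ i; last by rewrite mulrA.
  rewrite powRM ?invr_ge0 ?ltW //; congr (_ * _).
  have -> : 4 ^- i = (4 : R) `^ (- i%:R) by rewrite powRN powR_mulrn.
  rewrite -powRrM -[r ^+ i]powR_mulrn ?(ltW r0) // /r -powRrM; congr powR; ring.
apply: (@le_trans _ _ (\sum_(i < K) c * r ^+ i)).
  elim: K step {m1 m3 he} => [|K IH] step.
    rewrite expr0 divr1 big_ord0 /Pr /Ex big1 // => w _.
    by rewrite andbN mulr0.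
  rewrite big_ord_recr /=; apply: le_trans (lerD (IH _) (step K _)) => //.
    apply: Pr_le_or => // w /andP[-> nr] /=; rewrite nr andbT.
    by case: (reach _ _ _ (high (h / 4 ^+ K))).
  by move=> i iK; apply: step; exact: ltnW.
have -> : ladder_cost k b h = c / (1 - r) by rewrite /ladder_cost mulrA.
rewrite -big_distrr /= ler_wpM2l // -[leRHS]mul1r ler_pdivlMr; last by lra.
have -> : (\sum_(i < K) r ^+ i) * (1 - r) = 1 - r ^+ K.
  by rewrite mulrC -opprB mulNr -subrX1 opprB.
by rewrite lerBlDr lerDl exprn_ge0 // ltW.
Qed.

End Ladder.
Arguments high {R n m}.

Section Chain.
Import Fin.
Variable R : realType.
Implicit Types (T : R -> R -> R) (l L k b q h d e : R).

Lemma amb_budget L d (m : nat) : 0 < 2 * L + 3 -> m%:R^-1 <= d ->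
  (2 * L + 3) * (4 * d + 2 / m%:R) <= 8 * ((2 * L + 3) * d).
Proof.
move=> h1 h2; have -> : 8 * ((2 * L + 3) * d) = (2 * L + 3) * (8 * d) by ring.
have h3 : 0 <= m%:R^-1 :> R by rewrite invr_ge0.
by rewrite ler_pM2l //; lra.
Qed.

Lemma avg_addc (m : nat) (F : 'I_m -> R) c : (0 < m)%N ->
  (\sum_(j < m) (F j + c)) / m%:R = (\sum_(j < m) F j) / m%:R + c.
Proof.
move=> m0; rewrite big_split /= mulrDl big_const_ord iter_addr_0.
by rewrite -[c *+ m]mulr_natr mulfK // gt_eqF // ltr0n.
Qed.

Lemma rows_below (m : nat) h : (0 < m)%N -> 0 <= h ->
  (\sum_(j < m) ((j.+1%:R / m%:R < h :> R)%:R : R)) / m%:R <= h.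
Proof.
move=> m0 h0; have h01 : (0 <= (0 : R)) && ((0 : R) < 1) by rewrite lexx /= ltr01.
have := @row_sum R m m 0 h m0 h01 h0; rewrite subr0 divr1 powRr1; last first.
  by rewrite le_min h0 divr_ge0.
move=> H; apply: le_trans (_ : Num.min (m%:R / m%:R) h <= _); last by rewrite ge_min lexx orbT.
apply: le_trans H; rewrite mulr_suml [leRHS]big_mkcond; apply: ler_sum => j _.
case: ltP => [/ltW ->|_]; first by rewrite oppr0 powRr0.
by rewrite mul0r; case: ifP => // _; rewrite divr_ge0 ?powR_ge0.
Qed.

Lemma compare_row T1 T2 k b l L h d u n m (v : 'I_n * 'I_m) :
  thr T1 -> thr T2 -> 0 <= k -> 0 <= b < 1 -> 1 <= l -> 0 < u ->
  l + k * l `^ b * u `^ (- b) <= L -> 0 < h <= gU R v -> 0 <= d ->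
  (forall x y, h <= x <= 1 -> h <= y <= 1 -> `|T1 x y - T2 x y| <= d) ->
  (forall x, 0 < x <= 1 -> T1 x l^-1 <= kT k b x l^-1) ->
  Dr T1 l v <= DL T2 l L v + (tau k b l u + (2 * L + 1) * h + (2 * L + 3) * (4 * d + 2 / m%:R)).
Proof.
move=> t1 t2 k0 hb l1 u0 hL /andP[h0 hv] d0 hd hT.
have l0 : 0 < l by lra.
have lL : l <= L by apply: le_trans hL; rewrite lerDl !mulr_ge0 ?powR_ge0.
case: (t1) => Ts _ Ta.
pose S := tailS T1 l L n m (gX R v).
have mS : mass R m S <= tau k b l u by apply: (@tail_mass R T1 k b l L u n m) => //; exact: cell_m0 v.
apply: le_trans (@compare R n m (adj T1) (adj T2) T1 v l L h d S Ts _ lL d0 _ _ _ _ _) _.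
- lra.
- by rewrite ltW.
- by rewrite inE subrr normr0 negb_and -leNgt; apply/orP; left; lra.
- by move=> y; apply: adj_refl.
- move=> y z; rewrite negb_or -leNgt -ltNge => /andP[y1 y2] z1 a; rewrite inE z1 /=.
  have -> : gX R z - gX R v = (gX R y - gX R v) - (gX R y - gX R z) by ring.
  apply: le_trans (ler_normB _ _) _; apply: lerD => //.
  apply: le_trans a _; rewrite [leRHS]Ts; apply: Ta; rewrite ?gU_gt0 ?invr_gt0 //.
  exact: ltW.
- move=> y z _ _ hy hz; rewrite /adj -ltNge => a1 a2.
  have := hd (gU R y) (gU R z); rewrite hy hz !gU_le1 => /(_ isT isT).
  rewrite ler_norml => /andP[b1 b2]; apply/andP; split; lra.
by rewrite lerD2l lerD2r lerD2r.
Qed.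

Lemma compare_Dn T1 T2 k b l L h d u n m (i : 'I_n) :
  thr T1 -> thr T2 -> 0 <= k -> 0 <= b < 1 -> 1 <= l -> 0 < u -> (0 < m)%N ->
  l + k * l `^ b * u `^ (- b) <= L -> 0 < h -> 0 <= d ->
  (forall x y, h <= x <= 1 -> h <= y <= 1 -> `|T1 x y - T2 x y| <= d) ->
  (forall x, 0 < x <= 1 -> T1 x l^-1 <= kT k b x l^-1) ->
  Dn T1 l m i <= (\sum_(j < m) DL T2 l L (i, j)) / m%:R +
    (h + (tau k b l u + (2 * L + 1) * h + (2 * L + 3) * (4 * d + 2 / m%:R))).
Proof.
move=> t1 t2 k0 hb l1 u0 m0 hL h0 d0 hd hT; set E := tau _ _ _ _ + _ + _.
have mp : 0 < m%:R :> R by rewrite ltr0n.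
have lL : l <= L by apply: le_trans hL; rewrite lerDl !mulr_ge0 ?powR_ge0.
have E0 : 0 <= E.
  case/andP: hb => b0 b1.
  rewrite /E /tau !addr_ge0 ?mulr_ge0 ?powR_ge0 ?invr_ge0 //; try lra.
  by rewrite addr_ge0 ?mulr_ge0 ?invr_ge0.
apply: le_trans (_ : (\sum_(j < m) (DL T2 l L (i, j) +
   (((j.+1%:R / m%:R < h :> R)%:R : R) + E))) / m%:R <= _).
  rewrite /Dn ler_pM2r ?invr_gt0 //; apply: ler_sum => j _.
  case: ltP => hj /=; last by rewrite add0r; apply: compare_row => //; rewrite h0.
  apply: le_trans (Pr_le1 _ (@prob_pm R m _)) _.
  by rewrite addrCA lerDl addr_ge0 // Pr_ge0 //; exact: prob_pm.
rewrite big_split /= mulrDl lerD2l big_split /= mulrDl; apply: lerD.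
  exact: rows_below (ltW h0).
by rewrite big_const_ord iter_addr_0 -[_ *+ m]mulr_natr mulfK // gt_eqF.
Qed.

(** For heights at least [h], z = - ln (x y) is at most A = - 2 ln h, so (x y)^(-b) = exp (b z)
    varies uniformly little with b. *)
Lemma kT_close k b h d : 0 < k -> 0 < b -> 0 < h <= 1 -> 0 < d -> exists2 s, 0 < s &
  forall k' b', `|k' - k| <= s -> `|b' - b| <= s ->
  forall x y, h <= x <= 1 -> h <= y <= 1 -> `|kT k' b' x y - kT k b x y| <= d.
Proof.
move=> k0 b0 /andP[h0 h1] d0.
pose A : R := 2 * - ln h; pose M : R := expR (b * A).
have A0 : 0 <= A by rewrite mulr_ge0 // oppr_ge0 ln_le0.
have M0 : 0 < M by exact: expR_gt0.
pose s := Num.min (2 * (A + 1))^-1 (d / (M * (2 + 2 * k * A))).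
have D0 : 0 < M * (2 + 2 * k * A) by rewrite mulr_gt0 //; nra.
have s0 : 0 < s by rewrite lt_min invr_gt0 divr_gt0 //; lra.
exists s => // k' b' hk hb x y /andP[x0 x1] /andP[y0 y1].
have s1 : s <= (2 * (A + 1))^-1 by rewrite ge_min lexx.
have s2 : s * (M * (2 + 2 * k * A)) <= d by rewrite -ler_pdivlMr // ge_min lexx orbT.
have xp : 0 < x by lra.
have yp : 0 < y by lra.
have xyp : 0 < x * y by rewrite mulr_gt0.
pose z := - ln (x * y).
have z0 : 0 <= z by rewrite oppr_ge0 ln_le0 //; nra.
have zA : z <= A.
  rewrite /z /A mulrN lerN2 mulr_natl -lnXn // ler_ln ?posrE ?exprn_gt0 //; nra.
have e1 c : (x * y) `^ (- c) = expR (c * z) by rewrite /powR gt_eqF // /z mulNr mulrN.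
rewrite /kT !e1; set t := (b' - b) * z.
have -> : expR (b' * z) = expR (b * z) * expR t by rewrite -expRD; congr expR; rewrite /t; ring.
have sA : s * A <= 2^-1.
  apply: le_trans (_ : (2 * (A + 1))^-1 * A <= _); first by rewrite ler_wpM2r.
  rewrite invfM -mulrA -[leRHS]mulr1 ler_pM2l // mulrC ler_pdivrMr; lra.
have tA : `|t| <= s * A by rewrite normrM ler_pM // ger0_norm.
move: tA; rewrite ler_norml => /andP[t1 t2].
have E1 : 1 - s * A <= expR t by apply: le_trans (expR_ge1Dx t); lra.
have E2 : expR t <= 1 + 2 * (s * A).
  have h2 : 1 - t <= expR (- t) by apply: expR_ge1Dx.
  have h3 : expR t * expR (- t) = 1 by rewrite -expRD subrr expR0.
  have := expR_gt0 t; nra.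
have Mz : expR (b * z) <= M by rewrite ler_expR ler_pM2l.
have -> : k' * (expR (b * z) * expR t) - k * expR (b * z) = expR (b * z) * (k' * expR t - k) by ring.
rewrite normrM [`|expR _|]ger0_norm ?expR_ge0 //.
apply: le_trans s2; rewrite mulrCA; apply: ler_pM => //.
move: hk; rewrite ler_norml => /andP[c1 c2]; have := expR_gt0 t.
have sp := ltW s0; rewrite ler_norml => ep; apply/andP; split; nra.
Qed.

Lemma small_powR_le (s C e : R) : 0 < s -> 0 <= C -> 0 < e ->
  exists2 u0, 0 < u0 <= 1 & forall u, 0 < u <= u0 -> C * u `^ s <= e.
Proof.
move=> s0 C0 e0; have [u0 hu0 h] := small_powR s0 C0 e0; exists u0 => // u /andP[p1 p2].
apply: le_trans h; rewrite ler_wpM2l // ge0_ler_powR ?nnegrE ?(ltW s0) ?(ltW p1) //.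
by case/andP: hu0 => /ltW.
Qed.

Lemma small_ladder k b e : 0 < k -> 2^-1 < b -> 0 < e ->
  exists2 h0, 0 < h0 <= 1 & forall h, 0 < h <= h0 -> ladder_cost k b h <= e.
Proof.
move=> k0 b0 e0; have s0 : 0 < 2 * b - 1 by lra.
have r1 : 0 < 1 - (4 : R) `^ (1 - 2 * b).
  rewrite subr_gt0 /powR ifF ?gt_eqF // -[ltRHS]expR0 ltr_expR.
  by have : 0 < ln 4 :> R; [rewrite ln_gt0 // ltr1n|nra].
have C0 : 0 <= 16 / k / (1 - 4 `^ (1 - 2 * b)).
  by rewrite divr_ge0 ?(ltW r1) // divr_ge0 // ltW.
have [h0 hh0 H] := small_powR_le s0 C0 e0; exists h0 => // h hh.
by apply: le_trans (H h hh); rewrite /ladder_cost mulrA mulrAC.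
Qed.

Variable UF : set_system nat.
Hypotheses (UFu : UltraFilter UF) (UFoo : tails UF).

Lemma UF_real (B : R) : UF (fun m => B <= m%:R).
Proof.
apply: UF_imp (UFoo (Num.truncn B).+1) => m hm.
by apply: le_trans (ltW (truncnS_gt B)) _; rewrite ler_nat.
Qed.

Lemma UF_inv (B : R) : 0 < B -> UF (fun m => m%:R^-1 <= B).
Proof.
move=> B0; apply: UF_imp (UF_real B^-1) => m hm.
by rewrite -[leRHS]invrK lef_pV2 ?posrE ?invr_gt0 //; apply: lt_le_trans hm; rewrite invr_gt0.
Qed.

Lemma hit_band n m x1 x2 h : 0 <= x1 -> x2 * m%:R < n%:R -> 2 / m%:R <= h / 2 -> 0 < h <= 1 ->
  m%:R^-1 <= (x2 - x1) / 2 -> (0 < m)%N -> 0 < x2 - x1 ->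
  Pr (@pm R m _) (vac [set z : 'I_n * 'I_m | (gU R z <= h) && (x1 <= gX R z <= x2)])
   <= 4 / (h * (x2 - x1)).
Proof.
move=> a1 a2 a3 /andP[a4 a5] a6 m0 a7; apply: le_trans (vac_le _ _ _) _.
have c0 : 0 < h * (x2 - x1) / 4 by rewrite divr_gt0 // mulr_gt0.
apply: le_trans (_ : expR (- (h * (x2 - x1) / 4)) <= _); last first.
  by apply: le_trans (expN_le c0) _; rewrite invf_div.
rewrite ler_expR lerN2.
apply: le_trans (@mass_rect R n m x1 x2 0 h _ m0 a1 a2 _ a5 _ _ _); [nra|by []|lra|lra|].
by move=> z /andP[z1 z2] z3; rewrite inE z2.
Qed.

(** On each side of [v], within distance [l], there is an occupied site of height at most [h],
    except with probability 4 / (h l); then [cover_exit] applies inside the window. *)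
Lemma cover_window T n m (v : 'I_n * 'I_m) l L h : thr T -> l <= L -> 0 < h <= 1 -> 0 < l ->
  l^-1 <= h -> 2 / m%:R <= h / 2 -> m%:R^-1 <= l / 2 ->
  L * m%:R <= v.1%:R -> v.1%:R + L * m%:R + 1 <= n%:R ->
  DL T l L v <= Pr (@pm R m _) (fun w => reach (adj T) ((v |: w) :&: winv L v) v (high h)) + 8 / (h * l).
Proof.
move=> hT lL h01 l0 lh m1 m2 r1 r2; have m0 := cell_m0 v.
have mp : 0 < m%:R :> R by rewrite ltr0n.
have xm : gX R v * m%:R = v.1%:R by rewrite divfK // gt_eqF.
have lm : l * m%:R <= L * m%:R by rewrite ler_pM2r.
have lm0 : 0 < l * m%:R by rewrite mulr_gt0.
pose R1 := [set z : 'I_n * 'I_m | (gU R z <= h) && (gX R v <= gX R z <= gX R v + l)].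
pose R2 := [set z : 'I_n * 'I_m | (gU R z <= h) && (gX R v - l <= gX R z <= gX R v)].
set p := @pm R m _; have hp : prob p by exact: prob_pm.
have b1 : Pr p (vac R1) <= 4 / (h * l).
  have := @hit_band n m (gX R v) (gX R v + l) h; rewrite (_ : gX R v + l - gX R v = l); last by ring.
  apply=> //; [exact: gX_ge0|by rewrite mulrDl xm; lra].
have b2 : Pr p (vac R2) <= 4 / (h * l).
  have := @hit_band n m (gX R v - l) (gX R v) h; rewrite (_ : gX R v - (gX R v - l) = l); last by ring.
  apply=> //; last by rewrite xm; lra.
  by rewrite subr_ge0 -(ler_pM2r mp) xm; lra.
have H : DL T l L v <= Pr p (fun w => reach (adj T) ((v |: w) :&: winv L v) v (high h)) +
    Pr p (fun w => vac R1 w || vac R2 w).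
  apply: Pr_le_or => // w hr.
  case: (boolP (vac R1 w)) => [_|/set0Pn[x1]]; first by rewrite orbT.
  rewrite !inE => /andP[x1w /andP[x1h x1x]].
  case: (boolP (vac R2 w)) => [_|/set0Pn[x2]]; first by rewrite !orbT.
  rewrite !inE => /andP[x2w /andP[x2h x2x]]; rewrite !orbF.
  have inL x : `|gX R x - gX R v| <= l -> x \in winv L v by rewrite inE => hx; exact: le_trans hx lL.
  apply: (cover_exit hT _ _ _ x1h x2h lh x1x x2x) hr.
  - by rewrite inE setU11 inL // subrr normr0 ltW.
  - by rewrite inE in_setU x1w orbT inL // ler_norml; move: x1x l0; lra.
  - by rewrite inE in_setU x2w orbT inL // ler_norml; move: x2x l0; lra.
apply: le_trans H _; rewrite lerD2l; apply: le_trans (Pr_or _ _ hp) _.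
apply: le_trans (lerD b1 b2) _; rewrite -mulrDl; lra.
Qed.

Lemma cover_row T n m (v : 'I_n * 'I_m) l L h : thr T -> l <= L -> 0 < h <= 1 -> 0 < l ->
  l^-1 <= h -> 2 / m%:R <= h / 2 -> m%:R^-1 <= l / 2 ->
  L * m%:R <= v.1%:R -> v.1%:R + L * m%:R + 1 <= n%:R ->
  DL T l L v <= Pr (@pm R m _) (fun w => reach (adj T) (v |: w) v (high h)) + 8 / (h * l).
Proof.
move=> hT lL h01 l0 lh m1 m2 r1 r2; apply: le_trans (cover_window hT lL h01 l0 lh m1 m2 r1 r2) _.
rewrite lerD2r; apply: Pr_le => [|w]; first exact: prob_pm.
by apply: reach_mono => //; exact: subsetIl.
Qed.

(** Escape in the kernel (k, b) passes by [compare_Dn] to a kernel [T] close to it above height [h],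
    by [cover_row] to a site of height at most [H], and by the ladder of a smaller kernel (k1, b1)
    down to [H / 4 ^+ K]. The constants are fixed before [T] and [K]: semicontinuity varies [T], and
    the giant component needs [K] growing with N. *)
Lemma chain k b k1 b1 q e : 0 < k -> 2^-1 < b < 1 -> 0 < k1 -> 2^-1 < b1 -> 0 <= q ->
  q < cc UF k b -> 0 < e ->
  exists l L h d H, [/\ 1 <= l, l <= L, 0 < h <= 1, 0 < d & 0 < H <= 1] /\
  forall T (K : nat), thr T ->
   (forall x y, h <= x <= 1 -> h <= y <= 1 -> `|kT k b x y - T x y| <= d) ->
   (forall x y, H / 4 ^+ K / 16 < x <= 1 -> H / 4 ^+ K / 16 < y <= 1 -> kT k1 b1 x y <= T x y) ->
   UF (fun m => forall n (i : 'I_n), L * m%:R <= i%:R -> i%:R + L * m%:R + 1 <= n%:R ->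
    2 * (k1 * (H / 4 ^+ K) `^ (- (2 * b1))) * m%:R + 2 <= n%:R ->
    q - e <= (\sum_(j < m) Pr (@pm R m _)
    (fun w => reach (adj T) ((i, j) |: w) (i, j) (high (H / 4 ^+ K)))) / m%:R).
Proof.
move=> k0 /andP[bh b1'] k10 b10 q0 qc e0.
have e8 : 0 < e / 8 by lra.
have [H0 /andP[H00 H01] HH] := small_ladder k10 b10 e8.
pose H := Num.min H0 (e / 64).
have Hp : 0 < H by rewrite lt_min H00; lra.
have HH0 : H <= H0 by rewrite ge_min lexx.
have He : H <= e / 64 by rewrite ge_min lexx orbT.
have H1 : H <= 1 by lra.
(* This makes 1 / l <= H and turns the cost 8 / (H l) of [cover_row] into 8 H. *)
pose l := H ^- 2.
have l0 : 0 < l by rewrite invr_gt0 exprn_gt0.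
have l1 : 1 <= l by rewrite /l invf_ge1 ?exprn_gt0 // exprn_ile1 // ltW.
have hb : 0 <= b < 1 by apply/andP; lra.
have [u /andP[u0 u1] hu] := small_tau (ltW k0) hb l0 e8.
pose L := l + k * l `^ b * u `^ (- b).
have lL : l <= L by rewrite lerDl !mulr_ge0 ?powR_ge0 ?ltW.
pose h := Num.min 1 (e / 8 / (2 * L + 2)); pose d := e / 64 / (2 * L + 3).
have h0 : 0 < h by rewrite lt_min ltr01 !divr_gt0 //; lra.
have hh : (2 * L + 2) * h <= e / 8 by rewrite mulrC -ler_pdivlMr ?ge_min ?lexx ?orbT //; lra.
have h1 : h <= 1 by rewrite ge_min lexx.
have d0 : 0 < d by rewrite !divr_gt0 //; lra.
have dd : (2 * L + 3) * d = e / 64 by rewrite /d; field; lra.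
exists l, L, h, d, H; split; first by rewrite h0 h1 Hp H1.
move=> T K hT hd hk.
have hbb : 0 <= b by case/andP: hb.
have H4 : 0 < H / 4 by rewrite divr_gt0.
have e64 : 0 < e / 64 by rewrite divr_gt0.
apply: UF_imp (UF_and UFu (cc_local UFu UFoo (ltW k0) hb q0 qc l1 u0 (lexx _))
  (UF_and UFu (UF_real (64 * 4 ^+ K / H)) (UF_and UFu (UF_real (64 / k1))
   (UF_and UFu (UF_inv H4) (UF_and UFu (UF_inv e64)
   (UF_and UFu (UF_inv d0) (UFoo 1))))))).
move=> m [m1 [m2 [m3 [m4 [m5 [m6 m0]]]]]] n i r1 r2 r3.
have mp : 0 < m%:R :> R by rewrite ltr0n.
have {m1} S1 := m1 n i r1 r2.
have S2 : (\sum_(j < m) DL (kT k b) l L (i, j)) / m%:R <= Dn (kT k b) l m i.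
  by rewrite ler_pM2r ?invr_gt0 //; apply: ler_sum => j _; exact: DL_le.
have S3 := @compare_Dn (kT k b) T k b l L h d u n m i (thr_kT (ltW k0) hbb) hT (ltW k0) hb l1 u0 m0
  (lexx _) h0 (ltW d0) hd (fun _ _ => lexx _).
have S4 : (\sum_(j < m) DL T l L (i, j)) / m%:R <= (\sum_(j < m) (Pr (@pm R m _)
    (fun w => reach (adj T) ((i, j) |: w) (i, j) (high (H / 4 ^+ K))) + (e / 8 + e / 8))) / m%:R.
  rewrite ler_pM2r ?invr_gt0 //; apply: ler_sum => j _.
  apply: le_trans (@cover_row T n m (i, j) l L H hT lL _ l0 _ _ _ r1 r2) _.
  - by rewrite Hp H1.
  - by rewrite /l invrK expr2 -[leRHS]mul1r ler_pM2r.
  - by clear -m4; lra.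
  - by clear -m4 H1 l1; lra.
  have HE : 8 / (H * l) <= e / 8.
    have -> : H * l = H^-1 by rewrite /l; field; rewrite gt_eqF.
    by rewrite invrK; clear -He; lra.
  rewrite addrA; apply: lerD => //.
  have P1 := @ladder R n m (adj T) k1 b1 (i, j) H K k10 b10 _ m2 _ r3 _.
  have P2 : ladder_cost k1 b1 H <= e / 8 by apply: HH; rewrite Hp.
  apply: le_trans (_ : Pr (@pm R m _) (fun w => reach (adj T) ((i, j) |: w) (i, j) (high (H / 4 ^+ K)))
    + Pr (@pm R m _) (fun w => reach (adj T) ((i, j) |: w) (i, j) (high H) &&
    ~~ reach (adj T) ((i, j) |: w) (i, j) (high (H / 4 ^+ K))) <= _).
    apply: Pr_le_or; first exact: prob_pm.
    by move=> w ->; case: (reach _ _ _ (high (H / _))).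
  rewrite lerD2l; apply: le_trans P2; apply: P1.
  - by rewrite Hp H1.
  - by rewrite mulrC -ler_pdivrMr.
  move=> z x hz hx a; apply: le_trans a _; apply: hk; rewrite gU_le1 ?hz ?hx //.
rewrite avg_addc // in S4.
have S5 : (2 * L + 3) * (4 * d + 2 / m%:R) <= e / 8.
  apply: le_trans (amb_budget _ m6) _; [|rewrite dd]; clear -l1 lL e0; lra.
nra.
Qed.

End Chain.

(** * Positivity and semicontinuity of the constant *)

Section Critical.
Import Fin.
Variable R : realType.
Implicit Types (T : R -> R -> R) (l L k b q h d e : R).
Variable UF : set_system nat.
Hypotheses (UFu : UltraFilter UF) (UFoo : tails UF).

Lemma pow4_large (x : R) : exists K : nat, x <= 4 ^+ K.
Proof.
exists (Num.truncn x).+1; apply: le_trans (ltW (truncnS_gt x)) _.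
by rewrite -natrX ler_nat ltnW // ltn_expl.
Qed.

Lemma cc_ge k b q : (forall l, 1 <= l -> UF (fun m => exists n (i : 'I_n), q <= Dn (kT k b) l m i)) ->
  q <= cc UF k b.
Proof.
move=> H; apply: lb_le_inf; first by exists 1; exact: cset1.
move=> x [x0 [l l1 hx]].
have [m [h1 [n [i h2]]]] := UF_ex UFu (UF_and UFu hx (H l l1)).
exact: le_trans (h1 n i).
Qed.

Lemma nat_large (x : R) : exists n : nat, x <= n%:R.
Proof. by exists (Num.truncn x).+1; exact: ltW (truncnS_gt x). Qed.

Lemma high_Out l n m (v z : 'I_n * 'I_m) (x : R) : x <= l^-1 -> high x z -> Out l v z.
Proof. by move=> xl hz; apply/orP; right; apply: le_trans hz xl. Qed.

(** A root of height at most [H] descends the whole ladder with probability at least 1/2, and such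
    roots form a fraction of about [H]; the value [H / 8] absorbs the rounding of rows. *)
Lemma cc_pos k b : 0 < k -> 2^-1 < b -> 0 < cc UF k b.
Proof.
move=> k0 b0; have [H /andP[H0 H1] HH] := small_ladder k0 b0 (ltac:(lra) : 0 < 2^-1 :> R).
apply: (@lt_le_trans _ _ (H / 8)); first by lra.
apply: cc_ge => l l1; have [K hK] := pow4_large (l * H).
have H8 : 0 < H / 8 by lra.
apply: UF_imp (UF_and UFu (UF_real UFu UFoo (64 * 4 ^+ K / H)) (UF_and UFu (UF_real UFu UFoo (64 / k))
  (UF_and UFu (UF_inv UFu UFoo H8) (UFoo 1)))) => m [m1 [m2 [m3 m0]]].
have mp : 0 < m%:R :> R by rewrite ltr0n.
have [n hn] := nat_large (2 * (k * (H / 4 ^+ K) `^ (- (2 * b))) * m%:R + 2).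
have n0 : (0 < n)%N.
  rewrite -(ltr_nat R); apply: lt_le_trans hn.
  by rewrite ltr_wpDl // !mulr_ge0 ?powR_ge0 ?ltW.
exists n, (Ordinal n0).
have P (j : 'I_m) : gU R (Ordinal n0, j) <= H -> 2^-1 <= Dr (kT k b) l (Ordinal n0, j).
  move=> hj; set v := (_, j); pose p := @pm R m ('I_n * 'I_m)%type.
  have hp : prob p by exact: prob_pm.
  have P1 := @ladder R n m (adj (kT k b)) k b v H K k0 b0 _ m1 _ hn (fun z x _ _ a => a).
  have P2 : 1 <= Dr (kT k b) l v + Pr p (fun w => reach (adj (kT k b)) (v |: w) v (high H) &&
    ~~ reach (adj (kT k b)) (v |: w) v (high (H / 4 ^+ K))).
    rewrite -{1}(@Ex_cst R _ p 1) -[leLHS]/(Pr p (fun _ => true)); apply: Pr_le_or => // w _.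
    have -> : reach (adj (kT k b)) (v |: w) v (high H).
    by apply/existsP; exists v; rewrite /high hj connect0.
    case: (boolP (reach _ _ _ (high (H / _)))) => hr; last by rewrite orbT.
    rewrite orbF; apply: reach_mono hr => // z _; apply: high_Out.
    by rewrite -[leRHS]mul1r ler_pdivlMr ?ler_pdivrMr ?exprn_gt0 //; [rewrite mulrC mulrA ler_pdivrMr ?exprn_gt0 ?mul1r // mulrC|lra].
  have P3 : ladder_cost k b H <= 2^-1 by apply: HH; rewrite H0 lexx.
  have P4 : 64 <= k * m%:R by rewrite mulrC -ler_pdivrMr.
  have P5 : 0 < H <= 1 by rewrite H0 H1.
  have := P1 P5 P4; lra.
rewrite /Dn ler_pdivlMr //.
apply: (@le_trans _ _ (\sum_(j < m | 0 <= j%:R <= H * m%:R - 1) 2^-1)); last first.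
  rewrite big_mkcond; apply: ler_sum => j _; case: ifPn => [/andP[_ hj]|_].
    by apply: P; rewrite /gU /= ler_pdivrMr // -natr1; lra.
  by apply: Pr_ge0; exact: prob_pm.
rewrite sumr_const -[leRHS]mulr_natr.
have hm : H * m%:R - 1 < m%:R by nra.
have hmi : 1 <= H / 8 * m%:R by rewrite -ler_pdivrMr // div1r.
apply: (@le_trans _ _ (2^-1 * (H * m%:R - 1 - 0 - 1))); first by clear -hmi; lra.
by rewrite ler_pM2l //; exact: count_ge.
Qed.

(** Near (k, b) every kernel dominates the fixed kernel (k / 2, (b + 1/2) / 2), which carries the
    ladder; so the constants of [chain] are the same for all of them. *)
Lemma cc_lsc k b e : 0 < k -> 2^-1 < b < 1 -> 0 < e -> exists2 s, 0 < s &
  forall k' b', `|k' - k| <= s -> `|b' - b| <= s -> cc UF k b - e <= cc UF k' b'.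
Proof.
move=> k0 /andP[bh b1] e0.
have [c0|c0] := lerP (cc UF k b) (e / 2).
  by exists 1 => // k' b' _ _; apply: le_trans (cc_ge0 UFu UFoo _ _); lra.
have q0 : 0 <= cc UF k b - e / 2 by lra.
have qc : cc UF k b - e / 2 < cc UF k b by lra.
have k2 : 0 < k / 2 by lra.
have bb : 2^-1 < (b + 2^-1) / 2 by lra.
have e2 : 0 < e / 2 by lra.
have bhb : 2^-1 < b < 1 by rewrite bh b1.
have [l [L [h [d [H [[l1 lL h01 d0 H01] HC]]]]]] := chain UFu UFoo k0 bhb k2 bb q0 qc e2.
have b00 : 0 < b by lra.
have [s s0 hs] := kT_close k0 b00 h01 d0.
exists (Num.min s (Num.min (k / 2) ((b - 2^-1) / 2))).
  by rewrite !lt_min s0 k2 /=; lra.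
move=> k' b'; rewrite !le_min => /and3P[a1 a2 _] /and3P[a3 _ a4].
apply: cc_ge => l' l1'; case/andP: H01 => H0 H1.
move: a2 a4; rewrite !ler_norml => /andP[a2 _] /andP[a4 _].
have [K hK] := pow4_large (l' * H).
have thr' : thr (kT k' b') by apply: thr_kT; clear -a2 a4 k0 bh; lra.
apply: UF_imp (UF_and UFu (HC (kT k' b') K thr' _ _) (UFoo 1)); last first.
- move=> x y /andP[x0 x1] /andP[y0 y1]; apply: kT_mono; rewrite ?x1 ?y1 ?andbT; try by clear -a2 a4 k0; lra.
  + by apply: le_lt_trans x0; rewrite !divr_ge0 ?exprn_ge0 // ltW.
  + by apply: le_lt_trans y0; rewrite !divr_ge0 ?exprn_ge0 // ltW.
- by move=> x y hx hy; rewrite distrC; apply: hs.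
move=> m [hm m0].
have mp : 0 < m%:R :> R by rewrite ltr0n.
have [i hi] := nat_large (L * m%:R).
have [n hn] := nat_large (i%:R + L * m%:R + 1 + (2 * (k / 2 * (H / 4 ^+ K) `^ (- (2 * ((b + 2^-1) / 2)))) * m%:R + 2)).
have Lm : 0 <= L * m%:R by rewrite mulr_ge0 //; clear -l1 lL; lra.
have hp : 0 <= 2 * (k / 2 * (H / 4 ^+ K) `^ (- (2 * ((b + 2^-1) / 2)))) * m%:R.
  by rewrite !mulr_ge0 ?powR_ge0 // ltW.
have iN : (i < n)%N.
  by rewrite -(ltr_nat R); clear -hn hp Lm; lra.
exists n, (Ordinal iN); have := hm n (Ordinal iN) hi.
have c1 : i%:R + L * m%:R + 1 <= n%:R by clear -hn hp; lra.
have c2 : 2 * (k / 2 * (H / 4 ^+ K) `^ (- (2 * ((b + 2^-1) / 2)))) * m%:R + 2 <= n%:R.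
  by clear -hn Lm; have := ler0n R i; lra.
move=> /(_ c1 c2) hh.
apply: le_trans (_ : cc UF k b - e / 2 - e / 2 <= _); first by clear; lra.
apply: le_trans hh _; rewrite ler_pM2r ?invr_gt0 //; apply: ler_sum => j _.
apply: Pr_le; first exact: prob_pm.
move=> w; apply: reach_mono => // z _; apply: high_Out.
rewrite ler_pdivrMr ?exprn_gt0 // mulrC ler_pdivlMr; last by clear -l1'; lra.
by rewrite mulrC.
Qed.

(** One good scale [l] for (k, b) serves all nearby kernels; their tails are dominated by the single
    kernel (2 k, (1 + b) / 2), whose exponent is still below 1. *)
Lemma cc_usc k b e : 0 < k -> 0 < b < 1 -> 0 < e -> exists2 s, 0 < s &
  forall k' b', `|k' - k| <= s -> `|b' - b| <= s -> cc UF k' b' <= cc UF k b + e.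
Proof.
move=> k0 /andP[b0 b1] e0.
have [q0 [l l1 hq]] : cset UF k b (cc UF k b + e / 2) by apply: cc_lt => //; lra.
have l0 : 0 < l by lra.
pose b2 := (1 + b) / 2.
have hb2 : 0 <= b2 < 1 by rewrite /b2; apply/andP; lra.
have k2 : 0 <= 2 * k by lra.
have e8 : 0 < e / 16 by lra.
have [u /andP[u0 u1] hu] := small_tau k2 hb2 l0 e8.
pose L := l + 2 * k * l `^ b2 * u `^ (- b2).
have lL : l <= L by rewrite lerDl mulr_ge0 ?powR_ge0 // mulr_ge0 ?powR_ge0.
pose h := Num.min 1 (e / 16 / (2 * L + 2)); pose d := e / 64 / (2 * L + 3).
have h0 : 0 < h by rewrite lt_min ltr01 !divr_gt0 //; lra.
have hh : (2 * L + 2) * h <= e / 16 by rewrite mulrC -ler_pdivlMr ?ge_min ?lexx ?orbT //; lra.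
have h1 : h <= 1 by rewrite ge_min lexx.
have d0 : 0 < d by rewrite !divr_gt0 //; lra.
have dd : (2 * L + 3) * d = e / 64 by rewrite /d; field; lra.
have h01 : 0 < h <= 1 by rewrite h0 h1.
have [s s0 hs] := kT_close k0 b0 h01 d0.
exists (Num.min s (Num.min (k / 2) (Num.min (b / 2) ((1 - b) / 2)))).
  by rewrite !lt_min s0 /=; lra.
move=> k' b'; rewrite !le_min => /and4P[a1 a2 _ _] /and4P[a3 _ a4 a5].
move: a2 a4 a5; rewrite !ler_norml => /andP[a2 a2'] /andP[a4 _] /andP[_ a5].
apply: cc_le; split; first by have := cc_ge0 UFu UFoo k b; lra.
exists l; first by [].
apply: UF_imp (UF_and UFu hq (UF_and UFu (UF_inv UFu UFoo d0) (UFoo 1))) => m [hm [md m0]] n i.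
have mp : 0 < m%:R :> R by rewrite ltr0n.
have t1 : thr (kT k' b') by apply: thr_kT; clear -a2 a4 k0 b0; lra.
have t2 : thr (kT k b) by apply: thr_kT; exact: ltW.
have S := @compare_Dn R (kT k' b') (kT k b) (2 * k) b2 l L h d u n m i t1 t2 k2 hb2 l1 u0 m0
  (lexx _) h0 (ltW d0) (fun x y hx hy => hs k' b' a1 a3 x y hx hy).
have S1 : (\sum_(j < m) DL (kT k b) l L (i, j)) / m%:R <= Dn (kT k b) l m i.
  by rewrite ler_pM2r ?invr_gt0 //; apply: ler_sum => j _; exact: DL_le.
have S2 := hm n i.
have S3 : (2 * L + 3) * (4 * d + 2 / m%:R) <= e / 8.
  apply: le_trans (amb_budget _ md) _; [|rewrite dd]; clear -l1 lL e0; lra.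
apply: le_trans (S _) _.
  move=> x /andP[x0 x1]; apply: kT_mono; rewrite ?x0 ?x1 ?invr_gt0 ?l0 ?invf_le1 ?l1 //.
    by clear -a2 a2' k0; apply/andP; lra.
  by rewrite /b2; clear -a5; lra.
clear S; move: e0 S1 S2 S3 hu hh.
move: (Dn (kT k b) l m i) (\sum_(j < m) DL (kT k b) l L (i, j)) (tau _ _ _ _) => D S t; clear; lra.
Qed.

End Critical.

(** * Bounds away from one and near one *)

Section Extremes.
Import Fin.
Variable R : realType.
Implicit Types (T : R -> R -> R) (l L k b q h d e : R).

Lemma isolated_root (V : finType) (e : rel V) (N w : {set V}) v z :
  (forall x, e v x -> x \in N) -> vac N w -> connect (gr e (v |: w)) v z -> z = v.
Proof.
move=> hN hw /connectP[s]; elim: s => [|y s IH] /= => [_ -> //|].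
case/andP => /and3P[_ yw evy]; suff -> : y = v by exact: IH.
move: yw; rewrite !inE => /orP[/eqP //|yw].
by move/eqP/setP/(_ y): hw; rewrite !inE yw hN.
Qed.

Lemma Pr_all (V : finType) (p : V -> R) (S : nat -> {set V}) (A : nat -> {set V} -> bool) (r : R) n :
  prob p -> 0 <= r -> (forall i, dep (S i) (A i)) ->
  (forall i j, (i < j < n)%N -> [disjoint S i & S j]) ->
  (forall i, (i < n)%N -> Pr p (A i) <= r) ->
  Pr p (fun w => all (fun i => A i w) (iota 0 n)) <= r ^+ n.
Proof.
move=> hp r0 dA; elim: n => [|n IH] dS hA; first by rewrite expr0; exact: Pr_le1.
pose S' := [set v | [exists i : 'I_n, v \in S i]].
rewrite (eq_Pr _ (B := fun w => all (fun i => A i w) (iota 0 n) && A n w)); last first.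
  by move=> w; rewrite -addn1 iotaD all_cat /= andbT add0n.
rewrite (@PrI R V p (fun w => all (fun i => A i w) (iota 0 n)) (A n) S' (S n)) //.
- rewrite exprSr ler_pM ?Pr_ge0 //; last by apply: hA.
  apply: IH => [i j /andP[ij jn]|i ilt]; [apply: dS; lia|apply: hA; lia].
- rewrite disjoint_subset; apply/subsetP => v; rewrite !inE => /existsP[i vi].
  have := dS i n; rewrite ltn_ord ltnSn => /(_ isT) /pred0P /(_ v) /=.
  by rewrite vi /= => ->.
move=> w; apply: eq_in_all => i; rewrite mem_iota add0n => /= ilt.
rewrite -[RHS]dA -[LHS]dA; congr (A i _); apply/setP => v; rewrite !inE.
case vS : (v \in S i); rewrite ?andbF // !andbT.
by rewrite (_ : [exists _, _] = true) ?andbT //; apply/existsP; exists (Ordinal ilt).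
Qed.

Lemma disjoint_notin (V : finType) (S S' : {set V}) :
  (forall v, v \in S -> v \notin S') -> [disjoint S & S'].
Proof. by move=> h; rewrite disjoint_subset; apply/subsetP => v /h. Qed.

(** Dyadic rows with widths growing like 2^i, so that every strip has mass at least s / 8
    ([strip_mass]). Together they have the profile of a neighbourhood for b = 1, whose mass
    diverges. *)
Definition strip (s : R) n m (v : 'I_n * 'I_m) (i : nat) : {set 'I_n * 'I_m} :=
  [set x | (2 ^- i.+1 < gU R x <= 2 ^- i) && (`|gX R x - gX R v| <= s * 2 ^+ i)].

Lemma strip_mass (s : R) n m (v : 'I_n * 'I_m) i : 0 < s ->
  16 * 2 ^+ i <= m%:R :> R -> 16 <= s * m%:R -> 2 * (s * 2 ^+ i) * m%:R + 2 <= n%:R ->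
  s / 8 <= mass R m (strip s v i).
Proof.
move=> s0 m1 m2 m3; have m0 := cell_m0 v.
have mp : 0 < m%:R :> R by rewrite ltr0n.
have p2 : 0 < 2 ^+ i :> R by rewrite exprn_gt0.
have p21 : 1 <= 2 ^+ i :> R by rewrite exprn_ege1 // ler1n.
pose t : R := s * 2 ^+ i; have t0 : 0 < t by rewrite mulr_gt0.
have st : s <= t by rewrite -[leLHS]mulr1 ler_pM2l.
have iS : 2 ^- i.+1 = 2 ^- i / 2 :> R by rewrite exprSr invfM.
have im : m%:R^-1 <= 2 ^- i / 16 :> R.
  by rewrite -invfM lef_pV2 ?posrE ?mulr_gt0 // mulrC.
have im2 : m%:R^-1 <= t / 16.
  by rewrite -div1r ler_pdivrMr //; move: m2 st; clear -mp; nra.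
have im0 : 0 < m%:R^-1 :> R by rewrite invr_gt0.
have hxm : gX R v * m%:R = v.1%:R by rewrite divfK // gt_eqF.
have hz1 : v.1%:R + 1 <= n%:R :> R by rewrite natr1 ler_nat.
have tm : 0 < t * m%:R by rewrite mulr_gt0.
have sE : s / 8 = 2 ^- i * t / 8 by rewrite /t; field; rewrite gt_eqF.
have i0 : 0 < 2 ^- i :> R by rewrite invr_gt0.
have i1 : 2 ^- i <= 1 :> R by rewrite invf_le1.
have prd : 2 ^- i * t / 8 <= (2 ^- i - 2 ^- i.+1 - 2 / m%:R) * (t - m%:R^-1).
  have a1 : 2 ^- i / 4 <= 2 ^- i - 2 ^- i.+1 - 2 / m%:R :> R by rewrite iS; clear -im i0; lra.
  have a2 : t / 2 <= t - m%:R^-1 by clear -im2 t0; lra.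
  rewrite (_ : 2 ^- i * t / 8 = 2 ^- i / 4 * (t / 2)); last by field; rewrite gt_eqF.
  by rewrite ler_pM // ltW // divr_gt0.
have u1 : 0 <= 2 ^- i - 2 ^- i.+1 - 2 / m%:R :> R by rewrite iS; clear -im i0; lra.
have u2 : 0 <= t - m%:R^-1 by clear -im2 t0; lra.
have u3 : 0 <= 2 ^- i.+1 :> R by rewrite iS; clear -i0; lra.
rewrite sE; apply: le_trans prd _.
have [hl|hl] := lerP (2 * v.1%:R) (n%:R : R).
  have -> : t - m%:R^-1 = (gX R v + t) - gX R v - m%:R^-1 by ring.
  apply: (@mass_rect R n m (gX R v) (gX R v + t) (2 ^- i.+1) (2 ^- i) _ m0) => //.
  + exact: gX_ge0.
  + by rewrite mulrDl hxm; move: m3; rewrite -/t; clear -hl tm; lra.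
  + by rewrite (_ : gX R v + t - gX R v - m%:R^-1 = t - m%:R^-1) //; ring.
  by move=> x hx /andP[a1 a2]; rewrite inE hx /= -/t ler_norml; apply/andP; split; lra.
have -> : t - m%:R^-1 = gX R v - (gX R v - t) - m%:R^-1 by ring.
apply: (@mass_rect R n m (gX R v - t) (gX R v) (2 ^- i.+1) (2 ^- i) _ m0) => //.
+ by rewrite subr_ge0 -(ler_pM2r mp) hxm; move: m3; rewrite -/t; clear -hl tm; lra.
+ by rewrite hxm; clear -hz1; lra.
+ by rewrite (_ : gX R v - (gX R v - t) - m%:R^-1 = t - m%:R^-1) //; ring.
by move=> x hx /andP[a1 a2]; rewrite inE hx /= -/t ler_norml; apply/andP; split; lra.
Qed.

Lemma strips_vac (s : R) n m (v : 'I_n * 'I_m) i0 M (S : {set 'I_n * 'I_m}) : 0 < s ->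
  16 * 2 ^+ (i0 + M) <= m%:R :> R -> 16 <= s * m%:R -> 2 * (s * 2 ^+ (i0 + M)) * m%:R + 2 <= n%:R ->
  (forall i, (i < M)%N -> strip s v (i0 + i) \subset S) ->
  Pr (@pm R m _) (vac S) <= expR (- (s / 8)) ^+ M.
Proof.
move=> s0 m1 m2 m3 hS; have hp : prob (@pm R m ('I_n * 'I_m)%type) by exact: prob_pm.
apply: (@le_trans _ _ (Pr (@pm R m ('I_n * 'I_m)%type)
    (fun w => all (fun i => vac (strip s v (i0 + i)) w) (iota 0 M)))).
  apply: Pr_le => // w hw; apply/allP => i; rewrite mem_iota => /andP[_ iM].
  by rewrite /vac -subset0 -(eqP hw) setIS // hS.
apply: (@Pr_all _ _ (fun i => strip s v (i0 + i)) (fun i w => vac (strip s v (i0 + i)) w)) => //.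
- by move=> i; exact: dep_vac.
- move=> i j /andP[ij _]; apply: disjoint_notin => x; rewrite !inE => /andP[/andP[a1 _] _].
  apply/negP => /andP[/andP[_ a2] _]; have : 2 ^- (i0 + i).+1 < 2 ^- (i0 + j) :> R by apply: lt_le_trans a2.
  by rewrite ltf_pV2 ?posrE ?exprn_gt0 // ltr_eXn2l ?ltr1n //; lia.
move=> i iM; apply: le_trans (vac_le _ _ _) _; rewrite ler_expR lerN2.
have pw : 2 ^+ (i0 + i) <= 2 ^+ (i0 + M) :> R by rewrite ler_eXn2l ?ltr1n //; lia.
have mp : 0 < m%:R :> R by rewrite ltr0n; exact: cell_m0 v.
apply: strip_mass => //; first by apply: le_trans m1; rewrite ler_pM2l.
by apply: le_trans m3; rewrite lerD2r ler_pM2r // ler_pM2l // ler_pM2l.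
Qed.

Variable UF : set_system nat.
Hypotheses (UFu : UltraFilter UF) (UFoo : tails UF).

(** A root of height at least 1/2 has a neighbourhood of mass at most [C], so it is isolated with
    probability at least [d]; with l = 4 such a root has not escaped by itself. *)
Lemma cc_lt1 k b : 0 < k -> 0 < b < 1 -> cc UF k b < 1.
Proof.
move=> k0 /andP[b0 b1]; have hb : 0 <= b < 1 by rewrite (ltW b0).
pose A : R := k * 2^-1 `^ (- b); have A0 : 0 <= A by rewrite mulr_ge0 ?powR_ge0 // ltW.
pose C : R := 2 * A * (1 / (1 - b)) + 1.
pose d : R := expR (- (2 * C)); have d0 : 0 < d by exact: expR_gt0.
have d1 : d <= 1.
  have ib : 0 <= 1 / (1 - b) by apply: divr_ge0 => //; lra.
  have C0 : 0 <= C by rewrite /C addr_ge0 // mulr_ge0 // mulr_ge0.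
  by rewrite /d -[leRHS]expR0 ler_expR oppr_le0 mulr_ge0.
apply: (@le_lt_trans _ _ (1 - d / 2)); last by lra.
apply: cc_le; split; first by lra.
exists 4; first by rewrite ler1n.
apply: UF_imp (UFoo 2) => m m2 n i; have m0 : (0 < m)%N by lia.
have mp : 0 < m%:R :> R by rewrite ltr0n.
have H (j : 'I_m) : Dr (kT k b) 4 (i, j) <= d * ((j.+1%:R / m%:R < 2^-1 :> R)%:R : R) + (1 - d).
  set v := (i, j); case: ltP => hj /=.
    by rewrite mulr1 addrCA subrr addr0; apply: Pr_le1; exact: prob_pm.
  rewrite mulr0 add0r.
  pose N := [set x | adj (kT k b) v x].
  have mN : mass R m N <= C.
    apply: le_trans (@mass_shape R n m A 0 b 1 (gX R v) N m0 A0 (lexx _) hb ler01 _) _.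
    move=> x; rewrite inE /adj distrC => hx; rewrite gU_le1 addr0; split=> //.
    apply: le_trans hx _; rewrite /kT powRM ?(ltW (gU_gt0 _ _)) // mulrA.
    by rewrite ler_wpM2r ?powR_ge0 // ler_pM2l // powR_anti // ?invr_gt0 // (ltW b0).
    rewrite powR1 mulr0 add0r mulr1 /C lerD2l invf_le1 // ler1n //.
  have vN : d <= Pr (@pm R m _) (vac N).
    apply: le_trans (vac_ge R N m2); rewrite /d ler_expR lerN2 ler_pM2l //.
  apply: (@le_trans _ _ (1 - Pr (@pm R m _) (vac N))); last by rewrite lerD2l lerN2.
  rewrite -PrC; apply: Pr_le; first exact: prob_pm.
  move=> w; apply: contraL => hv; apply/existsPn => z; rewrite negb_and.
  case: (boolP (connect _ _ _)) => [c|_]; last by rewrite orbT.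
  have -> : z = v by apply: (isolated_root _ hv c) => x hx; rewrite inE.
  by rewrite orbF /Out subrr normr0 ltrn0 /= -ltNge; apply: lt_le_trans hj; lra.
apply: le_trans (_ : (\sum_(j < m) (d * ((j.+1%:R / m%:R < 2^-1 :> R)%:R : R) + (1 - d))) / m%:R <= _).
  by rewrite ler_pM2r ?invr_gt0 //; apply: ler_sum.
rewrite avg_addc // -big_distrr /= -mulrA.
have h2 : 0 <= 2^-1 :> R by [].
have := rows_below m0 h2; set q := (\sum_(j < m) _) / _ => hq.
have : d * q <= d * 2^-1 by rewrite ler_pM2l.
lra.
Qed.

Lemma cc_near1 k e : 0 < k -> 0 < e -> exists2 b0, b0 < 1 &
  forall b, b0 < b -> b < 1 -> 1 - e <= cc UF k b.
Proof.
move=> k0 e0.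
have b34 : 2^-1 < 3 / 4 :> R by lra.
have e2 : 0 < e / 2 by lra.
have [H /andP[H0 H1] HH] := small_ladder k0 b34 e2.
have [i0 hi0] := nat_large H^-1.
have p2i : i0%:R <= 2 ^+ i0 :> R by rewrite -natrX ler_nat ltnW // ltn_expl.
have Hi : 2 ^- i0 <= H by rewrite -[leRHS]invrK lef_pV2 ?posrE ?invr_gt0 ?exprn_gt0 //; apply: le_trans p2i.
pose s := k / 2; have s0 : 0 < s by rewrite divr_gt0.
have [M hM] : exists M : nat, expR (- (s / 8)) ^+ M <= e / 2.
  have [M hM] := nat_large (8 / s * (e / 2)^-1); exists M.
  rewrite -expRM_natr mulNr; have M0 : 0 < s / 8 * M%:R.
    rewrite mulr_gt0 ?divr_gt0 //; apply: lt_le_trans hM.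
    by rewrite mulr_gt0 ?divr_gt0 ?invr_gt0.
  apply: le_trans (expN_le M0) _; rewrite -[leRHS]invrK lef_pV2 ?posrE ?invr_gt0 //.
  by rewrite -ler_pdivrMl ?divr_gt0 // invf_div.
(* The bound 3/4 provides a fixed ladder. The other one gives (i0 + i) (1 - b) <= 1 for i < M:
   replacing exponent 1 by b then costs a factor of at most 2 on the strips used, which is the
   factor in [s]. *)
exists (Num.max (3 / 4) (1 - (i0 + M).+1%:R^-1)).
  by rewrite gt_max ltrBlDr ltrDl invr_gt0 ltr0n andbT; lra.
move=> b; rewrite gt_max => /andP[b1 b2] b3.
apply: cc_ge => // l l1; have [K hK] := pow4_large (l * H).
apply: UF_imp (UF_and UFu (UF_real UFu UFoo (64 * 4 ^+ K / H)) (UF_and UFu (UF_real UFu UFoo (64 / k))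
  (UF_and UFu (UF_real UFu UFoo (16 * 2 ^+ (i0 + M))) (UFoo 1)))) => m [m1 [m2 [m3 m0]]].
have mp : 0 < m%:R :> R by rewrite ltr0n.
have [n hn] := nat_large (2 * (k * (H / 4 ^+ K) `^ (- (2 * (3 / 4)))) * m%:R + 2 +
   2 * (s * 2 ^+ (i0 + M)) * m%:R).
have x1 : 0 <= 2 * (k * (H / 4 ^+ K) `^ (- (2 * (3 / 4)))) * m%:R.
  by rewrite !mulr_ge0 ?powR_ge0 // ltW.
have x2 : 0 <= 2 * (s * 2 ^+ (i0 + M)) * m%:R by rewrite !mulr_ge0 ?exprn_ge0 // ltW.
have n0 : (0 < n)%N by rewrite -(ltr_nat R); clear -hn x1 x2; lra.
have hn1 : 2 * (k * (H / 4 ^+ K) `^ (- (2 * (3 / 4)))) * m%:R + 2 <= n%:R by clear -hn x2; lra.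
have hn2 : 2 * (s * 2 ^+ (i0 + M)) * m%:R + 2 <= n%:R by clear -hn x1; lra.
exists n, (Ordinal n0).
have km : 64 <= k * m%:R by rewrite mulrC -ler_pdivrMr.
have P (j : 'I_m) : 1 - e <= Dr (kT k b) l (Ordinal n0, j).
  set v := (_, j); pose p := @pm R m ('I_n * 'I_m)%type.
  have hp : prob p by exact: prob_pm.
  have HP : 0 < H <= 1 by rewrite H0 H1.
  have P1 := @ladder R n m (adj (kT k b)) k (3 / 4) v H K k0 b34 HP m1 km hn1.
  pose S := [set x : 'I_n * 'I_m | (gU R x <= H) && adj (kT k b) v x].
  have P2 : Pr p (vac S) <= e / 2.
    apply: le_trans hM; apply: (@strips_vac s n m v i0 M _ s0 m3 _ hn2); first by rewrite /s; clear -km; lra.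
    move=> i iM; apply/subsetP => x; rewrite !inE => /andP[/andP[_ a1] a2].
    apply/andP; split.
    apply: le_trans a1 (le_trans _ Hi); rewrite lef_pV2 ?posrE ?exprn_gt0 //.
    by rewrite ler_eXn2l ?ltr1n // leq_addr.
    rewrite /adj distrC; apply: le_trans a2 _; rewrite /kT /s.
    have hx0 := gU_gt0 R x.
    apply: (@le_trans _ _ (k * (2 ^- (i0 + i)) `^ (- b))); last first.
    rewrite ler_pM2l //; apply: powR_anti; [by clear -b1; lra|by rewrite mulr_gt0 ?gU_gt0|].
    by apply: le_trans a1; rewrite ler_piMl ?gU_le1 // ltW.
    have -> : (2 ^- (i0 + i)) `^ (- b) = (2 ^+ (i0 + i)) `^ b :> R.
    by rewrite -powR_inv1 ?exprn_ge0 // -powRrM mulN1r opprK.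
    rewrite -mulrA ler_pM2l //.
    have p2 : 0 < 2 ^+ (i0 + i) :> R by rewrite exprn_gt0.
    have e3 : 2 ^+ (i0 + i) = (2 ^+ (i0 + i)) `^ b * (2 ^+ (i0 + i)) `^ (1 - b) :> R.
    rewrite -powRD; last by apply/implyP => _; rewrite gt_eqF.
    by rewrite addrC subrK powRr1 // ltW.
    rewrite ler_pdivrMl // [leLHS]e3.
    rewrite mulrC ler_pM2r ?powR_gt0 //.
    apply: (@le_trans _ _ (2 `^ ((i0 + i)%:R * (1 - b)))).
    by rewrite powRrM powR_mulrn.
    apply: ler1_powR; first by rewrite ler1n.
    have h3 : 1 - b <= (i0 + M).+1%:R^-1 by rewrite lerBlDr addrC -lerBlDr ltW.
    apply: le_trans (_ : (i0 + M).+1%:R * (1 - b) <= _).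
    by apply: ler_wpM2r; [rewrite subr_ge0; exact: ltW | rewrite ler_nat; clear -iM; lia].
    by rewrite mulrC -ler_pdivlMr ?ltr0n // div1r.
  have P3 : 1 <= Dr (kT k b) l v + Pr p (fun w => vac S w || reach (adj (kT k b)) (v |: w) v (high H) &&
    ~~ reach (adj (kT k b)) (v |: w) v (high (H / 4 ^+ K))).
    rewrite -{1}(@Ex_cst R _ p 1) -[leLHS]/(Pr p (fun _ => true)); apply: Pr_le_or => // w _.
    case: (boolP (vac S w)) => [_|/set0Pn[x]]; first by rewrite !orbT.
    rewrite !inE => /and3P[xw xH av].
    have -> : reach (adj (kT k b)) (v |: w) v (high H).
    apply/existsP; exists x; rewrite /high xH /=; apply: connect1.
    by rewrite /gr setU11 !inE xw orbT av.
    case: (boolP (reach _ _ _ (high (H / _)))) => hr; last by rewrite !orbT.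
    rewrite !orbF; apply: reach_mono hr => // z _; apply: high_Out.
    rewrite -[leRHS]mul1r ler_pdivlMr ?ler_pdivrMr ?exprn_gt0 //; last by lra.
    by rewrite mulrC mulrA ler_pdivrMr ?exprn_gt0 ?mul1r // mulrC.
  have P4 : ladder_cost k (3 / 4) H <= e / 2 by apply: HH; rewrite H0 lexx.
  have P5 := Pr_or (vac S) (fun w => reach (adj (kT k b)) (v |: w) v (high H) &&
    ~~ reach (adj (kT k b)) (v |: w) v (high (H / 4 ^+ K))) hp.
  have P6 : Pr p (fun w => reach (adj (kT k b)) (v |: w) v (high H) &&
    ~~ reach (adj (kT k b)) (v |: w) v (high (H / 4 ^+ K))) <= ladder_cost k (3 / 4) H.
    apply: P1 => z x _ _ a; apply: le_trans a _; apply: kT_mono; rewrite ?gU_gt0 ?gU_le1 ?lexx ?ltW //.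
  clear -P2 P3 P4 P5 P6; lra.
rewrite /Dn ler_pdivlMr //; apply: le_trans (_ : \sum_(j < m) (1 - e) <= _); last exact: ler_sum.
by rewrite big_const_ord iter_addr_0 mulr_natr.
Qed.

End Extremes.

(** * Empty wedges for b < 1/2 *)

Section Wedges.
Import Fin.
Variable R : realType.
Implicit Types (T : R -> R -> R) (l L k b q h d e z : R).

Lemma Pr_ex (V I : finType) (p : V -> R) (F : I -> {set V} -> bool) : prob p ->
  Pr p (fun w => [exists i, F i w]) <= \sum_i Pr p (F i).
Proof. by move=> hp; apply: le_trans (Pr_exists xpredT F hp); apply: Pr_le. Qed.

Definition wedge k b n m z : {set 'I_n * 'I_m} :=
  [set x | `|gX R x - z| <= k / 2 * gU R x `^ (- (2 * b))].

(* An edge across [z] needs an endpoint in the wedge: [2 (u u')^-b <= u^(-2b) + u'^(-2b)]. *)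
Lemma kT_amgm k b (u u' : R) : 0 <= k -> 0 < u -> 0 < u' ->
  kT k b u u' <= k / 2 * u `^ (- (2 * b)) + k / 2 * u' `^ (- (2 * b)).
Proof.
move=> k0 u0 u0'; rewrite /kT powRM ?(ltW u0) ?(ltW u0') //.
have e1 (x : R) : 0 < x -> x `^ (- (2 * b)) = x `^ (- b) ^+ 2.
  by move=> x0; rewrite -powR_mulrn ?powR_ge0 // -powRrM; congr powR; ring.
rewrite !e1 //; set p := u `^ _; set r := u' `^ _.
rewrite -subr_ge0 (_ : _ - _ = k / 2 * (p - r) ^+ 2); last by field.
by rewrite mulr_ge0 ?sqr_ge0 // divr_ge0.
Qed.

(** By [kT_amgm] an edge is no longer than the sum of the half-widths of the wedge at its endpoints,
    so an edge across [z] has an endpoint in the wedge. *)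
Lemma wedge_block k b n m (v y : 'I_n * 'I_m) (w : {set 'I_n * 'I_m}) z : 0 <= k ->
  (forall x, x \in w -> x \notin wedge k b n m z) ->
  connect (gr (adj (kT k b)) w) v y -> (gX R v < z) = (gX R y < z).
Proof.
move=> k0; move=> hw /connectP[s]; elim: s v => [|x s IH] a /= => [_ -> //|].
case/andP => /and3P[aw xw axe] hs hy; rewrite -(IH x hs hy).
have hx := hw x xw; have ha := hw a aw.
move: axe; rewrite /adj => axe.
have H := kT_amgm b k0 (gU_gt0 R a) (gU_gt0 R x).
move: hx ha; rewrite !inE -!ltNge => hx ha.
apply/idP/idP => h1; rewrite ltNge; apply/negP => h2.
  move: hx ha axe; rewrite (ger0_norm (_ : 0 <= gX R x - z)) ?subr_ge0 //.
  rewrite (ltr0_norm (_ : gX R a - z < 0)) ?subr_lt0 //.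
  rewrite ler0_norm; last by lra.
  lra.
move: hx ha axe; rewrite (ger0_norm (_ : 0 <= gX R a - z)) ?subr_ge0 //.
rewrite (ltr0_norm (_ : gX R x - z < 0)) ?subr_lt0 //.
rewrite ger0_norm; last by lra.
lra.
Qed.

Variable UF : set_system nat.
Hypotheses (UFu : UltraFilter UF) (UFoo : tails UF).

(** The centres are 3 D apart, and above height [u] the wedges have half-width at most D: these
    parts are disjoint, hence independent. *)
Lemma wedge_side k b (sg u D r : R) N n m (v : 'I_n * 'I_m) : 0 < k -> 0 < b -> 0 < u ->
  (sg = 1 \/ sg = -1) -> k / 2 * u `^ (- (2 * b)) <= D -> 0 < D ->
  (forall z, Pr (@pm R m _) (fun w => ~~ vac (wedge k b n m z) w) <= r) -> 0 <= r ->
  Pr (@pm R m _) (fun w => all (fun i => ~~ vac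
    [set x in wedge k b n m (gX R v + sg * (D * (3 * i.+1%:R + 1))) | u < gU R x] w) (iota 0 N)) <= r ^+ N.
Proof.
move=> k0 b0 u0 hsg hD D0 hr r0; set z := fun i : nat => gX R v + sg * (D * (3 * i.+1%:R + 1)).
have hp : prob (@pm R m ('I_n * 'I_m)%type) by exact: prob_pm.
apply: (@Pr_all _ _ _ (fun i => [set x in wedge k b n m (z i) | u < gU R x])
   (fun i w => ~~ vac [set x in wedge k b n m (z i) | u < gU R x] w)) => //.
- by move=> i w; rewrite dep_vac.
- move=> i j /andP[ij _]; apply: disjoint_notin => x; rewrite !inE => /andP[x1 x2].
  rewrite x2 andbT -ltNge.
  have hx : k / 2 * gU R x `^ (- (2 * b)) <= D.
    apply: le_trans hD; rewrite ler_pM2l ?divr_gt0 //; apply: powR_anti => //; last exact: ltW.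
    by rewrite mulr_ge0 // ltW.
  apply: (le_lt_trans hx); have x3 := le_trans x1 hx.
  have ijR : i%:R + 1 <= j%:R :> R by rewrite natr1 ler_nat.
  have Dij : D <= D * (j%:R - i%:R) by rewrite ler_peMr ?(ltW D0) //; lra.
  move: x3; rewrite ler_norml => /andP[a1 a2]; rewrite lter_normr; apply/orP.
  have e1 : z j - z i = sg * (3 * (D * (j%:R - i%:R))) by rewrite /z -!natr1; ring.
  case: hsg e1 => -> e1; [right|left]; lra.
move=> i _; apply: le_trans (hr (z i)); apply: Pr_le => // w.
apply: contra => /eqP hv; rewrite /vac -subset0 -hv; apply: setIS.
by apply/subsetP => x; rewrite inE => /andP[].
Qed.

Lemma expr_small (r e : R) : 0 <= r < 1 -> 0 < e -> exists N : nat, r ^+ N <= e.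
Proof.
move=> /andP[r0 r1] e0; have [->|rn] := eqVneq r 0; first by exists 1; rewrite expr1 ltW.
have rp : 0 < r by rewrite lt_def rn.
have lr : ln r < 0 by rewrite ln_lt0 // rp r1.
have [N hN] := nat_large ((- ln r)^-1 * e^-1); exists N.
have M0 : 0 < - ln r * N%:R.
  by rewrite mulr_gt0 ?oppr_gt0 //; apply: lt_le_trans hN; rewrite mulr_gt0 ?invr_gt0 ?oppr_gt0.
rewrite -(lnK rp) -expRM_natr -[ln r]opprK mulNr; apply: le_trans (expN_le M0) _.
rewrite -[leRHS]invrK lef_pV2 ?posrE ?invr_gt0 //.
by rewrite -ler_pdivrMl ?oppr_gt0.
Qed.

(** As 2b < 1, a wedge has bounded mass and is empty with probability bounded below. Among N wedges
    on each side one is likely to be empty, their parts below [u] being negligible. The cluster is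
    then enclosed within distance E, and l is taken so large that a site of height at most 1 / l is
    unlikely there. *)
Lemma cc_sub k b : 0 < k -> 0 < b < 2^-1 -> cc UF k b = 0.
Proof.
move=> k0 /andP[b0 b1]; apply/eqP; rewrite eq_le (cc_ge0 UFu UFoo) andbT.
apply/ler_addgt0Pr => e e0; rewrite add0r.
have k2 : 0 <= k / 2 by rewrite divr_ge0 // ltW.
have hb : 0 <= 2 * b < 1 by apply/andP; lra.
have s0 : 0 < 1 - 2 * b by lra.
pose C : R := 2 * (k / 2) * (1 / (1 - 2 * b)) + 1.
have C0 : 0 <= C by rewrite /C addr_ge0 // mulr_ge0 //; [exact: mulr_ge0 | rewrite divr_ge0 // ltW].
pose r : R := 1 - expR (- (2 * C)).
have hr : 0 <= r < 1.
  rewrite /r subr_ge0 -[leRHS]expR0 ler_expR oppr_le0 mulr_ge0 //= ltrBlDr ltrDl.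
  exact: expR_gt0.
have e8 : 0 < e / 8 by lra.
have [N hN] := expr_small hr e8.
have A0 : 0 <= 2 * N%:R * (2 * (k / 2) / (1 - 2 * b) + 1).
  by rewrite !mulr_ge0 // addr_ge0 // divr_ge0 ?(ltW s0) // mulr_ge0.
have [u' /andP[u0' u1'] hu'] := small_powR_le s0 A0 e8.
pose u := Num.min u' (e / 8).
have u0 : 0 < u by rewrite lt_min u0'.
have ue : u <= e / 8 by rewrite ge_min lexx orbT.
have uu' : u <= u' by rewrite ge_min lexx.
have u1 : u <= 1 by lra.
have hu : 2 * N%:R * (2 * (k / 2) / (1 - 2 * b) + 1) * u `^ (1 - 2 * b) <= e / 8.
  by apply: hu'; rewrite u0.
pose D : R := k / 2 * u `^ (- (2 * b)).
have D0 : 0 < D by rewrite mulr_gt0 ?powR_gt0 ?divr_gt0.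
pose E : R := D * (3 * N%:R + 1).
have E0 : 0 < E by rewrite mulr_gt0 // ltr_wpDl // mulr_ge0.
pose l := Num.max (1 + E) (Num.max ((2 * E + 1) / (e / 8)) (8 / e + u^-1)).
have l1 : 1 + E <= l by rewrite le_max lexx.
have l0 : 0 < l by clear -l1 E0; lra.
have l2 : (2 * E + 1) * l^-1 <= e / 8.
  by rewrite ler_pdivrMr // [leRHS]mulrC -ler_pdivrMr // !le_max lexx orbT.
have l3 : 8 / e + u^-1 <= l by rewrite !le_max lexx !orbT.
have l5 : l^-1 < u.
  rewrite -[ltRHS]invrK ltf_pV2 ?posrE ?invr_gt0 //; apply: lt_le_trans l3.
  by rewrite ltrDr divr_gt0.
apply: cc_le; split; first exact: ltW.
clearbody l; exists l; first by clear -l1 E0; lra.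
apply: UF_imp (UFoo 2) => m m2 n i; have m0 : (0 < m)%N := ltnW m2.
have mp : 0 < m%:R :> R by rewrite ltr0n.
have W1 z : Pr (@pm R m ('I_n * 'I_m)%type) (fun w => ~~ vac (wedge k b n m z) w) <= r.
  rewrite PrC /r lerD2l lerN2; apply: le_trans (vac_ge R _ m2).
  rewrite ler_expR lerN2 ler_pM2l //.
  apply: le_trans (@mass_shape R n m (k / 2) 0 (2 * b) 1 z _ m0 k2 (lexx _) hb ler01 _) _.
    by move=> x; rewrite inE gU_le1 addr0.
  by rewrite powR1 mulr0 add0r mulr1 /C lerD2l invf_le1 // ler1n.
pose p := @pm R m ('I_n * 'I_m)%type; have hp : prob p by exact: prob_pm.
have H (j : 'I_m) : Dr (kT k b) l (i, j) <= ((j.+1%:R / m%:R < u :> R)%:R : R) + e / 2.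
  set v := (i, j); case: ltP => hj /=.
    by apply: le_trans (Pr_le1 _ hp) _; rewrite lerDl; lra.
  rewrite add0r.
  pose z (sg : R) (a : nat) := gX R v + sg * (D * (3 * a.+1%:R + 1)).
  pose Wh sg a := [set x in wedge k b n m (z sg a) | u < gU R x].
  pose Wl sg a := [set x in wedge k b n m (z sg a) | gU R x <= u].
  pose F := [set x : 'I_n * 'I_m | (gU R x <= l^-1) && (`|gX R x - gX R v| <= E)].
  pose noW sg := fun w => all (fun a => ~~ vac (Wh sg a) w) (iota 0 N).
  pose lw sg := fun w => [exists a : 'I_N, ~~ vac (Wl sg a) w].
  have S1 sg : sg = 1 \/ sg = -1 -> Pr p (noW sg) <= e / 8.
    by move=> hsg; apply: le_trans hN; apply: (@wedge_side k b sg u D r N n m v) => //; case/andP: hr.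
  have S2 sg : Pr p (lw sg) <= e / 16.
    apply: le_trans (Pr_ex _ hp) _.
    apply: (@le_trans _ _ (\sum_(a < N) (2 * (k / 2) / (1 - 2 * b) + 1) * u `^ (1 - 2 * b))).
    apply: ler_sum => a _; apply: le_trans (hit_le _ _ _) _.
    apply: le_trans (@mass_shape R n m (k / 2) 0 (2 * b) u (z sg a) _ m0 k2 (lexx _) hb (ltW u0) _) _.
    by move=> x; rewrite !inE addr0 => /andP[-> ->].
    rewrite mulr0 add0r [leRHS]mulrDl mul1r; apply: lerD.
    by rewrite mulrA mulrAC.
    apply: (@le_trans _ _ (1 * u)); first by rewrite ler_wpM2r ?(ltW u0) // invf_le1 // ler1n.
    by rewrite mul1r -{1}(powRr1 (ltW u0)); apply: ger_powR; rewrite ?u0 //; lra.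
    rewrite big_const_ord iter_addr_0 -[leLHS]mulr_natl; lra.
  have S3 : Pr p (fun w => ~~ vac F w) <= e / 8.
    apply: le_trans (hit_le _ _ _) _; apply: le_trans l2.
    have li0 : 0 <= l^-1 by rewrite invr_ge0 ltW.
    apply: le_trans (@mass_low R n m (gX R v) E l^-1 F m0 (ltW E0) li0 _) _.
    by move=> x; rewrite inE => /andP[].
    by rewrite ler_wpM2r // lerD2l invf_le1 // ler1n.
  have HS : Dr (kT k b) l v <= Pr p (fun w => noW 1 w || (noW (-1) w || (lw 1 w || (lw (-1) w || ~~ vac F w)))).
    apply: Pr_le => // w hr'; apply: contraT; rewrite !negb_or => /and5P[n1 n2 n3 n4].
    rewrite negbK => n5.
    have G sg : ~~ noW sg w -> ~~ lw sg w -> sg = 1 \/ sg = -1 ->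
    exists2 a, (a < N)%N & forall x, x \in v |: w -> x \notin wedge k b n m (z sg a).
    rewrite -has_predC => /hasP[a]; rewrite mem_iota add0n => /= aN /negPn v1.
    rewrite negb_exists => /forallP /(_ (Ordinal aN)) /negPn v2 hsg; exists a => // x.
    rewrite !inE => /orP[/eqP -> |xw]; rewrite -ltNge.
    have -> : gX R v - z sg a = - (sg * (D * (3 * a.+1%:R + 1))) by rewrite /z; ring.
    rewrite normrN normrM (_ : `|sg| = 1) ?mul1r; last first.
    by case: hsg => ->; rewrite ?normrN normr1.
    rewrite ger0_norm; last by rewrite mulr_ge0 ?(ltW D0) // addr_ge0 // mulr_ge0.
    apply: (@le_lt_trans _ _ D); last by rewrite ltr_pMr // ltrDr mulr_gt0.
    by rewrite ler_pM2l ?divr_gt0 //; apply: powR_anti => //; case/andP: hb.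
    rewrite ltNge; apply/negP => xW; case: (lerP (gU R x) u) => hxu.
    by move/eqP/setP/(_ x): v2; rewrite !inE xw xW hxu.
    by move/eqP/setP/(_ x): v1; rewrite !inE xw xW hxu.
    have [a aN ha] := G 1 n1 n3 (or_introl erefl).
    have [a' aN' ha'] := G (-1) n2 n4 (or_intror erefl).
    have bnd c : (c < N)%N -> D * (3 * c.+1%:R + 1) <= E.
    by move=> cN; rewrite ler_pM2l // lerD2r ler_pM2l // ler_nat.
    have pos c : 0 < D * (3 * c.+1%:R + 1) by rewrite mulr_gt0 // ltr_wpDl // mulr_ge0.
    case/existsP: hr' => y /andP[oy cy].
    have y1 := wedge_block (ltW k0) ha cy; have y2 := wedge_block (ltW k0) ha' cy.
    have p1 := pos a; have p2 := pos a'; have b1' := bnd a aN; have b2' := bnd a' aN'.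
    have yE : `|gX R y - gX R v| <= E.
    move: y1 y2; rewrite /z mul1r mulN1r ltrDl p1 => /esym y1.
    rewrite ltNge gerBl (ltW p2) /= => /esym/negbT; rewrite -leNgt => y2.
    rewrite ler_norml; clear -y1 y2 b1' b2'; apply/andP; lra.
    have yl : gU R y <= l^-1.
    by case/orP: oy => //; rewrite ltNge => /negP[]; clear -yE l1; lra.
    have yv : y != v by apply: contraTneq yl => ->; rewrite -ltNge; apply: lt_le_trans hj.
    rewrite eq_sym in yv; case/andP: (conn_in cy yv) => _; rewrite !inE eq_sym (negbTE yv) /= => yw.
    by move/eqP/setP/(_ y): n5; rewrite !inE yw yl yE.
  apply: le_trans HS _.
  have O1 := Pr_or (noW 1) (fun w => noW (-1) w || (lw 1 w || (lw (-1) w || ~~ vac F w))) hp.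
  have O2 := Pr_or (noW (-1)) (fun w => lw 1 w || (lw (-1) w || ~~ vac F w)) hp.
  have O3 := Pr_or (lw 1) (fun w => lw (-1) w || ~~ vac F w) hp.
  have O4 := Pr_or (lw (-1)) (fun w => ~~ vac F w) hp.
  have q1 := S1 1 (or_introl erefl); have q2 := S1 (-1) (or_intror erefl).
  have q3 := S2 1; have q4 := S2 (-1).
  clear -O1 O2 O3 O4 q1 q2 q3 q4 S3; lra.
apply: le_trans (_ : (\sum_(j < m) (((j.+1%:R / m%:R < u :> R)%:R : R) + e / 2)) / m%:R <= _).
  by rewrite ler_pM2r ?invr_gt0 //; apply: ler_sum.
rewrite avg_addc //; have := rows_below m0 (ltW u0); clear -ue e0; lra.
Qed.

End Wedges.

Ltac nneg := by repeat first [done | assumption | (apply: ltW; assumption) | rewrite subr_ge0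
  | apply: powR_ge0 | apply: expR_ge0 | apply: addr_ge0 | apply: mulr_ge0 | rewrite invr_ge0
  | apply: exprn_ge0 | apply: ler0n].
Ltac pstv := by repeat first [done | assumption | rewrite subr_gt0
  | apply: powR_gt0 | apply: expR_gt0 | apply: addr_gt0 | apply: mulr_gt0 | rewrite invr_gt0
  | apply: exprn_gt0 | rewrite ltr0n].

(** * Strict monotonicity by insertion of a vertex *)

Section Strict.
Import Fin.
Variable R : realType.
Implicit Types (T : R -> R -> R) (l L k b q h d e : R).

(** A form of the Harris inequality that loses a factor 2. The event that [A] holds without the
    sites of [S] is independent of hitting [S]; and if [A] holds only thanks to [S], then [S] is
    hit. *)
Lemma Pr_inc_hit (V : finType) (p : V -> R) (A : {set V} -> bool) (S : {set V}) : prob p ->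
  (forall w w' : {set V}, w \subset w' -> A w -> A w') ->
  Pr p A * Pr p (fun w => ~~ vac S w) / 2 <= Pr p (fun w => A w && ~~ vac S w).
Proof.
move=> hp inc; pose A0 w := A (w :&: ~: S); pose hit := fun w => ~~ vac S w.
have A0A w : A0 w -> A w by apply: inc; apply: subsetIl.
have e1 : Pr p (fun w => A0 w && hit w) = Pr p A0 * Pr p hit.
  apply: (@PrI _ _ _ _ _ (~: S) S); first by rewrite disjoint_sym -setI_eq0 setICr.
    by move=> w; rewrite /A0 -setIA setIid.
  by move=> w; rewrite /hit dep_vac.
have h1 : Pr p (fun w => A0 w && hit w) <= Pr p (fun w => A w && hit w).
  by apply: Pr_le => // w /andP[/A0A -> ->].
have h2 : Pr p (fun w => A w && ~~ A0 w) <= Pr p (fun w => A w && hit w).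
  apply: Pr_le => // w /andP[aw]; rewrite aw /=; apply: contra => /eqP v0.
  rewrite /A0 (_ : w :&: ~: S = w) //; apply/setIidPl; apply/subsetP => x xw; rewrite inE.
  by apply/negP => xS; move/setP/(_ x): v0; rewrite !inE xw xS.
have h3 : Pr p A <= Pr p A0 + Pr p (fun w => A w && ~~ A0 w).
  by apply: Pr_le_or => // w ->; rewrite orbN.
have q0 : 0 <= Pr p hit by apply: Pr_ge0.
have q1 : Pr p hit <= 1 by apply: Pr_le1.
have d0 : 0 <= Pr p (fun w => A w && ~~ A0 w) by apply: Pr_ge0.
have h4 : Pr p (fun w => A w && ~~ A0 w) * Pr p hit <= Pr p (fun w => A w && ~~ A0 w).
  by rewrite ler_piMr.
have h5 := ler_wpM2r q0 h3.
rewrite -/hit; move: h1 h2 h3 h4 h5; rewrite e1 mulrDl => h1 h2 h3 h4 h5.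
rewrite ler_pdivrMr //; lra.
Qed.

Lemma Dr_le1 T l n m (v : 'I_n * 'I_m) : Dr T l v <= 1.
Proof. by rewrite /Dr; apply: Pr_le1; exact: prob_pm. Qed.

Definition nbr T n m (v : 'I_n * 'I_m) : {set 'I_n * 'I_m} := [set x | adj T v x].

(** Escape avoiding the whole neighbourhood of the root, hence independent of that neighbourhood
    being empty. The starting point is free in a ball, all of which an inserted vertex of long range
    will see. *)
Definition freach T l L n m (v : 'I_n * 'I_m) (w : {set 'I_n * 'I_m}) : bool :=
  [exists y, [&& y \in w :\: nbr T v, `|gX R y - gX R v| <= L &
    reach (adj T) (w :\: nbr T v) y (Out l v)]].

Lemma freach_inc T l L n m (v : 'I_n * 'I_m) (w w' : {set 'I_n * 'I_m}) : w \subset w' ->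
  freach T l L v w -> freach T l L v w'.
Proof.
move=> ww /existsP[y /and3P[y1 y2 y3]]; apply/existsP; exists y; rewrite y2 /=.
have s := setSD (nbr T v) ww; rewrite (subsetP s) //=.
by apply: reach_mono y3.
Qed.

Lemma freach_dep T l L n m (v : 'I_n * 'I_m) : dep (~: nbr T v) (freach T l L v).
Proof. by move=> w; rewrite /freach !setDE -!setIA setIid. Qed.

(* Cutting a path from the inserted root at its last visit to the neighbourhood of [v]. *)
Lemma freach_ge T l L lam h n m (v v1 : 'I_n * 'I_m) : thr T -> v1.1 = v.1 -> h <= gU R v1 ->
  0 < lam -> lam^-1 < h -> lam <= l ->
  (forall x, adj T v x -> h <= gU R x -> `|gX R x - gX R v| <= lam) ->
  Dr T l v1 <= Pr (@pm R m _) (freach T l L v) +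
    (mass R m [set x | adj T v x & gU R x < h] + mass R m (tailS T lam L n m (gX R v))).
Proof.
move=> hT v1v hv1 lam0 lamh laml hnear.
set Low := [set x | _ & _]; set S := tailS _ _ _ _ _ _.
pose p := @pm R m ('I_n * 'I_m)%type; have hp : prob p by exact: prob_pm.
have XX : gX R v1 = gX R v by rewrite /gX v1v.
have : Dr T l v1 <= Pr p (fun w => freach T l L v w || (~~ vac Low w || ~~ vac S w)).
  apply: Pr_le => // w hr; case: (boolP (freach T l L v w)) => // nF.
  case: (boolP (vac Low w)) => // vL; case: (boolP (vac S w)) => // vS; exfalso.
  case/existsP: hr => z /andP[oz cz].
  have Kv1 : v1 \in nbr T v by rewrite inE; apply: adj_refl.
  have big x : x \in v1 |: w -> x \in nbr T v -> h <= gU R x.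
    rewrite !inE => /orP[/eqP -> //|xw] ax; rewrite leNgt; apply/negP => hx.
    by move/eqP/setP/(_ x): vL; rewrite !inE xw ax hx.
  have il : l^-1 <= lam^-1 by rewrite lef_pV2 ?posrE //; apply: lt_le_trans laml.
  have Kz : z \notin nbr T v.
    apply/negP => Kz; have zw : z \in v1 |: w.
    have [->|ne] := eqVneq z v1; first by rewrite setU11.
    by rewrite eq_sym in ne; case/andP: (conn_in cz ne).
    have hz := big z zw Kz; move: oz; rewrite /Out XX => /orP[].
    by rewrite ltNge => /negP[]; apply: le_trans laml; apply: hnear => //; rewrite inE in Kz.
    by rewrite leNgt (lt_le_trans _ hz) // (le_lt_trans il).
  have [x [y [Kx Ky gxy cyz]]] := conn_last (K := mem (nbr T v)) (@adj_sym _ _ n m hT) cz Kv1 Kz.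
  case/and3P: gxy => xw yw axy.
  have sub : [set u in v1 |: w | u \notin nbr T v] \subset w :\: nbr T v.
    apply/subsetP => u; rewrite in_setD in_set in_setU1 andbC => /andP[nu /orP[/eqP uv|->]]; last by rewrite nu.
    by rewrite uv Kv1 in nu.
  have yD : y \in w :\: nbr T v by apply: (subsetP sub); rewrite inE yw.
  case/negP: nF; apply/existsP; exists y; rewrite yD /=; apply/andP; split; last first.
    apply/existsP; exists z; rewrite /Out -XX; apply/andP; split=> //.
    by apply: conn_mono cyz.
  rewrite leNgt; apply/negP => hy; have hx := big x xw Kx.
  have yw' : y \in w by case/setDP: yD.
  move/eqP/setP/(_ y): vS; rewrite [in LHS]inE yw' /= inE hy /= inE => /negP[].
  have := ler_distD (gX R x) (gX R y) (gX R v); move/le_trans; apply.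
  have Kx' : x \in nbr T v by exact: Kx.
  rewrite inE in Kx'.
  rewrite addrC lerD //; first exact: hnear.
  case: hT => ts t0 tm; rewrite ts distrC; apply: le_trans axy _; apply: tm; rewrite ?gU_gt0 ?invr_gt0 //.
  by apply: le_trans hx; apply: ltW.
move=> H; apply: le_trans H _; apply: le_trans (Pr_or _ _ hp) _; rewrite lerD2l.
by apply: le_trans (Pr_or _ _ hp) _; apply: lerD; apply: hit_le.
Qed.

(** When the [T]-neighbourhood of [v] is empty, [v] does not escape in [T]; an occupied z in [Z] and
    a start y for [freach] give the [T']-path v, z, y and onwards. This event is disjoint from
    escape in [T], so its probability is added. *)
Lemma boost T T' l L n m (v : 'I_n * 'I_m) (Z : {set 'I_n * 'I_m}) : thr T ->
  (forall x y : 'I_n * 'I_m, adj T x y -> adj T' x y) ->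
  ~~ Out l v v ->
  (forall z, z \in Z -> ~~ adj T v z) -> (forall z, z \in Z -> adj T' v z) ->
  (forall z y, z \in Z -> `|gX R y - gX R v| <= L -> adj T' z y) ->
  Dr T l v + Pr (@pm R m _) (vac (nbr T v)) *
    (Pr (@pm R m _) (freach T l L v) * Pr (@pm R m _) (fun w => ~~ vac Z w) / 2) <= Dr T' l v.
Proof.
move=> hT TT nO Z1 Z2 Z3.
pose p := @pm R m ('I_n * 'I_m)%type; have hp : prob p by exact: prob_pm.
pose G w := vac (nbr T v) w && (freach T l L v w && ~~ vac Z w).
have e1 : Pr p G = Pr p (vac (nbr T v)) * Pr p (fun w => freach T l L v w && ~~ vac Z w).
  apply: (@PrI _ _ _ _ _ (nbr T v) (~: nbr T v)); first by rewrite -setI_eq0 setICr.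
    exact: dep_vac.
  have sZ : Z \subset ~: nbr T v by apply/subsetP => z /Z1; rewrite !inE.
  have dv := dep_sub sZ (@dep_vac _ Z).
  by move=> w; rewrite freach_dep dv.
have h1 : Dr T l v + Pr p G <= Dr T' l v.
  have e2 : Dr T l v + Pr p G = Pr p (fun w => reach (adj T) (v |: w) v (Out l v) || G w).
    rewrite /Dr /Pr -ExD; apply: eq_Ex => w.
    case: (boolP (reach _ _ _ _)) => hr; last by rewrite add0r.
    rewrite (_ : G w = false) ?addr0 //; apply/negbTE; apply/negP => /andP[vN _].
    case/existsP: hr => z /andP[oz cz].
    have ez : z = v.
    by refine (@isolated_root _ (adj T) (nbr T v) w v z _ vN cz) => x a; rewrite inE.
    by rewrite ez (negbTE nO) in oz.
  rewrite e2; apply: Pr_le => // w /orP[hr|/and3P[_ /existsP[y /and3P[yD yL yr]] hZ]].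
    by apply: reach_mono hr => // x y _ _; apply: TT.
  case/set0Pn: hZ => z; rewrite inE => /andP[zw zZ].
  case/existsP: yr => o /andP[oo co]; apply/existsP; exists o; rewrite oo /=.
  have yw : y \in v |: w by case/setDP: yD => yw _; rewrite inE yw orbT.
  have zw' : z \in v |: w by rewrite inE zw orbT.
  apply: (@connect_trans _ _ z); first by apply: connect1; rewrite /gr setU11 zw' Z2.
  apply: (@connect_trans _ _ y); first by apply: connect1; rewrite /gr yw zw' Z3.
  apply: conn_mono co; first by move=> a c _ _; apply: TT.
  by apply: subset_trans (subsetDl _ _) (subsetUr _ _).
apply: le_trans h1; rewrite lerD2l e1; apply: ler_wpM2l; first exact: Pr_ge0.
by apply: Pr_inc_hit => // w w'; apply: freach_inc.
Qed.

Variable UF : set_system nat.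
Hypotheses (UFu : UltraFilter UF) (UFoo : tails UF).

(** A vertex of height in (s t, t], just out of [kT k b] range of every root of height at least s,
    has [kT k' b'] range larger by D. The condition reads k s^(-2b) t^(b'-b) + D t^b' <= k'. Small t
    suffices if b < b'; otherwise s is first taken so close to 1 that k s^(-2b) < k'. *)
Lemma kT_gap k k' b b' : 0 < k <= k' -> 0 < b <= b' -> (k < k') || (b < b') ->
  exists2 s, 0 < s < 1 & forall D, 0 <= D -> exists2 t, 0 < t < 1 &
    kT k b s (s * t) + D <= kT k' b' 1 t.
Proof.
move=> /andP[k0 kk] /andP[b0 bb] lt.
have k0' : 0 < k' by apply: lt_le_trans kk.
have b0' : 0 < b' by apply: lt_le_trans bb.
have [s /andP[s0 s1] s2] : exists2 s, 0 < s < 1 & (k * s `^ (- (2 * b)) < k') \/ (b < b').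
  case/orP: lt => [lk|lb]; last by exists 2^-1; [apply/andP; lra|right].
  pose y := ln (k' / k).
  have ey : k' = k * expR y by rewrite /y lnK ?posrE ?divr_gt0 // mulrC divfK // gt_eqF.
  have y0 : 0 < y by rewrite /y ln_gt0 // ltr_pdivlMr // mul1r.
  exists (expR (- y / (4 * b))).
    by rewrite expR_gt0 -expR0 ltr_expR mulNr oppr_lt0 divr_gt0 // mulr_gt0.
  left; rewrite -expRM ey ltr_pM2l // ltr_expR.
  have -> : - y / (4 * b) * - (2 * b) = y / 2 by field; rewrite gt_eqF.
  lra.
exists s; first by rewrite s0.
move=> D D0; pose k1 := k * s `^ (- (2 * b)).
have k10 : 0 < k1 by rewrite mulr_gt0 ?powR_gt0.
suff [t /andP[t0 t1] ht] : exists2 t, 0 < t < 1 & k1 * t `^ (b' - b) + D * t `^ b' <= k'.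
  exists t; first by rewrite t0.
  rewrite /kT mul1r mulrA powRM ?(ltW t0) ?mulr_ge0 ?(ltW s0) //.
  have -> : (s * s) `^ (- b) = s `^ (- (2 * b)).
    by rewrite -expr2 -powR_mulrn ?(ltW s0) // -powRrM; congr powR; ring.
  rewrite mulrA -/k1.
  have := ler_wpM2r (powR_ge0 t (- b')) ht; rewrite mulrDl -!mulrA -!powRD; first last.
  - by apply/implyP => _; rewrite gt_eqF.
  - by apply/implyP => _; rewrite gt_eqF.
  by rewrite subrr powRr0 mulr1 (_ : b' - b - b' = - b) //; ring.
have h2 : 0 < 1 / 2 :> R by lra.
have cap (u0 : R) : 0 < u0 -> 0 < Num.min u0 (1 / 2) < 1.
  by move=> u00; rewrite lt_min u00 h2 gt_min; apply/orP; right; lra.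
case: s2 => [hk|lb].
  have g0 : 0 < k' - k1 by rewrite subr_gt0.
  have [u0 /andP[u00 _] hu] := small_powR_le b0' D0 g0.
  exists (Num.min u0 (1 / 2)); first exact: cap.
  have /andP[m0 m1] := cap u0 u00.
  have : D * Num.min u0 (1 / 2) `^ b' <= k' - k1 by apply: hu; rewrite m0 ge_min lexx.
  have : Num.min u0 (1 / 2) `^ (b' - b) <= 1.
    by rewrite -[leRHS](powRr0 (Num.min u0 (1/2))); apply: ger_powR; rewrite ?m0 ?(ltW m1) // subr_ge0.
  move=> h; have := ler_wpM2l (ltW k10) h; rewrite mulr1; lra.
have g0 : 0 < b' - b by rewrite subr_gt0.
have k2 : 0 < k' / 2 by rewrite divr_gt0.
have [u0 /andP[u00 _] hu] := small_powR_le b0' D0 k2.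
have [u1 /andP[u10 _] hu1] := small_powR_le g0 (ltW k10) k2.
have u01 : 0 < Num.min u0 u1 by rewrite lt_min u00.
exists (Num.min (Num.min u0 u1) (1 / 2)); first exact: cap.
have /andP[m0 m1] := cap _ u01.
have a1 : D * Num.min (Num.min u0 u1) (1 / 2) `^ b' <= k' / 2 by apply: hu; rewrite m0 !ge_min lexx.
have a2 : k1 * Num.min (Num.min u0 u1) (1 / 2) `^ (b' - b) <= k' / 2.
  by apply: hu1; rewrite m0 !ge_min lexx orbT.
lra.
Qed.

Lemma mass_nbr k b s h n m (v : 'I_n * 'I_m) (S : {set 'I_n * 'I_m}) : 0 <= k -> 0 <= b < 1 ->
  0 < s <= gU R v -> 0 <= h -> (0 < m)%N ->
  (forall x, x \in S -> adj (kT k b) v x /\ gU R x <= h) ->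
  mass R m S <= 2 * (k * s `^ (- b)) * (h `^ (1 - b) / (1 - b)) + h.
Proof.
move=> k0 /[dup] hb /andP[b0 b1] /andP[s0 sv] h0 m0 hS.
have A0 : 0 <= k * s `^ (- b) by rewrite mulr_ge0 ?powR_ge0.
apply: le_trans (@mass_shape R n m (k * s `^ (- b)) 0 b h (gX R v) S m0 A0 (lexx _) hb h0 _) _.
  move=> x /hS[a ->]; split=> //; rewrite addr0 distrC; apply: le_trans a _.
  rewrite /kT powRM ?(ltW (gU_gt0 _ _)) // mulrA ler_wpM2r ?powR_ge0 // ler_wpM2l //.
  exact: powR_anti.
by rewrite mulr0 add0r lerD2l -[leRHS]mul1r ler_wpM2r // invf_le1 ?ltr0n // ler1n.
Qed.

Lemma mass_far n m (v : 'I_n * 'I_m) (s t A : R) (Z : {set 'I_n * 'I_m}) : 0 < s < 1 -> 0 < t <= 1 ->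
  0 <= A -> gX R v + A + 1 < n%:R / m%:R -> m%:R^-1 <= t * (1 - s) / 4 -> 2 <= m%:R :> R ->
  (forall x, s * t < gU R x <= t -> A <= gX R x - gX R v <= A + 1 -> x \in Z) ->
  t * (1 - s) / 4 <= mass R m Z.
Proof.
move=> /andP[s0 s1] /andP[t0 t1] A0 hn m1 m2 hZ.
have mp : 0 < m%:R :> R by lra.
have m0 : (0 < m)%N by rewrite -(ltr0n R).
have X0 := gX_ge0 R v.
have mi : m%:R^-1 <= 2^-1 :> R by rewrite lef_pV2 ?posrE.
have mi0 : 0 < m%:R^-1 :> R by rewrite invr_gt0.
have st0 : 0 <= s * t by rewrite mulr_ge0 ?ltW.
have e1 : t - s * t = t * (1 - s) by ring.
have q0 : 0 < t * (1 - s) by rewrite mulr_gt0 // subr_gt0.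
have H := @mass_rect R n m (gX R v + A) (gX R v + A + 1) (s * t) t Z m0.
apply: le_trans (H _ _ _ _ _ _ _) => //.
- rewrite (_ : t * (1 - s) / 4 = (t * (1 - s) / 2) * 2^-1); last by field.
  apply: ler_pM; rewrite ?e1; clear -m1 mi q0; lra.
- by rewrite addr_ge0.
- by rewrite -ltr_pdivlMr.
- by rewrite e1; clear -m1 q0; lra.
- by clear -mi; lra.
by move=> x x1 /andP[x2 x3]; apply: hZ => //; clear -x2 x3; apply/andP; lra.
Qed.

Lemma avg_boost (m : nat) (F G : 'I_m -> R) (S s : R) : (0 < m)%N -> 0 <= S -> 0 <= s ->
  (forall j, F j + S <= G j + S * ((j.+1%:R / m%:R < s :> R)%:R : R)) ->
  (\sum_(j < m) F j) / m%:R + S <= (\sum_(j < m) G j) / m%:R + S * s.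
Proof.
move=> m0 S0 s0 h; rewrite -avg_addc //.
apply: (@le_trans _ _ ((\sum_(j < m) (G j + S * ((j.+1%:R / m%:R < s :> R)%:R : R))) / m%:R)).
  by rewrite ler_pM2r ?invr_gt0 ?ltr0n //; apply: ler_sum.
rewrite big_split /= mulrDl lerD2l -big_distrr /= -mulrA; apply: ler_wpM2l => //.
exact: rows_below.
Qed.

(** If the larger kernel had no larger constant, its [Dn] would be at most c + d/2 at some scale. By
    [boost] every root of height at least [s] gains a fixed amount, [d] on average, so for the
    smaller kernel [Dn] would be at most c - d/2 on every line, contradicting the definition of
    c. *)
Theorem cc_strict k k' b b' : 0 < k <= k' -> 0 < b <= b' -> b' < 1 -> (k < k') || (b < b') ->
  0 < cc UF k b -> cc UF k b < cc UF k' b'.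
Proof.
move=> kk bb b1' lt c0; set c := cc UF k b in c0 *.
have [k0 kk'] := andP kk; have [b0 bb'] := andP bb.
have b1 : b < 1 by apply: le_lt_trans b1'.
have hb : 0 <= b < 1 by rewrite (ltW b0).
have k0' : 0 < k' by apply: lt_le_trans kk'.
have b0' : 0 < b' by apply: lt_le_trans bb'.
have c1 : c <= 1 by apply: cc_le1.
have s1b : 0 < 1 - b by rewrite subr_gt0.
have [s /andP[s0 s1] hgap] := kT_gap kk bb lt.
have hs : 0 < s < 1 by rewrite s0.
pose A := k * s `^ (- b); have A0 : 0 < A by rewrite /A; pstv.
have c8 : 0 < c / 16 by rewrite divr_gt0.
have C0 : 0 <= 2 * A / (1 - b) by nneg.
have [h1 /andP[h10 h11] hh1] := small_powR_le s1b C0 c8.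
pose h := Num.min h1 (c / 16).
have h0 : 0 < h by rewrite lt_min h10.
have hc : h <= c / 16 by rewrite ge_min lexx orbT.
have hpow : 2 * A * (h `^ (1 - b) / (1 - b)) <= c / 16.
  rewrite mulrA mulrAC; apply: hh1; rewrite h0 /h ge_min lexx //.
(* Every neighbour of height at least [h] of a root of height at least [s] lies within [lam], and
   the height [h] exceeds 1 / lam: such neighbours have not escaped. *)
pose lam := Num.max (2 / h) (A * h `^ (- b)).
have lam1 : 2 / h <= lam by rewrite le_max lexx.
have lam2 : A * h `^ (- b) <= lam by rewrite le_max lexx orbT.
have lam0 : 0 < lam by apply: lt_le_trans lam1; rewrite divr_gt0.
have lamh : lam^-1 < h.
  rewrite -[ltRHS]invrK ltf_pV2 ?posrE ?invr_gt0 //; apply: lt_le_trans lam1.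
  by rewrite ltr_pMl ?invr_gt0 // ltr1n.
clearbody lam.
have [u /andP[u0 u1] hu] := small_tau (ltW k0) hb lam0 c8.
pose L1 := lam + k * lam `^ b * u `^ (- b).
have L10 : 0 <= L1 by rewrite /L1; nneg.
have D0 : 0 <= L1 + 3 by rewrite addr_ge0.
have [t /andP[t0 t1] ht] := hgap (L1 + 3) D0.
pose A1 := kT k b s (s * t) + 1.
have A10 : 0 <= A1 by rewrite /A1 /kT; nneg.
pose C := 2 * A * (1 `^ (1 - b) / (1 - b)) + 1.
pose dA := expR (- (2 * C)); have dA0 : 0 < dA by apply: expR_gt0.
have C1 : 0 <= C by rewrite /C; nneg.
have dA1 : dA <= 1 by rewrite /dA -[leRHS]expR0 ler_expR oppr_le0 mulr_ge0.
pose z0 := 1 - expR (- (t * (1 - s) / 4)).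
have q0 : 0 < t * (1 - s) / 4 by rewrite divr_gt0 // mulr_gt0 // subr_gt0.
have z00 : 0 < z0 by rewrite subr_gt0 -[ltRHS]expR0 ltr_expR oppr_lt0.
have z01 : z0 <= 1 by rewrite lerBlDr lerDl expR_ge0.
pose d := (1 - s) * (dA * (c / 8 * z0 / 2)).
have d0 : 0 < d by rewrite /d; pstv.
have dc : d <= c.
  rewrite /d; apply: (@le_trans _ _ (1 * (1 * (c / 8 * 1 / 2)))); last by lra.
  apply: ler_pM; [nneg|nneg|by rewrite lerBlDr lerDl ltW|].
  apply: ler_pM; [nneg|nneg|done|].
  by rewrite ler_pM2r ?invr_gt0 // ler_pM2l // divr_gt0.
rewrite ltNge; apply/negP => hcc.
have [l0 l01 hl0] : exists2 l, 1 <= l &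
   UF (fun m => forall n (i : 'I_n), Dn (kT k' b') l m i <= c + d / 2).
  by apply: (proj2 (cc_lt UFu UFoo _)); apply: le_lt_trans hcc _; rewrite ltrDl divr_gt0.
pose l := Num.max l0 (Num.max lam (s^-1 + 1)).
have ll0 : l0 <= l by rewrite le_max lexx.
have llam : lam <= l by rewrite !le_max lexx orbT.
have ls : s^-1 + 1 <= l by rewrite !le_max lexx !orbT.
have l1 : 1 <= l by apply: le_trans ll0.
have lp : 0 < l by apply: lt_le_trans l1.
clearbody l.
have [u' /andP[u0' u1'] hu'] := small_tau (ltW k0) hb lp c8.
pose L := l + k * l `^ b * u' `^ (- b).
have c2 : 0 <= c / 2 by nneg.
have c2c : c / 2 < c by clear -c0; lra.
have hL := cc_local UFu UFoo (ltW k0) hb c2 c2c l1 u0' (lexx L).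
suff : cc UF k b <= c - d / 2 by rewrite -/c; clear -d0; lra.
apply: cc_le; split; first by clear -d0 dc; lra.
exists l => //.
apply: UF_imp (UF_and UFu hl0 (UF_and UFu hL (UF_and UFu (UF_inv UFu UFoo q0) (UFoo 2)))).
move=> m [Hm1 [Hm2 [Hm3 m2]]] n i.
have m0 : (0 < m)%N := ltnW m2.
have mp : 0 < m%:R :> R by rewrite ltr0n.
have L0 : 0 <= L by rewrite /L; nneg.
(* The line is padded by [W] columns on each side. By [Dr_shift] padding can only increase [Dn], and
   the padded column has room for the inserted vertex. *)
have [W hW] := nat_large ((L + A1 + 2) * m%:R + 1).
have hWn : (W + n <= W + n + W)%N := leq_addr _ _.
pose i' : 'I_(W + n + W) := Ordinal (shift_lt i hWn).
have room1 : L * m%:R <= i'%:R.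
  apply: (@le_trans _ _ W%:R); last by rewrite /= natrD lerDl.
  have : 0 <= (A1 + 2) * m%:R by nneg.
  move: hW; rewrite (_ : (L + A1 + 2) * m%:R = L * m%:R + (A1 + 2) * m%:R); last by ring.
  set aa := L * _; set bb2 := (A1 + 2) * _; move: aa bb2 => aa bb2; clear; lra.
have iN : i%:R + 1 <= n%:R :> R by rewrite natr1 ler_nat.
have room2 (x : R) : x <= L + A1 + 2 -> i'%:R + x * m%:R + 1 <= (W + n + W)%:R.
  move=> hx; have := ler_wpM2r (ltW mp) hx; rewrite /= !natrD; clear -hW iN; lra.
have D1 : Dn (kT k b) l m i <= Dn (kT k b) l m i'.
  by rewrite /Dn ler_pM2r ?invr_gt0 //; apply: ler_sum => j _; apply: (Dr_shift _ _ hWn (i, j)).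
clearbody i'; move: (W + n + W)%N i' room1 room2 D1 => n' i' room1 room2 D1; clear hWn hW W iN.
have hLL : L <= L + A1 + 2 by rewrite -addrA lerDl addr_ge0.
have FL := Hm2 _ i' room1 (room2 L hLL).
have T1 := thr_kT (ltW k0) (ltW b0); have T1' := thr_kT (ltW k0') (ltW b0').
pose p := @pm R m ('I_n' * 'I_m)%type; have hp : prob p by exact: prob_pm.
have TT (x y : 'I_n' * 'I_m) : adj (kT k b) x y -> adj (kT k' b') x y.
  by move/le_trans; apply; apply: kT_mono; rewrite ?gU_gt0 ?gU_le1 ?(ltW k0).
pose S1 := dA * (c / 8 * z0 / 2).
have S0 : 0 <= S1 by rewrite /S1; nneg.
have key (j : 'I_m) : Dr (kT k b) l (i', j) + S1 <=
    Dr (kT k' b') l (i', j) + S1 * ((j.+1%:R / m%:R < s :> R)%:R : R).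
  case: ltP => hj /=.
    rewrite [S1 * _]mulr1 lerD2r /Dr; apply: Pr_le => [|w]; first exact: prob_pm.
    by apply: reach_mono => // x y _ _; apply: TT.
  rewrite [S1 * _]mulr0 [X in _ <= X]addr0; set v := (i', j).
  have sv : s <= gU R v by [].
  have near x : adj (kT k b) v x -> h <= gU R x -> `|gX R x - gX R v| <= lam.
    move=> a hx; rewrite distrC; apply: le_trans a (le_trans _ lam2).
    rewrite /kT powRM ?(ltW (gU_gt0 _ _)) // mulrA.
    apply: ler_pM; rewrite ?mulr_ge0 ?powR_ge0 ?(ltW k0) //; last exact: powR_anti (ltW b0) h0 hx.
    by rewrite /A ler_pM2l //; apply: powR_anti (ltW b0) s0 sv.
  pose F := Pr p (freach (kT k b) l L1 v).
  have F0 : 0 <= F by apply: Pr_ge0.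
  have hF : c / 8 <= F.
    pose Low := [set x | adj (kT k b) v x & gU R x < h].
    have M1 : mass R m Low <= c / 16 + c / 16.
    apply: le_trans (mass_nbr (ltW k0) hb (h := h) (s := s) (v := v) _ (ltW h0) m0 _) _; first by rewrite s0.
    by move=> x; rewrite inE => /andP[-> /ltW].
    exact: lerD.
    have M2 : mass R m (tailS (kT k b) lam L1 n' m (gX R v)) <= c / 16.
    apply: le_trans hu; apply: tail_mass => //; first exact: ltW.
    have P1 (j1 : 'I_m) : DL (kT k b) l L (i', j1) <=
    ((j1.+1%:R / m%:R < h :> R)%:R : R) + (F + (c / 16 + c / 16 + c / 16)).
    apply: le_trans (DL_le _ _ _ _) _; case: ltP => hj1 /=.
    apply: (@le_trans _ _ 1); first exact: Dr_le1.
    by rewrite lerDl; nneg.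
    rewrite add0r; have Y := freach_ge (v := v) (v1 := (i', j1)) L1 T1 erefl hj1 lam0 lamh llam near.
    by apply: (le_trans Y); rewrite lerD2l; apply: lerD.
    have : (\sum_(j1 < m) DL (kT k b) l L (i', j1)) / m%:R <=
    (\sum_(j1 < m) (((j1.+1%:R / m%:R < h :> R)%:R : R) + (F + (c / 16 + c / 16 + c / 16)))) / m%:R.
    by rewrite ler_pM2r ?invr_gt0 //; apply: ler_sum.
    rewrite avg_addc //; have := rows_below m0 (ltW h0); move: FL hu' hc c0; rewrite /=; clear; lra.
  pose Z := [set x : 'I_n' * 'I_m | (s * t < gU R x <= t) && (A1 <= gX R x - gX R v <= A1 + 1)].
  have Tsmall x : x \in Z -> kT k b (gU R v) (gU R x) < A1.
    rewrite inE => /andP[/andP[x1 _] _]; rewrite /A1; apply: (@le_lt_trans _ _ (kT k b s (s * t))).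
    rewrite /kT ler_pM2l //; apply: powR_anti; rewrite ?(ltW b0) ?mulr_gt0 //.
    by apply: ler_pM; rewrite ?mulr_ge0 // ltW.
    by rewrite ltrDl.
  have Zx x : x \in Z -> A1 <= `|gX R v - gX R x| <= A1 + 1.
    rewrite inE => /andP[_ /andP[x1 x2]]; rewrite distrC ger0_norm ?x1 //.
    exact: le_trans x1.
  have big x (y : R) : x \in Z -> 0 < y <= 1 -> L1 + 2 + A1 <= kT k' b' (gU R x) y.
    rewrite inE => /andP[/andP[_ x1] _] /andP[y0 y1].
    have : kT k' b' 1 t <= kT k' b' (gU R x) y.
    rewrite /kT ler_pM2l //; apply: powR_anti; [exact: ltW|by rewrite mulr_gt0 ?gU_gt0|].
    by rewrite mulrC; apply: ler_pM => //; [exact: ltW|exact: ltW (gU_gt0 _ _)].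
    move: ht; rewrite /A1; clear; lra.
  apply: le_trans (boost (T := kT k b) (T' := kT k' b') (L := L1) (v := v) (Z := Z) T1 TT _ _ _ _).
  - rewrite lerD2l /S1; apply: ler_pM; rewrite ?(ltW dA0) ?divr_ge0 ?mulr_ge0 ?(ltW c0) ?(ltW z00) ?invr_ge0 //.
    apply: le_trans (vac_ge R _ m2); rewrite /dA ler_expR lerN2 ler_pM2l //.
    apply: (mass_nbr (ltW k0) hb (s := s) (v := v)) => //; first by rewrite s0.
    by move=> x; rewrite inE => ->; rewrite gU_le1.
    rewrite ler_pM2r ?invr_gt0 //; apply: ler_pM; rewrite ?(ltW z00) ?divr_ge0 ?(ltW c0) //.
    rewrite PrC lerD2l lerN2; apply: le_trans (vac_le _ _ _) _; rewrite ler_expR lerN2.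
    apply: (mass_far (s := s) (t := t) (A := A1) (v := v)) => //; first by rewrite t0 ltW.
    rewrite ltr_pdivlMr // -addrA mulrDl /gX divfK ?gt_eqF //.
    have hA1 : A1 + 1 <= L + A1 + 2 by clear -L0; lra.
    by apply: lt_le_trans (room2 _ hA1); rewrite ltrDl.
    by rewrite (ler_nat R 2).
    by move=> x x1 x2; rewrite inE x1 x2.
  - rewrite /Out subrr normr0 negb_or -leNgt (ltW lp) -ltNge; apply: lt_le_trans sv.
    rewrite -[ltRHS]invrK ltf_pV2 ?posrE ?invr_gt0 //; apply: lt_le_trans ls.
    by rewrite ltrDl.
  - move=> x xZ; rewrite /adj -ltNge; apply: lt_le_trans (Tsmall x xZ) _.
    by case/andP: (Zx x xZ).
  - move=> x xZ; case/andP: (Zx x xZ) => _ xx; apply: le_trans xx _.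
    case: (T1') => ts _ _; rewrite ts; have hv : 0 < gU R v <= 1 by rewrite gU_gt0 gU_le1.
    apply: le_trans (big x _ xZ hv).
    by clear -L10; lra.
  move=> x y xZ hy; case/andP: (Zx x xZ) => _ xx.
  have hy' : 0 < gU R y <= 1 by rewrite gU_gt0 gU_le1.
  apply: le_trans (big x _ xZ hy').
  apply: le_trans (ler_distD (gX R v) _ _) _; rewrite distrC [X in _ + X]distrC; clear -xx hy; lra.
have key2 : Dn (kT k b) l m i' + S1 <= Dn (kT k' b') l m i' + S1 * s.
  exact: avg_boost m0 S0 (ltW s0) key.
have l00 : 0 < l0 by apply: lt_le_trans l01.
have D2 : Dn (kT k' b') l m i' <= Dn (kT k' b') l0 m i' by apply: Dn_anti.
have D3 := Hm1 _ i'.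
move: key2 D1 D2 D3; rewrite /d -/S1; clear key S0.
move: (Dn (kT k b) l m i') (Dn (kT k' b') l m i') (Dn (kT k' b') l0 m i') S1 => x y z S.
clear; lra.
Qed.

End Strict.

(** * Crossings of windows at b = 1/2 *)

Section Crossing.
Import Fin.
Variable R : realType.
Implicit Types (T : R -> R -> R) (l L k b q h d e eta : R).

Definition above eta n m (w : {set 'I_n * 'I_m}) : {set 'I_n * 'I_m} := [set u in w | ~~ high eta u].
Definition cross (n m : nat) (e : rel ('I_n * 'I_m)) eta (D E : nat) (w : {set 'I_n * 'I_m}) :=
  [exists a : 'I_n * 'I_m, exists b : 'I_n * 'I_m, [&& (a.1 <= D)%N, (E <= b.1)%N & connect (gr e (above eta w)) a b]].

Lemma Dn_room T l m q (W : nat) :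
  (forall n (i : 'I_n), (W <= i)%N -> (i + W <= n)%N -> Dn T l m i <= q) ->
  forall n (i : 'I_n), Dn T l m i <= q.
Proof.
move=> H n i; have hn : (W + n <= W + n + W)%N := leq_addr _ _.
apply: le_trans (H (W + n + W)%N (Ordinal (shift_lt i hn)) _ _) => /=.
- case: m {H} => [|m]; first by rewrite /Dn invr0 !mulr0.
  rewrite /Dn ler_pM2r ?invr_gt0 ?ltr0n //; apply: ler_sum => j _; exact: (Dr_shift _ _ hn (i, j)).
- exact: leq_addr.
- by rewrite leq_add2r leq_add2l ltnW.
Qed.

(** At b = 1/2 two sites above [eta] are adjacent only within distance k / eta. Lengths scale as
    inverse heights, so the model looks alike at all scales, and [D] columns measure one jump. *)
Lemma jump k eta n m (x y : 'I_n * 'I_m) (D : nat) : 0 < k -> 0 < eta -> k * m%:R <= eta * D%:R ->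
  ~~ high eta x -> ~~ high eta y -> adj (kT k 2^-1) x y -> (y.1 <= x.1 + D)%N.
Proof.
move=> k0 e0 hD; rewrite -!ltNge => hx hy a.
have m0 := cell_m0 x; have mp : 0 < m%:R :> R by rewrite ltr0n.
have hu : (gU R x * gU R y) `^ (- 2^-1) <= eta^-1.
  rewrite (_ : eta^-1 = (eta * eta) `^ (- 2^-1)); last first.
    rewrite -expr2 -powR_mulrn ?(ltW e0) // -powRrM ?mulrN divff ?pnatr_eq0 // powR_inv1 ?ltW //.
  by apply: powR_anti => //; [exact: mulr_gt0|apply: ler_pM; exact: ltW].
have : `|gX R x - gX R y| <= k / eta by apply: le_trans a _; rewrite /kT ler_pM2l.
rewrite distrC /gX -mulrBl normrM [`|m%:R^-1|]ger0_norm ?invr_ge0 ?ler0n // ler_pdivrMr // mulrAC.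
rewrite ler_pdivlMr // => h1; rewrite -(ler_nat R) natrD.
have h2 : (y.1%:R - x.1%:R) * eta <= eta * D%:R.
  by apply: le_trans hD; apply: le_trans h1; rewrite ler_pM2r // ler_norm.
by move: h2; rewrite mulrC ler_pM2l // lerBlDl.
Qed.

Definition strip_win eta n m (s n' : nat) : {set 'I_n * 'I_m} :=
  [set x : 'I_n * 'I_m | (s <= x.1 < s + n')%N && ~~ high eta x].

Lemma cross_dep T eta n n' m s (hs : (s + n' <= n)%N) (D E : nat) :
  dep (@strip_win eta n m s n') (fun w => cross (adj T) eta D E (emb hs @^-1: w)).
Proof.
move=> w; rewrite /cross; suff -> : above eta (emb hs @^-1: (w :&: @strip_win eta n m s n')) =
  above eta (emb hs @^-1: w) by [].
apply/setP => x; rewrite !inE /= -andbA; congr (_ && _).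
by rewrite leq_addr /= ltn_add2l ltn_ord /= /high shift_U; case: (_ <= eta).
Qed.

(** Jumps span at most D columns. The piece of the path from its last site in the left buffer to the
    next site beyond column s + E therefore stays inside the window. *)
Lemma cross_window k eta n n' m s (hs : (s + n' <= n)%N) (D E : nat) (w : {set 'I_n * 'I_m}) v y :
  0 < k -> 0 < eta -> k * m%:R <= eta * D%:R -> (D < E)%N -> (E + D < n')%N ->
  connect (gr (adj (kT k 2^-1)) (above eta w)) v y ->
  (v.1 <= s + D)%N -> (s + E <= y.1)%N ->
  cross (adj (kT k 2^-1)) eta D E (emb hs @^-1: w).
Proof.
move=> k0 e0 hD DE hn c hv hy; set e := adj _ in c *; set A := above eta w in c *.
have es : symmetric e by apply/adj_sym/thr_kT; rewrite ?ltW.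
have jA x z : gr e A x z -> (z.1 <= x.1 + D)%N.
  case/and3P => xA zA; apply: jump k0 e0 hD _ _.
    by case/setIdP: xA.
  by case/setIdP: zA.
have jA' x z : gr e A x z -> (x.1 <= z.1 + D)%N.
  by move=> g; apply: jA; rewrite gr_sym.
pose K (x : 'I_n * 'I_m) := (x.1 <= s + D)%N; pose O (x : 'I_n * 'I_m) := (s + E <= x.1)%N.
have nKy : ~~ K y by rewrite /K -ltnNge; apply: leq_trans hy; rewrite ltn_add2l.
have [a [a' [Ka Ka' gaa' c1]]] := conn_last es c hv nKy.
have [b [Ob hb c2]] : exists b : 'I_n * 'I_m, [/\ O b, (b.1 <= s + E + D)%N &
    connect (gr e (A :&: [set x : 'I_n * 'I_m | s <= x.1 <= s + E + D]%N)) a b].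
  have aw : (s <= a.1 <= s + E + D)%N.
    have := jA _ _ gaa'; move: Ka Ka'; rewrite /K -ltnNge => h1 h2 h3; apply/andP; split.
    by move: (leq_trans h2 h3); rewrite ltn_add2r; exact: ltnW.
    by apply: leq_trans h1 _; rewrite -addnA leq_add2l leq_addl.
  have aw' : (s <= a'.1 <= s + E + D)%N.
    apply/andP; split; first by move: Ka'; rewrite /K -ltnNge => /ltnW; apply: leq_trans; exact: leq_addr.
    apply: leq_trans (jA _ _ gaa') _; rewrite leq_add2r; apply: leq_trans Ka _.
    by rewrite leq_add2l ltnW.
  have s1 : connect (gr e (A :&: [set x : 'I_n * 'I_m | s <= x.1 <= s + E + D]%N)) a a'.
    apply: connect1; case/and3P: gaa' => q1 q2 q3; rewrite /gr !inE aw aw' q3 !andbT.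
    by rewrite inE in q1; rewrite inE in q2; rewrite q1 q2.
  case: (boolP (O a')) => Oa'; first by exists a'; split=> //; case/andP: aw'.
  have [x [b [c2 nx Ob gxb]]] := conn_exit c1 Oa' hy.
  have gxb' : gr e A x b by apply: gr_mono gxb => //; apply/subsetP => z /setIdP[].
  have hb : (b.1 <= s + E + D)%N.
    by apply: leq_trans (jA _ _ gxb') _; rewrite leq_add2r ltnW // ltnNge.
  exists b; split=> //.
  have sub : [set u in [set u in A | ~~ K u] | ~~ O u] \subset A :&: [set x : 'I_n * 'I_m | s <= x.1 <= s + E + D]%N.
    apply/subsetP => z /setIdP[/setIdP[zA nK] nO]; rewrite in_setI zA in_set /=.
    move: nK nO; rewrite /K /O -!ltnNge => h1 h2; apply/andP; split.
    by apply: leq_trans (ltnW h1); exact: leq_addr.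
    by apply: leq_trans (ltnW h2) _; exact: leq_addr.
  have c3 := conn_mono (fun _ _ _ _ (a : e _ _) => a) sub c2.
  apply: connect_trans s1 (connect_trans c3 (connect1 _)).
  case/and3P: gxb => q1 q2 q3; rewrite /gr q3 andbT.
  have bA : b \in A by case/setIdP: q2.
  have xA : x \in A by case/setIdP: q1.
  have nKx : ~~ K x by case/setIdP: q1.
  rewrite in_setI [in X in _ && X]in_setI xA bA !in_set hb !andbT /=; apply/andP; split; first (apply/andP; split).
  - by move: nKx; rewrite /K -ltnNge => /ltnW; apply: leq_trans; exact: leq_addr.
  - by move: nx; rewrite /O -ltnNge => /ltnW h; apply: leq_trans h _; exact: leq_addr.
  - by apply: leq_trans Ob; exact: leq_addr.
have aw : (s <= a.1)%N.
  have := jA _ _ gaa'; move: Ka'; rewrite /K -ltnNge => h2 h3.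
  by move: (leq_trans h2 h3); rewrite ltn_add2r; exact: ltnW.
have pre (x : 'I_n * 'I_m) : (s <= x.1)%N -> (x.1 <= s + E + D)%N ->
    exists2 x0 : 'I_n' * 'I_m, emb hs x0 = x & (x0.1 = x.1 - s :> nat)%N.
  move=> h1 h2; have lt : (x.1 - s < n')%N by rewrite ltn_subLR //; apply: leq_ltn_trans h2 _; rewrite -addnA ltn_add2l.
  exists (Ordinal lt, x.2) => //; case: x h1 {h2} lt => x1 x2 /= h1 lt.
  by congr (_, _); apply: val_inj => /=; rewrite subnKC.
have ab1 : (a.1 <= s + E + D)%N by apply: leq_trans Ka _; rewrite -addnA leq_add2l leq_addl.
have bb1 : (s <= b.1)%N by apply: leq_trans Ob; exact: leq_addr.
have [a0 ea ha0] := pre a aw ab1; have [b0 eb hb0] := pre b bb1 hb.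
apply/existsP; exists a0; apply/existsP; exists b0; apply/and3P; split.
- by rewrite ha0 leq_subLR.
- by rewrite hb0 leq_subRL.
rewrite -(@conn_img _ _ (emb hs) e (adj (kT k 2^-1)) (@shift_inj _ _ _ _ hs)); last by move=> x z; exact: shift_adj.
rewrite ea eb; apply: conn_mono c2 => //; apply/subsetP => x.
rewrite in_setI => /andP[xA]; rewrite in_set => /andP[h1 h2].
have [x0' e0' _] := pre x h1 h2.
have -> : x = emb hs x0' by rewrite e0'.
apply: imset_f; move: xA; rewrite -e0' !inE /high shift_U; exact.
Qed.

Lemma emb_preim_root n n' m s (hs : (s + n' <= n)%N) (v : 'I_n * 'I_m) (w : {set 'I_n * 'I_m}) :
  ~~ (s <= v.1 < s + n')%N -> emb hs @^-1: (v |: w) = emb hs @^-1: w.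
Proof.
move=> hv; apply/setP => x; rewrite !inE; case: eqP => //= ev; case/negP: hv.
by rewrite -ev /= leq_addr ltn_add2l ltn_ord.
Qed.

(** The sites of height at most eta that can be adjacent to a site above eta within dl of v. *)
Definition spill k eta dl n m (v : 'I_n * 'I_m) : {set 'I_n * 'I_m} :=
  [set x | (gU R x <= eta) && (`|gX R x - gX R v| <= dl + k * eta `^ (- 2^-1) * gU R x `^ (- 2^-1))].

(** If the part of the cluster above [eta] stays within [dl] and no spill site is occupied, the
    cluster never goes below [eta], so it does not escape. *)
Lemma confined k eta dl l n m (v : 'I_n * 'I_m) (w : {set 'I_n * 'I_m}) : 0 < k -> 0 < eta ->
  eta < gU R v -> dl <= l -> l^-1 <= eta ->
  (forall y, connect (gr (adj (kT k 2^-1)) (above eta (v |: w))) v y -> `|gX R y - gX R v| <= dl) ->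
  vac (spill k eta dl v) w -> ~~ reach (adj (kT k 2^-1)) (v |: w) v (Out l v).
Proof.
move=> k0 e0 hv dll le hc vQ; apply/negP => hr.
have nO y : connect (gr (adj (kT k 2^-1)) (above eta (v |: w))) v y -> ~~ high eta y -> ~~ Out l v y.
  move=> c ny; rewrite /Out negb_or -leNgt (le_trans (hc _ c)) //= -ltNge.
  by apply: le_lt_trans le _; move: ny; rewrite /high -ltNge.
have hv' : ~~ high eta v by rewrite /high -ltNge.
case: (boolP (reach (adj (kT k 2^-1)) (v |: w) v (high eta))) => hh.
  have [x [y [c nx Oy /and3P[xw yw axy]]]] := reach_exit hh hv'.
  have yw' : y \in w.
    by move: yw; rewrite in_setU1 => /orP[/eqP yv|//]; rewrite yv (negbTE hv') in Oy.
  move/eqP/setP/(_ y): vQ; rewrite !inE yw' /= => /negP[]; apply/andP; split => //.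
  have hx : eta < gU R x by move: nx; rewrite /high -ltNge.
  apply: le_trans (ler_distD (gX R x) _ _) _; rewrite addrC lerD //; first exact: hc.
  rewrite distrC; apply: le_trans axy _; rewrite /kT powRM ?(ltW (gU_gt0 _ _)) // mulrA.
  rewrite ler_wpM2r ?powR_ge0 // ler_pM2l //; apply: powR_anti => //; exact: ltW.
case/existsP: hr => z /andP[Oz cz].
have cz' : connect (gr (adj (kT k 2^-1)) (above eta (v |: w))) v z.
  apply: conn_avoid cz _ => y cy; apply/negP => Oy; case/negP: hh.
  by apply/existsP; exists y; rewrite Oy.
have nz : ~~ high eta z.
  by apply/negP => Oz'; case/negP: hh; apply/existsP; exists z; rewrite Oz'.
by case/negP: (nO z cz' nz).
Qed.

Lemma spill_mass k eta u dl n m (v : 'I_n * 'I_m) (S : {set 'I_n * 'I_m}) : 0 < k -> 0 < eta ->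
  0 < u <= eta -> 0 <= dl -> (0 < m)%N -> (forall x, x \in S -> x \in spill k eta dl v /\ gU R x <= u) ->
  mass R m S <= 4 * k * (eta `^ (- 2^-1) * u `^ 2^-1) + (2 * dl + 1) * u.
Proof.
move=> k0 e0 /andP[u0 ue] d0 m0 hS.
have A0 : 0 <= k * eta `^ (- 2^-1) by nneg.
have hs : 0 <= (2^-1 : R) < 1 by rewrite invr_ge0 ler0n /= invf_lt1 // ltr1n.
apply: le_trans (@mass_shape R n m _ dl 2^-1 u (gX R v) S m0 A0 d0 hs (ltW u0) _) _.
  by move=> x /hS[]; rewrite inE [dl + _]addrC => /andP[_ h1] h2.
apply: lerD.
  have -> : 1 - 2^-1 = 2^-1 :> R by field.
  by rewrite invrK le_eqVlt; apply/orP; left; apply/eqP; ring.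
by rewrite ler_pM2r // lerD2l invf_le1 ?ltr0n // ler1n.
Qed.

(** The window leaves room for a left buffer of D columns, a crossing up to column (t + 1) D and one
    more jump. *)
Definition ncross k eta (t D m : nat) : R :=
  Pr (@pm R m ('I_((t + 2) * D).+1 * 'I_m)%type)
    (fun w => ~~ cross (adj (kT k 2^-1)) eta D (t.+1 * D) w).

Section Scale.
Variables (k eta dl : R) (t D n m : nat) (v : 'I_n * 'I_m) (eta' : R).
Hypotheses (k0 : 0 < k) (e0 : 0 < eta) (m0 : (0 < m)%N) (t0 : (0 < t)%N).
Hypothesis hD : k * m%:R <= eta * D%:R.
Hypothesis hdl : (t + 4)%:R * D%:R <= dl * m%:R.
Hypotheses (roomL : ((t + 4) * D <= v.1)%N) (roomR : (v.1 + (t + 4) * D <= n)%N).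

Let n' := ((t + 2) * D).+1.
Let D0 : (0 < D)%N.
Proof.
rewrite lt0n; apply/negP => /eqP D0; move: hD; rewrite D0 mulr0; apply/negP; rewrite -ltNge.
by rewrite mulr_gt0 ?ltr0n.
Qed.
Lemma scale_size : (D + n' <= (t + 4) * D)%N.
Proof. rewrite /n'; have := D0; clear; nia. Qed.
Lemma scaleR : (v.1 + D + n' <= n)%N.
Proof. by apply: leq_trans roomR; rewrite -addnA leq_add2l scale_size. Qed.
Lemma scaleL : (v.1 - (D + n') + n' <= n)%N.
Proof.
apply: leq_trans (ltnW (ltn_ord v.1)); rewrite -{2}(subnK (leq_trans scale_size roomL)) leq_add2l.
exact: leq_addl.
Qed.

(** The spill below [eta'] extends too far and is left to a union bound over the scales; what
    remains has a bounded support, which can be made disjoint from those of the other scales. *)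
Definition shut (w : {set 'I_n * 'I_m}) : bool :=
  ~~ cross (adj (kT k 2^-1)) eta D (t.+1 * D) (emb scaleR @^-1: w) &&
  (~~ cross (adj (kT k 2^-1)) eta D (t.+1 * D) (emb scaleL @^-1: w) &&
   vac [set x in spill k eta dl v | eta' < gU R x] w).

Definition shut_sup : {set 'I_n * 'I_m} :=
  [set x | (~~ high eta x && (D%:R <= `|gX R x - gX R v| * m%:R <= (t + 4)%:R * D%:R)) ||
    ((x \in spill k eta dl v) && (eta' < gU R x))].

Let mp : 0 < m%:R :> R. Proof. by rewrite ltr0n. Qed.

Lemma winR_sup : @strip_win eta n m (v.1 + D) n' \subset
  [set x | ~~ high eta x && (D%:R <= (gX R x - gX R v) * m%:R <= (t + 4)%:R * D%:R)].
Proof.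
apply/subsetP => x; rewrite !inE => /andP[/andP[h1 h2] ->] /=.
rewrite mulrBl /gX !divfK ?gt_eqF // -natrM lerBrDl lerBlDl -!natrD !ler_nat h1 /=.
apply: ltnW (leq_trans h2 _); rewrite -addnA leq_add2l; exact: scale_size.
Qed.

Lemma winL_sup : @strip_win eta n m (v.1 - (D + n')) n' \subset
  [set x | ~~ high eta x && (D%:R <= (gX R v - gX R x) * m%:R <= (t + 4)%:R * D%:R)].
Proof.
apply/subsetP => x; rewrite !inE => /andP[/andP[h1 h2] ->] /=.
have h3 := leq_trans scale_size roomL.
rewrite mulrBl /gX !divfK ?gt_eqF // -natrM lerBrDl lerBlDl -!natrD !ler_nat.
apply/andP; split.
  have aux (x1 v1 d n1 : nat) : (d + n1 <= v1 -> x1 < v1 - (d + n1) + n1 -> x1 + d <= v1)%N by clear; lia.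
  exact: aux h3 h2.
have aux (x1 v1 d n1 q : nat) : (v1 - (d + n1) <= x1 -> d + n1 <= q -> d + n1 <= v1 -> v1 <= x1 + q)%N by clear; lia.
exact: aux h1 scale_size h3.
Qed.

Lemma shut_dep : dep shut_sup shut.
Proof.
have d1 := dep_sub _ (@cross_dep (kT k 2^-1) eta _ _ m _ scaleR D (t.+1 * D)).
have d2 := dep_sub _ (@cross_dep (kT k 2^-1) eta _ _ m _ scaleL D (t.+1 * D)).
have s3 : [set x in spill k eta dl v | eta' < gU R x] \subset shut_sup.
  by apply/subsetP => x; rewrite !inE => /andP[-> ->]; rewrite orbT.
have d3 := dep_sub s3 (@dep_vac _ _).
have s1 : @strip_win eta n m (v.1 + D) n' \subset shut_sup.
  apply: subset_trans winR_sup _; apply/subsetP => x; rewrite !inE => /andP[-> /andP[h1 h2]] /=.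
  have : 0 <= gX R x - gX R v by rewrite -(pmulr_lge0 _ mp); apply: le_trans h1.
  by move/ger0_norm => ->; rewrite h1 h2.
have s2 : @strip_win eta n m (v.1 - (D + n')) n' \subset shut_sup.
  apply: subset_trans winL_sup _; apply/subsetP => x; rewrite !inE distrC => /andP[-> /andP[h1 h2]] /=.
  have : 0 <= gX R v - gX R x by rewrite -(pmulr_lge0 _ mp); apply: le_trans h1.
  by move/ger0_norm => ->; rewrite h1 h2.
by move=> w; rewrite /shut (d1 _ s1) (d2 _ s2) d3.
Qed.

Lemma shut_pr c : c <= Pr (@pm R m _) (vac [set x in spill k eta dl v | eta' < gU R x]) -> 0 <= c ->
  ncross k eta t D m * (ncross k eta t D m * c) <= Pr (@pm R m _) shut.
Proof.
move=> hc c0; have hp : prob (@pm R m ('I_n * 'I_m)%type) by exact: prob_pm.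
have d1 := @cross_dep (kT k 2^-1) eta _ _ m _ scaleR D (t.+1 * D).
have d2 := @cross_dep (kT k 2^-1) eta _ _ m _ scaleL D (t.+1 * D).
have cr s (hs : (s + n' <= n)%N) : ncross k eta t D m =
    Pr (@pm R m ('I_n * 'I_m)%type) (fun w => ~~ cross (adj (kT k 2^-1)) eta D (t.+1 * D) (emb hs @^-1: w)).
  rewrite (@Pr_preim R _ _ (emb hs) (@shift_inj _ _ _ _ hs) (@pm R m _)
    (fun u => ~~ cross (adj (kT k 2^-1)) eta D (t.+1 * D) u)) //.
rewrite {1}(cr _ scaleR) (cr _ scaleL) /shut.
set LQ := @strip_win eta n m (v.1 - (D + n')) n' :|: [set x in spill k eta dl v | eta' < gU R x].
rewrite (@PrI _ _ _ _ _ (@strip_win eta n m (v.1 + D) n') LQ); first last.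
- move=> w; rewrite (dep_sub _ d2) ?subsetUl //; congr (_ && _).
  by rewrite (dep_sub _ (@dep_vac _ _)) // subsetUr.
- by move=> w; rewrite d1.
- apply: disjoint_notin => x xR; rewrite inE negb_or; have := subsetP winR_sup x xR.
  rewrite inE => /andP[h1 /andP[h2 h3]]; apply/andP; split.
    apply/negP => /(subsetP winL_sup); rewrite inE => /andP[_ /andP[h4 _]].
    have : 0 < D%:R :> R by rewrite ltr0n D0.
    by move: h2 h4; rewrite !mulrBl => h2 h4 h5; lra.
  by apply/negP; rewrite !inE => /andP[/andP[h4 _] _]; rewrite /high h4 in h1.
rewrite (@PrI _ _ _ _ _ (@strip_win eta n m (v.1 - (D + n')) n') [set x in spill k eta dl v | eta' < gU R x]); first last.
- exact: dep_vac.
- by move=> w; rewrite d2.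
- apply: disjoint_notin => x; rewrite inE => /andP[_ h1]; apply/negP; rewrite !inE => /andP[/andP[h4 _] _].
  by rewrite /high h4 in h1.
apply: ler_wpM2l; first exact: Pr_ge0.
by apply: ler_wpM2l; first exact: Pr_ge0.
Qed.

Lemma shut_confined l w : eta < gU R v -> dl <= l -> l^-1 <= eta -> shut w ->
  vac [set x in spill k eta dl v | gU R x <= eta'] w ->
  ~~ reach (adj (kT k 2^-1)) (v |: w) v (Out l v).
Proof.
move=> hv dll le /and3P[c1 c2 v1] v2.
apply: (confined (eta := eta) (dl := dl)) => //; last first.
  apply/negPn; apply/negP => /set0Pn[x]; rewrite inE => /andP[xw xS].
  case: (lerP (gU R x) eta') => hx.
    by move/eqP/setP/(_ x): v2; rewrite !inE; rewrite inE in xS; rewrite xw xS hx.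
  by move/eqP/setP/(_ x): v1; rewrite !inE; rewrite inE in xS; rewrite xw xS hx.
move=> y c.
have es : symmetric (adj (kT k 2^-1) : rel ('I_n * 'I_m)) by apply/adj_sym/thr_kT; rewrite ?ltW.
have DE : (D < t.+1 * D)%N by rewrite -{1}(mul1n D) ltn_mul2r D0 ltnS.
have En : (t.+1 * D + D < n')%N by rewrite /n' ltnS; clear; lia.
have h3 := leq_trans scale_size roomL.
have yR : (y.1 < v.1 + D + t.+1 * D)%N.
  rewrite ltnNge; apply/negP => hy; case/negP: c1; rewrite -(emb_preim_root (v := v) scaleR); last first.
    by rewrite negb_and -ltnNge -{1}(addn0 v.1) ltn_add2l D0.
  by apply: (cross_window (v := v) (y := y) scaleR k0 e0 hD DE En c) => //; rewrite -addnA leq_addr.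
have yL : (v.1 - (D + n') + D < y.1)%N.
  rewrite ltnNge; apply/negP => hy; case/negP: c2; rewrite -(emb_preim_root (v := v) scaleL); last first.
    rewrite negb_and orbC -leqNgt; apply/orP; left.
    move: h3; clear; lia.
  apply: (cross_window (v := y) (y := v) scaleL k0 e0 hD DE En) => //.
    by rewrite (sym_connect_sym (gr_sym _ es)).
  have aux (a d n1 p : nat) : (d + n1 <= a -> p + d < n1 -> a - (d + n1) + p <= a)%N by clear; lia.
  exact: aux h3 En.
rewrite -(ler_pM2r mp); apply: le_trans hdl.
rewrite -{1}(ger0_norm (ltW mp)) -normrM mulrBl /gX !divfK ?gt_eqF // -natrM.
rewrite ler_norml lerBlDl lerNl opprB lerBlDl -!natrD !ler_nat; apply/andP; split.
  have aux (a b d n1 p : nat) : (a - (d + n1) + d < b -> d + n1 <= p -> d + n1 <= a -> a <= b + p)%N by clear; lia.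
  exact: aux yL scale_size h3.
by apply: leq_trans (ltnW yR) _; rewrite -addnA leq_add2l; clear; lia.
Qed.

End Scale.

Variable UF : set_system nat.
Hypotheses (UFu : UltraFilter UF) (UFoo : tails UF).

Lemma UF_all (J : nat) (P : nat -> nat -> Prop) : (forall j, (j < J)%N -> UF (P j)) ->
  UF (fun m => forall j, (j < J)%N -> P j m).
Proof.
elim: J => [|J IH] h; first by apply: UF_imp (UFoo 0).
have h1 : UF (fun m => forall j, (j < J)%N -> P j m) by apply: IH => j jJ; apply: h; apply: ltnW.
apply: UF_imp (UF_and UFu h1 (h J (ltnSn J))) => m [h2 h3] j.
by rewrite ltnS leq_eqVlt => /orP[/eqP -> //|]; apply: h2.
Qed.

Lemma scales (rho h : R) (P : R -> Prop) : 0 < rho < 1 -> 0 < h -> (forall h, 0 < h -> exists2 eta, 0 < eta <= h & P eta) ->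
  exists f : nat -> R, [/\ f 0%N <= h, forall j, 0 < f j, forall j, P (f j),
    forall j, f j.+1 <= rho * f j & forall i j, (i <= j)%N -> f j <= f i].
Proof.
move=> /andP[r0 r1] h0 H.
have /choice[g hg] : forall x : R, exists y : R, 0 < x -> 0 < y <= x /\ P y.
  by move=> x; case: (ltP 0 x) => [/H[y y1 y2]|_]; [exists y|exists 0].
pose f j := iter j (fun x => g (rho * x)) (g h).
have f0 j : 0 < f j.
  elim: j => [|j IH] /=; first by case: (hg h h0) => /andP[].
  by case: (hg (rho * f j)) => [|/andP[]//]; exact: mulr_gt0.
have fS j : f j.+1 <= rho * f j.
  by case: (hg (rho * f j)) => [|/andP[]//]; exact: mulr_gt0.
exists f; split=> //.
- by case: (hg h h0) => /andP[].
- case=> [|j]; first by case: (hg h h0).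
  by case: (hg (rho * f j)) => [|//]; exact: mulr_gt0.
move=> i j /subnKC <-; elim: (j - i)%N => [|d IH]; first by rewrite addn0.
rewrite addnS; apply: le_trans (fS _) (le_trans _ IH).
by rewrite ler_piMl // ltW.
Qed.

Lemma powR_half (x : R) : 0 < x -> x `^ 2^-1 * x `^ 2^-1 = x.
Proof.
move=> x0; rewrite -powRD; last by apply/implyP => _; rewrite gt_eqF.
by rewrite (_ : 2^-1 + 2^-1 = 1 :> R) ?powRr1 ?ltW //; field.
Qed.

Lemma powR_halfV (x : R) : 0 < x -> x `^ (- 2^-1) * x `^ 2^-1 = 1.
Proof.
move=> x0; rewrite -powRD; last by apply/implyP => _; rewrite gt_eqF.
by rewrite addNr powRr0.
Qed.

(** If windows fail to be crossed with probability at least [eps] at arbitrarily small heights, one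
    can choose J heights so far apart that the events [shut] have disjoint supports. Each has
    probability at least [a], so with high probability one of them occurs and confines the root. *)
Lemma confine_zero k (t : nat) eps : 0 < k -> (0 < t)%N -> 0 < eps ->
  (forall h, 0 < h -> exists2 eta, 0 < eta <= h & UF (fun m => exists D,
    [/\ k * m%:R <= eta * D%:R, eta * D%:R <= 2 * (k * m%:R) & eps <= ncross k eta t D m])) ->
  cc UF k 2^-1 = 0.
Proof.
move=> k0 t0 eps0 H; apply/eqP; rewrite eq_le (cc_ge0 UFu UFoo) andbT.
apply/ler_addgt0Pr => e e0; rewrite add0r.
have eps1 : eps <= 1.
  have [eta _ /(UF_ex UFu)[m [D [_ _ h]]]] := H 1 ltr01.
  by apply: le_trans h _; apply: Pr_le1; exact: prob_pm.
(* A bound for the spill of one scale: 4 k from its hyperbolic profile, 4 k (t + 4) from its width 2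
   dl at height eta with dl = 2 k (t + 4) / eta, and 1 for rounding. *)
pose C0 : R := 4 * k + 4 * k * (t + 4)%:R + 1.
have C00 : 0 < C0 by rewrite /C0; pstv.
pose a := eps * (eps * expR (- (2 * C0))).
have a0 : 0 < a by rewrite /a; pstv.
have a1 : a <= 1.
  have q : expR (- (2 * C0)) <= 1 by rewrite -[leRHS]expR0 ler_expR oppr_le0; nneg.
  rewrite /a -[leRHS]mulr1; apply: ler_pM => //; [exact: ltW|nneg|].
  by rewrite -[leRHS]mulr1; apply: ler_pM => //; exact: ltW.
have ra : 0 <= 1 - a < 1 by rewrite subr_ge0 a1 ltrBlDr ltrDl.
have e4 : 0 < e / 4 by rewrite divr_gt0.
have [J hJ] := expr_small ra e4.
have CJ : 0 <= C0 * J%:R by nneg.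
have half0 : 0 < 2^-1 :> R by rewrite invr_gt0.
have [rho0 /andP[rho00 _] hrho] := small_powR_le half0 CJ e4.
(* The ratio of consecutive heights is small enough for the supports to be disjoint ([sep]) and for
   the low spills of all J scales to be unlikely ([PB]). *)
pose rho := Num.min rho0 (1 / (16 * (t + 4)%:R)).
have rho_gt0 : 0 < rho by rewrite lt_min rho00 divr_gt0 // mulr_gt0 // ltr0n addn4.
have t4 : 4 <= (t + 4)%:R :> R by rewrite (ler_nat R 4) leq_addl.
have rho_t : 16 * rho * (t + 4)%:R <= 1.
  rewrite mulrAC -ler_pdivlMl; last by rewrite mulr_gt0 //; clear -t4; lra.
  by rewrite mulrC /rho ge_min lexx orbT.
have rho16 : rho <= 1 / 64.
  have : 16 * rho * 4 <= 1 by apply: le_trans rho_t; rewrite ler_pM2l // mulr_gt0.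
  by clear; lra.
have rho1 : 0 < rho < 1 by rewrite rho_gt0 /=; clear -rho16; lra.
have hr : C0 * J%:R * rho `^ 2^-1 <= e / 4 by apply: hrho; rewrite rho_gt0 ge_min lexx.
have e8 : 0 < Num.min (e / 8) 1 by rewrite lt_min ltr01 divr_gt0.
have [f [fe f0 fP fS fmono]] := scales rho1 e8 H.
have fe8 j : f j <= e / 8.
  by apply: le_trans (fmono 0%N j (leq0n _)) (le_trans fe _); rewrite ge_min lexx.
have f1 j : f j <= 1.
  by apply: le_trans (fmono 0%N j (leq0n _)) (le_trans fe _); rewrite ge_min lexx orbT.
pose dl j := 2 * k * (t + 4)%:R / f j.
have dl0 j : 0 < dl j.
  by rewrite /dl divr_gt0 // !mulr_gt0 // ltr0n addn4.
pose l := 1 + dl J + (f J)^-1.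
have l1 : 1 <= l by rewrite /l -addrA lerDl addr_ge0 ?invr_ge0 ?ltW.
have lp : 0 < l by apply: lt_le_trans l1.
have dll j : (j < J)%N -> dl j <= l.
  move=> jJ; apply: (@le_trans _ _ (dl J)).
    rewrite /dl ler_pM2l ?lef_pV2 ?posrE ?f0 //; last by rewrite !mulr_gt0 // ltr0n addn4.
    by apply: fmono; apply: ltnW.
  by rewrite /l addrAC lerDr addr_ge0 // invr_ge0 ltW.
have lf j : (j < J)%N -> l^-1 <= f j.
  move=> jJ; rewrite -[leRHS]invrK lef_pV2 ?posrE ?invr_gt0 ?f0 //.
  apply: (@le_trans _ _ (f J)^-1); first by rewrite lef_pV2 ?posrE ?f0 //; apply: fmono; apply: ltnW.
  by rewrite /l lerDr addr_ge0 // ltW.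
apply: cc_le; split; first exact: ltW.
exists l => //.
apply: UF_imp (UF_and UFu (UF_all (J := J) (fun j _ => fP j)) (UFoo 2)) => m [Hm m2].
have m0 : (0 < m)%N := ltnW m2.
have mp : 0 < m%:R :> R by rewrite ltr0n.
have /choice[D hD] : forall j, exists D, (j < J)%N ->
   [/\ k * m%:R <= f j * D%:R, f j * D%:R <= 2 * (k * m%:R) & eps <= ncross k (f j) t D m].
  by move=> j; case: (ltnP j J) => [/Hm[d hd]|_]; [exists d|exists 0%N].
apply: (@Dn_room _ _ _ _ (\sum_(j < J) (t + 4) * D j)) => n i hi1 hi2.
have room1 j : (j < J)%N -> ((t + 4) * D j <= i)%N.
  move=> jJ; apply: leq_trans hi1.
  by rewrite (bigD1 (Ordinal jJ)) //= leq_addr.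
have room2 j : (j < J)%N -> (i + (t + 4) * D j <= n)%N.
  move=> jJ; apply: leq_trans hi2; rewrite leq_add2l.
  by rewrite (bigD1 (Ordinal jJ)) //= leq_addr.
have hdl j : (j < J)%N -> (t + 4)%:R * (D j)%:R <= dl j * m%:R.
  move=> jJ; have [_ h _] := hD j jJ.
  rewrite /dl (_ : _ / _ * _ = (t + 4)%:R * (2 * (k * m%:R) / f j)); last by rewrite -!mulrA; ring.
  by rewrite ler_pM2l ?ltr0n ?addn4 // ler_pdivlMr // mulrC.
have rt0 : 0 <= rho `^ 2^-1 by apply: powR_ge0.
have rtt := powR_half rho_gt0.
have rt8 : rho `^ 2^-1 <= 1 / 8.
  rewrite leNgt; apply/negP => h8.
  have : 1 / 8 * (1 / 8) < rho `^ 2^-1 * rho `^ 2^-1 by apply: ltr_pM.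
  by rewrite rtt; clear -rho16; lra.
have rrt : rho <= rho `^ 2^-1.
  by rewrite -{1}rtt ler_piMl //; clear -rt8; lra.
have ratio j : f j `^ (- 2^-1) * f j.+1 `^ 2^-1 <= rho `^ 2^-1.
  apply: (@le_trans _ _ (f j `^ (- 2^-1) * (rho * f j) `^ 2^-1)).
    rewrite ler_wpM2l ?powR_ge0 //; apply: ge0_ler_powR; rewrite ?nnegrE ?(ltW half0) ?(ltW (f0 _)) //.
    by rewrite mulr_ge0 // ltW.
  by rewrite powRM ?(ltW (f0 _)) ?(ltW rho_gt0) // mulrCA powR_halfV // mulr1.
(* The support at scale j ends before the windows of scale j + 1 begin: those start one jump, that
   is at least k / f (j + 1), away from the root. *)
have sep j : dl j + k * f j `^ (- 2^-1) * f j.+1 `^ (- 2^-1) < k / f j.+1.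
  have q0 := f0 j.+1; have p0 := f0 j.
  have e1 : k * f j `^ (- 2^-1) * f j.+1 `^ (- 2^-1) = k / f j.+1 * (f j `^ (- 2^-1) * f j.+1 `^ 2^-1).
    rewrite -{2}(powR_half q0) invfM; set y := f j.+1 `^ 2^-1.
    have y0 : 0 < y by apply: powR_gt0.
    have -> : f j.+1 `^ (- 2^-1) = y^-1 by rewrite powRN.
    by field; rewrite gt_eqF.
  have kq : 0 < k / f j.+1 by rewrite divr_gt0.
  have b1 : k * f j `^ (- 2^-1) * f j.+1 `^ (- 2^-1) <= k / f j.+1 * (1 / 8).
    by rewrite e1 ler_pM2l //; apply: le_trans (ratio j) rt8.
  have b2 : dl j <= k / f j.+1 * (1 / 8).
    rewrite /dl ler_pdivrMr // (_ : k / f j.+1 * (1 / 8) * f j = k * (f j / f j.+1 / 8)); last by field; rewrite gt_eqF.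
    rewrite (_ : 2 * k * (t + 4)%:R = k * (2 * (t + 4)%:R)); last by ring.
    rewrite ler_pM2l // ler_pdivlMr // ler_pdivlMr //.
    have r1 : 16 * (t + 4)%:R * f j.+1 <= 16 * (t + 4)%:R * (rho * f j).
    by rewrite ler_wpM2l //; nneg.
    have r2 : 16 * rho * (t + 4)%:R * f j <= 1 * f j by rewrite ler_wpM2r // ltW.
    have e2 : 2 * (t + 4)%:R * 8 * f j.+1 = 16 * (t + 4)%:R * f j.+1 by ring.
    rewrite e2; apply: le_trans r1 _; rewrite mul1r in r2; apply: le_trans r2.
    by rewrite le_eqVlt; apply/orP; left; apply/eqP; ring.
  clear -b1 b2 kq; lra.
have H1 (jj : 'I_m) : Dr (kT k 2^-1) l (i, jj) <= ((jj.+1%:R / m%:R < e / 4 :> R)%:R : R) + (e / 4 + e / 4).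
  set v := (i, jj); case: ltP => hj /=.
    by apply: le_trans (Dr_le1 _ _ _) _; rewrite lerDl addr_ge0 // ltW.
  rewrite add0r.
  have hv j : f j < gU R v.
    by apply: lt_le_trans hj; apply: le_lt_trans (fe8 j) _; clear -e0; lra.
  pose p := @pm R m ('I_n * 'I_m)%type; have hp : prob p by exact: prob_pm.
  pose rest j := [set x in spill k (f j) (dl j) v | gU R x <= f j.+1].
  (* [shut] takes proofs depending on j < J as arguments; supports and events are packed by choice
     into functions of every j, with a dummy value from J on. *)
  have /choice[SA hSA] : forall j, exists SA : {set 'I_n * 'I_m} * ({set 'I_n * 'I_m} -> bool),
    dep SA.1 SA.2 /\ ((j < J)%N -> [/\ SA.1 = shut_sup k (f j) (dl j) t (D j) v (f j.+1), a <= Pr p SA.2 &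
    forall w, SA.2 w -> vac (rest j) w -> ~~ reach (adj (kT k 2^-1)) (v |: w) v (Out l v)]).
    move=> j; case: (ltnP j J) => jJ; last by exists (set0, fun=> false).
    have [h1 h2 h3] := hD j jJ.
    pose A := @shut k (f j) (dl j) t (D j) n m v (f j.+1) k0 m0 h1 (room1 j jJ) (room2 j jJ).
    exists (shut_sup k (f j) (dl j) t (D j) v (f j.+1), A); split.
    by apply: shut_dep => //; exact: hdl.
    move=> _; split=> //; last first.
    by move=> w; apply: shut_confined => //; [exact: hdl | exact: dll | exact: lf].
    have vQ : expR (- (2 * C0)) <= Pr p (vac [set x in spill k (f j) (dl j) v | f j.+1 < gU R x]).
    apply: le_trans (vac_ge R _ m2); rewrite ler_expR lerN2 ler_pM2l //.
    have u1 : 0 < f j <= f j by rewrite f0 lexx.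
    apply: le_trans (spill_mass (v := v) k0 (f0 j) u1 (ltW (dl0 j)) m0 _) _.
    by move=> x; rewrite inE => /andP[h _]; split=> //; move: h; rewrite inE => /andP[].
    rewrite powR_halfV // mulr1 /C0 -addrA lerD2l mulrDl mul1r; apply: lerD; last exact: f1.
    by rewrite /dl mulrA divfK ?gt_eqF // le_eqVlt; apply/orP; left; apply/eqP; ring.
    have Y := shut_pr (v := v) k0 m0 h1 (room1 j jJ) (room2 j jJ) vQ (expR_ge0 _).
    apply: le_trans Y.
    rewrite /a; apply: ler_pM => //; [exact: ltW|nneg|].
    by apply: ler_wpM2r => //; exact: expR_ge0.
  have PA : Pr p (fun w => all (fun j => ~~ (SA j).2 w) (iota 0 J)) <= (1 - a) ^+ J.
    apply: (@Pr_all R _ p (fun j => (SA j).1) (fun j w => ~~ (SA j).2 w) (1 - a) J hp).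
    - by case/andP: ra.
    - by move=> j w; have [h _] := hSA j; rewrite h.
    - move=> i1 j1 /andP[ij jJ]; have [_ /(_ jJ)[-> _ _]] := hSA j1.
    have [_ /(_ (ltn_trans ij jJ))[-> _ _]] := hSA i1.
    apply: disjoint_notin => x hx.
    have b1 : `|gX R x - gX R v| <= dl i1 + k * f i1 `^ (- 2^-1) * f i1.+1 `^ (- 2^-1) /\ f i1.+1 < gU R x.
    move: hx; rewrite in_set => /orP[/andP[g1 /andP[_ g2]]|/andP[]].
    split; last by apply: le_lt_trans (fmono _ _ (leqnSn i1)) _; move: g1; rewrite /high -ltNge.
    have : `|gX R x - gX R v| <= dl i1.
    by rewrite -(ler_pM2r mp); apply: le_trans g2 _; apply: hdl; apply: ltn_trans jJ.
    by move/le_trans; apply; rewrite lerDl; nneg.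
    rewrite in_set => /andP[_ g1] g2; split=> //; apply: le_trans g1 _.
    by rewrite lerD2l ler_wpM2l ?powR_anti //; nneg.
    case: b1 => b1 b2; apply/negP; rewrite in_set => /orP[/andP[_ /andP[g1 _]]|/andP[g1 _]].
    have [h1 _ _] := hD j1 jJ.
    have : k / f i1.+1 <= `|gX R x - gX R v|.
    rewrite -(ler_pM2r mp); apply: le_trans g1; rewrite mulrAC ler_pdivrMr ?f0 //.
    apply: le_trans h1 _; rewrite mulrC ler_wpM2l ?ler0n //; exact: fmono.
    by rewrite leNgt (le_lt_trans b1) // sep.
    move: g1; rewrite in_set => /andP[g1 _].
    by move: b2; rewrite ltNge (le_trans g1) // fmono.
    - move=> j jJ; rewrite PrC lerD2l lerN2; by have [_ /(_ jJ)[]] := hSA j.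
  have PB : Pr p (fun w => [exists j : 'I_J, ~~ vac (rest j) w]) <= e / 4.
    apply: le_trans (Pr_ex _ hp) _; apply: le_trans hr; rewrite mulrAC.
    apply: (@le_trans _ _ (\sum_(j < J) C0 * rho `^ 2^-1)); last by rewrite big_const_ord iter_addr_0 mulr_natr.
    apply: ler_sum => j _; apply: le_trans (hit_le R m _) _.
    have u1 : 0 < f j.+1 <= f j by rewrite f0 fmono.
    apply: le_trans (spill_mass (v := v) k0 (f0 j) u1 (ltW (dl0 j)) m0 _) _.
    by move=> x; rewrite in_set => /andP[].
    have q1 : (2 * dl j + 1) * f j.+1 <= (4 * k * (t + 4)%:R + 1) * rho.
    rewrite mulrDl mul1r [leRHS]mulrDl mul1r; apply: lerD; last first.
    by apply: le_trans (fS j) _; rewrite ler_piMr // ltW.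
    rewrite /dl (_ : 2 * (_ / _) * _ = 4 * k * (t + 4)%:R * (f j.+1 / f j)); last by ring.
    by rewrite ler_wpM2l ?ler_pdivrMr //; nneg.
    have q2 : (4 * k * (t + 4)%:R + 1) * rho <= (4 * k * (t + 4)%:R + 1) * rho `^ 2^-1.
    by rewrite ler_wpM2l //; nneg.
    have q3 : 4 * k * (f j `^ (- 2^-1) * f j.+1 `^ 2^-1) <= 4 * k * rho `^ 2^-1.
    by rewrite ler_wpM2l //; nneg.
    apply: le_trans (lerD q3 (le_trans q1 q2)) _; rewrite -mulrDl /C0 addrA //.
  have HS : Dr (kT k 2^-1) l v <= Pr p (fun w => all (fun j => ~~ (SA j).2 w) (iota 0 J)) +
    Pr p (fun w => [exists j : 'I_J, ~~ vac (rest j) w]).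
    apply: Pr_le_or => // w hrch; case: (boolP (all _ _)) => //=; rewrite -has_predC => /hasP[j].
    rewrite mem_iota add0n => /= jJ /negPn Aj; apply/existsP; exists (Ordinal jJ).
    apply/negP => vj; have [_ /(_ jJ)[_ _ h]] := hSA j.
    by move: (h w Aj vj); rewrite hrch.
  apply: le_trans HS (lerD (le_trans PA hJ) PB).
apply: le_trans (_ : (\sum_(jj < m) (((jj.+1%:R / m%:R < e / 4 :> R)%:R : R) + (e / 4 + e / 4))) / m%:R <= _).
  by rewrite ler_pM2r ?invr_gt0 //; apply: ler_sum.
rewrite avg_addc //; have := rows_below m0 (ltW e4); clear -e0; lra.
Qed.

(** The contrapositive of [confine_zero]; maximality of the filter turns the failure of the
    conclusion into the hypothesis there. *)
Theorem crossing k (t : nat) eps : 0 < k -> (0 < t)%N -> 0 < eps -> 0 < cc UF k 2^-1 ->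
  exists2 h, 0 < h & forall eta, 0 < eta <= h ->
   UF (fun m => forall D, k * m%:R <= eta * D%:R -> eta * D%:R <= 2 * (k * m%:R) ->
    ncross k eta t D m < eps).
Proof.
move=> k0 t0 eps0 c0; apply: contrapT => H.
have : cc UF k 2^-1 = 0.
  apply: (confine_zero k0 t0 eps0) => h h0; apply: contrapT => H1; apply: H; exists h => // eta he.
  apply: contrapT => H2; apply: H1; exists eta => //.
  apply: UF_imp (UF_not UFu H2) => m H3; apply: contrapT => H4; apply: H3 => D h1 h2.
  by rewrite ltNge; apply/negP => h3; apply: H4; exists D.
by move=> e0; rewrite e0 ltxx in c0.
Qed.

End Crossing.

(** * Vanishing at b = 1/2 for small k *)

Section SmallK.
Import Fin.
Variable R : realType.
Implicit Types (l L k b q h d e eta : R).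

Lemma PrN (V : finType) (p : V -> R) A : Pr p A = 1 - Pr p (fun w => ~~ A w).
Proof. by rewrite PrC opprB addrC subrK. Qed.

(* Crossing a window at height [eta / 4] requires a point between the two heights or
   crossings of two disjoint windows at height [eta]. *)
Lemma ncross_step k eta (D m : nat) : 0 < k -> 0 < eta <= 1 -> (0 < m)%N -> k * m%:R <= eta * D%:R ->
  eta * D%:R <= 2 * (k * m%:R) ->
  1 - ncross k (eta / 4) 3 (4 * D) m <= (1 - ncross k eta 3 D m) ^+ 2 + (40 * k + m%:R^-1).
Proof.
move=> k0 /andP[e0 e1] m0 hD hD2.
have mp : 0 < m%:R :> R by rewrite ltr0n.
have e40 : 0 < eta / 4 by rewrite divr_gt0.
set n := ((3 + 2) * (4 * D)).+1; pose n' := ((3 + 2) * D).+1.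
pose p := @pm R m ('I_n * 'I_m)%type; have hp : prob p by exact: prob_pm.
have D0 : (0 < D)%N.
  rewrite lt0n; apply/negP => /eqP D0; move: hD; rewrite D0 mulr0; apply/negP; rewrite -ltNge.
  by rewrite mulr_gt0.
(* Two disjoint windows of 5 D + 1 columns, both between the buffer of 4 D columns and column 16 D
   of the large window. *)
have hs1 : (4 * D + n' <= n)%N by rewrite /n /n'; clear; lia.
have hs2 : (10 * D + n' <= n)%N by rewrite /n /n'; move: D0; clear; lia.
pose B := [set x : 'I_n * 'I_m | gU R x <= eta].
pose c1 (w : {set 'I_n * 'I_m}) := cross (adj (kT k 2^-1)) eta D (4 * D) (emb hs1 @^-1: w).
pose c2 (w : {set 'I_n * 'I_m}) := cross (adj (kT k 2^-1)) eta D (4 * D) (emb hs2 @^-1: w).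
have cr s (hs : (s + n' <= n)%N) : 1 - ncross k eta 3 D m =
    Pr p (fun w => cross (adj (kT k 2^-1)) eta D (4 * D) (emb hs @^-1: w)).
  rewrite [RHS]PrN; congr (1 - _).
  by rewrite (@Pr_preim R _ _ (emb hs) (@shift_inj _ _ _ _ hs) p
    (fun u => ~~ cross (adj (kT k 2^-1)) eta D (4 * D) u)).
have -> : 1 - ncross k (eta / 4) 3 (4 * D) m = Pr p (fun w => cross (adj (kT k 2^-1)) (eta / 4) (4 * D) (4 * (4 * D)) w).
  by rewrite [RHS]PrN.
have mB : mass R m B <= 40 * k + m%:R^-1.
  have hw : 0 <= (20 * D)%:R / m%:R :> R by rewrite divr_ge0 ?ler0n.
  have h0 : 0 <= 10 * D%:R / m%:R :> R by rewrite divr_ge0 ?mulr_ge0 ?ler0n.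
  apply: le_trans (@mass_low R n m (10 * D%:R / m%:R) (10 * D%:R / m%:R) eta B m0 h0 (ltW e0) _) _.
    move=> x; rewrite inE => ->; split=> //; rewrite ler_norml /gX.
    rewrite lerBrDl addrN divr_ge0 ?ler0n //= lerBlDl -mulrDl ler_pM2r ?invr_gt0 //.
    have : (x.1 <= 20 * D)%N by have := ltn_ord x.1; rewrite ltnS /n; clear; lia.
    rewrite -(ler_nat R) natrM; clear; lra.
  rewrite mulrDl; apply: lerD; last by rewrite ler_piMr // invr_ge0 ltW.
  rewrite (_ : 2 * (10 * D%:R / m%:R) * eta = 20 * (eta * D%:R) / m%:R); last by ring.
  by rewrite ler_pdivrMr //; move: hD2; clear; lra.
have : Pr p (fun w => cross (adj (kT k 2^-1)) (eta / 4) (4 * D) (4 * (4 * D)) w) <=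
   Pr p (fun w => c1 w && c2 w) + Pr p (fun w => ~~ vac B w).
  apply: Pr_le_or => // w; case: (boolP (vac B w)) => [vB|]; rewrite ?orbT // orbF.
  case/existsP => a /existsP[b' /and3P[ha hb]].
  have -> : above (eta / 4) w = above eta w.
    apply/setP => x; rewrite !inE /high; case xw: (x \in w) => //=.
    have xe : eta < gU R x.
    by rewrite ltNge; apply/negP => hx; move/eqP/setP/(_ x): vB; rewrite !inE xw hx.
    by rewrite -!ltNge xe (lt_trans _ xe) // ltr_pdivrMr // ltr_pMr // ltr1n.
  move=> c; rewrite /c1 /c2.
  have DE : (D < 4 * D)%N by move: D0; clear; lia.
  have En : (4 * D + D < n')%N by rewrite /n'; clear; lia.
  apply/andP; split; apply: (cross_window _ k0 e0 hD DE En c).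
  - by apply: leq_trans ha _; rewrite leq_addr.
  - by apply: leq_trans hb; clear; lia.
  - by apply: leq_trans ha _; clear; lia.
  - by apply: leq_trans hb; clear; lia.
move/le_trans; apply; apply: lerD; last by apply: le_trans (hit_le R m B) mB.
rewrite (@PrI _ _ _ _ _ (@strip_win R eta n m (4 * D) n') (@strip_win R eta n m (10 * D) n')).
- by rewrite expr2 {1}(cr _ hs1) (cr _ hs2).
- apply: disjoint_notin => x; rewrite !inE => /andP[/andP[_ h1] _]; rewrite negb_and negb_and -ltnNge.
  by apply/orP; left; apply/orP; left; apply: leq_trans h1 _; rewrite /n'; move: D0; clear; lia.
- exact: cross_dep.
- exact: cross_dep.
Qed.

Lemma ncross_top k (t D m : nat) : (0 < t)%N -> (0 < D)%N -> ncross k 1 t D m = 1.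
Proof.
move=> t0 D0; rewrite /ncross; have hp : prob (@pm R m ('I_((t + 2) * D).+1 * 'I_m)%type) by exact: prob_pm.
rewrite -[RHS](@Ex_cst R _ (@pm R m ('I_((t + 2) * D).+1 * 'I_m)%type)); apply: eq_Ex => w.
suff -> : cross (adj (kT k 2^-1)) (1 : R) D (t.+1 * D) w = false by [].
apply/negbTE; apply/negP; case/existsP => a /existsP[b' /and3P[h1 h2 c]].
have ab : a != b'.
  apply: contraTneq h2 => <-; rewrite -ltnNge; apply: leq_ltn_trans h1 _.
  by rewrite -{1}(mul1n D) ltn_pmul2r.
case/andP: (conn_in c ab); rewrite !inE /high gU_le1 andbF //.
Qed.

Variable UF : set_system nat.
Hypotheses (UFu : UltraFilter UF) (UFoo : tails UF).

(** The recursion p' <= p^2 + 40 k + 1/m of [ncross_step] preserves p <= 1/2 because 40 k + 1/m <=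
    1/4. It starts from p = 0, no site having height above 1. *)
Lemma cc_small k : 0 < k -> k <= 1 / 200 -> cc UF k 2^-1 = 0.
Proof.
move=> k0 k1; apply: (@confine_zero R UF UFu UFoo k 3 (1 / 2)) => // h h0.
have [i hi] := pow4_large h^-1; exists (4 ^- i).
  rewrite invr_gt0 exprn_gt0 //= -[leRHS]invrK lef_pV2 ?posrE ?invr_gt0 ?exprn_gt0 //.
apply: UF_imp (UF_and UFu (UF_real UFu UFoo (20 / k)) (UFoo 1)) => m [hm m0].
have mp : 0 < m%:R :> R by rewrite ltr0n.
have km : 20 <= k * m%:R by rewrite mulrC -ler_pdivrMr.
have mi : m%:R^-1 <= k / 20.
  by rewrite -[leRHS]invrK lef_pV2 ?posrE ?invr_gt0 ?divr_gt0 // invf_div.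
pose D0 := (Num.truncn (k * m%:R)).+1.
have [d1 d2] : k * m%:R <= D0%:R /\ D0%:R <= 2 * (k * m%:R).
  have km0 : 0 <= k * m%:R by nneg.
  have /andP[t1 t2] := truncn_itv km0; split; first exact: ltW.
  by rewrite /D0 -natr1; clear -t1 km; lra.
have D00 : (0 < D0)%N by [].
have sc j : k * m%:R <= 4 ^- j * (4 ^ j * D0)%:R /\ 4 ^- j * (4 ^ j * D0)%:R <= 2 * (k * m%:R).
  by rewrite natrM natrX mulKf // expf_neq0.
have main j : 1 - ncross k (4 ^- j) 3 (4 ^ j * D0) m <= 1 / 2.
  elim: j => [|j IH]; first by rewrite expr0 invr1 ncross_top ?expn0 ?mul1n // subrr.
  have [s1 s2] := sc j.
  have e1 : 0 < (4 ^- j : R) <= 1 by rewrite invr_gt0 exprn_gt0 //= invf_le1 ?exprn_gt0 // exprn_ege1 // ler1n.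
  have := ncross_step k0 e1 m0 s1 s2.
  have -> : (4 ^- j.+1 : R) = 4 ^- j / 4 by rewrite exprSr invfM mulrC.
  rewrite expnS -mulnA; move/le_trans; apply.
  have q0 : 0 <= 1 - ncross k (4 ^- j) 3 (4 ^ j * D0) m by rewrite subr_ge0 Pr_le1 //; exact: prob_pm.
  have : (1 - ncross k (4 ^- j) 3 (4 ^ j * D0) m) ^+ 2 <= (1 / 2) ^+ 2 by rewrite lerXn2r ?nnegrE.
  have -> : (1 / 2 : R) ^+ 2 = 1 / 4 by field.
  clear -mi k1 k0; lra.
exists (4 ^ i * D0)%N; have [s1 s2] := sc i; split=> //.
have := main i; clear; lra.
Qed.

End SmallK.

(** * Block recursion for large k *)

Section Blocks.
Import mathcomp.boot.seq mathcomp.boot.fintype mathcomp.boot.finset.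
Variable R : realType.
Variables (k : R) (n m D : nat).
Hypotheses (k0 : 0 < k) (m0 : (0 < m)%N) (D0 : (0 < D)%N).
Hypothesis hD : 8 * D%:R <= k * m%:R.
Notation V := ('I_n * 'I_m)%type.
Let e : rel V := adj (kT k 2^-1).
Let hgt (i : nat) : R := 8 ^- i / 2.
Let mp : 0 < m%:R :> R. Proof. by rewrite ltr0n. Qed.

(* Level [i] blocks have [D * 8 ^ i] columns; the bridge rows of level [i] are those with
   heights in [(hgt i.+1, hgt i]], and the vertices of level [i] clusters have heights above [hgt i]. *)
Definition blk (i z : nat) : {set V} := [set x : V | (z * (D * 8 ^ i) <= x.1 < z.+1 * (D * 8 ^ i))%N].
Definition top_cell (z : nat) : {set V} := [set x in blk 0 z | (2^-1 : R) < gU R x].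
Definition bridge (i z : nat) : {set V} := [set x in blk i z | hgt i.+1 < gU R x <= hgt i].
(** The 8 blocks composing block z of the next level and 4 more on either side: neighbouring blocks
    share 8 children, through which their clusters meet. The truncated subtraction is exact for z >
    0. *)
Definition kids (z : nat) : seq nat := iota (8 * z - 4) 16.

(** Bridges are demanded only when some child is bad. A bad block thus has two distant bad children,
    or a bad child and an empty bridge, and either case carries the factor of a bad child. Demanding
    bridges always would leave a cost that does not shrink with the level. *)
Fixpoint good (i z : nat) (w : {set V}) : bool :=
  if i is i'.+1 then
    all (fun c => good i' c w) (kids z) ||
    (all (fun c => all (fun c' => (c + 3 <= c')%N ==> (good i' c w || good i' c' w)) (kids z)) (kids z) &&
    all (fun c => ~~ vac (bridge i' c) w) (kids z))
  else [&& ~~ vac (top_cell z.-1) w, ~~ vac (top_cell z) w & ~~ vac (top_cell z.+1) w].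

Variable v0 : V.
(** A vertex of the cluster of a good block, inherited from its first good child; [v0] and [0] are
    default values. *)
Fixpoint repr (i z : nat) (w : {set V}) : V :=
  if i is i'.+1 then repr i' (nth 0%N (kids z) (find (fun c => good i' c w) (kids z))) w
  else odflt v0 [pick x in w :&: top_cell z].

Lemma goodS i z w : good i.+1 z w = all (fun c => good i c w) (kids z) ||
    (all (fun c => all (fun c' => (c + 3 <= c')%N ==> (good i c w || good i c' w)) (kids z)) (kids z) &&
    all (fun c => ~~ vac (bridge i c) w) (kids z)).
Proof. by []. Qed.

Let W i (w : {set V}) : {set V} := above (hgt i) w.
Let conn i (w : {set V}) := connect (gr e (W i w)).

Lemma hgt_gt0 i : 0 < hgt i. Proof. by rewrite /hgt divr_gt0 // invr_gt0 exprn_gt0. Qed.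
Lemma hgtS i : hgt i.+1 = hgt i / 8.
Proof. by rewrite /hgt exprSr invfM mulrAC. Qed.

Lemma e_sym : symmetric e. Proof. by apply/adj_sym/thr_kT; rewrite ?ltW. Qed.

Lemma conn_sym i w x y : conn i w x y = conn i w y x.
Proof. exact: (sym_connect_sym (gr_sym _ e_sym)). Qed.

Lemma connS i w x y : conn i w x y -> conn i.+1 w x y.
Proof.
apply: conn_mono => //; apply/subsetP => z; rewrite !inE => /andP[-> /=]; apply: contra.
by move/le_trans; apply; rewrite hgtS ler_pdivrMr // ler_peMr ?ler1n // ltW // hgt_gt0.
Qed.

Lemma near_adj (h : R) (N : nat) x y : 0 < h -> N%:R * h <= k * m%:R -> gU R x <= h -> gU R y <= h ->
  (x.1 <= y.1 + N)%N -> (y.1 <= x.1 + N)%N -> e x y.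
Proof.
move=> h0 hN hx hy h1 h2; rewrite /e /adj.
apply: (@le_trans _ _ (k / h)).
  rewrite /gX -mulrBl normrM [`|m%:R^-1|]ger0_norm ?invr_ge0 ?ler0n // ler_pdivrMr //.
  apply: (@le_trans _ _ N%:R).
    by rewrite ler_norml lerBlDl lerNl opprB lerBlDl -!natrD !ler_nat h1 h2.
  by rewrite mulrAC ler_pdivlMr.
rewrite /kT ler_pM2l // (_ : h^-1 = (h * h) `^ (- 2^-1)); last first.
  by rewrite -expr2 -powR_mulrn ?(ltW h0) // -powRrM ?mulrN divff ?pnatr_eq0 // powR_inv1 ?ltW.
apply: powR_anti; [by rewrite invr_ge0|by rewrite mulr_gt0 ?gU_gt0|].
by apply: ler_pM => //; rewrite ltW // gU_gt0.
Qed.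

Lemma kidsP z c : (0 < z)%N -> (c \in kids z) = (8 * z - 4 <= c < 8 * z + 12)%N.
Proof. by move=> z0; rewrite mem_iota (_ : 8 * z - 4 + 16 = 8 * z + 12)%N //; lia. Qed.

Lemma kids_gt0 z c : (0 < z)%N -> c \in kids z -> (0 < c)%N.
Proof. by move=> z0; rewrite kidsP // => /andP[h _]; lia. Qed.

Definition spans i z w x :=
  exists a b : V, [/\ conn i w x a, conn i w x b, (a.1 <= z * (D * 8 ^ i))%N & (z.+1 * (D * 8 ^ i) <= b.1)%N].

Definition sound i w := forall z, (0 < z)%N -> good i z w ->
  [/\ repr i z w \in W i w, spans i z w (repr i z w) &
    good i z.+1 w -> conn i w (repr i z w) (repr i z.+1 w)].

Lemma repr0 z w : ~~ vac (top_cell z) w -> repr 0 z w \in w :&: top_cell z.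
Proof.
move=> hv /=; case: pickP => [x //|h0]; case/negP: hv; apply/eqP/setP => x.
by have := h0 x; rewrite /= => ->; rewrite inE.
Qed.

Lemma top_adj z z' x y : (z <= z'.+1)%N -> (z' <= z.+1)%N -> x \in top_cell z -> y \in top_cell z' -> e x y.
Proof.
move=> h1 h2; rewrite !inE expn0 muln1 => /andP[/andP[x1 x2] _] /andP[/andP[y1 y2] _].
have aux (a b c d : nat) : (a <= b.+1 -> c < a.+1 * D -> b * D <= d -> c <= d + 8 * D)%N.
  move=> q1 q2 q3; have : (a.+1 * D <= b.+2 * D)%N by rewrite leq_mul2r ltnS q1 orbT.
  rewrite !mulSn => q4; move: q2; rewrite mulSn; lia.
apply: (near_adj (h := 1) (N := 8 * D)) => //; rewrite ?gU_le1 //; last 2 first.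
- exact: aux h1 x2 y1.
- exact: aux h2 y2 x1.
by rewrite mulr1 natrM.
Qed.

Lemma top_in z w x : x \in w :&: top_cell z -> x \in W 0 w.
Proof.
rewrite !inE => /andP[-> /andP[_ h]]; rewrite /high /hgt expr0 invr1 div1r -ltNge //.
Qed.

Lemma sound0 w : sound 0 w.
Proof.
move=> z z0 /and3P[g1 g2 g3].
have r1 := repr0 g1; have r2 := repr0 g2; have r3 := repr0 g3.
have c12 : conn 0 w (repr 0 z w) (repr 0 z.-1 w).
  apply: connect1; rewrite /gr (top_in r1) (top_in r2) /=; apply: (top_adj (z := z) (z' := z.-1)).
  - by rewrite prednK.
  - by apply: leq_trans (leq_pred _) _.
  - by case/setIP: r2.
  - by case/setIP: r1.
have c23 : conn 0 w (repr 0 z w) (repr 0 z.+1 w).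
  apply: connect1; rewrite /gr (top_in r3) (top_in r2) /=; apply: (top_adj (z := z) (z' := z.+1)) => //.
  - by apply: leq_trans (leqnSn _) _.
  - by case/setIP: r2.
  - by case/setIP: r3.
split=> //; first exact: top_in r2.
exists (repr 0 z.-1 w), (repr 0 z.+1 w); split=> //.
  by case/setIP: r1 => _; rewrite !inE => /andP[/andP[_ h] _]; rewrite prednK // in h; apply: ltnW.
by case/setIP: r3 => _; rewrite !inE => /andP[/andP[h _] _].
Qed.

Lemma good_far i z w c c' : good i.+1 z w -> c \in kids z -> c' \in kids z -> (c + 3 <= c')%N ->
  good i c w || good i c' w.
Proof.
rewrite goodS => /orP[/allP h|/andP[/allP h _]] hc hc' cc; first by rewrite h.
by move/allP: (h c hc) => /(_ c' hc') /implyP /(_ cc).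
Qed.

Lemma conn_W i w x y : x \in W i w -> conn i w x y -> y \in W i w.
Proof.
move=> hx c; have [<- //|ne] := eqVneq x y.
by case/andP: (conn_in c ne).
Qed.

(** If all children are good, consecutive ones are joined by soundness. Otherwise the cluster of a
    good child spans its block and so covers the bridge vertex there, and bridge vertices of the 16
    children are mutually adjacent. *)
Lemma kids_conn i w z c c' : sound i w -> (0 < z)%N -> good i.+1 z w -> c \in kids z -> c' \in kids z ->
  good i c w -> good i c' w -> conn i.+1 w (repr i c w) (repr i c' w).
Proof.
move=> sd z0; rewrite goodS => /orP[/allP hall|/andP[_ /allP hbr]] hc hc' gc gc'.
  wlog lecc : c c' hc hc' gc gc' / (c <= c')%N.
    move=> H; case/orP: (leq_total c c') => h; first exact: H.
    by rewrite conn_sym; apply: H.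
  have : forall d, (c + d <= c')%N -> conn i.+1 w (repr i c w) (repr i (c + d) w).
    elim=> [|d IH] hd; first by rewrite addn0; exact: connect0.
    rewrite addnS in hd *; apply: connect_trans (IH (ltnW hd)) _; apply: connS.
    have k1 : (c + d)%N \in kids z.
    by move: hc hc' hd; rewrite !kidsP //; clear; lia.
    have k2 : (c + d).+1 \in kids z.
    by move: hc hc' hd; rewrite !kidsP //; clear; lia.
    have [_ _ h] := sd (c + d)%N (kids_gt0 z0 k1) (hall _ k1).
    exact: h (hall _ k2).
  by move/(_ (c' - c)%N); rewrite subnKC // => /(_ (leqnn _)).
have br x : x \in kids z -> good i x w -> exists s : V, [/\ s \in w :&: bridge i x, s \in W i.+1 w &
    conn i.+1 w (repr i x w) s].
  move=> hx gx; case/set0Pn: (hbr x hx) => s hs.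
  have [hr [a [b [ca cb ha hb]]] _] := sd x (kids_gt0 z0 hx) gx.
  have sW : s \in W i.+1 w.
    by move: hs; rewrite !inE => /and3P[-> _ /andP[h _]]; rewrite /high -ltNge.
  exists s; split=> //.
  have cab : connect (gr (adj (kT k 2^-1)) (W i w)) a b.
    by apply: connect_trans cb; rewrite -/(conn i w a _) conn_sym.
  have aW := conn_W hr ca.
  have su : gU R s <= hgt i by move: hs; rewrite !inE => /and3P[_ _ /andP[_ h]].
  have sx : gX R a <= gX R s <= gX R b \/ gX R b <= gX R s <= gX R a.
    left; move: hs; rewrite !inE => /and3P[_ /andP[h1 h2] _].
    rewrite /gX !ler_pM2r ?invr_gt0 // !ler_nat (leq_trans ha h1) /=.
    exact: leq_trans (ltnW h2) hb.
  have hU y : y \in a |: W i w -> gU R s <= gU R y.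
    move=> hy; apply: le_trans su _; apply: ltW; rewrite ltNge.
    have : y \in W i w by move: hy; rewrite in_setU1 => /orP[/eqP ->|].
    by rewrite inE => /andP[_].
  have T1 : thr (kT k 2^-1) by apply: thr_kT; rewrite ?ltW.
  have [q cq aq] := adj_cover T1 cab hU sx.
  apply: (@connect_trans _ _ a); first exact: connS ca.
  apply: (@connect_trans _ _ q); first exact: connS cq.
  apply: connect1; rewrite /gr sW; apply/and3P; split=> //.
  have qW : q \in W i w := conn_W aW cq.
  move: qW; rewrite !inE => /andP[-> /=]; apply: contra.
  by move/le_trans; apply; rewrite hgtS ler_pdivrMr // ler_peMr ?ler1n // ltW // hgt_gt0.
have [s [s1 s2 s3]] := br c hc gc; have [s' [s1' s2' s3']] := br c' hc' gc'.
apply: connect_trans s3 _; rewrite -/(conn i.+1 w s _) conn_sym; apply: connect_trans s3' _.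
apply: connect1; rewrite /gr s2 s2' /=.
move: s1 s1'; rewrite !inE => /and3P[_ /andP[q1 q2] /andP[_ q3]] /and3P[_ /andP[q1' q2'] /andP[_ q3']].
have aux (a b x y : nat) : (a < b + 16 -> x < a.+1 * (D * 8 ^ i) -> b * (D * 8 ^ i) <= y -> x <= y + 16 * (D * 8 ^ i))%N.
  move=> r1 r2 r3; have : (a.+1 * (D * 8 ^ i) <= (b + 16) * (D * 8 ^ i))%N by rewrite leq_mul2r r1 orbT.
  rewrite mulnDl; move: r2 r3; clear; lia.
apply: (near_adj (h := hgt i) (N := 16 * (D * 8 ^ i))) => //; first exact: hgt_gt0.
- rewrite !natrM natrX /hgt.
  rewrite (_ : 16 * (D%:R * 8 ^+ i) * (8 ^- i / 2) = 8 * D%:R) //.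
  by field; rewrite expf_neq0.
- by apply: (aux c' c) q2' q1; move: hc hc'; rewrite !kidsP //; clear; lia.
- by apply: (aux c c') q2 q1'; move: hc hc'; rewrite !kidsP //; clear; lia.
Qed.

Lemma kid_ex i w z : (0 < z)%N -> good i.+1 z w ->
  exists2 c, (c \in kids z) && good i c w & repr i.+1 z w = repr i c w.
Proof.
move=> z0 g; have hs : has (fun c => good i c w) (kids z).
  have k1 : (8 * z)%N \in kids z by rewrite kidsP //; lia.
  have k2 : (8 * z + 3)%N \in kids z by rewrite kidsP //; lia.
  by case/orP: (good_far g k1 k2 (leqnn _)) => h; apply/hasP; [exists (8 * z)%N|exists (8 * z + 3)%N].
exists (nth 0%N (kids z) (find (fun c => good i c w) (kids z))) => //.
rewrite (nth_find 0%N hs) andbT; apply: mem_nth; by rewrite -has_find.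
Qed.

Lemma kid_conn i w z c : sound i w -> (0 < z)%N -> good i.+1 z w -> c \in kids z -> good i c w ->
  conn i.+1 w (repr i.+1 z w) (repr i c w).
Proof.
move=> sd z0 g hc gc; have [c0 /andP[k1 g1] ->] := kid_ex z0 g.
exact: (kids_conn sd z0 g k1 hc g1 gc).
Qed.

(** Of two children at distance 3 one is good. A pair beyond each end gives the span of the block,
    and a pair among the shared children joins it to its right neighbour. *)
Lemma soundP i w : sound i w.
Proof.
elim: i => [|i sd]; first exact: sound0.
move=> z z0 g; have [c0 /andP[k0' g0] er] := kid_ex z0 g.
have W0 : repr i.+1 z w \in W i.+1 w.
  rewrite er; have [h _ _] := sd c0 (kids_gt0 z0 k0') g0; move: h; rewrite !inE => /andP[-> /=]; apply: contra.
  by move/le_trans; apply; rewrite hgtS ler_pdivrMr // ler_peMr ?ler1n // ltW // hgt_gt0.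
have pick c d : c \in kids z -> d \in kids z -> (c + 3 <= d)%N ->
    exists2 x, (x == c) || (x == d) & good i x w && (x \in kids z).
  move=> kc kd cd; case/orP: (good_far g kc kd cd) => h; [exists c|exists d]; rewrite ?eqxx ?orbT ?h //.
split=> //.
  have [|||x hx /andP[gx kx]] := @pick (8 * z - 4)%N (8 * z - 1)%N; try by rewrite ?kidsP //; clear -z0; lia.
  have [|||y hy /andP[gy ky]] := @pick (8 * z + 8)%N (8 * z + 11)%N; try by rewrite ?kidsP //; clear -z0; lia.
  have [_ [a [_ [ca _ ha _]]] _] := sd x (kids_gt0 z0 kx) gx.
  have [_ [_ [b [_ cb _ hb]]] _] := sd y (kids_gt0 z0 ky) gy.
  exists a, b; split.
  - by apply: connect_trans (kid_conn sd z0 g kx gx) _; apply: connS.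
  - by apply: connect_trans (kid_conn sd z0 g ky gy) _; apply: connS.
  - apply: leq_trans ha _; rewrite (_ : z * (D * 8 ^ i.+1) = 8 * z * (D * 8 ^ i))%N; last by rewrite expnS; ring.
    by rewrite leq_mul2r; apply/orP; right; case/orP: hx => /eqP ->; clear; lia.
  apply: leq_trans hb; rewrite (_ : z.+1 * (D * 8 ^ i.+1) = 8 * z.+1 * (D * 8 ^ i))%N; last by rewrite expnS; ring.
  by rewrite leq_mul2r; apply/orP; right; case/orP: hy => /eqP ->; clear; lia.
move=> g'.
have [|||x hx /andP[gx kx]] := @pick (8 * z + 4)%N (8 * z + 7)%N; try by rewrite ?kidsP //; clear -z0; lia.
apply: connect_trans (kid_conn sd z0 g kx gx) _; rewrite -/(conn i.+1 w _ _) conn_sym.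
apply: kid_conn => //; rewrite kidsP //.
by case/orP: hx => /eqP ->; clear -z0; lia.
Qed.

(** All that [good i z] looks at: block z with one block on each side, above [hgt i]. Being three
    blocks wide, the areas of children at distance 3 are disjoint, which explains the 3 in
    [good]. *)
Definition area (i z : nat) : {set V} :=
  [set x : V | (z.-1 * (D * 8 ^ i) <= x.1 < (z + 2) * (D * 8 ^ i))%N && (hgt i < gU R x)].

Lemma sup_kid i z c : (0 < z)%N -> c \in kids z -> area i c \subset area i.+1 z.
Proof.
move=> z0 hc; apply/subsetP => x; rewrite !inE => /andP[/andP[h1 h2] h3]; apply/andP; split; last first.
  by apply: le_lt_trans h3; rewrite hgtS ler_pdivrMr // ler_peMr ?ler1n // ltW // hgt_gt0.
have e1 : (z.-1 * (D * 8 ^ i.+1) = 8 * z.-1 * (D * 8 ^ i))%N by rewrite expnS; ring.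
have e2 : ((z + 2) * (D * 8 ^ i.+1) = 8 * (z + 2) * (D * 8 ^ i))%N by rewrite expnS; ring.
have c0 := kids_gt0 z0 hc; rewrite kidsP // in hc.
rewrite e1 e2; apply/andP; split.
  by apply: leq_trans h1; rewrite leq_mul2r; apply/orP; right; move: hc z0 c0; clear; lia.
by apply: leq_trans h2 _; rewrite leq_mul2r; apply/orP; right; move: hc z0 c0; clear; lia.
Qed.

Lemma bridge_sup i z c : (0 < z)%N -> c \in kids z -> bridge i c \subset area i.+1 z.
Proof.
move=> z0 hc; apply/subsetP => x; rewrite !inE => /andP[/andP[h1 h2] /andP[-> _]]; rewrite andbT.
have e1 : (z.-1 * (D * 8 ^ i.+1) = 8 * z.-1 * (D * 8 ^ i))%N by rewrite expnS; ring.
have e2 : ((z + 2) * (D * 8 ^ i.+1) = 8 * (z + 2) * (D * 8 ^ i))%N by rewrite expnS; ring.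
have c0 := kids_gt0 z0 hc; rewrite kidsP // in hc.
rewrite e1 e2; apply/andP; split.
  by apply: leq_trans h1; rewrite leq_mul2r; apply/orP; right; move: hc z0 c0; clear; lia.
by apply: leq_trans h2 _; rewrite leq_mul2r; apply/orP; right; move: hc z0 c0; clear; lia.
Qed.

Lemma top_sup z c : (z.-1 <= c)%N -> (c <= z.+1)%N -> top_cell c \subset area 0 z.
Proof.
move=> h1 h2; apply/subsetP => x; rewrite !inE /hgt expr0 invr1 div1r => /andP[/andP[q1 q2] ->]; rewrite andbT.
apply/andP; split; first by apply: leq_trans q1; rewrite leq_mul2r h1 orbT.
by apply: leq_trans q2 _; rewrite leq_mul2r; apply/orP; right; rewrite addn2.
Qed.

Lemma good_dep i z : (0 < z)%N -> dep (area i z) (good i z).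
Proof.
elim: i z => [|i IH] z z0 w.
  have d c : (z.-1 <= c)%N -> (c <= z.+1)%N -> vac (top_cell c) (w :&: area 0 z) = vac (top_cell c) w.
    by move=> h1 h2; apply: (dep_sub (top_sup h1 h2) (@dep_vac _ _)).
  by rewrite /= !d // ?leq_pred // (leq_trans (leq_pred z)).
have d1 c : c \in kids z -> good i c (w :&: area i.+1 z) = good i c w.
  by move=> hc; apply: (dep_sub (sup_kid _ z0 hc) (IH c (kids_gt0 z0 hc))).
have d2 c : c \in kids z -> vac (bridge i c) (w :&: area i.+1 z) = vac (bridge i c) w.
  by move=> hc; apply: (dep_sub (bridge_sup _ z0 hc) (@dep_vac _ _)).
rewrite !goodS; congr (_ || (_ && _)).
- exact: eq_in_all.
- by apply: eq_in_all => c hc; apply: eq_in_all => c' hc'; rewrite !d1.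
- by apply: eq_in_all => c hc; rewrite d2.
Qed.

Let p := @pm R m V.
Let hp : prob p. Proof. exact: prob_pm. Qed.

(** Union bound over the 256 pairs of children; the two events of each pair have disjoint
    supports. *)
Lemma bad_step i z (bt ep : R) : (0 < z)%N -> 0 <= bt -> 0 <= ep ->
  (forall c, c \in kids z -> Pr p (fun w => ~~ good i c w) <= bt) ->
  (forall c, c \in kids z -> Pr p (vac (bridge i c)) <= ep) ->
  Pr p (fun w => ~~ good i.+1 z w) <= 256 * (bt * bt + bt * ep).
Proof.
move=> z0 b0 ep0 hb he.
pose kid (a : 'I_16) := (8 * z - 4 + a)%N.
have kidK (a : 'I_16) : kid a \in kids z by rewrite mem_iota leq_addr /= ltn_add2l.
have kidE c : c \in kids z -> exists a, c = kid a.
  rewrite mem_iota => /andP[h1 h2]; have lt : (c - (8 * z - 4) < 16)%N by rewrite ltn_subLR.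
  by exists (Ordinal lt); rewrite /kid /= subnKC.
pose F1 (q : 'I_16 * 'I_16) w := (kid q.1 + 3 <= kid q.2)%N && (~~ good i (kid q.1) w && ~~ good i (kid q.2) w).
pose F2 (q : 'I_16 * 'I_16) w := ~~ good i (kid q.1) w && vac (bridge i (kid q.2)) w.
apply: (@le_trans _ _ (Pr p (fun w => [exists q, F1 q w]) + Pr p (fun w => [exists q, F2 q w]))).
  apply: Pr_le_or => // w; rewrite goodS negb_or => /andP[/allPn[c hc gc]].
  rewrite negb_and => /orP[/allPn[c1 hc1 /allPn[c2 hc2]]|/allPn[c2 hc2 vc]].
    rewrite negb_imply negb_or => /andP[h1 h2]; apply/orP; left; apply/existsP.
    have [a1 e1] := kidE _ hc1; have [a2 e2] := kidE _ hc2; exists (a1, a2).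
    by rewrite /F1 /= -e1 -e2 h1.
  apply/orP; right; apply/existsP; have [a1 e1] := kidE _ hc; have [a2 e2] := kidE _ hc2; exists (a1, a2).
  by rewrite /F2 /= -e1 -e2 gc; rewrite negbK in vc.
have dg c : c \in kids z -> dep (area i c) (fun w => ~~ good i c w).
  by move=> hc w; rewrite good_dep // (kids_gt0 z0 hc).
have S1 : Pr p (fun w => [exists q, F1 q w]) <= 256 * (bt * bt).
  apply: le_trans (Pr_ex _ hp) _; apply: (@le_trans _ _ (\sum_(q : 'I_16 * 'I_16) (bt * bt))); last first.
    by rewrite sumr_const card_prod !card_ord -[leLHS]mulr_natl.
  apply: ler_sum => -[a1 a2] _; rewrite /F1 /=; case: (leqP (kid a1 + 3) (kid a2)) => h; last first.
    by rewrite /= /Pr Ex_cst mulr_ge0.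
  rewrite /= (@PrI _ _ _ _ _ (area i (kid a1)) (area i (kid a2)) _ (dg _ (kidK a1)) (dg _ (kidK a2))).
    by apply: ler_pM; rewrite ?Pr_ge0 // hb.
  apply: disjoint_notin => x; rewrite !inE => /andP[/andP[_ h1] _]; rewrite negb_and negb_and -ltnNge.
  apply/orP; left; apply/orP; left; apply: leq_trans h1 _; rewrite leq_mul2r; apply/orP; right.
  by move: h; clear; lia.
have S2 : Pr p (fun w => [exists q, F2 q w]) <= 256 * (bt * ep).
  apply: le_trans (Pr_ex _ hp) _; apply: (@le_trans _ _ (\sum_(q : 'I_16 * 'I_16) (bt * ep))); last first.
    by rewrite sumr_const card_prod !card_ord -[leLHS]mulr_natl.
  apply: ler_sum => -[a1 a2] _; rewrite /F2 /=.
  rewrite (@PrI _ _ _ _ _ (area i (kid a1)) (bridge i (kid a2)) _ (dg _ (kidK a1)) (@dep_vac _ _)).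
    by apply: ler_pM; rewrite ?Pr_ge0 // ?hb // he.
  apply: disjoint_notin => x; rewrite !inE => /andP[_ h1]; rewrite negb_and; apply/orP; right.
  by rewrite negb_and -[~~ (gU R x <= hgt i)]ltNge h1 orbT.
by rewrite mulrDr; apply: lerD.
Qed.

(** With y the failure probability of a level, y + ep <= 1/512 gives 256 y (y + ep) <= y / 2:
    failure halves from each level to the next. The factor 3 comes from the three top cells. *)
Lemma bad_pr (ep : R) (I : nat) : 0 <= ep -> ep <= 1 / 2048 ->
  (forall z, (z.+1 * D <= n)%N -> Pr p (vac (top_cell z)) <= ep) ->
  (forall i z, (i < I)%N -> (z.+1 * (D * 8 ^ i) <= n)%N -> Pr p (vac (bridge i z)) <= ep) ->
  forall i z, (i <= I)%N -> (0 < z)%N -> ((z + 2) * (D * 8 ^ i) <= n)%N ->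
  Pr p (fun w => ~~ good i z w) <= 3 * ep * 2 ^- i.
Proof.
move=> ep0 ep1 hT hB; elim=> [|i IH] z iI z0 hz.
  rewrite expr0 invr1 mulr1; move: hz; rewrite expn0 muln1 => hz.
  apply: (@le_trans _ _ (Pr p (vac (top_cell z.-1)) + (Pr p (vac (top_cell z)) + Pr p (vac (top_cell z.+1))))).
    apply: (@le_trans _ _ (Pr p (fun w => vac (top_cell z.-1) w || (vac (top_cell z) w || vac (top_cell z.+1) w)))).
    by apply: Pr_le => // w; rewrite /= !negb_and !negbK.
    by apply: le_trans (Pr_or _ _ hp) _; rewrite lerD2l; apply: Pr_or.
  have zz c : (c <= z.+1)%N -> (c.+1 * D <= n)%N.
    by move=> h; apply: leq_trans hz; rewrite leq_mul2r addn2 ltnS h orbT.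
  have := hT _ (zz z.-1 (leq_trans (leq_pred z) (leqnSn z))); have := hT _ (zz z (leqnSn z)); have := hT _ (zz _ (leqnn _)).
  lra.
have q0 : 0 <= 3 * ep * 2 ^- i by rewrite !mulr_ge0 // invr_ge0 exprn_ge0.
have kidn c d : c \in kids z -> (d <= c + 2)%N -> (d * (D * 8 ^ i) <= n)%N.
  rewrite kidsP // => /andP[h1 h2] hd; apply: leq_trans hz.
  rewrite (_ : (z + 2) * (D * 8 ^ i.+1) = 8 * (z + 2) * (D * 8 ^ i))%N; last by rewrite expnS; ring.
  by rewrite leq_mul2r; apply/orP; right; move: h2 hd; clear; lia.
have hb c : c \in kids z -> Pr p (fun w => ~~ good i c w) <= 3 * ep * 2 ^- i.
  move=> hc; apply: IH; [exact: ltnW|exact: kids_gt0 hc|exact: kidn hc (leqnn _)].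
have he c : c \in kids z -> Pr p (vac (bridge i c)) <= ep.
  by move=> hc; apply: hB => //; apply: kidn hc _; rewrite addn2.
apply: le_trans (bad_step z0 q0 ep0 hb he) _.
have p2 : 0 <= (2 ^- i : R) <= 1.
  by rewrite invr_ge0 exprn_ge0 //= invf_le1 ?exprn_gt0 // exprn_ege1 // ler1n.
rewrite -mulrDr (_ : 2 ^- i.+1 = 2 ^- i / 2 :> R); last by rewrite exprSr invfM mulrC.
move: q0 p2; set y : R := 2 ^- i => q0 /andP[y0 y1].
have : 3 * ep * y + ep <= 1 / 512.
  have : 3 * ep * y <= 3 * ep by rewrite ler_piMr // mulr_ge0.
  move: ep1; lra.
move=> h; have := ler_wpM2l q0 h; rewrite (_ : 3 * ep * (y / 2) = 3 * ep * y / 2); last by ring.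
set a := 3 * ep * y; set b := a * (a + ep); move: a b => a b; lra.
Qed.

Lemma sum_half (J : nat) : \sum_(i < J) (2 ^- i : R) <= 2.
Proof.
suff : \sum_(i < J) (2 ^- i : R) <= 2 - 2 * 2 ^- J.
  by move/le_trans; apply; rewrite gerBl mulr_ge0 // invr_ge0 exprn_ge0.
elim: J => [|J IH]; first by rewrite big_ord0 expr0 invr1 mulr1 subrr.
rewrite big_ord_recr /= (_ : 2 ^- J.+1 = 2 ^- J / 2 :> R); last by rewrite exprSr invfM mulrC.
by move: IH; set y : R := 2 ^- J; lra.
Qed.

(** The blocks containing [v] at successive levels are children of one another, so their clusters
    merge. The last cluster spans more than 2 l, so one of its ends is farther than [l] from [v]. *)
Lemma good_reach (l : R) I (v : V) (w : {set V}) : 2^-1 < gU R v -> (D * 8 ^ I <= v.1)%N ->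
  2 * l * m%:R < (D * 8 ^ I)%:R ->
  (forall i, (i <= I)%N -> good i (v.1 %/ (D * 8 ^ i)) w) ->
  reach e (v |: w) v (Out l v).
Proof.
move=> hv hI hl hg.
pose zz i := (v.1 %/ (D * 8 ^ i))%N.
have D8 i : (0 < D * 8 ^ i)%N by rewrite muln_gt0 D0 expn_gt0.
have zz0 i : (i <= I)%N -> (0 < zz i)%N.
  move=> iI; rewrite divn_gt0 //; apply: leq_trans hI; rewrite leq_pmul2l //; exact: leq_pexp2l.
have c0 i : (i <= I)%N -> connect (gr e (v |: w)) v (repr i (zz i) w).
  elim: i => [|i IH] iI.
    have /and3P[_ g _] := hg 0%N iI; have r := repr0 g; apply: connect1.
    rewrite /gr setU11 in_setU1; case/setIP: r => -> r2; rewrite orbT /=.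
    apply: (top_adj (z := zz 0%N) (z' := zz 0%N)) => //; rewrite !inE hv andbT /zz expn0 muln1.
    by rewrite leq_trunc_div ltn_ceil.
  apply: connect_trans (IH (ltnW iI)) _.
  have kz : zz i \in kids (zz i.+1).
    rewrite kidsP ?zz0 //.
    have -> : zz i.+1 = (zz i %/ 8)%N by rewrite /zz expnSr mulnA divnMA.
    have := divn_eq (zz i) 8; have := ltn_pmod (zz i) (isT : (0 < 8)%N); clear; lia.
  have h := kid_conn (@soundP i w) (zz0 _ iI) (hg _ iI) kz (hg _ (ltnW iI)).
  rewrite conn_sym in h; apply: conn_mono h => //; apply/subsetP => x; rewrite !inE => /andP[-> _].
  by rewrite orbT.
have [_ [a [b [ca cb ha hb]]] _] := soundP (zz0 I (leqnn I)) (hg I (leqnn I)).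
have up x : conn I w (repr I (zz I) w) x -> connect (gr e (v |: w)) v x.
  move=> h; apply: connect_trans (c0 I (leqnn I)) _.
  by apply: conn_mono h => //; apply/subsetP => y; rewrite !inE => /andP[-> _]; rewrite orbT.
have far : l < `|gX R a - gX R v| \/ l < `|gX R b - gX R v|.
  case: (ltrP l `|gX R a - gX R v|) => h1; [by left|right].
  rewrite ltNge; apply/negP => h2; move: hl; rewrite ltNge => /negP; apply.
  have h3 : `|gX R b - gX R a| <= 2 * l.
    apply: le_trans (ler_distD (gX R v) _ _) _; rewrite [X in _ + X]distrC; move: h1 h2; lra.
  apply: le_trans (ler_wpM2r (ltW mp) h3).
  rewrite -{1}(ger0_norm (ltW mp)) -normrM mulrBl /gX !divfK ?gt_eqF //.
  apply: le_trans (ler_norm _); rewrite lerBrDl -natrD ler_nat; apply: leq_trans hb.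
  by rewrite mulSn addnC leq_add2l.
by case: far => h; apply/existsP; [exists a|exists b]; rewrite /Out h up.
Qed.

End Blocks.

(** * Positivity at b = 1/2 for large k *)

Section LargeK.
Import mathcomp.boot.seq mathcomp.boot.fintype mathcomp.boot.finset.
Variable R : realType.
Implicit Types (l k : R).

Lemma band_mass n m (S : {set 'I_n * 'I_m}) (lo hi : R) (a b : nat) (x : R) : (0 < m)%N -> 0 <= lo -> hi <= 1 ->
  (forall v, lo < gU R v <= hi -> (a <= v.1 < b)%N -> v \in S) -> (b <= n)%N -> (a < b)%N ->
  2 / m%:R <= (hi - lo) / 4 -> x <= (hi - lo) * 3 / 4 * ((b%:R - a%:R - 2) / m%:R) -> 2 <= b%:R - a%:R :> R ->
  x <= mass R m S.
Proof.
move=> m0 l0 h1 hS bn ab hm hx h2.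
have mp : 0 < m%:R :> R by rewrite ltr0n.
apply: le_trans hx _.
have e1 : b.-1%:R = b%:R - 1 :> R by rewrite -subn1 natrB // (leq_ltn_trans _ ab).
apply: le_trans (@mass_rect R n m (a%:R / m%:R) (b.-1%:R / m%:R) lo hi S m0 _ _ l0 h1 _ _ _).
- have -> : b.-1%:R / m%:R - a%:R / m%:R - m%:R^-1 = (b%:R - a%:R - 2) / m%:R :> R by rewrite e1; ring.
  apply: ler_pM => //.
  + by rewrite mulr_ge0 // mulr_ge0 //; have : 0 <= 2 / m%:R :> R by []; move: hm; clear; lra.
  + by rewrite divr_ge0 // subr_ge0.
  + by move: hm; clear; lra.
- by [].
- by rewrite divfK ?gt_eqF // ltr_nat prednK // (leq_ltn_trans _ ab).
- have : 0 <= 2 / m%:R :> R by [].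
  by move: hm; clear; lra.
- have -> : b.-1%:R / m%:R - a%:R / m%:R - m%:R^-1 = (b%:R - a%:R - 2) / m%:R :> R by rewrite e1; ring.
  by rewrite divr_ge0 // subr_ge0.
move=> v hv; rewrite /gX !ler_pM2r ?invr_gt0 // !ler_nat => /andP[q1 q2]; apply: hS => //.
rewrite q1 /=; apply: leq_ltn_trans q2 _; rewrite prednK // (leq_ltn_trans _ ab) //.
Qed.

Variable UF : set_system nat.
Hypotheses (UFu : UltraFilter UF) (UFoo : tails UF).

Lemma cc_large k c : 256 <= c -> 512 * c <= k -> 0 < cc UF k 2^-1.
Proof.
have ar1 (M : R) : 64 <= M -> 2 <= (1 - 2^-1) / 4 * M by move=> h; lra.
have ar2 (d x : R) : k * x / 8 - 1 <= d -> 32 * 64 <= k * x -> 9 * k / 512 * x <= (1 - 2^-1) * 3 / 4 * (d - 2).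
  by rewrite (_ : 9 * k / 512 * x = 9 / 512 * (k * x)); [move: (k * x) => y; clear; lra|ring].
have ar3 (d y : R) : y / 8 - 1 <= d -> 32 * 64 <= y -> 2 <= d by clear; lra.
have ar4 (y : R) : 64 <= y -> 2 <= 7 / 64 * y by move=> h; lra.
have ar5 (d x y : R) : k * x / 8 - 1 <= d -> 32 * 64 <= k * x -> y <= 2 -> 9 * k / 512 * x <= 21 / 64 * (d - y).
  by rewrite (_ : 9 * k / 512 * x = 9 / 512 * (k * x)); [move: (k * x) => z; clear; lra|ring].
have ar6 : 2^-1 < 9 / 16 :> R by lra.
have ar7 (x : R) : 32 * x <= k * x -> 64 <= x -> 3 * x <= k * x / 8 - 1 by move: (k * x) => y; lra.
have ar8 (a b d : R) : a <= b -> 3 * b <= d -> 0 < b -> 2 * a < d by lra.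
move=> hc hck; have hk : 32 <= k by move: hc hck; clear; lra.
have k0 : 0 < k by apply: lt_le_trans hk.
apply: (@lt_le_trans _ _ (1 / 4)); first by rewrite divr_gt0.
apply: cc_ge => // l l1.
have lp : 0 < l by apply: lt_le_trans l1.
have [I hI] : exists I : nat, l <= 8 ^+ I.
  have [K hK] := pow4_large l; exists K; apply: le_trans hK _.
  by rewrite lerXn2r ?nnegrE // ler_nat.
apply: UF_imp (UF_and UFu (UF_real UFu UFoo (64 * 8 ^+ I : R)) (UFoo 1)) => m [hm m0].
have mp : 0 < m%:R :> R by rewrite ltr0n.
have p8 : 1 <= 8 ^+ I :> R by rewrite exprn_ege1 // ler1n.
have m64 : 64 <= m%:R :> R by apply: le_trans hm; rewrite ler_peMr.
have km : 32 * 64 <= k * m%:R by apply: ler_pM.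
(* The largest width with 8 D <= k m, the condition under which blocks are built. *)
pose D := Num.truncn (k * m%:R / 8).
have km0 : 0 <= k * m%:R / 8 by nneg.
have /andP[t1 t2] := truncn_itv km0; rewrite -/D in t1 t2.
have hD : 8 * D%:R <= k * m%:R by move: t1; clear; lra.
have hD2 : k * m%:R / 8 - 1 <= D%:R by move: t2; rewrite -natr1; clear; lra.
have D0 : (0 < D)%N by rewrite -(ltr_nat R); move: hD2 km; clear; lra.
pose n := (5 * (D * 8 ^ I))%N; pose i0 := (2 * (D * 8 ^ I))%N.
have D8 : (0 < D * 8 ^ I)%N by rewrite muln_gt0 D0 expn_gt0.
have in0 : (i0 < n)%N by rewrite ltn_pmul2r.
exists n, (Ordinal in0).
pose p := @pm R m ('I_n * 'I_m)%type; have hp : prob p by exact: prob_pm.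
(* Top cells and bridges have mass about 24 k / 512 and 21 k / 512; the value 9 k / 512 leaves room
   for rounding. *)
pose ep := expR (- (9 * k / 512)).
have ep0 : 0 <= ep by exact: expR_ge0.
have kk : 0 < 9 * k / 512 by apply: divr_gt0; [exact: mulr_gt0|rewrite ltr0n].
have ep1 : ep <= 1 / 2048.
  apply: le_trans (expN_le kk) _; rewrite div1r lef_pV2 ?posrE; [|exact: kk|by rewrite ltr0n].
  by move: hc hck; clear; lra.
have vb (S : {set 'I_n * 'I_m}) : 9 * k / 512 <= mass R m S -> Pr p (vac S) <= ep.
  by move=> h; apply: le_trans (vac_le _ _ _) _; rewrite ler_expR lerN2.
have hT z : (z.+1 * D <= n)%N -> Pr p (vac (top_cell R n m D z)) <= ep.
  move=> hz; apply: vb; apply: (@band_mass n m _ 2^-1 1 (z * D) (z.+1 * D)) => //.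
  - by move=> x /andP[x1 _] x2; rewrite !inE expn0 muln1 x1 x2.
  - by rewrite ltn_mul2r D0 ltnSn.
  - by rewrite ler_pdivrMr //; exact: ar1.
  - rewrite mulSn natrD addrK mulrA ler_pdivlMr //; exact: ar2 hD2 km.
  - by rewrite mulSn natrD addrK; exact: ar3 hD2 km.
have hB i z : (i < I)%N -> (z.+1 * (D * 8 ^ i) <= n)%N -> Pr p (vac (bridge R n m D i z)) <= ep.
  move=> iI hz; apply: vb.
  have q8 : 1 <= 8 ^+ i :> R by rewrite exprn_ege1 // ler1n.
  have q8p : 0 < 8 ^+ i :> R by apply: lt_le_trans q8.
  have iI8 : 8 ^+ i <= 8 ^+ I :> R by rewrite ler_eXn2l ?ltr1n // ltnW.
  have eh : 8 ^- i / 2 - 8 ^- i.+1 / 2 = 7 / 16 * 8 ^- i :> R.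
    by rewrite exprSr; field; rewrite gt_eqF.
  apply: (@band_mass n m _ (8 ^- i.+1 / 2) (8 ^- i / 2) (z * (D * 8 ^ i)) (z.+1 * (D * 8 ^ i))) => //.
  - by rewrite ler_pdivrMr // mul1r (@le_trans _ _ 1) ?ler1n // invf_le1.
  - by move=> x x1 x2; rewrite !inE x1 x2.
  - by rewrite ltn_mul2r ltnSn andbT muln_gt0 D0 expn_gt0.
  - rewrite eh ler_pdivrMr // (_ : 7 / 16 * 8 ^- i / 4 * m%:R = 7 / 64 * (m%:R / 8 ^+ i)); last by field; rewrite gt_eqF.
    apply: ar4; rewrite ler_pdivlMr //; apply: le_trans hm; by rewrite ler_pM2l.
  - rewrite eh mulSn natrD addrK natrM natrX.
    rewrite (_ : 7 / 16 * 8 ^- i * 3 / 4 * ((D%:R * 8 ^+ i - 2) / m%:R) = 21 / 64 * ((D%:R - 2 / 8 ^+ i) / m%:R)); last first.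
    by field; rewrite !gt_eqF.
    have : 2 / 8 ^+ i <= 2 :> R by rewrite ler_pdivrMr // ler_peMr.
    by move=> h; rewrite mulrA ler_pdivlMr //; exact: ar5 hD2 km h.
  - rewrite mulSn natrD addrK natrM natrX; apply: (@le_trans _ _ (2 * 1)); first by rewrite mulr1.
    by apply: ler_pM => //; exact: ar3 hD2 km.
have bad := bad_pr k0 m0 D0 hD ep0 ep1 hT hB.
pose zz i := (i0 %/ (D * 8 ^ i))%N.
have D8i i : (0 < D * 8 ^ i)%N by rewrite muln_gt0 D0 expn_gt0.
have le8 i : (i <= I)%N -> (D * 8 ^ i <= D * 8 ^ I)%N.
  by move=> iI; rewrite leq_pmul2l //; apply: leq_pexp2l.
have hz0 i : (i <= I)%N -> (0 < zz i)%N.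
  move=> iI; rewrite divn_gt0 //; apply: leq_trans (le8 i iI) _; rewrite /i0; exact: leq_pmull.
have hzn i : (i <= I)%N -> ((zz i + 2) * (D * 8 ^ i) <= n)%N.
  move=> iI; rewrite mulnDl; have := leq_trunc_div i0 (D * 8 ^ i); have := le8 i iI.
  rewrite -/(zz i) /i0 /n; clear; lia.
pose G (w : {set 'I_n * 'I_m}) := [exists i : 'I_I.+1, ~~ good R D i (zz i) w].
have PG : Pr p G <= 1 / 4.
  apply: le_trans (Pr_ex _ hp) _; apply: (@le_trans _ _ (\sum_(i < I.+1) 3 * ep * 2 ^- i)).
    by apply: ler_sum => i _; apply: bad; rewrite ?hz0 ?hzn // -ltnS.
  rewrite -big_distrr /=; have q0 : 0 <= 3 * ep by rewrite mulr_ge0.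
  have := ler_wpM2l q0 (sum_half R I.+1); move: ep1; clear; lra.
have key (j : 'I_m) : 3 / 4 <= Dr (kT k 2^-1) l (Ordinal in0, j) +
    3 / 4 * ((j.+1%:R / m%:R < 9 / 16 :> R)%:R : R).
  case: ltP => hj /=.
    by rewrite mulr1 lerDr; apply: Pr_ge0.
  rewrite mulr0 addr0; set v := (_, j).
  have : Pr p (fun w => ~~ G w) <= Dr (kT k 2^-1) l v.
    apply: Pr_le => // w; rewrite /G negb_exists => /forallP hg.
    apply: (@good_reach R k n m D k0 m0 D0 hD v l I v w).
    - exact: lt_le_trans ar6 hj.
    - by rewrite /= /i0 leq_pmull.
    - rewrite natrM natrX.
    have h1 : l * m%:R <= 8 ^+ I * m%:R by rewrite ler_pM2r.
    have h2 : 3 * m%:R <= D%:R :> R.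
    by apply: le_trans hD2; apply: ar7 (ler_wpM2r (ltW mp) hk) m64.
    have h3 : 3 * m%:R * 8 ^+ I <= D%:R * 8 ^+ I :> R by rewrite ler_wpM2r // (le_trans _ p8).
    have h4 : 0 < 8 ^+ I * m%:R :> R by rewrite mulr_gt0 // (lt_le_trans _ p8).
    have e1 : 3 * m%:R * 8 ^+ I = 3 * (8 ^+ I * m%:R) :> R by ring.
    have e2 : 2 * l * m%:R = 2 * (l * m%:R) by ring.
    by rewrite e2; rewrite e1 in h3; apply: ar8 h1 h3 h4.
    move=> i iI; have lt : (i < I.+1)%N by [].
    by have := hg (Ordinal lt); rewrite negbK.
  by rewrite PrC; move: PG; clear; lra.
have h9 : 0 <= 9 / 16 :> R by nneg.
have h34 : 0 <= 3 / 4 :> R by nneg.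
have A := @avg_boost R m (fun=> 0) (fun j => Dr (kT k 2^-1) l (Ordinal in0, j)) (3 / 4) (9 / 16) m0 h34 h9.
have : (\sum_(j < m) 0) / m%:R + 3 / 4 <= Dn (kT k 2^-1) l m (Ordinal in0) + 3 / 4 * (9 / 16) :> R.
  by apply: A => j; rewrite add0r; exact: key.
rewrite big1 // mul0r; clear; lra.
Qed.

End LargeK.

(** * Few vertices lie in large components *)

Section Upper.
Import Fin.
Variable R : realType.
Implicit Types (T : R -> R -> R) (l L k b q h d : R).

Definition cnt (V : finType) (P : V -> {set V} -> bool) (w : {set V}) : R := \sum_(v in w) (P v w)%:R.
Definition clus (V : finType) (e : rel V) (w : {set V}) v : {set V} := [set z | connect (gr e w) v z].
Definition bigc (V : finType) (e : rel V) (s : R) (v : V) (w : {set V}) : bool := s <= #|clus e w v|%:R.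

Lemma cnt_ge0 (V : finType) (P : V -> {set V} -> bool) w : 0 <= cnt P w.
Proof. exact: sumr_ge0. Qed.

Lemma cntE (V : finType) (P : V -> {set V} -> bool) w : cnt P w = \sum_v ((v \in w) && P v w)%:R.
Proof. by rewrite /cnt big_mkcond; apply: eq_bigr => v _; case: (v \in w). Qed.

Lemma cnt_le (V : finType) (P Q : V -> {set V} -> bool) (w : {set V}) :
  (forall v, v \in w -> P v w -> Q v w) -> cnt P w <= cnt Q w.
Proof.
move=> h; apply: ler_sum => v vw; case: (boolP (P v w)) => [/(h v vw) -> //|_]; exact: ler0n.
Qed.

Lemma cnt_or (V : finType) (P Q : V -> {set V} -> bool) w :
  cnt (fun v w => P v w || Q v w) w <= cnt P w + cnt Q w.
Proof.
rewrite /cnt -big_split; apply: ler_sum => v _ /=.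
by case: (P v w); case: (Q v w); rewrite /= ?addr0 ?add0r // lerDl.
Qed.

Lemma Ex_cnt (V : finType) (p : V -> R) (P : V -> {set V} -> bool) :
  Ex p (cnt P) = \sum_v p v * Pr p (fun w => P v (v |: w)).
Proof.
under eq_Ex => w do rewrite cntE.
rewrite Ex_sum; apply: eq_bigr => v _; rewrite -Pr_mecke; apply: eq_Ex => w.
by case: (boolP (v \in w)) => //= vw; rewrite setU1_in // (_ : v |: w = w) //; apply/setUidPr; rewrite sub1set.
Qed.

Lemma Pr_cnt (V : finType) (p : V -> R) (P : V -> {set V} -> bool) s : prob p -> 0 < s ->
  Pr p (fun w => s <= cnt P w) <= (\sum_v p v * Pr p (fun w => P v (v |: w))) / s.
Proof. by move=> hp s0; rewrite -Ex_cnt; apply: markov => // w; apply: cnt_ge0. Qed.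

(** Chebyshev: indicators with disjoint supports are uncorrelated, and the other pairs contribute at
    most p v p z, besides the diagonal. *)
Lemma cnt_var (V : finType) (p : V -> R) (P : V -> {set V} -> bool) (D : V -> {set V}) (M C s : R) :
  prob p -> (forall v, v \in D v) -> (forall v, dep (D v) (P v)) -> 0 < s ->
  \sum_v p v <= M -> (forall v, \sum_(z | ~~ [disjoint D v & D z]) p z <= C) -> 0 <= C ->
  Pr p (fun w => Ex p (cnt P) + s <= cnt P w) <= M * (1 + C) / s ^+ 2.
Proof.
move=> hp hD hd s0 hM hC C0.
pose f v (w : {set V}) := (v \in w) && P v w.
have fd v : dep (D v) (f v).
  by move=> w; rewrite /f hd inE hD andbT.
have h1 : Pr p (fun w => Ex p (cnt P) + s <= cnt P w) <= Pr p (fun w => s <= `|cnt P w - Ex p (cnt P)|).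
  apply: Pr_le => // w h; apply: le_trans (ler_norm _); by rewrite lerBrDl.
apply: le_trans h1 _; apply: le_trans (chebyshev _ hp s0) _.
rewrite ler_pM2r ?invr_gt0 ?exprn_gt0 //.
have e1 : Ex p (cnt P) = \sum_v Pr p (f v).
  by under eq_Ex => w do rewrite cntE; rewrite Ex_sum.
have e2 : Ex p (fun w => cnt P w ^+ 2) = \sum_v \sum_z Pr p (fun w => f v w && f z w).
  transitivity (Ex p (fun w => \sum_v \sum_z (f v w && f z w)%:R)).
    apply: eq_Ex => w; rewrite cntE expr2 mulr_suml; apply: eq_bigr => v _.
    rewrite mulr_sumr; apply: eq_bigr => z _; rewrite -/(f v w) -/(f z w).
    by case: (f v w); case: (f z w); rewrite /= ?mulr1 ?mulr0.
  by rewrite Ex_sum; apply: eq_bigr => v _; rewrite Ex_sum.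
have pf v : Pr p (f v) <= p v.
  by rewrite -(Pr_in p v); apply: Pr_le => // w /andP[].
have key v : \sum_z Pr p (fun w => f v w && f z w) <= p v * (1 + C) + \sum_z Pr p (f v) * Pr p (f z).
  have t1 : Pr p (fun w => f v w && f v w) <= p v.
    by apply: le_trans (pf v); apply: Pr_le => // w /andP[].
  have t2 z : z != v -> Pr p (fun w => f v w && f z w) <=
    p v * (if [disjoint D v & D z] then 0 else p z) + Pr p (f v) * Pr p (f z).
    move=> zv; case: ifPn => dj.
    by rewrite (PrI _ dj (fd v) (fd z)) mulr0 add0r.
    apply: (@le_trans _ _ (p v * p z)); last by rewrite lerDl mulr_ge0 // Pr_ge0.
    apply: (@le_trans _ _ (Pr p (fun w => (v \in w) && (z \in w)))).
    by apply: Pr_le => // w /andP[/andP[-> _] /andP[-> _]].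
    rewrite Pr_mecke ler_wpM2l //; first by case/andP: (hp v).
    by rewrite -(Pr_in p z); apply: Pr_le => // w; rewrite !inE (negbTE zv).
  rewrite (bigD1 v) //= [in leRHS](bigD1 v) //=.
  apply: (@le_trans _ _ (p v + (p v * C + \sum_(z | z != v) Pr p (f v) * Pr p (f z)))).
    apply: lerD => //; apply: le_trans (ler_sum _ (fun z zv => t2 z zv)) _.
    rewrite big_split /= lerD2r -mulr_sumr ler_wpM2l //; first by case/andP: (hp v).
    apply: le_trans (hC v); rewrite [leRHS]big_mkcond [leLHS]big_mkcond; apply: ler_sum => z _.
    by case/andP: (hp z) => q0 _; case: (z != v); case: ifPn => //= _.
  rewrite mulrDr mulr1 !addrA lerD2r lerDl mulr_ge0 // Pr_ge0 //.
rewrite e2 e1 expr2 mulr_suml lerBlDr; apply: le_trans (ler_sum _ (fun v _ => key v)) _.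
rewrite big_split /= -mulr_suml; apply: lerD; first by rewrite ler_wpM2r // addr_ge0.
by apply: ler_sum => v _; rewrite mulr_sumr.
Qed.

Lemma sum_pm m (V : finType) : \sum_(v : V) @pm R m V v = #|V|%:R * m%:R ^- 2.
Proof. by rewrite sumr_const -[LHS]mulr_natl. Qed.

Lemma sum_pm_set m (V : finType) (P : pred V) : \sum_(v | P v) @pm R m V v = mass R m [set v | P v].
Proof. by rewrite sumr_const -[LHS]mulr_natl /mass cardsE. Qed.

(** A cluster that does not escape lies within [l] of [v], so if it has s sites it contains s^2
    pairs at distance at most 2 l. As the expected number of such pairs is linear in N
    ([Ex_near_pairs]), clusters of size of order N must escape. *)
Lemma confined_big n m (e : rel ('I_n * 'I_m)) l s (w : {set 'I_n * 'I_m}) v : symmetric e -> 0 <= s ->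
  1 < s -> bigc e s v w -> ~~ reach e w v (Out l v) ->
  s ^+ 2 <= \sum_(z in w) \sum_(z' in w) (`|gX R z - gX R z'| <= 2 * l :> R)%:R.
Proof.
move=> es s0 s1 hs hr; pose C := clus e w v.
have hC z : z \in C -> `|gX R z - gX R v| <= l.
  rewrite inE => cz; rewrite leNgt; apply: contra hr => hz.
  by apply/existsP; exists z; rewrite cz andbT /Out hz.
have [z0 z0C z0v] : exists2 z0, z0 \in C & z0 != v.
  apply: contrapT => H; move: hs; rewrite /bigc; apply/negP; rewrite -ltNge.
  suff : (#|C| <= 1)%N by rewrite -(ler_nat R) => h; exact: le_lt_trans s1.
  rewrite -(cards1 v); apply: subset_leq_card; apply/subsetP => z zC; rewrite inE.
  by apply: contrapT => /negP nz; apply: H; exists z.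
have vw : v \in w.
  by rewrite inE in z0C; rewrite eq_sym in z0v; case/andP: (conn_in z0C z0v).
have Cw : C \subset w.
  apply/subsetP => z; rewrite inE => cz; have [<- //|ne] := eqVneq v z.
  by case/andP: (conn_in cz ne).
have h1 : s ^+ 2 <= #|C|%:R * #|C|%:R by rewrite expr2 ler_pM.
apply: le_trans h1 _.
apply: (@le_trans _ _ (\sum_(z in C) \sum_(z' in C) (1 : R))).
  by rewrite !sumr_const -[leRHS]mulr_natl.
rewrite [leRHS](bigID (mem C)) /= -[leLHS]addr0; apply: lerD; last by apply: sumr_ge0 => z _; apply: sumr_ge0.
rewrite [leLHS](eq_bigl (fun z => (z \in w) && (z \in C))); last first.
  by move=> z; case zC: (z \in C); rewrite ?andbF // (subsetP Cw).
apply: ler_sum => z /andP[_ zC].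
rewrite [leRHS](bigID (mem C)) /= -[leLHS]addr0; apply: lerD; last exact: sumr_ge0.
rewrite [leLHS](eq_bigl (fun z => (z \in w) && (z \in C))); last first.
  by move=> z'; case z'C: (z' \in C); rewrite ?andbF // (subsetP Cw).
apply: ler_sum => z' /andP[_ z'C].
suff -> : `|gX R z - gX R z'| <= 2 * l by [].
apply: le_trans (ler_distD (gX R v) _ _) _; have := hC z zC; have := hC z' z'C; rewrite [X in X <= _ -> _]distrC; lra.
Qed.

Variable UF : set_system nat.
Hypotheses (UFu : UltraFilter UF) (UFoo : tails UF).

Definition near_pairs n m l (w : {set 'I_n * 'I_m}) : R :=
  \sum_(z in w) \sum_(z' in w) (`|gX R z - gX R z'| <= 2 * l :> R)%:R.

Lemma grid_mass N m : (0 < m)%N -> #|{: 'I_(N * m) * 'I_m}|%:R * m%:R ^- 2 = N%:R :> R.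
Proof.
move=> m0; rewrite card_prod !card_ord !natrM expr2; field.
by rewrite pnatr_eq0 -lt0n.
Qed.

Lemma Ex_near_pairs N m l : (0 < m)%N -> 0 <= l ->
  Ex (@pm R m _) (@near_pairs (N * m) m l) <= N%:R * (4 * l + 2).
Proof.
move=> m0 l0; pose p := @pm R m ('I_(N * m) * 'I_m)%type; have hp : prob p by exact: prob_pm.
have -> : Ex p (@near_pairs (N * m) m l) =
   \sum_z p z * Ex p (fun w => \sum_(z' in z |: w) (`|gX R z - gX R z'| <= 2 * l :> R)%:R).
  transitivity (Ex p (fun w => \sum_z (z \in w)%:R * \sum_(z' in w) (`|gX R z - gX R z'| <= 2 * l :> R)%:R)).
    apply: eq_Ex => w; rewrite /near_pairs big_mkcond; apply: eq_bigr => z _.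
    by case: (z \in w); rewrite ?mul1r ?mul0r.
  by rewrite Ex_sum; apply: eq_bigr => z _; rewrite mecke.
have key z : Ex p (fun w => \sum_(z' in z |: w) (`|gX R z - gX R z'| <= 2 * l :> R)%:R) <= 1 + (4 * l + 1).
  apply: (@le_trans _ _ (Ex p (fun w => 1 + \sum_z' (z' \in w)%:R * (`|gX R z - gX R z'| <= 2 * l :> R)%:R))).
    apply: Ex_le => // w; rewrite big_mkcond (bigD1 z) //= setU11 subrr normr0.
    apply: lerD; first by case: (_ <= 2 * l).
    rewrite [leRHS](bigD1 z) //= -[leLHS]add0r; apply: lerD; first by rewrite mulr_ge0.
    apply: ler_sum => z' zz; rewrite in_setU1 (negbTE zz) /=; by case: (z' \in w) => /=; rewrite ?mul1r ?mul0r.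
  rewrite ExD Ex_cst lerD2l Ex_sum.
  apply: (@le_trans _ _ (mass R m (@win R (N * m) m (gX R z) (2 * l)))); last first.
    apply: le_trans (mass_win _ _ m0 _) _; first by rewrite mulr_ge0.
    have : m%:R^-1 <= 1 :> R by rewrite invf_le1 ?ltr0n // ler1n.
    by clear; lra.
  rewrite /win -sum_pm_set [leRHS]big_mkcond; apply: ler_sum => z' _.
  rewrite mecke Ex_cst [`|gX R z' - _|]distrC; by case: (`|gX R z - gX R z'| <= 2 * l) => /=; rewrite ?mulr1 ?mulr0.
apply: (@le_trans _ _ (\sum_z p z * (1 + (4 * l + 1)))).
  by apply: ler_sum => z _; rewrite ler_wpM2l //; case/andP: (hp z).
rewrite -mulr_suml sum_pm grid_mass // ler_wpM2l // ; lra.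
Qed.

(** Three copies of [tailS], because the line is a circle of length N cut open and an edge may go
    round it. *)
Definition spread k b C l L N m (v : 'I_(N * m) * 'I_m) : {set 'I_(N * m) * 'I_m} :=
  [set z | L < `|gX R z - gX R v| & z \in tailS (kT (C * k) b) l L (N * m) m (gX R v) :|:
  (tailS (kT (C * k) b) l L (N * m) m (gX R v + N%:R) :|: tailS (kT (C * k) b) l L (N * m) m (gX R v - N%:R))].

Definition centre L N m (v : 'I_(N * m) * 'I_m) : bool := L < gX R v < N%:R - L.

Lemma spread_far k b C l L N m (e : rel ('I_(N * m) * 'I_m)) (v : 'I_(N * m) * 'I_m) : 0 < k -> 0 < b -> 1 <= C ->
  (forall x y, e x y -> `|gX R x - gX R y| <= C * kT k b (gU R x) (gU R y) \/
    N%:R - `|gX R x - gX R y| <= C * kT k b (gU R x) (gU R y)) -> 0 < l -> 0 <= L -> centre L v -> forall y z,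
  ~~ Out l v y -> L < `|gX R z - gX R v| -> e y z -> z \in spread k b C l L v.
Proof.
move=> k0 b0 C1 e_far l0 L0 /andP[c1 c2] y z; rewrite /Out negb_or -!leNgt -ltNge => /andP[hy hu] hz eyz.
have m0 := cell_m0 v; have mp : 0 < m%:R :> R by rewrite ltr0n.
have T0 : kT k b (gU R y) (gU R z) * C <= kT (C * k) b (gU R z) l^-1.
  rewrite /kT mulrAC [k * C]mulrC ler_pM2l ?mulr_gt0 ?(lt_le_trans _ C1) //.
  by apply: powR_anti; [exact: ltW|rewrite mulr_gt0 ?gU_gt0 ?invr_gt0|rewrite mulrC ler_pM2r ?gU_gt0 // ltW].
set T := kT (C * k) b (gU R z) l^-1 in T0.
have XN (x : 'I_(N * m) * 'I_m) : gX R x < N%:R.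
  rewrite /gX ltr_pdivrMr // -natrM ltr_nat; exact: ltn_ord.
have X0 := gX_ge0 R z; have XzN := XN z.
rewrite !inE hz /=; case: (e_far _ _ eyz) => h.
  apply/orP; left; apply: le_trans (ler_distD (gX R y) _ _) _; rewrite addrC lerD //.
  by rewrite distrC; apply: le_trans h _; rewrite mulrC.
rewrite mulrC in h; have h' := le_trans h T0.
apply/orP; right; move: hy; rewrite ler_norml => /andP[y1 y2].
case: (lerP (gX R y) (gX R z)) => yz.
  move: h'; rewrite distrC ger0_norm ?subr_ge0 // => h'; apply/orP; left.
  have s0 : gX R z - (gX R v + N%:R) < 0 by move: c1 XzN L0; clear; lra.
  rewrite ltr0_norm //; apply/andP; split; first by move: c1 XzN L0; clear; lra.
  by rewrite -/T; move: h' y1 y2; clear; lra.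
move: h'; rewrite gtr0_norm ?subr_gt0 // => h'; apply/orP; right.
have s0 : 0 < gX R z - (gX R v - N%:R) by move: c2 X0 L0; clear; lra.
rewrite gtr0_norm //; apply/andP; split; first by move: c2 X0 L0; clear; lra.
by rewrite -/T; move: h' y1 y2; clear; lra.
Qed.

Lemma spread_mass k b C l L u N m (v : 'I_(N * m) * 'I_m) : 0 < k -> 0 < b -> b < 1 -> 1 <= C -> 0 < l -> 0 < u -> (0 < m)%N ->
  l + (C * k) * l `^ b * u `^ (- b) <= L -> mass R m (spread k b C l L v) <= 3 * tau (C * k) b l u.
Proof.
move=> k0 b0 b1 C1 l0 u0 m0 hL; have Ck : 0 <= C * k by rewrite mulr_ge0 ?(ltW k0) // (le_trans _ C1).
have hb : 0 <= b < 1 by rewrite (ltW b0).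
have t x0 : mass R m (tailS (kT (C * k) b) l L (N * m) m x0) <= tau (C * k) b l u by apply: tail_mass.
rewrite (_ : 3 * tau (C * k) b l u = tau (C * k) b l u + (tau (C * k) b l u + tau (C * k) b l u)); last by ring.
apply: (@le_trans _ _ (mass R m (tailS (kT (C * k) b) l L (N * m) m (gX R v) :|:
  (tailS (kT (C * k) b) l L (N * m) m (gX R v + N%:R) :|: tailS (kT (C * k) b) l L (N * m) m (gX R v - N%:R))))).
  by apply: mass_mono; apply/subsetP => z; rewrite inE => /andP[].
apply: le_trans (massU R m _ _) _; apply: lerD => //.
by apply: le_trans (massU R m _ _) _; apply: lerD.
Qed.

Lemma edge_mass L N m (S : {set 'I_(N * m) * 'I_m}) : (0 < m)%N -> 0 <= L ->
  (forall v, v \in S -> ~~ centre L v) -> mass R m S <= 2 * (2 * L + 1).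
Proof.
move=> m0 L0 hS; have mp : 0 < m%:R :> R by rewrite ltr0n.
have sub : S \subset win (N * m) m 0 L :|: win (N * m) m N%:R L.
  apply/subsetP => v /hS; rewrite /centre negb_and -!leNgt !inE subr0 ger0_norm ?gX_ge0 //.
  case/orP => h; first by rewrite h.
  apply/orP; right; rewrite ler0_norm; first by rewrite opprB lerBlDr addrC -lerBlDr.
  by rewrite subr_le0 ler_pdivrMr // -natrM ler_nat ltnW // ltn_ord.
have mi : m%:R^-1 <= 1 :> R by rewrite invf_le1 // ler1n.
apply: le_trans (@mass_mono R m _ _ _ sub) (le_trans (massU R m _ _) _).
have w x0 : mass R m (win (N * m) m x0 L) <= 2 * L + 1.
  by apply: le_trans (mass_win _ _ m0 L0) _; rewrite lerD2l.
by rewrite mulr2n mulrDl mul1r; apply: lerD.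
Qed.

(** Unless there are too many near pairs, a vertex in a large cluster escapes inside its window
    ([A1]), or a site of its [spread] is occupied ([A2]), or it is near the cut ([A3]). The count of
    [A1] is a sum of local terms, so it concentrates, and [compare] bounds its mean by (c + eps) N.
    The relation is a parameter so that the bound serves both the ideal line and the hyperbolic
    graph. *)
Theorem upper k b C (e : forall N m, rel ('I_(N * m) * 'I_m)) (eps dl : R) : 0 < k -> 0 < b -> b < 1 -> 1 <= C ->
  (forall N m, symmetric (@e N m)) ->
  (forall N, UF (fun m => forall x y : 'I_(N * m) * 'I_m, e _ _ x y ->
    `|gX R x - gX R y| <= C * kT k b (gU R x) (gU R y) \/
    N%:R - `|gX R x - gX R y| <= C * kT k b (gU R x) (gU R y))) ->
  (forall h d : R, 0 < h -> 0 < d -> exists N0 : nat, forall N, (N0 <= N)%N ->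
    UF (fun m => forall x y : 'I_(N * m) * 'I_m, h <= gU R x -> h <= gU R y ->
    `|gX R x - gX R y| <= N%:R / 2 -> e _ _ x y -> `|gX R x - gX R y| <= kT k b (gU R x) (gU R y) + d)) ->
  0 < eps -> 0 < dl -> exists N0 : nat, forall N, (N0 <= N)%N ->
  UF (fun m => Pr (@pm R m _) (fun w => (cc UF k b + 6 * eps) * N%:R <=
    cnt (fun v w => bigc (@e N m) (eps * N%:R) v w) w) <= dl).
Proof.
have ar (a1 a2 a3 a4 x y : R) : 4 * y + (a1 + a2 + a3) + a4 <= x -> 0 < a1 -> 0 < a2 -> 0 < a3 -> 0 < y -> 0 < a4 ->
    a1 <= x /\ (a2 <= x /\ (a3 <= x /\ (4 * y <= x /\ a4 <= x))).
  by move=> *; do !split; lra.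
have ar8 (x : R) : 0 < x -> x / 8 + (x / 8 + (x / 8 + x / 8)) <= x by lra.
have ar9 (x : R) : 2 * (2 * x + 1) <= 4 * x + 4 by lra.
move=> k0 b0 b1 C1 e_sym e_far e_near eps0 dl0; set c := cc UF k b.
have [l l1 hl] : exists2 l, 1 <= l & UF (fun m => forall n (i : 'I_n), Dn (kT k b) l m i <= c + eps / 2).
  by apply: (proj2 (cc_lt UFu UFoo _)); rewrite ltrDl divr_gt0.
have l0 : 0 < l by apply: lt_le_trans l1.
have Ck : 0 <= C * k by rewrite mulr_ge0 ?(ltW k0) // (le_trans _ C1).
have hb : 0 <= b < 1 by rewrite (ltW b0).
pose g := Num.min (eps / 16) (eps * dl / 16).
have g0 : 0 < g by rewrite lt_min; apply/andP; split; pstv.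
have g1 : g <= eps / 16 by rewrite ge_min lexx.
have g2 : g <= eps * dl / 16 by rewrite ge_min lexx orbT.
have g30 : 0 < g / 3 by rewrite divr_gt0.
have [u /andP[u0 u1] hu] := small_tau Ck hb l0 g30.
pose L := l + (C * k) * l `^ b * u `^ (- b).
have lL : l <= L by rewrite /L lerDl; nneg.
have hLd : l + (C * k) * l `^ b * u `^ (- b) <= L by exact: lexx.
clearbody L.
have L0 : 0 < L by apply: lt_le_trans lL.
pose h := g / (2 * L + 3).
have L3 : 0 < 2 * L + 3 by rewrite addr_gt0 ?mulr_gt0.
have h0 : 0 < h by rewrite divr_gt0.
have hLg : (2 * L + 3) * h = g by rewrite /h mulrC divfK // gt_eqF.
have hg : (2 * L + 1) * h <= g by rewrite -hLg ler_pM2r // lerD2l ler1n.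
have hle : h <= g by rewrite -hLg ler_peMl ?(ltW h0) //; clear -L0; lra.
pose d := g / (8 * (2 * L + 3)).
have d0 : 0 < d by rewrite divr_gt0 // mulr_gt0.
have [N1 hN1] := e_near _ _ h0 d0.
have [N2 hN2] := nat_large (4 * L + (4 * L + 4) * (64 / (eps * dl) + 64 / (eps ^+ 2 * dl) + 64 / eps) + 2 / eps).
exists (maxn N1 (maxn N2 1)) => N; rewrite !geq_max => /and3P[NN1 NN2 Np].
have Nr : 0 < N%:R :> R by rewrite ltr0n.
have {}hN2 : 4 * L + (4 * L + 4) * (64 / (eps * dl) + 64 / (eps ^+ 2 * dl) + 64 / eps) + 2 / eps <= N%:R.
  by apply: le_trans hN2 _; rewrite ler_nat.
have ed0 : 0 < 64 / (eps * dl) by pstv.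
have ed1 : 0 < 64 / (eps ^+ 2 * dl) by pstv.
have ed2 : 0 < 64 / eps by pstv.
have ed3 : 0 < 2 / eps by pstv.
have L4 : 0 < 4 * L + 4 by pstv.
have K : (4 * L + 4) * (64 / (eps * dl)) <= N%:R /\ ((4 * L + 4) * (64 / (eps ^+ 2 * dl)) <= N%:R /\
   ((4 * L + 4) * (64 / eps) <= N%:R /\ (4 * L <= N%:R /\ 2 / eps <= N%:R))).
  have q0 := mulr_gt0 L4 ed0; have q1 := mulr_gt0 L4 ed1; have q2 := mulr_gt0 L4 ed2.
  move: hN2 q0 q1 q2 L0 ed3; rewrite !mulrDr.
  set a1 := _ * (64 / (eps * dl)); set a2 := _ * (64 / (eps ^+ 2 * dl)); set a3 := _ * (64 / eps).
  set a4 := 2 / eps; exact: ar.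
case: K => K1 [K2 [K3 [K4 K5]]].
apply: UF_imp (UF_and UFu hl (UF_and UFu (UF_inv UFu UFoo d0) (UF_and UFu (UFoo 2) (UF_and UFu (e_far N) (hN1 N NN1))))) =>
  m [Hm [md [m2 [hfar hnear]]]].
have m0 : (0 < m)%N := ltnW m2.
have mp : 0 < m%:R :> R by rewrite ltr0n.
pose V := ('I_(N * m) * 'I_m)%type.
pose p := @pm R m V; have hp : prob p by exact: prob_pm.
have sM : \sum_v p v <= N%:R by rewrite sum_pm grid_mass.
pose A1 (v : V) w := reach (@e N m) (w :&: winv L v) v (Out l v).
pose A2 (v : V) w := centre L v && ~~ vac (spread k b C l L v) w.
pose A3 (v : V) (w : {set V}) := ~~ centre L v.
pose Bg := bigc (@e N m) (eps * N%:R).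
have split w : near_pairs l w < (eps * N%:R) ^+ 2 ->
    cnt (fun v w => Bg v w) w <= cnt A1 w + (cnt A2 w + cnt A3 w).
  move=> hQ; apply: le_trans (lerD (lexx _) (cnt_or _ _ _)); apply: le_trans (cnt_or _ _ _).
  apply: cnt_le => v vw hB; rewrite /A1 /A2 /A3.
  case: (boolP (centre L v)) => [cv|]; last by rewrite !orbT.
  rewrite /= orbF; case: (boolP (vac (spread k b C l L v) w)) => [vS|]; last by rewrite orbT.
  rewrite orbF; have hr : reach (@e N m) w v (Out l v).
    apply: contraLR hQ => nr; rewrite -leNgt.
    apply: (confined_big (@e_sym N m) _ _ hB nr); first by rewrite mulr_ge0 ?ltW.
    have := K5; rewrite ler_pdivrMr // mulrC => q; apply: lt_le_trans q; by rewrite ltr1n.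
  have vS' : v \notin spread k b C l L v by rewrite inE subrr normr0 ltNge (ltW L0).
  have vv : v |: w = w by apply/setUidPr; rewrite sub1set.
  have Y := @reach_local R (N * m) m (@e N m) l L v w (spread k b C l L v) lL (spread_far k0 b0 C1 hfar l0 (ltW L0) cv) vS vS'.
  by rewrite vv in Y; apply: Y.
have eN : 0 < eps * N%:R by rewrite mulr_gt0.
have PQ : Pr p (fun w => (eps * N%:R) ^+ 2 <= near_pairs l w) <= dl / 8.
  have f0 (w : {set V}) : 0 <= near_pairs l w by apply: sumr_ge0 => z _; apply: sumr_ge0.
  apply: le_trans (markov hp f0 _) _; first by rewrite exprn_gt0.
  apply: le_trans (_ : N%:R * (4 * L + 4) / (eps * N%:R) ^+ 2 <= _).
    rewrite ler_pM2r ?invr_gt0 ?exprn_gt0 //; apply: le_trans (Ex_near_pairs _ m0 (ltW l0)) _.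
    rewrite ler_pM2l //; move: lL L0; clear; lra.
  rewrite (_ : N%:R * (4 * L + 4) / (eps * N%:R) ^+ 2 = (4 * L + 4) * (64 / (eps ^+ 2 * dl)) / N%:R * (dl / 64)); last first.
    by field; rewrite ?gt_eqF.
  have : (4 * L + 4) * (64 / (eps ^+ 2 * dl)) / N%:R <= 1 by rewrite ler_pdivrMr // mul1r.
  move=> q; have q' := ler_wpM2r (_ : 0 <= dl / 64) q; apply: le_trans (q' _) _; first by nneg.
  by rewrite mul1r ler_pM2l // lef_pV2 ?posrE // ler_nat.
have PA2 : Pr p (fun w => eps * N%:R <= cnt A2 w) <= dl / 8.
  apply: le_trans (Pr_cnt A2 hp eN) _.
  apply: (@le_trans _ _ (N%:R * g / (eps * N%:R))).
    rewrite ler_pM2r ?invr_gt0 //; apply: (@le_trans _ _ (\sum_v p v * g)); last first.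
    by rewrite -mulr_suml ler_wpM2r // ltW.
    apply: ler_sum => v _; rewrite ler_wpM2l //; first by case/andP: (hp v).
    apply: (@le_trans _ _ (mass R m (spread k b C l L v))); last first.
    apply: le_trans (spread_mass v k0 b0 b1 C1 l0 u0 m0 hLd) _; move: hu; clear; lra.
    apply: le_trans (hit_le R m _); apply: Pr_le => // w /andP[_]; apply: contra => /eqP h1.
    apply/eqP; apply/setP => z; rewrite inE in_set0; apply/negP => /andP[]; rewrite in_setU1 => /orP[/eqP ->|zw] zS.
    by move: zS; rewrite inE subrr normr0 ltNge (ltW L0).
    by move/setP/(_ z): h1; rewrite in_setI zw zS in_set0.
  rewrite (_ : N%:R * g / (eps * N%:R) = g / eps); last by field; rewrite ?gt_eqF.
  by rewrite ler_pdivrMr //; move: g2 (mulr_gt0 eps0 dl0); rewrite (mulrC (dl / 8)) mulrA; clear; lra.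
have MC : \sum_v p v * (~~ centre L v)%:R <= 4 * L + 4.
  apply: (@le_trans _ _ (mass R m [set v : V | ~~ centre L v])).
    rewrite -sum_pm_set [leRHS]big_mkcond; apply: ler_sum => v _; case: ifP => _; first by rewrite mulr1.
    by rewrite mulr0.
  apply: le_trans (edge_mass (L := L) m0 (ltW L0) _) _; last by exact: ar9.
  by move=> v; rewrite inE.
have PA3 : Pr p (fun w => eps * N%:R <= cnt A3 w) <= dl / 8.
  apply: le_trans (Pr_cnt A3 hp eN) _.
  apply: (@le_trans _ _ ((4 * L + 4) / (eps * N%:R))).
    rewrite ler_pM2r ?invr_gt0 //; apply: le_trans MC; apply: ler_sum => v _.
    by rewrite /A3 /Pr Ex_cst.
  rewrite (_ : (4 * L + 4) / (eps * N%:R) = (4 * L + 4) * (64 / (eps * dl)) / N%:R * (dl / 64)); last first.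
    by field; rewrite ?gt_eqF.
  have : (4 * L + 4) * (64 / (eps * dl)) / N%:R <= 1 by rewrite ler_pdivrMr // mul1r.
  move=> q; have q' := ler_wpM2r (_ : 0 <= dl / 64) q; apply: le_trans (q' _) _; first by nneg.
  by rewrite mul1r ler_pM2l // lef_pV2 ?posrE // ler_nat.
have PA1 : Pr p (fun w => Ex p (cnt A1) + eps * N%:R <= cnt A1 w) <= dl / 8.
  have D1 v : v \in winv L v :> bool by rewrite inE subrr normr0 ltW.
  have D2 v : dep (winv L v) (A1 v) by move=> w; rewrite /A1 -setIA setIid.
  have C40 : 0 <= 4 * L + 1 by rewrite addr_ge0 // mulr_ge0 // ltW.
  have D3 (v : V) : \sum_(z | ~~ [disjoint winv L v & winv L z]) p z <= 4 * L + 1.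
    rewrite sum_pm_set; apply: (@le_trans _ _ (mass R m (win (N * m) m (gX R v) (2 * L)))).
    apply: mass_mono; apply/subsetP => z; rewrite !inE => /pred0Pn[x /andP[]]; rewrite !inE => q1 q2.
    apply: le_trans (ler_distD (gX R x) _ _) _; rewrite distrC; move: q1 q2; clear; lra.
    apply: le_trans (mass_win _ _ m0 _) _; first by rewrite mulr_ge0 // ltW.
    have : m%:R^-1 <= 1 :> R by rewrite invf_le1 // ler1n.
    by clear; lra.
  have X := @cnt_var V p A1 (fun v => winv L v) N%:R (4 * L + 1) (eps * N%:R) hp (fun v => D1 _ _ v) D2 eN sM D3 C40.
  apply: le_trans X _.
  rewrite (_ : N%:R * (1 + (4 * L + 1)) / (eps * N%:R) ^+ 2 =
    (4 * L + 2) * (64 / (eps ^+ 2 * dl)) / N%:R * (dl / 64)); last by field; rewrite ?gt_eqF.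
  have : (4 * L + 2) * (64 / (eps ^+ 2 * dl)) / N%:R <= 1.
    rewrite ler_pdivrMr // mul1r; apply: le_trans K2; rewrite ler_pM2r //; lra.
  move=> q; have q' := ler_wpM2r (_ : 0 <= dl / 64) q; apply: le_trans (q' _) _; first by nneg.
  by rewrite mul1r ler_pM2l // lef_pV2 ?posrE // ler_nat.
have T1 := thr_kT (ltW k0) (ltW b0).
have mu : Ex p (cnt A1) <= (c + eps) * N%:R.
  rewrite Ex_cnt.
  have pt (v : V) : Pr p (fun w => A1 v (v |: w)) <=
    Dr (kT k b) l v + (~~ centre L v)%:R + (gU R v < h)%R%:R + 3 * g.
    have D0 : 0 <= Dr (kT k b) l v by apply: Pr_ge0.
    have le1 : Pr p (fun w => A1 v (v |: w)) <= 1 by apply: Pr_le1.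
    case: (boolP (centre L v)) => [cv|_] /=; last first.
    by apply: le_trans le1 _; case: (_ < h) => /=; move: D0 g0; clear; lra.
    case: ltP => [hv|hv] /=; first by apply: le_trans le1 _; move: D0 g0; clear; lra.
    rewrite !addr0; apply: (@le_trans _ _ (Pr p (fun w => reach (@e N m) (v |: w) v (Out l v)))).
    apply: Pr_le => // w; apply: reach_mono => //; exact: subsetIl.
    have hv' : 0 <= h <= gU R v by rewrite (ltW h0).
    have vS' : v \notin spread k b C l L v by rewrite inE subrr normr0 ltNge (ltW L0).
    apply: le_trans (@compare R (N * m) m (@e N m) (adj (kT k b)) (kT k b) v l L h d (spread k b C l L v) _ (ltW L0) lL (ltW d0) hv' vS' _ (spread_far k0 b0 C1 hfar l0 (ltW L0) cv) _) _.
    - by case: T1.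
    - by move=> y; apply: adj_refl.
    - move=> y z; rewrite !inE => yL zL hy hz eyz; rewrite /adj -ltNge => ny; apply/andP; split.
    by apply: ltW; apply: le_lt_trans ny; rewrite gerBl ltW.
    apply: (hnear y z hy hz _ eyz).
    apply: le_trans (ler_distD (gX R v) _ _) _; rewrite [X in _ + X]distrC.
    move: yL zL K4; clear; lra.
    apply: lerD; first exact: DL_le.
    have q1 := spread_mass v k0 b0 b1 C1 l0 u0 m0 hLd.
    have q2 := amb_budget L3 md.
    have q3 : 8 * ((2 * L + 3) * d) = g by rewrite /d; field; rewrite gt_eqF.
    rewrite q3 in q2; move: q1 q2 hg hu g0; clear; lra.
  apply: (@le_trans _ _ (\sum_v p v * (Dr (kT k b) l v + (~~ centre L v)%:R + (gU R v < h)%R%:R + 3 * g))).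
    by apply: ler_sum => v _; rewrite ler_wpM2l //; case/andP: (hp v).
  under eq_bigr => v _ do rewrite !mulrDr.
  rewrite !big_split /= -mulr_suml.
  have rows (f : V -> R) (q : R) : (forall i, (\sum_(j < m) f (i, j)) / m%:R <= q) -> \sum_v p v * f v <= N%:R * q.
    move=> hf; rewrite -mulr_sumr (_ : \sum_v f v = \sum_i \sum_j f (i, j)); last first.
    by rewrite pair_bigA; apply: eq_bigr => -[].
    rewrite (_ : N%:R * q = m%:R ^- 2 * \sum_(i < N * m) (q * m%:R)); last first.
    by rewrite sumr_const card_ord -[X in _ = _ * X]mulr_natl natrM; field; rewrite gt_eqF.
    rewrite ler_pM2l ?invr_gt0 ?exprn_gt0 //; apply: ler_sum => i _; by rewrite -ler_pdivrMr.
  have r1 : \sum_v p v * Dr (kT k b) l v <= N%:R * (c + eps / 2) by apply: rows => i; apply: Hm.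
  have r2 : \sum_v p v * (gU R v < h)%R%:R <= N%:R * h.
    by apply: rows => i; apply: rows_below => //; exact: ltW.
  have r3 : (\sum_v p v) * (3 * g) <= N%:R * (3 * g) by rewrite ler_wpM2r //; nneg.
  have r4 : \sum_v p v * (~~ centre L v)%:R <= N%:R * (eps / 16).
    apply: le_trans MC _; have K3' : (4 * L + 4) * 64 <= N%:R * eps by move: K3; rewrite -ler_pdivrMr // -mulrA.
    by rewrite mulrA; move: K3' (mulr_gt0 Nr eps0) L0; clear; lra.
  apply: le_trans (lerD (lerD (lerD r1 r4) r2) r3) _; rewrite -!mulrDr mulrC ler_pM2r //.
  move: hle g1 g0; clear; lra.
apply: (@le_trans _ _ (Pr p (fun w => ((eps * N%:R) ^+ 2 <= near_pairs l w) || ((Ex p (cnt A1) + eps * N%:R <= cnt A1 w) ||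
   ((eps * N%:R <= cnt A2 w) || (eps * N%:R <= cnt A3 w)))))).
  apply: Pr_le => // w hw; apply: contraLR hw; rewrite !negb_or -!ltNge => /and4P[s1 s2 s3 s4].
  apply: le_lt_trans (split w s1) _; move: mu s2 s3 s4 eN; rewrite !mulrDl; clear; lra.
apply: le_trans (Pr_or _ _ hp) _; apply: (@le_trans _ _ (dl / 8 + (dl / 8 + (dl / 8 + dl / 8)))); last by exact: ar8.
apply: lerD => //; apply: le_trans (Pr_or _ _ hp) _; apply: lerD => //.
by apply: le_trans (Pr_or _ _ hp) _; apply: lerD.
Qed.

End Upper.

(** * Gluing escaped vertices into one component *)

Section Lower.
Import Fin.
Variable R : realType.
Implicit Types (T : R -> R -> R) (l L k b q h d : R).

Definition giant (V : finType) (e : rel V) (s : R) (w : {set V}) : bool := [exists v in w, bigc e s v w].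

Lemma Ex_card2 (V : finType) (p : V -> R) M : prob p -> \sum_v p v <= M -> 0 <= M ->
  Ex p (fun w => #|w|%:R * #|w|%:R) <= M * (1 + M).
Proof.
move=> hp hM M0.
have E1 : Ex p (fun w : {set V} => #|w|%:R) = \sum_v p v.
  transitivity (Ex p (fun w => \sum_v (v \in w)%:R)).
    apply: eq_Ex => w; rewrite -sum1_card natr_sum big_mkcond; apply: eq_bigr => v _; by case: (v \in w).
  by rewrite Ex_sum; apply: eq_bigr => v _; exact: Pr_in.
have -> : Ex p (fun w : {set V} => #|w|%:R * #|w|%:R) = \sum_v p v * Ex p (fun w => #|v |: w|%:R).
  transitivity (Ex p (fun w => \sum_v (v \in w)%:R * #|w|%:R)).
    apply: eq_Ex => w; rewrite -mulr_suml; congr (_ * _).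
    rewrite -sum1_card natr_sum big_mkcond; apply: eq_bigr => v _; by case: (v \in w).
  by rewrite Ex_sum; apply: eq_bigr => v _; rewrite mecke.
apply: (@le_trans _ _ (\sum_v p v * (1 + M))).
  apply: ler_sum => v _; rewrite ler_wpM2l //; first by case/andP: (hp v).
  apply: (@le_trans _ _ (Ex p (fun w : {set V} => 1 + #|w|%:R))).
    by apply: Ex_le => // w; rewrite cardsU1 natrD lerD2r; case: (v \notin w).
  by rewrite ExD Ex_cst lerD2l E1.
by rewrite -mulr_suml ler_wpM2r // addr_ge0.
Qed.

Lemma cnt_le_card (V : finType) (P : V -> {set V} -> bool) (w : {set V}) : cnt R P w <= #|w|%:R.
Proof.
rewrite /cnt -sum1_card natr_sum; apply: ler_sum => v _; by case: (P v w).
Qed.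

(* Reverse Markov: the count of [A] is at most (c + O(eps)) N off a bad event, so its mean forces it
   to be close to c N with high probability. *)
Lemma glue_giant (V : finType) (p : V -> R) (e : rel V) (A : V -> {set V} -> bool) (G : {set V} -> bool)
    (c eps eta M : R) : prob p -> \sum_v p v <= M -> 1 <= M -> 0 <= c -> 0 < eps -> eps <= 1 ->
  0 < eta -> eta <= 1 -> 0 < c - eta ->
  (c - eps) * M <= Ex p (cnt R A) -> Pr p (fun w => ~~ G w) <= eps ^+ 2 ->
  (forall w v v', G w -> v \in w -> v' \in w -> A v w -> A v' w -> connect (gr e w) v v') ->
  Pr p (fun w => (c + 6 * eps) * M <= cnt R (bigc e (eps * M)) w) <= eps ^+ 2 ->
  Pr p (fun w => ~~ giant e ((c - eta) * M) w) <= 30 * eps / eta.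
Proof.
move=> hp hM M1 c0 eps0 eps1 eta0 eta1 ce hE hG hg hU.
have M0 : 0 < M by apply: lt_le_trans M1.
pose B (w : {set V}) := ~~ G w || ((c + 6 * eps) * M <= cnt R (bigc e (eps * M)) w).
pose S (w : {set V}) := ~~ giant e ((c - eta) * M) w.
have PB : Pr p B <= 2 * eps ^+ 2.
  by apply: le_trans (Pr_or _ _ hp) _; rewrite (_ : 2 * eps ^+ 2 = eps ^+ 2 + eps ^+ 2); [exact: lerD|ring].
have comp_ge (w : {set V}) v : G w -> v \in w -> A v w -> cnt R A w <= #|clus e w v|%:R.
  move=> Gw vw Av; have -> : cnt R A w = #|[set z in w | A z w]|%:R.
    rewrite cntE -sum1_card natr_sum [in RHS]big_mkcond; apply: eq_bigr => z _; rewrite inE.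
    by case: (z \in w); case: (A z w).
  rewrite ler_nat; apply: subset_leq_card; apply/subsetP => z; rewrite !inE => /andP[zw Az].
  exact: hg Az.
have key w : cnt R A w <= (c + 6 * eps) * M - (eta + 6 * eps) * M * (S w)%:R +
    ((eps / M) * (#|w|%:R * #|w|%:R) + (M / eps + 7 * M) * (B w)%:R).
  have sq0 : 0 <= (eps / M) * (#|w|%:R * #|w|%:R) by nneg.
  case: (boolP (B w)) => [_|].
    apply: le_trans (cnt_le_card _ _) _; rewrite mulr1.
    (* On the bad event the count is only known to be at most [#|w|]. This trades it for a multiple
       of the second moment, of order eps M on average, and a multiple of [Pr p B]. *)
    have amgm : #|w|%:R <= (eps / M) * (#|w|%:R * #|w|%:R) + M / eps.
    set x := #|w|%:R; have x0 : 0 <= x by exact: ler0n.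
    have : 0 <= (eps / M) * (x - M / eps) ^+ 2 + x by rewrite addr_ge0 // mulr_ge0 ?sqr_ge0 //; nneg.
    rewrite (_ : (eps / M) * (x - M / eps) ^+ 2 + x = (eps / M) * (x * x) + M / eps - x); last first.
    by field; rewrite ?gt_eqF.
    by rewrite subr_ge0.
    have sS : (eta + 6 * eps) * M * (S w)%:R <= 7 * M.
    apply: (@le_trans _ _ ((eta + 6 * eps) * M)).
    by rewrite ler_piMr // ?mulr_ge0 ?(ltW M0) //; [nneg|case: (S w)].
    rewrite ler_pM2r //; move: eta1 eps1; clear; lra.
    have cM : 0 <= (c + 6 * eps) * M by nneg.
    move: amgm sS cM; set t1 := _ * M; set t2 := _ * _ * (S w)%:R; set t3 := _ * (_ * _); set t4 := M / eps.
    set t5 := #|w|%:R; set t6 := 7 * M; clear; lra.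
  rewrite /B negb_or negbK -ltNge => /andP[Gw Uw]; rewrite mulr0 addr0.
  apply: (@le_trans _ _ ((c + 6 * eps) * M - (eta + 6 * eps) * M * (S w)%:R)); last by rewrite lerDl.
  case: (boolP [exists v in w, A v w]) => [/existsP[v /andP[vw Av]]|nA]; last first.
    have -> : cnt R A w = 0.
    rewrite /cnt big1 // => v vw; case: (boolP (A v w)) => // Av.
    by case/negP: nA; apply/existsP; exists v; rewrite vw.
    rewrite -mulrA [M * _]mulrC mulrA -mulrBl mulr_ge0 ?(ltW M0) // subr_ge0.
    apply: (@le_trans _ _ (eta + 6 * eps)); first by rewrite ler_piMr //; [nneg|case: (S w)].
    rewrite lerD2r; move: ce; clear; lra.
  case: (boolP (S w)) => [Sw|_].
    rewrite mulr1 -mulrBl (_ : c + 6 * eps - (eta + 6 * eps) = c - eta); last by ring.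
    apply: le_trans (comp_ge _ _ Gw vw Av) _; rewrite leNgt; apply: contra Sw => h.
    by apply/existsP; exists v; rewrite vw; exact: ltW.
  rewrite mulr0 subr0.
  have [le|gt] := lerP (eps * M) (cnt R A w); last first.
    apply: le_trans (ltW gt) _; rewrite ler_pM2r //; move: c0 eps0; clear; lra.
  apply: le_trans (ltW Uw); apply: cnt_le => z zw Az; apply: le_trans le _; exact: comp_ge.
have : (c - eps) * M <= (c + 6 * eps) * M - (eta + 6 * eps) * M * Pr p S +
    ((eps / M) * (M * (1 + M)) + (M / eps + 7 * M) * Pr p B).
  apply: le_trans hE _; apply: le_trans (Ex_le hp key) _.
  have -> : Ex p (fun w => (c + 6 * eps) * M - (eta + 6 * eps) * M * (S w)%:R +
    ((eps / M) * (#|w|%:R * #|w|%:R) + (M / eps + 7 * M) * (B w)%:R)) =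
    (c + 6 * eps) * M - (eta + 6 * eps) * M * Pr p S +
    ((eps / M) * Ex p (fun w => #|w|%:R * #|w|%:R) + (M / eps + 7 * M) * Pr p B).
    rewrite ExD ExD Ex_cst ExD !ExZ; congr (_ + _ + _).
    rewrite -mulNr /Pr -ExZ; apply: eq_Ex => w; by rewrite mulNr.
  rewrite lerD2l lerD2r ler_wpM2l //; first by nneg.
  by apply: Ex_card2 => //; exact: ltW.
have -> : (eps / M) * (M * (1 + M)) = eps * (1 + M) by field; rewrite gt_eqF.
have q1 : eps * (1 + M) <= 2 * eps * M.
  rewrite [2 * eps]mulrC -mulrA ler_pM2l //; move: M1; clear; lra.
have q2 : (M / eps + 7 * M) * Pr p B <= 16 * eps * M.
  apply: le_trans (_ : (M / eps + 7 * M) * (2 * eps ^+ 2) <= _); first by rewrite ler_wpM2l //; nneg.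
  rewrite (_ : (M / eps + 7 * M) * (2 * eps ^+ 2) = (2 * eps + 14 * eps * eps) * M); last by field; rewrite gt_eqF.
  rewrite ler_pM2r //; have : eps * eps <= eps by rewrite ler_piMl // ltW.
  clear; lra.
move=> H.
have H2 : (eta + 6 * eps) * Pr p S * M <= 25 * eps * M.
  move: H q1 q2; set t := _ * Pr p B; clear; lra.
rewrite ler_pM2r // mulrDl in H2.
rewrite ler_pdivlMr // mulrC; apply: le_trans (_ : _ <= 25 * eps) _; last by move: eps0; clear; lra.
apply: le_trans H2; rewrite lerDl mulr_ge0 ?Pr_ge0 //; nneg.
Qed.

Lemma sum_central N m (F : 'I_(N * m) * 'I_m -> R) (M q : R) : (0 < m)%N -> 0 <= q -> 0 <= M ->
  (forall v, 0 <= F v) ->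
  (forall i : 'I_(N * m), M * m%:R <= i%:R -> i%:R + M * m%:R + 1 <= N%:R * m%:R ->
    q <= (\sum_(j < m) F (i, j)) / m%:R) ->
  (N%:R - 2 * M - 2 / m%:R) * q <= \sum_v @pm R m _ v * F v.
Proof.
move=> m0 q0 M0 F0 hF; have mp : 0 < m%:R :> R by rewrite ltr0n.
have -> : \sum_v @pm R m _ v * F v = \sum_(i < N * m) m%:R^-1 * ((\sum_(j < m) F (i, j)) / m%:R).
  rewrite -mulr_sumr (_ : \sum_v F v = \sum_i \sum_j F (i, j)); last first.
    by rewrite pair_bigA; apply: eq_bigr => -[].
  by rewrite mulr_sumr; apply: eq_bigr => i _; field; rewrite gt_eqF.
rewrite (bigID [pred i : 'I_(N * m) | M * m%:R <= i%:R <= N%:R * m%:R - M * m%:R - 1]) /= -[leLHS]addr0.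
apply: lerD; last first.
  by apply: sumr_ge0 => i _; rewrite !mulr_ge0 ?invr_ge0 ?(ltW mp) //; apply: sumr_ge0.
apply: (@le_trans _ _ (\sum_(i < N * m | M * m%:R <= i%:R <= N%:R * m%:R - M * m%:R - 1) m%:R^-1 * q)).
  rewrite sumr_const -[leRHS]mulr_natl mulrA ler_wpM2r // ler_pdivlMr //.
  have h := @count_ge R (N * m) (M * m%:R) (N%:R * m%:R - M * m%:R - 1) (mulr_ge0 M0 (ltW mp)) _.
  apply: le_trans (h _); last by rewrite natrM; have := mulr_ge0 M0 (ltW mp); lra.
  rewrite !mulrBl divfK ?gt_eqF //; lra.
apply: ler_sum => i /andP[i1 i2]; rewrite ler_pM2l ?invr_gt0 //; apply: hF => //; lra.
Qed.

Variable UF : set_system nat.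
Hypotheses (UFu : UltraFilter UF) (UFoo : tails UF).

Lemma upper_ideal k b (eps dl : R) : 0 < k -> 0 < b < 1 -> 0 < eps -> 0 < dl ->
  exists N0 : nat, forall N, (N0 <= N)%N ->
  UF (fun m => Pr (@pm R m _) (fun w => (cc UF k b + 6 * eps) * N%:R <=
    cnt R (fun v w => bigc (@adj R (kT k b) (N * m) m) (eps * N%:R) v w) w) <= dl).
Proof.
move=> k0 /andP[b0 b1] eps0 dl0.
apply: (@upper R UF UFu UFoo k b 1 (fun N m => @adj R (kT k b) (N * m) m)) => //.
- by move=> N m; apply: adj_sym; exact: thr_kT (ltW _) (ltW _).
- by move=> N; apply: UF_imp (UFoo 0) => m _ x y h; left; rewrite mul1r.
by move=> h d h0 d0; exists 0%N => N _; apply: UF_imp (UFoo 0) => m _ x y _ _ _ h1; apply: le_trans h1 _; rewrite lerDl ltW.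
Qed.

(** At heights up to h' = H / 4^K all sites of a line of length N are adjacent once k h'^(-2b) >= N.
    The first such K keeps this quantity below 16 N, since one rung multiplies it by 4^(2b) <=
    16. *)
Lemma clique_scale k b H (N : nat) : 0 < k -> 2^-1 < b < 1 -> 0 < H -> k * H `^ (- (2 * b)) < N%:R ->
  exists K, N%:R <= k * (H / 4 ^+ K) `^ (- (2 * b)) <= 16 * N%:R.
Proof.
move=> k0 /andP[b0 b1] H0 hN.
have s0 K : 0 < H / 4 ^+ K by rewrite divr_gt0 // exprn_gt0.
have step K : (H / 4 ^+ K.+1) `^ (- (2 * b)) = 4 `^ (2 * b) * (H / 4 ^+ K) `^ (- (2 * b)).
  rewrite exprS invfM mulrCA powRM ?invr_ge0 ?(ltW (s0 K)) //; congr (_ * _).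
  by rewrite -powR_inv1 // -powRrM mulN1r opprK.
have p1 : 4 <= (4 : R) `^ (2 * b) by rewrite -[leLHS]powRr1 // ler_powR; lra.
have p2 : (4 : R) `^ (2 * b) <= 16.
  rewrite (_ : 16 = 4 `^ 2); first by rewrite ler_powR //; lra.
  by rewrite powR_mulrn // expr2; ring.
have grow K : k * H `^ (- (2 * b)) * 4 ^+ K <= k * (H / 4 ^+ K) `^ (- (2 * b)).
  elim: K => [|K IH]; first by rewrite expr0 invr1 !mulr1.
  rewrite step exprS [leLHS]mulrCA [leRHS]mulrCA.
  by apply: ler_pM => //; rewrite mulr_ge0 ?exprn_ge0 // mulr_ge0 ?powR_ge0 // ltW.
have c0 : 0 < k * H `^ (- (2 * b)) by rewrite mulr_gt0 // powR_gt0.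
have ex : exists K, N%:R <= k * (H / 4 ^+ K) `^ (- (2 * b)).
  have [K hK] := pow4_large (N%:R / (k * H `^ (- (2 * b)))).
  by exists K; apply: le_trans (grow K); rewrite mulrC -ler_pdivrMr.
case: (ex_minnP ex) => -[|K] hK min; first by move: hK; rewrite expr0 invr1 mulr1 leNgt hN.
exists K.+1; rewrite hK /= step mulrCA; apply: ler_pM; rewrite ?powR_ge0 //; first by rewrite mulr_ge0 ?powR_ge0 // ltW.
by rewrite leNgt; apply/negP => /ltW /min; rewrite ltnn.
Qed.

Lemma gX_lt N m (x : 'I_(N * m) * 'I_m) : gX R x < N%:R.
Proof.
have mp : 0 < m%:R :> R by rewrite ltr0n (cell_m0 x).
by rewrite /gX ltr_pdivrMr // -natrM ltr_nat ltn_ord.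
Qed.

Lemma gX_dist N m (x y : 'I_(N * m) * 'I_m) : `|gX R x - gX R y| <= N%:R.
Proof. by have := gX_lt x; have := gX_lt y; have := gX_ge0 R x; have := gX_ge0 R y; rewrite ler_norml; lra. Qed.

Lemma lower_mean (N q c eps a : R) : 0 <= eps -> 0 <= a -> c <= 1 -> 0 < c - eps / 2 -> c - eps / 2 <= q ->
  a <= eps / 2 * N -> a <= N -> (c - eps) * N <= (N - a) * q.
Proof.
move=> e0 a0 c1 c0 hq ha aN; apply: (@le_trans _ _ ((N - a) * (c - eps / 2))); last by rewrite ler_wpM2l // subr_ge0.
have : a * (c - eps / 2) <= a * 1 by rewrite ler_wpM2l //; lra.
lra.
Qed.

(** The vertices counted are those connected to the clique of [clique_scale], so any two of them are
    connected; [chain] bounds their mean number from below. *)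
Lemma lower_super k b (eta dl : R) : 0 < k -> 2^-1 < b < 1 -> 0 < eta -> eta <= 1 -> 0 < dl ->
  0 < cc UF k b - eta -> exists N0 : nat, forall N, (N0 <= N)%N ->
  UF (fun m => Pr (@pm R m _) (fun w => ~~ giant (@adj R (kT k b) (N * m) m) ((cc UF k b - eta) * N%:R) w) <= dl).
Proof.
move=> k0 b01 eta0 eta1 dl0 ce; set c := cc UF k b in ce *.
have b02 : 0 < b < 1 by move: b01; lra.
pose eps := Num.min eta (dl * eta / 30).
have eps0 : 0 < eps by rewrite lt_min eta0; pstv.
have epse : eps <= eta by rewrite ge_min lexx.
have eps1 : eps <= 1 by apply: le_trans eta1.
have eps30 : 30 * eps / eta <= dl.
  by rewrite ler_pdivrMr // mulrC -ler_pdivlMr // ge_min lexx orbT.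
have c1 : c <= 1 by exact: cc_le1.
have qc : c - eps / 4 < c by rewrite gtrBl divr_gt0.
have q0 : 0 <= c - eps / 4 by move: ce epse eps0; clear; lra.
have e40 : 0 < eps / 4 by pstv.
(* The ladder runs with k / 64 so that its windows fit at the height of the clique: there 2 (k / 64)
   h'^(-2b) <= N / 2. *)
have k10 : 0 < k / 64 by pstv.
have b1h : 2^-1 < b by case/andP: b01.
have [l [L [h [d [H [[l1 lL h01 d0 H01] ch]]]]]] := chain UFu UFoo k0 b01 k10 b1h q0 qc e40.
have L0 : 0 <= L by apply: le_trans lL; apply: le_trans l1.
have [N1 hN1] := upper_ideal k0 b02 eps0 (exprn_gt0 2 eps0).
have [N2 hN2] := nat_large (k * H `^ (- (2 * b)) + 1 + (2 * L + 2) / (eps / 2) + (2 * L + 2)).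
exists (maxn N1 (maxn N2 1)) => N; rewrite !geq_max => /and3P[NN1 NN2 Np].
have Nr : 1 <= N%:R :> R by rewrite ler1n.
have x1 : 0 <= k * H `^ (- (2 * b)) by rewrite mulr_ge0 ?powR_ge0 // ltW.
have x2 : 0 <= (2 * L + 2) / (eps / 2) by rewrite divr_ge0 // ?addr_ge0 ?mulr_ge0 //; apply: ltW; pstv.
have {}hN2 : k * H `^ (- (2 * b)) + 1 + (2 * L + 2) / (eps / 2) + (2 * L + 2) <= N%:R.
  by apply: le_trans hN2 _; rewrite ler_nat.
have y1 : k * H `^ (- (2 * b)) < N%:R by move: hN2 x2 L0; clear; lra.
have y2 : 2 * L + 2 <= eps / 2 * N%:R.
  have : (2 * L + 2) / (eps / 2) <= N%:R by move: hN2 x1 L0; clear; lra.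
  by rewrite [eps / 2 * _]mulrC -ler_pdivrMr // divr_gt0.
have y3 : 2 * L + 2 <= N%:R by move: hN2 x1 x2; clear; lra.
have [H0 H1] := andP H01.
have [K /andP[K1 K2]] := clique_scale k0 b01 H0 y1; set h' := H / 4 ^+ K in K1 K2.
have h'0 : 0 < h' by rewrite /h' divr_gt0 // exprn_gt0.
have T1 : thr (kT k b) by apply: thr_kT; apply: ltW => //; case/andP: b02.
have := ch (kT k b) K T1 _ _; rewrite -/h' => {}ch.
apply: UF_imp (UF_and UFu (hN1 N NN1) (UF_and UFu (ch _ _) (UFoo 4))) => [m [hup [hm m4]]||]; last first.
- by move=> x y /andP[hx hx1] /andP[hy hy1]; apply: kT_mono => //; [rewrite (ltW k10) /=; lra| |];
    apply/andP; split => //; [apply: lt_trans hx|apply: lt_trans hy]; pstv.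
- by move=> x y _ _; rewrite subrr normr0 ltW.
have m0 : (0 < m)%N by apply: leq_trans m4.
have mp : 0 < m%:R :> R by rewrite ltr0n.
have m2 : 2 / m%:R <= 2 :> R by rewrite ler_pdivrMr // ler_peMr // ler1n.
pose p := @pm R m ('I_(N * m) * 'I_m)%type; have hp : prob p by exact: prob_pm.
pose e := @adj R (kT k b) (N * m) m.
pose A (v : 'I_(N * m) * 'I_m) (w : {set 'I_(N * m) * 'I_m}) := reach e w v (high h').
have sM : \sum_v p v <= N%:R by rewrite sum_pm grid_mass.
apply: le_trans (glue_giant (A := A) (G := fun=> true) hp sM Nr (cc_ge0 UFu UFoo k b) eps0 eps1 eta0 eta1 ce _ _ _ hup) eps30.
- rewrite Ex_cnt; apply: le_trans (sum_central m0 (q := c - eps / 4 - eps / 4) _ L0 _ _); last 3 first.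
  + move: ce epse eps0; clear; lra.
  + by move=> v; apply: Pr_ge0.
  + move=> i i1 i2; apply: hm => //; first by rewrite natrM.
    rewrite natrM; have := ler_pM2r mp (2 * (k / 64 * h' `^ (- (2 * b)))) (N%:R / 2).
    have -> : 2 * (k / 64 * h' `^ (- (2 * b))) <= N%:R / 2 by move: K2; clear; lra.
    have : 4 <= N%:R * m%:R :> R.
    by rewrite -natrM ler_nat (leq_trans m4) // leq_pmull.
    clear; lra.
  rewrite -/c (_ : N%:R - 2 * L - 2 / m%:R = N%:R - (2 * L + 2 / m%:R)); last by ring.
  apply: (@lower_mean N%:R (c - eps / 4 - eps / 4) c eps (2 * L + 2 / m%:R)) => //.
  + exact: ltW.
  + by rewrite addr_ge0 ?mulr_ge0 // ?divr_ge0.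
  + move: ce epse eps0; clear; lra.
  + clear; lra.
  + by apply: le_trans y2; rewrite lerD2l.
  + by apply: le_trans y3; rewrite lerD2l.
- by rewrite (_ : Pr p _ = 0); [nneg|exact: Ex_cst].
move=> w v v' _ vw v'w /existsP[z /andP[hz cz]] /existsP[z' /andP[hz' cz']].
have e_sym : symmetric (gr e w) by apply: gr_sym; apply: adj_sym.
have inw x y : x \in w -> connect (gr e w) x y -> y \in w.
  by move=> xw cxy; have [<- //|ne] := eqVneq x y; case/andP: (conn_in cxy ne).
apply: (connect_trans cz); have cs := sym_connect_sym e_sym; rewrite cs in cz'.
apply: (connect_trans _ cz'); apply: connect1; rewrite /gr (inw v z) // (inw v' z') //=; last by rewrite cs.
rewrite /e /adj; apply: le_trans (gX_dist _ _) (le_trans K1 _).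
rewrite /kT ler_pM2l // (_ : h' `^ (- (2 * b)) = (h' * h') `^ (- b)); last first.
  by rewrite -{2 3}[h']powRr1 ?(ltW h'0) // -powRD ?gt_eqF ?implybT // -powRrM; congr (_ `^ _); ring.
apply: powR_anti; [lra|by rewrite mulr_gt0 ?gU_gt0|].
by apply: ler_pM => //; exact/ltW/gU_gt0.
Qed.

(** By [adj_cover] the crossing, which stays above [eta], is joined to every site of height at most
    [eta] between its ends. *)
Lemma cross_glue k (eta : R) (t D n m : nat) (hs : (0 + ((t + 2) * D).+1 <= n)%N) (w : {set 'I_n * 'I_m}) (x1 x2 : R) z z' :
  0 < k -> (0 < t)%N -> (0 < D)%N ->
  D%:R <= x1 * m%:R -> x2 * m%:R <= (t.+1 * D)%:R ->
  cross (adj (kT k 2^-1)) eta D (t.+1 * D) (emb hs @^-1: w) -> z \in w -> z' \in w ->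
  high eta z -> high eta z' -> x1 <= gX R z <= x2 -> x1 <= gX R z' <= x2 ->
  connect (gr (adj (kT k 2^-1)) w) z z'.
Proof.
move=> k0 t0 D0 h1 h2 /existsP[a /existsP[b /and3P[ha hb cab]]] zw z'w hz hz' xz xz'.
have T1 : thr (kT k 2^-1) by apply: thr_kT => //; exact: ltW.
have m0 := cell_m0 z; have mp : 0 < m%:R :> R by rewrite ltr0n.
pose e := @adj R (kT k 2^-1) n m.
have es : symmetric (gr e w) by apply: gr_sym; exact: adj_sym.
have ab : a != b by apply: contraTneq hb => <-; rewrite -ltnNge (leq_ltn_trans ha) // -[X in (X < _)%N]mul1n ltn_pmul2r.
have aw : connect (gr e (above eta w)) (emb hs a) (emb hs b).
  move: cab; rewrite -(conn_img (@shift_inj _ _ m _ hs) (@shift_adj R (kT k 2^-1) _ _ m _ hs)).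
  apply: conn_mono => //; apply/subsetP => x /imsetP[y]; rewrite !inE => /andP[yw hy] ->.
  by rewrite yw /= /high shift_U.
have abw : emb hs a != emb hs b by apply: contra ab => /eqP/shift_inj ->.
have [aa _] := andP (conn_in aw abw).
have sub : above eta w \subset w by apply/subsetP => x; rewrite inE => /andP[].
have to_a y : y \in w -> high eta y -> x1 <= gX R y <= x2 -> connect (gr e w) (emb hs a) y.
  move=> yw hy /andP[y1 y2].
  have Xa : gX R (emb hs a) <= gX R y.
    apply: le_trans y1; rewrite shift_X mul0r add0r /gX ler_pdivrMr //; apply: le_trans h1; by rewrite ler_nat.
  have Xb : gX R y <= gX R (emb hs b).
    apply: le_trans y2 _; rewrite shift_X mul0r add0r /gX ler_pdivlMr //; apply: le_trans h2 _; by rewrite ler_nat.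
  have hU x : x \in emb hs a |: above eta w -> gU R y <= gU R x.
    rewrite in_setU1 => /orP[/eqP->|xa]; [move: aa|move: xa]; rewrite inE /high -ltNge => /andP[_ h]; exact: le_trans hy (ltW h).
  have [|q cq eq] := adj_cover T1 aw hU; first by left; rewrite Xa.
  have cq' : connect (gr e w) (emb hs a) q by apply: conn_mono cq.
  apply: (connect_trans cq'); apply: connect1; rewrite /gr yw /e eq !andbT.
  have [<-|ne] := eqVneq (emb hs a) q; first exact: (subsetP sub).
  by case/andP: (conn_in cq' ne).
have := to_a z zw hz xz; rewrite (sym_connect_sym es) => c1; exact: connect_trans c1 (to_a _ _ _ _).
Qed.

Lemma lower_crit k (eta dl : R) : 0 < k -> 0 < eta -> eta <= 1 -> 0 < dl ->
  0 < cc UF k 2^-1 - eta -> exists N0 : nat, forall N, (N0 <= N)%N ->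
  UF (fun m => Pr (@pm R m _)
    (fun w => ~~ giant (@adj R (kT k 2^-1) (N * m) m) ((cc UF k 2^-1 - eta) * N%:R) w) <= dl).
Proof.
move=> k0 eta0 eta1 dl0 ce; set c := cc UF k 2^-1 in ce *.
have b01 : 0 < (2^-1 : R) < 1 by apply/andP; split; lra.
have b01' : 0 <= (2^-1 : R) < 1 by apply/andP; split; lra.
pose eps := Num.min eta (dl * eta / 30).
have eps0 : 0 < eps by rewrite lt_min eta0; pstv.
have epse : eps <= eta by rewrite ge_min lexx.
have eps1 : eps <= 1 by apply: le_trans eta1.
have eps30 : 30 * eps / eta <= dl.
  by rewrite ler_pdivrMr // mulrC -ler_pdivlMr // ge_min lexx orbT.
have c1 : c <= 1 by exact: cc_le1.
have cp : 0 < c by move: ce eta0; clear; lra.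
have e8 : 0 < eps / 16 by pstv.
have qc : c - eps / 8 < c by rewrite gtrBl divr_gt0.
have q0 : 0 <= c - eps / 8 by move: ce epse eps0; clear; lra.
have [s1 /andP[s10 s11] hs1] := @small_powR R 2^-1 (4 * k) (eps / 16) (ltac:(lra)) (ltac:(nneg)) e8.
pose s := Num.min s1 (eps / 48).
have s0 : 0 < s by rewrite lt_min s10; pstv.
have sb : 4 * k * s `^ 2^-1 + 3 * s <= eps / 8.
  have a1 : 4 * k * s `^ 2^-1 <= eps / 16.
    apply: le_trans hs1; rewrite ler_wpM2l ?mulr_ge0 ?(ltW k0) //; apply: ge0_ler_powR; rewrite ?nnegrE ?(ltW s0) ?(ltW s10) ?invr_ge0 //.
    by rewrite ge_min lexx.
  have a2 : s <= eps / 48 by rewrite ge_min lexx orbT.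
  move: a1 a2; clear; lra.
pose B := 1 + k * s `^ (- 2^-1).
have B1 : 1 <= B by rewrite lerDl mulr_ge0 ?powR_ge0 // ltW.
have B0 : 0 < B by apply: lt_le_trans B1.
pose de := eps / (16 * B).
have de0 : 0 < de by pstv.
have deB : de * B = eps / 16 by rewrite /de; field; rewrite gt_eqF.
have [t0 ht0] := nat_large (64 / (k * de * eps) + 32 / eps + 1 / (k * de) + 1).
pose t := maxn t0 1; have tp : (0 < t)%N by rewrite leq_max orbT.
have z1 : 0 < 64 / (k * de * eps) by pstv.
have z2 : 0 < 32 / eps by pstv.
have z3 : 0 < 1 / (k * de) by pstv.
have ht : 64 / (k * de * eps) + 32 / eps + 1 / (k * de) + 1 <= (t + 3)%:R.
  by apply: le_trans ht0 _; rewrite ler_nat; apply: leq_trans (leq_addr 3 _); exact: leq_maxl.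
set t3 : R := (t + 3)%:R in ht.
have t30 : 0 < t3 by rewrite /t3 ltr0n addn3.
have [h0 h00 hcr] := crossing UFu UFoo k0 tp (exprn_gt0 2 eps0) cp.
have [N1 hN1] := upper_ideal k0 b01 eps0 (exprn_gt0 2 eps0).
have [N2 hN2] := nat_large (k * t3 / h0 + k * t3 + 1 / de + 8 / eps + 2).
exists (maxn N1 (maxn N2 1)) => N; rewrite !geq_max => /and3P[NN1 NN2 Np].
have Nr : 1 <= N%:R :> R by rewrite ler1n.
have N0 : 0 < N%:R :> R by rewrite ltr0n.
have x1 : 0 < k * t3 / h0 by pstv.
have x2 : 0 < k * t3 by pstv.
have x3 : 0 < 1 / de by pstv.
have x4 : 0 < 8 / eps by pstv.
have {}hN2 : k * t3 / h0 + k * t3 + 1 / de + 8 / eps + 2 <= N%:R by apply: le_trans hN2 _; rewrite ler_nat.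
pose eta0' := k * t3 / N%:R.
have f0 : 0 < eta0' by pstv.
have f1 : eta0' <= 1 by rewrite ler_pdivrMr // mul1r; move: hN2 x1 x3 x4; clear; lra.
have f2 : eta0' <= h0.
  rewrite ler_pdivrMr // [h0 * _]mulrC -ler_pdivrMr //; move: hN2 x2 x3 x4; clear; lra.
(* Lengths are taken proportional to N and heights to 1 / N. By scale invariance the tail bound with
   u = s / l is controlled by [s] alone ([tauE]). *)
pose l := de * N%:R; have l0 : 0 < l by pstv.
have l1 : 1 <= l.
  rewrite /l mulrC -ler_pdivrMr //; move: hN2 x1 x2 x4; clear; lra.
have f3 : l^-1 <= eta0'.
  rewrite invf_ple ?posrE // /eta0' /l invf_div ler_pdivrMr // mulrAC mulrA.
  have : 1 <= k * de * t3.
    rewrite mulrC -ler_pdivrMr; last by pstv.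
    move: ht z1 z2; clear; lra.
  by move=> q; have := ler_wpM2r (ltW N0) q; rewrite mul1r; move: q; clear; lra.
have f4 : 8 / (eta0' * l) <= eps / 8.
  have -> : eta0' * l = k * de * t3 by rewrite /eta0' /l; field; rewrite gt_eqF.
  rewrite ler_pdivrMr; last by pstv.
  have : 64 / (k * de * eps) <= t3 by move: ht z2 z3; clear; lra.
  rewrite ler_pdivrMr; last by pstv.
  by clear; lra.
pose L := l * B.
have lL : l <= L by rewrite ler_peMr // ltW.
have L0 : 0 <= L by apply: le_trans lL; exact: ltW.
have LE : L = eps / 16 * N%:R by rewrite /L /l mulrAC deB.
pose u := s / l; have u0 : 0 < u by pstv.
have ul : l * u = s by rewrite /u; field; rewrite gt_eqF.
have hLd : l + k * l `^ 2^-1 * u `^ (- 2^-1) <= L.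
  rewrite -[k * _ * _]mulrA; have -> : l `^ 2^-1 * u `^ (- 2^-1) = l * s `^ (- 2^-1).
    have lh : l `^ (2^-1 : R) * l `^ (2^-1 : R) = l by exact: powR_half.
    have hh : l `^ (2^-1 : R) * l `^ (2^-1 : R) * l `^ (- 2^-1) = l `^ 2^-1.
    by rewrite -mulrA [_ * l `^ (- _)]mulrC powR_halfV // mulr1.
    have E : (l * u) `^ (- 2^-1) = l `^ (- 2^-1) * u `^ (- 2^-1) by apply: powRM; exact: ltW.
    by rewrite -ul E mulrA -hh lh.
  by rewrite /L /B mulrDr mulr1 mulrCA.
have tauE : tau k 2^-1 l u <= eps / 8.
  apply: le_trans sb; rewrite /tau (_ : 1 - 2^-1 = 2^-1 :> R); last by lra.
  have us : u <= s by rewrite -ul ler_peMl // ltW.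
  have -> : 2 * (k * l `^ 2^-1) * (u `^ 2^-1 / 2^-1) = 4 * k * s `^ 2^-1.
    have -> : s `^ (2^-1 : R) = l `^ (2^-1 : R) * u `^ (2^-1 : R) by rewrite -ul powRM // ltW.
    by field.
  rewrite lerD2l mulrDl mul1r -mulrA ul; move: us; clear; lra.
pose M := L + 2 * N%:R / t3.
have tE : 2 * N%:R / t3 <= eps / 16 * N%:R.
  rewrite mulrAC ler_pM2r // ler_pdivrMr //.
  have : 32 / eps <= t3 by move: ht z1 z3; clear; lra.
  rewrite ler_pdivrMr //; clear; lra.
have tE0 : 0 <= 2 * N%:R / t3 by nneg.
have M0 : 0 <= M by apply: addr_ge0.
have ME : M <= eps / 8 * N%:R by rewrite /M LE; move: tE; clear; lra.
have NE : 2 <= eps / 4 * N%:R.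
  have : 8 / eps <= N%:R by move: hN2 x1 x2 x3; clear; lra.
  rewrite ler_pdivrMr //; clear; lra.
have loc := @cc_local R UF UFu UFoo k 2^-1 (c - eps / 8) l L u (ltW k0) b01' q0 qc l1 u0 hLd.
have f02 : 0 < eta0' <= h0 by rewrite f0.
apply: UF_imp (UF_and UFu (hN1 N NN1) (UF_and UFu loc (UF_and UFu (hcr _ f02)
  (UF_real UFu UFoo (4 / eta0' + 2 + t3 * t3 + eta0' / k))))) => m [hup [hloc [hcm mB]]].
have w1 : 0 < 4 / eta0' by pstv.
have w2 : 0 < t3 * t3 by pstv.
have w3 : 0 < eta0' / k by pstv.
have mp : 0 < m%:R :> R by move: mB w1 w2 w3; clear; lra.
have m0 : (0 < m)%N by rewrite -(ltr0n R).
have m1 : 2 / m%:R <= eta0' / 2.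
  have : 4 / eta0' <= m%:R by move: mB w2 w3; clear; lra.
  rewrite !ler_pdivrMr //; clear; lra.
have m2 : m%:R^-1 <= l / 2.
  apply: (@le_trans _ _ 2^-1); last by move: l1; clear; lra.
  rewrite lef_pV2 ?posrE //; move: mB w1 w2 w3; clear; lra.
have m3 : t3 * t3 <= N%:R * m%:R.
  apply: (@le_trans _ _ m%:R); first by move: mB w1 w3; clear; lra.
  by rewrite ler_peMl // ltW.
have m4 : eta0' <= k * m%:R.
  have : eta0' / k <= m%:R by move: mB w1 w2; clear; lra.
  by rewrite ler_pdivrMr // mulrC.
(* With this rounding the window of (t + 2) D + 1 columns fits into the N m columns while (t + 3) D
   exceeds them, so the window misses less than D columns. *)
pose D := (Num.truncn (N%:R * m%:R / t3 : R)).+1.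
have D1 : N%:R * m%:R / t3 < D%:R by exact: truncnS_gt.
have D2 : D%:R <= N%:R * m%:R / t3 + 1.
  have q : 0 <= N%:R * m%:R / t3 by nneg.
  by rewrite /D -natr1 lerD2r; case/andP: (truncn_itv q).
have kE : k * m%:R = eta0' * (N%:R * m%:R / t3) by rewrite /eta0'; field; rewrite ?gt_eqF.
have c1' : k * m%:R <= eta0' * D%:R by rewrite kE ler_pM2l // ltW.
have c2' : eta0' * D%:R <= 2 * (k * m%:R).
  apply: (@le_trans _ _ (eta0' * (N%:R * m%:R / t3 + 1))); first by rewrite ler_pM2l.
  rewrite mulrDr -kE mulr1; move: m4; clear; lra.
have {}hcm := hcm D c1' c2'.
have tR : (t + 2)%:R = t3 - 1 :> R by rewrite /t3 -[(t + 3)%N]/(t + (2 + 1))%N addnA [in RHS]natrD addrK.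
have tR1 : t.+1%:R = t3 - 2 :> R by rewrite /t3 -addn1 -[(t + 3)%N]/(t + (1 + 2))%N addnA [in RHS]natrD addrK.
set Q := N%:R * m%:R / t3 in D1 D2 kE *.
have QE : Q * t3 = N%:R * m%:R by rewrite /Q divfK // gt_eqF.
have hs : (0 + ((t + 2) * D).+1 <= N * m)%N.
  rewrite add0n -(ler_nat R) -natr1 !natrM tR.
  have : (t3 - 1) * D%:R <= (t3 - 1) * (Q + 1).
    by rewrite ler_wpM2l // subr_ge0 /t3 ler1n addn3.
  have : t3 <= Q by rewrite /Q ler_pdivlMr.
  move: QE; rewrite [Q * t3]mulrC; clear; nra.
pose p := @pm R m ('I_(N * m) * 'I_m)%type; have hp : prob p by exact: prob_pm.
pose e := @adj R (kT k 2^-1) (N * m) m.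
pose cent (v : 'I_(N * m) * 'I_m) := M <= gX R v <= N%:R - M.
pose A (v : 'I_(N * m) * 'I_m) (w : {set 'I_(N * m) * 'I_m}) := reach e (w :&: winv L v) v (high eta0') && cent v.
pose G (w : {set 'I_(N * m) * 'I_m}) := cross (adj (kT k 2^-1)) eta0' D (t.+1 * D) (emb hs @^-1: w).
have sM : \sum_v p v <= N%:R by rewrite sum_pm grid_mass.
have T1 : thr (kT k 2^-1) by apply: thr_kT => //; exact: ltW.
apply: le_trans (glue_giant (A := A) (G := G) hp sM Nr (cc_ge0 UFu UFoo k 2^-1) eps0 eps1 eta0 eta1 ce _ _ _ hup) eps30.
- rewrite Ex_cnt; apply: le_trans (sum_central m0 (q := c - eps / 8 - tau k 2^-1 l u - 8 / (eta0' * l)) _ M0 _ _); last 3 first.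
  + move: ce epse eps0 tauE f4; clear; lra.
  + by move=> v; apply: Pr_ge0.
  + move=> i i1 i2; have lM : L * m%:R <= M * m%:R by rewrite ler_pM2r // lerDl.
    have r1 : L * m%:R <= i%:R by apply: le_trans i1.
    have r2 : i%:R + L * m%:R + 1 <= (N * m)%:R by rewrite natrM; apply: le_trans i2; rewrite lerD2r lerD2l.
    rewrite lerBlDr -avg_addc //; apply: le_trans (hloc _ i r1 r2) _.
    rewrite ler_pM2r ?invr_gt0 //; apply: ler_sum => j _.
    apply: le_trans (@cover_window _ _ _ _ (i, j) l L eta0' T1 lL _ l0 f3 m1 m2 r1 r2) _; first by rewrite f0.
    rewrite lerD2r; apply: Pr_le => // w hr; rewrite /A hr /cent /gX /= ler_pdivlMr // i1 /= ler_pdivrMr // mulrBl.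
    move: i2; clear; lra.
  rewrite -/c (_ : N%:R - 2 * M - 2 / m%:R = N%:R - (2 * M + 2 / m%:R)); last by ring.
  have mm : 2 / m%:R <= 2 :> R by rewrite ler_pdivrMr // ler_peMr // ler1n.
  have aE : 2 * M + 2 / m%:R <= eps / 2 * N%:R by move: ME NE mm; clear; lra.
  apply: (@lower_mean N%:R _ c eps (2 * M + 2 / m%:R)) => //.
  + exact: ltW.
  + by rewrite addr_ge0 ?mulr_ge0 // ?divr_ge0.
  + move: ce epse eps0; clear; lra.
  + move: tauE f4 eps0; clear; lra.
  + apply: le_trans aE _; rewrite ler_piMl // ?ltW //; move: eps1; clear; lra.
- apply: ltW; apply: le_lt_trans hcm; rewrite /ncross.
  by rewrite -(Pr_preim (@shift_inj _ _ m _ hs) p (fun w => ~~ cross (adj (kT k 2^-1)) eta0' D (t.+1 * D) w)).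
move=> w v v' Gw vw v'w /andP[/existsP[z /andP[hz cz]] cv] /andP[/existsP[z' /andP[hz' cz']] cv'].
have cs := sym_connect_sym (gr_sym w (@adj_sym R _ (N * m) m T1)).
have inz x y : x \in w -> cent x -> connect (gr e (w :&: winv L x)) x y ->
    [/\ y \in w, connect (gr e w) x y & 2 * N%:R / t3 <= gX R y <= N%:R - 2 * N%:R / t3].
  move=> xw /andP[xc xc'] cxy; split.
  - by have [<- //|ne] := eqVneq x y; case/andP: (conn_in cxy ne) => _; rewrite inE => /andP[].
  - by apply: conn_mono cxy => //; exact: subsetIl.
  have : `|gX R y - gX R x| <= L.
    have [<-|ne] := eqVneq x y; first by rewrite subrr normr0.
    by case/andP: (conn_in cxy ne) => _; rewrite !inE => /andP[].
  rewrite ler_norml => /andP[q1 q2]; move: xc xc' q1 q2; rewrite /M; clear; lra.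
have [zw cvz zX] := inz _ _ vw cv cz; have [z'w cvz' zX'] := inz _ _ v'w cv' cz'.
apply: (connect_trans cvz); rewrite cs in cvz'; apply: (connect_trans _ cvz').
have Q1 : 1 <= Q.
  rewrite /Q ler_pdivlMr // mul1r; apply: le_trans m3; rewrite ler_peMl ?(ltW t30) // /t3 ler1n addn3 //.
apply: (cross_glue (hs := hs) k0 tp _ _ _ Gw zw z'w hz hz' zX zX') => //.
- rewrite (_ : 2 * N%:R / t3 * m%:R = 2 * Q); last by rewrite /Q; ring.
  move: D2 Q1; clear; lra.
- rewrite natrM tR1 mulrBl (_ : 2 * N%:R / t3 * m%:R = 2 * Q); last by rewrite /Q; ring.
  rewrite -QE; apply: (@le_trans _ _ ((t3 - 2) * Q)); first by clear; lra.
  rewrite ler_wpM2l ?(ltW D1) // subr_ge0 /t3 ler_nat addn3 //.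
Qed.

End Lower.

(** * Hyperbolic adjacency in heights and abscissas *)

Section Geometry.
Local Open Scope classical_set_scope.
Local Open Scope ring_scope.
Variable R : realType.
Implicit Types (x y u r th : R).

Lemma sin_le x : 0 <= x -> sin x <= x.
Proof.
rewrite le_eqVlt => /predU1P[<-|x0]; first by rewrite sin0.
have df (z : R) : z \in `]0, x[%R -> is_derive z 1 (@sin R) (cos z) by move=> _; exact: is_derive_sin.
have cf : {within `[0, x], continuous (@sin R)} by apply: continuous_subspaceT; exact: continuous_sin.
have [z _] := MVT x0 df cf; rewrite sin0 !subr0 => ->.
by rewrite ler_piMl ?(ltW x0) // cos_le1.
Qed.

Lemma cos_half x : cos x = 1 - 2 * sin (x / 2) ^+ 2.
Proof.
rewrite -{1}[x](_ : x / 2 *+ 2 = x); last by rewrite -[LHS]mulr_natl mulrC divfK // pnatr_eq0.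
by rewrite cos_mulr2n cos2sin2 -[LHS]/((1 - sin (x / 2) ^+ 2) *+ 2 - 1) mulr2n; ring.
Qed.

Lemma sin_ge x : 0 <= x -> x <= 2 -> x * (1 - x ^+ 2 / 2) <= sin x.
Proof.
rewrite le_eqVlt => /predU1P[<- _|x0 x2]; first by rewrite sin0 mul0r.
have df (z : R) : z \in `]0, x[%R -> is_derive z 1 (@sin R) (cos z) by move=> _; exact: is_derive_sin.
have cf : {within `[0, x], continuous (@sin R)} by apply: continuous_subspaceT; exact: continuous_sin.
have [z] := MVT x0 df cf; rewrite in_itv /= sin0 !subr0 => /andP[z0 zx] ->.
rewrite [leRHS]mulrC ler_pM2l // cos_half lerD2l lerN2.
have s0 : 0 <= sin (z / 2) by apply: sin_ge0_pi; have := pi_ge2 R; move: z0 zx x2; lra.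
have s1 : sin (z / 2) <= z / 2 by apply: sin_le; move: z0; lra.
have s2 : sin (z / 2) <= x / 2 by move: s1 zx; lra.
have : sin (z / 2) ^+ 2 <= (x / 2) ^+ 2 by rewrite ler_pXn2r // nnegrE; move: x0; lra.
rewrite exprMn exprVn; lra.
Qed.

Lemma sin_ge_quarter x : 0 <= x -> x <= pi / 2 -> x / 4 <= sin x.
Proof.
move=> x0 xpi; have p2 := pihalf_lt2 R.
have [x1|x1] := lerP x 1.
  apply: le_trans (sin_ge x0 _); last by lra.
  rewrite ler_wpM2l //; have : x ^+ 2 <= 1 by rewrite expr_le1.
  lra.
have s1 : 1 / 2 <= sin (1 : R).
  by apply: le_trans (sin_ge _ _); rewrite ?expr1n; lra.
have : sin (1 : R) < sin x by rewrite ltr_sin ?in_itv //=; apply/andP; split; have := pihalf_ge1 R; lra.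
lra.
Qed.

Lemma rcosh_lt (x y : R) : 0 <= x -> x < y -> rcosh x < rcosh y.
Proof.
move=> x0 xy; rewrite /rcosh !expRN; have h1 : expR x < expR y by rewrite ltr_expR.
have h2 : 1 <= expR x by rewrite -expR0 ler_expR.
move: (expR x) (expR y) h1 h2 => a b ab a1; have b1 : 1 < b by lra.
have a0 : 0 < a by lra.
have b0 : 0 < b by lra.
rewrite ltr_pM2r ?invr_gt0 // -subr_gt0 (_ : _ - _ = (b - a) * (1 - (a * b)^-1)); last by field; rewrite !gt_eqF.
rewrite mulr_gt0 ?subr_gt0 // invf_lt1 ?mulr_gt0 //; apply: lt_le_trans b1 _.
by rewrite ler_peMl // ltW.
Qed.

Lemma rcosh_le (x y : R) : 0 <= x -> x <= y -> rcosh x <= rcosh y.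
Proof. by move=> x0; rewrite le_eqVlt => /orP[/eqP ->|/(rcosh_lt x0)/ltW]. Qed.

Lemma rcosh_ge1 (x : R) : 0 <= x -> 1 <= rcosh x.
Proof. by move=> x0; apply: le_trans (rcosh_le (lexx 0) x0); rewrite /rcosh oppr0 expR0; lra. Qed.

Lemma rcosh_gt1 (x : R) : 0 < x -> 1 < rcosh x.
Proof. by move=> x0; apply: le_lt_trans (rcosh_lt (lexx 0) x0); exact: rcosh_ge1. Qed.

Lemma rarcosh_ge0 (z : R) : 1 <= z -> 0 <= rarcosh z.
Proof. by move=> z1; rewrite ln_ge0 //; have := sqrtr_ge0 (z ^+ 2 - 1); lra. Qed.

Lemma rarcoshK (z : R) : 1 <= z -> rcosh (rarcosh z) = z.
Proof.
move=> z1; have q0 : 0 <= z ^+ 2 - 1 by rewrite subr_ge0 expr_ge1 //; lra.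
have s0 := sqrtr_ge0 (z ^+ 2 - 1); have ss := sqr_sqrtr q0.
rewrite /rcosh /rarcosh; set s := Num.sqrt _ in s0 ss *.
have zs : 0 < z + s by lra.
rewrite expRN lnK ?posrE //.
have -> : (z + s)^-1 = z - s.
  by apply: (@mulIf _ (z + s)); rewrite ?gt_eqF // mulVf ?gt_eqF // -subr_sqr ss; ring.
by field.
Qed.

Lemma rarcosh_le (z r : R) : 1 <= z -> 0 <= r -> (rarcosh z <= r) = (z <= rcosh r).
Proof.
move=> z1 r0; apply/idP/idP => h; first by rewrite -{1}(rarcoshK z1); exact/rcosh_le/h/rarcosh_ge0.
by rewrite leNgt; apply/negP => /(rcosh_lt r0); rewrite rarcoshK // ltNge h.
Qed.

(* With P = e^r, P' = e^r' and Q = e^Rad, division of the adjacency condition by P P' / 2. *)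
Lemma hdist_le r r' th th' Rad : 0 < r -> 0 < r' -> 0 <= Rad ->
  (hdist (r, th) (r', th') <= Rad) =
  ((1 - expR (- (2 * r))) * (1 - expR (- (2 * r'))) * sin ((th - th') / 2) ^+ 2 <=
   expR (Rad - r - r') * (1 + expR (- (2 * Rad))) - expR (- (2 * r)) - expR (- (2 * r'))).
Proof.
move=> r0 r'0 R0; rewrite /hdist /= cos_half; set S := sin _ ^+ 2.
have S0 : 0 <= S by exact: sqr_ge0.
have P0 := expR_gt0 r; have P'0 := expR_gt0 r'; have Q0 := expR_gt0 Rad.
have e2 x : expR (- (2 * x)) = (expR x)^-1 ^+ 2 by rewrite (_ : - (2 * x) = - x + - x); [rewrite expRD expRN expr2|ring].
rewrite rarcosh_le // /rcosh /rsinh; last first.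
  rewrite !expRN; set P := expR r in P0 *; set P' := expR r' in P'0 *.
  have P1 : P^-1 <= P.
    have : 1 <= P by rewrite -expR0 ler_expR ltW.
    by move=> p1; apply: (le_trans _ p1); rewrite invf_le1.
  have P'1 : P'^-1 <= P'.
    have : 1 <= P' by rewrite -expR0 ler_expR ltW.
    by move=> p1; apply: (le_trans _ p1); rewrite invf_le1.
  have t : 0 <= (P - P^-1) * (P' - P'^-1) * S by rewrite mulr_ge0 // mulr_ge0 // subr_ge0.
  have am : 2 <= P / P' + P' / P.
    rewrite -subr_ge0 (_ : _ - 2 = (P - P') ^+ 2 / (P * P')); last by field; rewrite !gt_eqF.
    by rewrite divr_ge0 ?sqr_ge0 // mulr_ge0 // ltW.
  rewrite (_ : _ - _ = (P / P' + P' / P) / 2 + (P - P^-1) * (P' - P'^-1) * S / 2); first lra.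
  by field; rewrite !gt_eqF.
rewrite !e2 -addrA -opprD expRD expRN expRD !expRN; set P := expR r in P0 *; set P' := expR r' in P'0 *; set Q := expR Rad in Q0 *.
rewrite -subr_ge0 -[RHS]subr_ge0.
rewrite -[RHS](pmulr_rge0 _ (_ : 0 < P * P' / 2)); last by rewrite divr_gt0 ?mulr_gt0.
by congr (0 <= _); field; rewrite !gt_eqF.
Qed.

(** Here a = e^(-2r), a' = e^(-2r'), A = e^(Rad-r-r'), g = e^(-2 Rad) and S is the squared sine of
    half the angle. If S > A with A < 1, the condition gives a + a' < A g (1 + A) <= 2 A g, whereas
    a + a' >= 2 sqrt (a a') = 2 A sqrt g >= 2 A g. *)
Lemma adj_upper_alg (a a' A g S : R) : 0 < a -> 0 < a' -> a < 1 -> a' < 1 -> 0 < A -> 0 < g -> g <= 1 ->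
  a * a' = A ^+ 2 * g -> 0 <= S -> S <= 1 ->
  (1 - a) * (1 - a') * S <= A * (1 + g) - a - a' -> S <= A.
Proof.
move=> a0 a'0 a1 a'1 A0 g0 g1 aa S0 S1 h.
have [A1|A1] := lerP 1 A; first exact: le_trans A1.
rewrite leNgt; apply/negP => AS.
have q : 0 < (1 - a) * (1 - a') by rewrite mulr_gt0 ?subr_gt0.
have : (1 - a) * (1 - a') * A < A * (1 + g) - a - a' by apply: lt_le_trans h; rewrite ltr_pM2l.
rewrite -subr_gt0 (_ : _ - _ = A * g - A * (a * a') - (1 - A) * (a + a')); last by ring.
rewrite aa (_ : A * g - A * (A ^+ 2 * g) = (1 - A) * (A * g * (1 + A))); last by ring.
rewrite -mulrBr pmulr_rgt0 ?subr_gt0 // => lt.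
have : (a + a') ^+ 2 < (2 * (A * g)) ^+ 2.
  rewrite ltr_pXn2r // ?nnegrE ?mulr_ge0 ?addr_ge0 ?ltW //; apply: lt_le_trans lt _.
  by rewrite mulrC ler_pM2r ?mulr_gt0 //; lra.
apply/negP; rewrite -leNgt exprMn exprMn.
have : A ^+ 2 * g ^+ 2 <= A ^+ 2 * g by rewrite ler_pM2l ?exprn_gt0 // expr2 ler_piMl // ltW.
have := sqr_ge0 (a - a'); have -> : (a + a') ^+ 2 = (a - a') ^+ 2 + 4 * (a * a') by ring.
rewrite aa; lra.
Qed.

(** Points with r + r' <= Rad are adjacent at every angle: at S = 1 the two sides differ by (A - 1)
    (1 - A g). *)
Lemma adj_core_alg (a a' A g S : R) : 0 < a -> 0 < a' -> a <= 1 -> a' <= 1 -> 1 <= A -> 0 < g -> A * g <= 1 ->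
  a * a' = A ^+ 2 * g -> S <= 1 ->
  (1 - a) * (1 - a') * S <= A * (1 + g) - a - a'.
Proof.
move=> a0 a'0 a1 a'1 A1 g0 Ag aa S1.
have q : 0 <= (1 - a) * (1 - a') by rewrite mulr_ge0 ?subr_ge0.
apply: (@le_trans _ _ ((1 - a) * (1 - a'))); first by rewrite ler_piMr.
rewrite -subr_ge0 (_ : _ - _ = A * (1 + g) - 1 - a * a'); last by ring.
rewrite aa (_ : _ - _ = (A - 1) * (1 - A * g)); last by ring.
by rewrite mulr_ge0 ?subr_ge0.
Qed.

Lemma adj_low_alg (a a' A g S : R) : 0 < a -> 0 < a' -> a <= 1 -> a' <= 1 -> 0 < A -> 0 < g ->
  0 <= S -> S + a + a' <= A -> (1 - a) * (1 - a') * S <= A * (1 + g) - a - a'.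
Proof.
move=> a0 a'0 a1 a'1 A0 g0 S0 h.
have q : (1 - a) * (1 - a') <= 1 by rewrite mulr_ile1 ?subr_ge0 // gerBl ltW.
apply: (@le_trans _ _ S); first by rewrite ler_piMl.
have := mulr_gt0 A0 g0; lra.
Qed.

(** From cosh x - 1 = (1 - e^(-x))^2 / (2 e^(-x)), the height u is e^(-alpha (Rad - r)) times ((1 -
    p) / (1 - t))^2. So u^(-1/(2 alpha)) is E up to a power of 1 - p, which any n >= 1 / alpha
    absorbs. *)
Lemma radial_powR (alpha r Rad : R) : 0 < alpha -> 0 < r -> r <= Rad ->
  let u := (rcosh (alpha * r) - 1) / (rcosh (alpha * Rad) - 1) in
  let p := expR (- (alpha * r)) in let E := expR ((Rad - r) / 2) in
  0 < u <= 1 /\ (E <= u `^ (- (1 / (2 * alpha))) /\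
   ((forall n : nat, 1 / alpha <= n%:R -> u `^ (- (1 / (2 * alpha))) * (1 - p) ^+ n <= E) /\
   (p <= expR (- (alpha * Rad)) / u /\ expR (- (alpha * Rad)) / p * (1 - p) ^+ 2 <= u))).
Proof.
move=> al0 r0 rR u p E.
set t := expR (- (alpha * Rad)).
have Rad0 : 0 < Rad by apply: lt_le_trans rR.
have t0 : 0 < t by exact: expR_gt0.
have p0 : 0 < p by exact: expR_gt0.
have p1 : p < 1 by rewrite -expR0 ltr_expR oppr_lt0 mulr_gt0.
have tp : t <= p by rewrite ler_expR lerN2 ler_pM2l.
have t1 : t < 1 by apply: le_lt_trans p1.
have c x : rcosh x - 1 = (1 - expR (- x)) ^+ 2 / (2 * expR (- x)).
  have xe : expR x = (expR (- x))^-1 by rewrite -expRN opprK.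
  by rewrite /rcosh xe; field; rewrite gt_eqF ?expR_gt0.
have uE : u = t / p * ((1 - p) / (1 - t)) ^+ 2.
  rewrite /u !c -/p -/t; field; rewrite !gt_eqF //; lra.
have q0 : 0 < 1 - p by lra.
have q1 : 0 < 1 - t by lra.
have y0 : 0 < (1 - p) / (1 - t) by rewrite divr_gt0.
have tp0 : 0 < t / p by rewrite divr_gt0.
have y1 : (1 - p) / (1 - t) <= 1 by rewrite ler_pdivrMr // mul1r; lra.
have yp : 1 - p <= (1 - p) / (1 - t) by rewrite ler_pdivlMr // ler_piMr ?(ltW q0) //; lra.
have u0 : 0 < u by rewrite uE mulr_gt0 // exprn_gt0.
have tpE : t / p = expR (- (alpha * (Rad - r))) by rewrite /t /p -expRN -expRD; congr expR; ring.
have u_le : u <= t / p.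
  by rewrite uE ler_piMr ?(ltW tp0) // expr_le1 // ltW.
have u_ge : t / p * (1 - p) ^+ 2 <= u.
  by rewrite uE ler_pM2l // ler_pXn2r // nnegrE ltW.
have pw x : 0 < x -> expR (- (alpha * x)) `^ (- (1 / (2 * alpha))) = expR (x / 2).
  move=> _; rewrite /powR gt_eqF ?expR_gt0 // expRK; congr expR; field; lra.
have be : 0 < 1 / (2 * alpha) by rewrite divr_gt0 // mulr_gt0.
have EE : E = (t / p) `^ (- (1 / (2 * alpha))).
  rewrite tpE /powR gt_eqF ?expR_gt0 // expRK /E; congr expR; field; lra.
have Ele : E <= u `^ (- (1 / (2 * alpha))) by rewrite EE; apply: powR_anti => //; exact: ltW.
split; first by rewrite u0 /=; apply: le_trans u_le _; rewrite ler_pdivrMr // mul1r.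
split; first exact: Ele.
split; last by split; [rewrite ler_pdivlMr // mulrC -ler_pdivlMr|].
move=> n hn.
have h1 : u `^ (- (1 / (2 * alpha))) <= (t / p * (1 - p) ^+ 2) `^ (- (1 / (2 * alpha))).
  by apply: powR_anti u_ge; rewrite ?(ltW be) // mulr_gt0 ?divr_gt0 ?exprn_gt0.
apply: (@le_trans _ _ ((t / p * (1 - p) ^+ 2) `^ (- (1 / (2 * alpha))) * (1 - p) ^+ n)).
  by rewrite ler_pM2r // exprn_gt0.
have pn k : (1 - p) ^+ k = (1 - p) `^ k%:R by rewrite powR_mulrn // ltW.
rewrite powRM ?divr_ge0 ?exprn_ge0 ?(ltW t0) ?(ltW p0) ?(ltW q0) // -EE -mulrA ler_piMr ?expR_ge0 // !pn -powRrM -powRD; last first.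
  by rewrite (gt_eqF q0) implybT.
have e0 : 0 <= 2 * - (1 / (2 * alpha)) + n%:R.
  rewrite (_ : 2 * - _ = - (1 / alpha)); last by field; rewrite gt_eqF.
  by rewrite addrC subr_ge0.
have -> : (1 - p) `^ (2 * - (1 / (2 * alpha)) + n%:R) <= 1 = ((1 - p) `^ (2 * - (1 / (2 * alpha)) + n%:R) <= 1 `^ (2 * - (1 / (2 * alpha)) + n%:R)).
  by rewrite powR1.
apply: ge0_ler_powR => //; rewrite ?nnegrE ?(ltW q0) //.
by rewrite gerBl ltW.
Qed.

Lemma bernoulli_pow x k : 0 <= x -> x <= 1 -> 1 - k%:R * x <= (1 - x) ^+ k.
Proof.
move=> x0 x1; elim: k => [|k IH]; first by rewrite mul0r subr0 expr0.
have y0 : 0 <= 1 - x by lra.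
have h := ler_wpM2l y0 IH; rewrite exprS; apply: le_trans h.
have : 0 <= k%:R * (x * x) by rewrite !mulr_ge0.
by rewrite -natr1; lra.
Qed.

Lemma low_factor (n : nat) (p p' X X' E E' f : R) : 0 < p -> 0 < p' -> 0 <= X -> 0 <= X' ->
  X * (1 - p) ^+ n <= E -> X' * (1 - p') ^+ n <= E' -> 0 <= f -> f <= 1 - n.+1%:R * (p + p') ->
  p + p' <= 1 /\ X * X' * f <= E * E' * (1 - p - p').
Proof.
move=> p0 p'0 X0 X'0 hE hE' f0 fp.
have n0 : 0 <= n%:R :> R by exact: ler0n.
have np : n.+1%:R * (p + p') = n%:R * p + n%:R * p' + p + p' by rewrite -natr1; ring.
rewrite np in fp.
have np0 := mulr_ge0 n0 (ltW p0); have np'0 := mulr_ge0 n0 (ltW p'0).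
have pp1 : p + p' <= 1 by lra.
have b1 : 1 - n%:R * p <= (1 - p) ^+ n by apply: bernoulli_pow; lra.
have b2 : 1 - n%:R * p' <= (1 - p') ^+ n by apply: bernoulli_pow; lra.
split => //; set x := n%:R * p in np0 fp b1; set x' := n%:R * p' in np'0 fp b2.
have w1 : 0 <= 1 - x by lra.
have w2 : 0 <= 1 - x' by lra.
have w3 : 0 <= 1 - p - p' by lra.
have w4 : f <= (1 - x) * (1 - x') * (1 - p - p').
  apply: le_trans fp _.
  have := mulr_ge0 np0 np'0.
  have : 0 <= (p + p') * (x + (1 - x) * x') by rewrite mulr_ge0 ?addr_ge0 ?(ltW p0) ?(ltW p'0) // mulr_ge0.
  lra.
apply: (@le_trans _ _ (X * X' * ((1 - x) * (1 - x') * (1 - p - p')))); first by rewrite ler_wpM2l ?mulr_ge0.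
rewrite mulrA ler_wpM2r // mulrACA; apply: ler_pM; rewrite ?mulr_ge0 //.
  by apply: le_trans hE; rewrite ler_wpM2l.
by apply: le_trans hE'; rewrite ler_wpM2l.
Qed.

Lemma sin_norm_le x : `|sin x| <= `|x|.
Proof.
have h (y : R) : 0 <= y -> `|sin y| <= y.
  move=> y0; have [y2|y2] := lerP 1 y; first by apply: le_trans y2; exact: sin_max.
  rewrite ger0_norm ?sin_le // sin_ge0_pi // y0 /=; have := pi_ge2 R; lra.
have [x0|x0] := lerP 0 x; first by rewrite (ger0_norm x0) h.
by rewrite (ltr0_norm x0); have := h (- x); rewrite sinN normrN oppr_ge0; apply; exact: ltW.
Qed.

Section Adjacency.
Local Open Scope classical_set_scope.
Local Open Scope ring_scope.
Variables (alpha nu : R) (N : nat).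
Hypotheses (al0 : 0 < alpha) (nu0 : 0 < nu) (nuN : nu < N%:R).
Local Notation Rad := (kpkvb_radius N nu).
(** The distribution function at the radius; [hX] does the same for the angle, scaled to length N.
    In these coordinates a point is uniform. *)
Definition hU r : R := (rcosh (alpha * r) - 1) / (rcosh (alpha * Rad) - 1).
Definition hX th : R := N%:R * th / (2 * pi).
Local Notation be := (1 / (2 * alpha)).
Local Notation kap := (nu / pi).
Local Notation tau := ((nu / N%:R) `^ (2 * alpha)).

Let N0 : 0 < N%:R :> R. Proof. exact: lt_trans nuN. Qed.

Let pi0 : pi != 0 :> R. Proof. by rewrite gt_eqF ?pi_gt0. Qed.
Let Nn : N%:R != 0 :> R. Proof. by rewrite gt_eqF. Qed.

Lemma Rad_gt0 : 0 < Rad.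
Proof. by rewrite /kpkvb_radius mulr_gt0 // ln_gt0 // ltr_pdivlMr // mul1r. Qed.

Lemma exp_Rad : expR (- (Rad / 2)) = nu / N%:R.
Proof.
rewrite /kpkvb_radius mulrC mulKf ?pnatr_eq0 // expRN lnK ?invf_div // posrE.
by rewrite divr_gt0.
Qed.

Lemma tauE : expR (- (alpha * Rad)) = tau.
Proof.
rewrite -exp_Rad /powR gt_eqF ?expR_gt0 // expRK; congr expR.
by rewrite mulrN; congr (- _); field.
Qed.

Lemma exp_split r r' : expR (Rad - r - r') = (nu / N%:R * (expR ((Rad - r) / 2) * expR ((Rad - r') / 2))) ^+ 2.
Proof.
by rewrite -exp_Rad -!expRD expr2 -expRD; congr expR; field.
Qed.

Section Pair.
Local Open Scope classical_set_scope.
Local Open Scope ring_scope.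
Variables r r' th th' : R.
Hypotheses (r0 : 0 < r <= Rad) (r'0 : 0 < r' <= Rad).
Hypotheses (h0 : 0 < th <= 2 * pi) (h'0 : 0 < th' <= 2 * pi).
Local Notation S := (sin ((th - th') / 2) ^+ 2).
Local Notation A := (expR (Rad - r - r')).
Local Notation g := (expR (- (2 * Rad))).

Lemma pair_facts : [/\ expR (- (2 * r)) < 1, expR (- (2 * r')) < 1, g <= 1, A * g <= 1 &
  expR (- (2 * r)) * expR (- (2 * r')) = A ^+ 2 * g].
Proof.
have R0 := Rad_gt0; have [q1 q2] := andP r0; have [q3 q4] := andP r'0.
split; rewrite -?expRD.
- by rewrite -expR0 ltr_expR oppr_lt0 mulr_gt0.
- by rewrite -expR0 ltr_expR oppr_lt0 mulr_gt0.
- by rewrite -expR0 ler_expR oppr_le0 mulr_ge0 // ltW.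
- by rewrite -[leRHS]expR0 ler_expR; move: q1 q3 R0; lra.
by rewrite expr2 -!expRD; congr expR; ring.
Qed.

Lemma S01 : 0 <= S <= 1.
Proof. by rewrite sqr_ge0 /= sin2cos2 gerBl sqr_ge0. Qed.

Lemma hdistE : (hdist (r, th) (r', th') <= Rad) =
  ((1 - expR (- (2 * r))) * (1 - expR (- (2 * r'))) * S <= A * (1 + g) - expR (- (2 * r)) - expR (- (2 * r'))).
Proof. by rewrite hdist_le ?(ltW Rad_gt0) //; [case/andP: r0|case/andP: r'0]. Qed.

Lemma hX_angle : pi * (hX th - hX th') / N%:R = (th - th') / 2.
Proof. by rewrite /hX; move: (pi0); move: (@pi R) => q q0; field; rewrite ?q0 ?Nn. Qed.

Lemma adj_upper : hdist (r, th) (r', th') <= Rad ->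
  `|sin ((th - th') / 2)| <= nu / N%:R * (hU r * hU r') `^ (- be).
Proof.
have [a1 a1' g1 Ag aa] := pair_facts; have [S0 S1] := andP S01.
rewrite hdistE => /(adj_upper_alg (expR_gt0 _) (expR_gt0 _) a1 a1' (expR_gt0 _) (expR_gt0 _) g1 aa S0 S1).
rewrite exp_split -real_normK ?num_real // ler_pXn2r ?nnegrE //; last first.
  by rewrite !mulr_ge0 ?expR_ge0 ?invr_ge0 // ltW.
move=> h; apply: le_trans h _; rewrite ler_pM2l ?divr_gt0 //.
have [q1 q2] := andP r0; have [q3 q4] := andP r'0.
have [/andP[u0 _] [e1 _]] := radial_powR al0 q1 q2; have [/andP[u'0 _] [e2 _]] := radial_powR al0 q3 q4.
rewrite -/(hU r) in u0 e1; rewrite -/(hU r') in u'0 e2; move: u0 e1 u'0 e2; move: (hU r) (hU r') => u u' u0 e1 u'0 e2.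
by rewrite powRM ?(ltW u0) ?(ltW u'0) //; apply: ler_pM => //; exact: expR_ge0.
Qed.

Lemma adj_core : nu / N%:R <= 2^-1 `^ alpha^-1 -> hU r < (nu / N%:R) `^ alpha / 4 -> hU r' < (nu / N%:R) `^ alpha / 4 ->
  hdist (r, th) (r', th') <= Rad.
Proof.
have [a1 a1' g1 Ag aa] := pair_facts; have [S0 S1] := andP S01 => hN hu hu'.
have q1 : (nu / N%:R) `^ alpha <= 2^-1.
  rewrite -[leRHS]powRr1 // -[X in _ <= _ `^ X](mulVf (_ : alpha != 0)) ?gt_eqF // powRrM.
  apply: ge0_ler_powR hN; rewrite ?nnegrE ?powR_ge0 ?divr_ge0 //; exact: ltW.
have qE : (nu / N%:R) `^ alpha = expR (- (alpha * (Rad / 2))).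
  by rewrite -exp_Rad /powR gt_eqF ?expR_gt0 // expRK mulrN.
have half x : 0 < x <= Rad -> hU x < (nu / N%:R) `^ alpha / 4 -> x <= Rad / 2.
  move=> /andP[x0 xR] hx; rewrite leNgt; apply/negP => lt; move: hx; apply/negP; rewrite -leNgt.
  have [_ [_ [_ [_ lo]]]] := radial_powR al0 x0 xR; apply: le_trans lo.
  set p := expR (- (alpha * x)); have p0 : 0 < p by exact: expR_gt0.
  set q := (nu / N%:R) `^ alpha in q1 qE *.
  have pq : p <= q by rewrite qE ler_expR lerN2 ler_pM2l // ltW.
  have -> : expR (- (alpha * Rad)) = q * q by rewrite qE -expRD; congr expR; field.
  have q0 : 0 < q by rewrite qE expR_gt0.
  have h1 : q <= q * q / p by rewrite ler_pdivlMr // ler_pM2l.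
  have h2 : 4^-1 <= (1 - p) ^+ 2.
    by rewrite (_ : 4^-1 = (2^-1) ^+ 2); [rewrite ler_pXn2r // ?nnegrE; move: pq q1; lra|field].
  apply: ler_pM => //; exact: ltW.
have h1 := half r r0 hu; have h2 := half r' r'0 hu'.
rewrite hdistE; apply: adj_core_alg => //; rewrite ?expR_gt0 ?(ltW a1) ?(ltW a1') //.
by rewrite -expR0 ler_expR; lra.
Qed.

(** The quantity [tau / hU r] bounds p = e^(-alpha r). The relative loss is n p + n p' from
    [radial_powR] and p + p' from the terms e^(-2r) and e^(-2r') of [hdist_le]; the latter are at
    most A p and A p' because alpha <= 1. *)
Lemma adj_low (n : nat) : alpha <= 1 -> 1 / alpha <= n%:R ->
  `|hX th - hX th'| <= kap * (hU r * hU r') `^ (- be) * (1 - n.+1%:R * (tau / hU r + tau / hU r')) ->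
  hdist (r, th) (r', th') <= Rad.
Proof.
move=> al1 hn hx; have [a1 a1' g1 Ag aa] := pair_facts; have [S0 S1] := andP S01.
have [q1 q2] := andP r0; have [q3 q4] := andP r'0.
have [/andP[u0 _] [_ [/(_ _ hn) e1 [p1 _]]]] := radial_powR al0 q1 q2.
have [/andP[u'0 _] [_ [/(_ _ hn) e2 [p2 _]]]] := radial_powR al0 q3 q4.
rewrite -/(hU r) tauE in u0 e1 p1; rewrite -/(hU r') tauE in u'0 e2 p2.
rewrite hdistE; apply: adj_low_alg => //; rewrite ?expR_gt0 ?(ltW a1) ?(ltW a1') //.
set p := expR (- (alpha * r)) in e1 p1; set p' := expR (- (alpha * r')) in e2 p2.
have p0 : 0 < p by exact: expR_gt0.
have p'0 : 0 < p' by exact: expR_gt0.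
have ar (a x y z : R) : y <= z -> a * x <= x -> - (2 * x) <= z - x - y - a * x by lra.
have low x y : 0 < x -> y <= Rad -> expR (- (2 * x)) <= expR (Rad - x - y) * expR (- (alpha * x)).
  move=> x0 yR; rewrite -expRD ler_expR; have : alpha * x <= x by rewrite ler_piMl // ltW.
  exact: ar.
have la := low r r' q1 q4; have la' := low r' r q3 q2.
rewrite [Rad - r' - r](_ : _ = Rad - r - r') in la'; last by ring.
rewrite -/p -/p' in la la'.
suff : S <= A * (1 - p - p') by move: la la'; lra.
rewrite exp_split; move: u0 u'0 e1 e2 p1 p2 hx; move: (hU r) (hU r') => u u' u0 u'0 e1 e2 p1 p2.
set f := 1 - n.+1%:R * _; set E := expR ((Rad - r) / 2) in e1 *; set E' := expR ((Rad - r') / 2) in e2 *.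
have K0 : 0 < kap * (u * u') `^ (- be) by rewrite mulr_gt0 ?powR_gt0 ?mulr_gt0 ?invr_gt0 ?pi_gt0.
move=> hx; have f0 : 0 <= f.
  by rewrite -(pmulr_rge0 _ K0); apply: le_trans hx.
have fp : f <= 1 - n.+1%:R * (p + p') by rewrite lerD2l lerN2 ler_wpM2l // lerD.
have [pp1 key] := low_factor p0 p'0 (powR_ge0 _ _) (powR_ge0 _ _) e1 e2 f0 fp.
rewrite -powRM ?(ltW u0) ?(ltW u'0) // in key.
have sB : `|sin ((th - th') / 2)| <= nu / N%:R * (E * E' * (1 - p - p')).
  apply: (@le_trans _ _ (nu / N%:R * ((u * u') `^ (- be) * f))); last by rewrite ler_pM2l ?divr_gt0.
  apply: le_trans (sin_norm_le _) _; rewrite -hX_angle normrM normrM (ger0_norm (pi_ge0 R)).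
  rewrite normfV (ger0_norm (ltW N0)) mulrAC.
  have pN : 0 <= pi / N%:R :> R by rewrite divr_ge0 ?pi_ge0 // ltW.
  apply: le_trans (ler_wpM2l pN hx) _; rewrite le_eqVlt; apply/orP; left; apply/eqP.
  by move: (pi0); move: (@pi R) => q q0; field; rewrite ?q0 ?Nn.
rewrite -real_normK ?num_real //.
have w3 : 0 <= 1 - p - p' by move: pp1; lra.
apply: (@le_trans _ _ ((nu / N%:R * (E * E' * (1 - p - p'))) ^+ 2)).
  by rewrite ler_pXn2r // nnegrE // (le_trans _ sB).
rewrite mulrA exprMn ler_wpM2l ?sqr_ge0 // expr2 ler_piMr //.
by move: p0 p'0; lra.
Qed.

End Pair.
End Adjacency.
End Geometry.

Lemma hdistC (R : realType) (p q : R * R) : hdist p q = hdist q p.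
Proof.
by rewrite /hdist; congr rarcosh; rewrite [rcosh p.1 * _]mulrC [rsinh p.1 * _]mulrC -(cosN (p.2 - q.2)) opprB.
Qed.

(** * Cells enclosing the points of the hyperbolic graph *)

Section Cells.
Import Fin.
Local Open Scope classical_set_scope.
Local Open Scope ring_scope.
Variables (R : realType) (alpha nu : R).
Hypotheses (al0 : 0 < alpha) (nu0 : 0 < nu).
Local Notation be := (1 / (2 * alpha)).
Local Notation kap := (nu / pi).

Definition in_cell N m (v : 'I_(N * m) * 'I_m) (p : R * R) : Prop :=
  [/\ 0 < p.1 <= kpkvb_radius N nu, 0 < p.2 <= 2 * pi, gX R v <= hX N p.2 <= gX R v + m%:R^-1 &
    gU R v - m%:R^-1 <= hU alpha nu N p.1 <= gU R v].

Definition eplus N m : rel ('I_(N * m) * 'I_m) := fun x y =>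
  (nu < N%:R) && `[< exists p q, [/\ in_cell x p, in_cell y q & hdist p q <= kpkvb_radius N nu] >].

Definition eminus N m : rel ('I_(N * m) * 'I_m) := fun x y =>
  `[< forall p q, in_cell x p -> in_cell y q -> hdist p q <= kpkvb_radius N nu >].

Lemma eplus_sym N m : symmetric (@eplus N m).
Proof.
move=> x y; rewrite /eplus; congr (_ && _); apply/asboolP/asboolP => -[p [q [h1 h2 h3]]];
  by exists q, p; split => //; rewrite hdistC.
Qed.

Lemma eminus_sym N m : symmetric (@eminus N m).
Proof.
by move=> x y; apply/asboolP/asboolP => h p q h1 h2; rewrite hdistC; apply: h.
Qed.

(** Distance on the circle of length N, for d the distance on the line cut open. *)
Definition cdist N (d : R) := Num.min d (N%:R - d).

Lemma sin_cdist N (d : R) : (0 < N)%N -> sin (pi * cdist N d / N%:R) = sin (pi * d / N%:R).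
Proof.
move=> N0; rewrite /cdist; case: leP => // _.
have Nn : N%:R != 0 :> R by rewrite pnatr_eq0 -lt0n.
have -> : pi * (N%:R - d) / N%:R = - (pi * d / N%:R) + pi.
  by move: (@pi R) => q; field.
by rewrite sinDpi sinN opprK.
Qed.

Lemma cell_dX N m (x y : 'I_(N * m) * 'I_m) p q : in_cell x p -> in_cell y q ->
  `| `|gX R x - gX R y| - `|hX N p.2 - hX N q.2| | <= m%:R^-1.
Proof.
move=> [_ _ /andP[a1 a2] _] [_ _ /andP[b1 b2] _]; apply: le_trans (ler_dist_dist _ _) _.
rewrite ler_norml; apply/andP; split; lra.
Qed.

Lemma hX_range N (th : R) : 0 < th <= 2 * pi -> 0 <= hX N th <= N%:R.
Proof.
move=> /andP[t0 t1]; have p0 := pi_gt0 R; rewrite /hX.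
have N0 : 0 <= N%:R :> R by exact: ler0n.
have pp : 0 < 2 * pi :> R by rewrite mulr_gt0.
apply/andP; split; first by rewrite divr_ge0 ?(ltW pp) // mulr_ge0 // ltW.
by rewrite ler_pdivrMr // ler_wpM2l.
Qed.

Lemma adj_sin N p q (d := `|hX N p.2 - hX N q.2|) (D := cdist N d) : nu < N%:R ->
  0 < p.1 <= kpkvb_radius N nu -> 0 < p.2 <= 2 * pi -> 0 < q.1 <= kpkvb_radius N nu -> 0 < q.2 <= 2 * pi ->
  hdist p q <= kpkvb_radius N nu ->
  [/\ 0 <= D, 0 <= pi * D / N%:R <= pi / 2 &
    sin (pi * D / N%:R) <= nu / N%:R * (hU alpha nu N p.1 * hU alpha nu N q.1) `^ (- be)].
Proof.
case: p q @d @D => [r th] [r' th'] /= nuN hr ht hr' ht' hd.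
set d := `|_|; set D := cdist N d.
have N0 : 0 < N%:R :> R by apply: lt_trans nuN.
have Nn : N%:R != 0 :> R by rewrite gt_eqF.
have [x1 x2] := andP (hX_range N ht); have [y1 y2] := andP (hX_range N ht').
have d0 : 0 <= d by exact: normr_ge0.
have dN : d <= N%:R by rewrite /d ler_norml; apply/andP; split; lra.
have D0 : 0 <= D by rewrite /D /cdist le_min d0 subr_ge0.
have DN : D <= N%:R / 2 by rewrite /D /cdist ge_min; case: (lerP d (N%:R / 2)) => //= h; lra.
have p0 := pi_gt0 R.
have q1 : 0 <= pi * D / N%:R by rewrite divr_ge0 ?mulr_ge0 ?(ltW p0) ?(ltW N0).
have q2 : pi * D / N%:R <= pi / 2.
  by rewrite ler_pdivrMr // -mulrA ler_pM2l // mulrC.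
split => //; first by rewrite q1.
have := adj_upper al0 nu0 nuN hr hr' hd; apply: le_trans.
rewrite sin_cdist; last by rewrite -(ltr0n R).
rewrite -(hX_angle nu0 nuN th th').
have [w|w] := lerP 0 (hX N th - hX N th').
  by rewrite /d (ger0_norm w) ler_norm.
rewrite /d (ltr0_norm w) mulrN mulNr sinN -normrN; exact: ler_norm.
Qed.

Lemma adj_far N p q (d := `|hX N p.2 - hX N q.2|) : nu < N%:R ->
  0 < p.1 <= kpkvb_radius N nu -> 0 < p.2 <= 2 * pi -> 0 < q.1 <= kpkvb_radius N nu -> 0 < q.2 <= 2 * pi ->
  hdist p q <= kpkvb_radius N nu ->
  cdist N d <= 4 * (kap * (hU alpha nu N p.1 * hU alpha nu N q.1) `^ (- be)).
Proof.
move=> nuN hp1 hp2 hq1 hq2 hd; have [D0 /andP[y0 y1] hs] := adj_sin nuN hp1 hp2 hq1 hq2 hd.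
have N0 : 0 < N%:R :> R by apply: lt_trans nuN.
have Nn : N%:R != 0 :> R by rewrite gt_eqF.
have p0 := pi_gt0 R.
have := le_trans (sin_ge_quarter y0 y1) hs; set X := _ `^ _; rewrite -/d; set D := cdist N d => h.
have pn : pi != 0 :> R by rewrite gt_eqF.
have qq : 0 <= 4 * N%:R / pi :> R by rewrite divr_ge0 ?mulr_ge0 // ltW.
have := ler_wpM2l qq h; rewrite (_ : 4 * N%:R / pi * (pi * D / N%:R / 4) = D); last first.
  by move: pn; move: (@pi R) => z zn; field; rewrite ?zn ?Nn.
by rewrite (_ : 4 * N%:R / pi * (nu / N%:R * X) = 4 * (nu / pi * X)) //; move: pn; move: (@pi R) => z zn; field; rewrite ?zn ?Nn.
Qed.

Lemma adj_near N p q B (d := `|hX N p.2 - hX N q.2|) : nu < N%:R ->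
  0 < p.1 <= kpkvb_radius N nu -> 0 < p.2 <= 2 * pi -> 0 < q.1 <= kpkvb_radius N nu -> 0 < q.2 <= 2 * pi ->
  kap * (hU alpha nu N p.1 * hU alpha nu N q.1) `^ (- be) <= B ->
  hdist p q <= kpkvb_radius N nu ->
  cdist N d <= kap * (hU alpha nu N p.1 * hU alpha nu N q.1) `^ (- be) + (8 * B) ^+ 3 / N%:R.
Proof.
move=> nuN hp1 hp2 hq1 hq2 hB hd; have [D0 /andP[y0 y1] hs] := adj_sin nuN hp1 hp2 hq1 hq2 hd.
have hf := adj_far nuN hp1 hp2 hq1 hq2 hd.
have N0 : 0 < N%:R :> R by apply: lt_trans nuN.
have Nn : N%:R != 0 :> R by rewrite gt_eqF.
have N1 : 1 <= N%:R :> R by rewrite ler1n -(ltr0n R).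
have p0 := pi_gt0 R; have p4 : pi <= 4 :> R by have := pihalf_lt2 R; lra.
move: hs hf hB; set X := _ `^ _; rewrite -/d; set D := cdist N d in D0 y0 y1 * => hs hf hB.
have DB : D <= 4 * B by apply: le_trans hf _; rewrite ler_pM2l.
have B0 : 0 <= B by lra.
have y2 : pi * D / N%:R <= 2 by apply: le_trans y1 _; have := pihalf_lt2 R; lra.
have yB : pi * D / N%:R <= 16 * B / N%:R.
  rewrite ler_pM2r ?invr_gt0 // (_ : 16 * B = 4 * (4 * B)); last by ring.
  by apply: ler_pM => //; exact: ltW.
have h := le_trans (sin_ge y0 y2) hs.
have pn : pi != 0 :> R by rewrite gt_eqF.
have qq : 0 <= N%:R / pi :> R by rewrite divr_ge0 // ltW.
have := ler_wpM2l qq h; rewrite (_ : N%:R / pi * (nu / N%:R * X) = nu / pi * X); last first.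
  by move: pn; move: (@pi R) => z zn; field; rewrite ?zn ?Nn.
rewrite mulrA (_ : N%:R / pi * (pi * D / N%:R) = D); last first.
  by move: pn; move: (@pi R) => z zn; field; rewrite ?zn ?Nn.
set y := pi * D / N%:R in y0 yB *; rewrite mulrBr mulr1 => {}h.
suff : D * (y ^+ 2 / 2) <= (8 * B) ^+ 3 / N%:R by lra.
have t1 : y ^+ 2 <= (16 * B / N%:R) ^+ 2 by rewrite ler_pXn2r // nnegrE ?divr_ge0 ?mulr_ge0 // ltW.
have t2 : D * (y ^+ 2 / 2) <= 4 * B * ((16 * B / N%:R) ^+ 2 / 2).
  by apply: ler_pM => //; rewrite ?divr_ge0 ?sqr_ge0 // ler_pM2r.
apply: le_trans t2 _; rewrite (_ : 4 * B * _ = (8 * B) ^+ 3 / N%:R * N%:R^-1); last by field.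
have B3 : 0 <= (8 * B) ^+ 3 / N%:R by rewrite divr_ge0 ?(ltW N0) // exprn_ge0 // mulr_ge0.
by rewrite ler_piMr // invf_le1.
Qed.

Variable UF : set_system nat.
Hypotheses (UFu : UltraFilter UF) (UFoo : tails UF).
Hypothesis al_half : 2^-1 < alpha.

Lemma be01 : 0 < be < 1.
Proof.
have a2 : 0 < 2 * alpha by rewrite mulr_gt0.
by rewrite divr_gt0 //= ltr_pdivrMr // mul1r; move: al_half; lra.
Qed.

Lemma kap0 : 0 < kap. Proof. by rewrite divr_gt0 ?pi_gt0. Qed.

(** 17 = 4 * 4 + 1: a factor 4 from sin x >= x / 4, another because heights at most halve inside a
    cell above the bottom row, and the cell width 1/m, which is below the kernel. In the bottom row
    heights have no positive lower bound, but there the kernel alone exceeds N once m is large. *)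
Lemma eplus_far N : UF (fun m => forall x y : 'I_(N * m) * 'I_m, eplus x y ->
    `|gX R x - gX R y| <= 17 * kT kap be (gU R x) (gU R y) \/
    N%:R - `|gX R x - gX R y| <= 17 * kT kap be (gU R x) (gU R y)).
Proof.
have [b0 b1] := andP be01; have k0 := kap0.
have [K hK] := nat_large ((N%:R / kap) `^ (be^-1) + kap^-1 + 2).
apply: UF_imp (UF_real UFu UFoo ((N%:R / kap) `^ (be^-1) + kap^-1 + 2)) => m hm x y /andP[nuN /asboolP[p [q [ip iq hd]]]].
have z1 : 0 <= (N%:R / kap) `^ (be^-1) by exact: powR_ge0.
have z2 : 0 < kap^-1 by rewrite invr_gt0.
have mp : 0 < m%:R :> R by lra.
have mk : m%:R^-1 <= kap by rewrite invf_ple ?posrE //; lra.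
have N0 : 0 <= N%:R :> R by exact: ler0n.
have dx := cell_dX ip iq.
have T1 : thr (kT kap be) by apply: thr_kT; exact: ltW.
have low (v v' : 'I_(N * m) * 'I_m) : v.2 = 0%N :> nat -> N%:R <= kT kap be (gU R v) (gU R v').
  move=> v0; have gv : gU R v = m%:R^-1 by rewrite /gU v0 mul1r.
  apply: (@le_trans _ _ (kap * (m%:R^-1) `^ (- be))); last first.
    rewrite /kT ler_pM2l //; apply: powR_anti; [exact: ltW|by rewrite mulr_gt0 ?gU_gt0|].
    by rewrite gv ler_piMr ?invr_ge0 ?(ltW mp) // gU_le1.
  rewrite -(powR_inv1 (ltW mp)) -powRrM mulN1r opprK mulrC -ler_pdivrMr //.
  apply: (@le_trans _ _ (((N%:R / kap) `^ (be^-1)) `^ be)).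
    by rewrite -powRrM mulVf ?gt_eqF // powRr1 // divr_ge0 // ltW.
  by apply: ge0_ler_powR; rewrite ?nnegrE ?(ltW b0) ?(ltW mp) //; lra.
have XN := gX_dist R x y.
have C0 : 0 <= kT kap be (gU R x) (gU R y) by case: T1 => _ h _; apply: h; exact: gU_gt0.
case: (posnP x.2) => [x0|x0]; first by left; have := low x y x0; lra.
case: (posnP y.2) => [y0|y0].
  by left; have := low y x y0; case: T1 => -> _ _; lra.
have hrow (v : 'I_(N * m) * 'I_m) r : (0 < v.2)%N -> gU R v - m%:R^-1 <= r -> gU R v / 2 <= r.
  move=> v0 h; apply: le_trans h; rewrite /gU -natr1.
  have v1 : 1 <= v.2%:R :> R by rewrite ler1n.
  rewrite -[X in _ - X]mul1r -mulrBl addrK mulrAC ler_pM2r ?invr_gt0 //; lra.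
case: ip iq => p1 p2 _ /andP[pu _] [q1 q2 _ /andP[qu _]].
have {}pu := hrow x _ x0 pu; have {}qu := hrow y _ y0 qu.
have far := adj_far nuN p1 p2 q1 q2 hd.
have g1 := gU_gt0 R x; have g2 := gU_gt0 R y.
have kb : kap * (hU alpha nu N p.1 * hU alpha nu N q.1) `^ (- be) <= 4 * kT kap be (gU R x) (gU R y).
  rewrite /kT [leRHS]mulrCA ler_pM2l //; apply: (@le_trans _ _ ((gU R x / 2 * (gU R y / 2)) `^ (- be))).
    have h1 : 0 < gU R x / 2 by rewrite divr_gt0.
    have h2 : 0 < gU R y / 2 by rewrite divr_gt0.
    by apply: (powR_anti (ltW b0) (mulr_gt0 h1 h2)); apply: ler_pM => //; exact: ltW.
  rewrite (_ : gU R x / 2 * (gU R y / 2) = 4^-1 * (gU R x * gU R y)); last by field.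
  have g0 := mulr_ge0 (ltW g1) (ltW g2).
  have g4 : 0 <= 4^-1 :> R by rewrite invr_ge0.
  rewrite (powRM _ g4 g0) ler_wpM2r ?powR_ge0 //.
  rewrite -(powR_inv1 (_ : 0 <= 4 :> R)) // -powRrM mulN1r opprK -[leRHS]powRr1 // ler_powR ?ltW //; lra.
have k1 : kap <= kT kap be (gU R x) (gU R y).
  have g12 : gU R x * gU R y <= 1 by apply: mulr_ile1; rewrite ?gU_le1 //; exact: ltW.
  have := powR_anti (ltW b0) (mulr_gt0 g1 g2) g12; rewrite powR1 => h1.
  by rewrite /kT ler_peMr // ltW.
move: far; rewrite /cdist ge_min; set d := `|hX N _ - _| in dx *.
move: dx; rewrite ler_norml => /andP[dx1 dx2].
move=> /orP[far|far]; [left|right]; lra.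
Qed.

(* Moving the levels by 1/m costs a factor (1 - z)^{-2b} <= 1 + 8 z with z = 1/(h m). *)
Lemma kT_slide (k h s u u' v v' : R) : 0 <= k -> 0 < h -> 0 <= s -> s / h <= 4^-1 -> h <= u -> h <= u' ->
  u - s <= v -> u' - s <= v' -> k * (v * v') `^ (- be) <= kT k be u u' * (1 + 8 * (s / h)).
Proof.
move=> k0 h0 s0 sh hu hu' hv hv'; have [b0 b1] := andP be01.
have u0 : 0 < u by apply: lt_le_trans hu.
have u'0 : 0 < u' by apply: lt_le_trans hu'.
set z := s / h in sh *; have z0 : 0 <= z by rewrite divr_ge0 // ltW.
have zh : s = z * h by rewrite /z divfK // gt_eqF.
have w0 : 0 < 1 - z by lra.
have lo x y : h <= x -> x - s <= y -> x * (1 - z) <= y.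
  move=> hx; apply: le_trans; rewrite mulrBr mulr1 lerD2l lerN2 zh mulrC ler_wpM2r //.
have l1 := lo _ _ hu hv; have l2 := lo _ _ hu' hv'.
rewrite /kT -mulrA ler_wpM2l //.
apply: (@le_trans _ _ ((u * (1 - z) * (u' * (1 - z))) `^ (- be))).
  have h1 := mulr_gt0 u0 w0; have h2 := mulr_gt0 u'0 w0.
  by apply: (powR_anti (ltW b0) (mulr_gt0 h1 h2)); apply: ler_pM => //; exact: ltW.
have g0 := mulr_ge0 (ltW u0) (ltW u'0); have g1 := mulr_ge0 (ltW w0) (ltW w0).
rewrite mulrACA (powRM _ g0 g1) ler_wpM2l ?powR_ge0 //.
apply: (@le_trans _ _ (((1 - z) * (1 - z)) `^ (- 1))).
  have y0 : 0 < (1 - z) * (1 - z) by rewrite mulr_gt0.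
  have y1 : (1 - z) * (1 - z) <= 1 by rewrite mulr_ile1 ?(ltW w0) // gerBl.
  have i1 : 1 <= ((1 - z) * (1 - z))^-1 by rewrite invf_ge1.
  rewrite -[X in X `^ _ <= _]invrK -[X in _ <= X `^ _]invrK -!(powR_inv1 (_ : 0 <= ((1 - z) * (1 - z))^-1)) ?invr_ge0 ?(ltW y0) //.
  by rewrite -!powRrM !mulN1r !opprK ler_powR // ltW.
rewrite powR_inv1 ?mulr_ge0 ?(ltW w0) // -[leLHS]mul1r ler_pdivrMr ?mulr_gt0 //.
have : z * z <= z * 4^-1 by rewrite ler_wpM2l.
nra.
Qed.

(** Between heights at least [h] ranges are bounded by [B], and the cubic error of sin x against x
    becomes (8 B)^3 / N; the size of the cells contributes terms of order 1/m. *)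
Lemma eplus_near (h d : R) : 0 < h -> 0 < d -> exists N0 : nat, forall N, (N0 <= N)%N ->
  UF (fun m => forall x y : 'I_(N * m) * 'I_m, h <= gU R x -> h <= gU R y ->
    `|gX R x - gX R y| <= N%:R / 2 -> eplus x y ->
    `|gX R x - gX R y| <= kT kap be (gU R x) (gU R y) + d).
Proof.
move=> h0 d0; have [b0 b1] := andP be01; have k0 := kap0.
pose B0 := kT kap be h h; pose B := B0 * 3.
have B00 : 0 < B0 by rewrite mulr_gt0 // powR_gt0 // mulr_gt0.
have B1 : 0 < B by rewrite mulr_gt0.
have [N1 hN1] := nat_large ((8 * B) ^+ 3 / (d / 4) + 8 * B + 4 + d).
exists N1 => N NN.
have {}hN1 : (8 * B) ^+ 3 / (d / 4) + 8 * B + 4 + d <= N%:R by apply: le_trans hN1 _; rewrite ler_nat.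
have c0 : 0 < (8 * B) ^+ 3 by rewrite exprn_gt0 // mulr_gt0.
have c1 : 0 < (8 * B) ^+ 3 / (d / 4) by rewrite divr_gt0 // divr_gt0.
have N0 : 0 < N%:R :> R by lra.
have c2 : (8 * B) ^+ 3 / N%:R <= d / 4.
  rewrite ler_pdivrMr // [d / 4 * _]mulrC -ler_pdivrMr ?divr_gt0 //; lra.
apply: UF_imp (UF_and UFu (UF_inv UFu UFoo (_ : 0 < h / 4)) (UF_and UFu (UF_inv UFu UFoo (_ : 0 < d / 4))
  (UF_and UFu (UF_inv UFu UFoo (_ : 0 < d * h / (32 * B0))) (UFoo 1)))); last 3 first.
- by rewrite divr_gt0.
- by rewrite divr_gt0.
- by pstv.
move=> m [m1 [m2 [m3 m4]]] x y hx hy hd /andP[nuN /asboolP[p [q [ip iq hpq]]]].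
have mi0 : 0 <= m%:R^-1 :> R by rewrite invr_ge0.
have mi1 : m%:R^-1 <= 1 :> R by rewrite invf_le1 ?ler1n // ltr0n.
have dx := cell_dX ip iq.
case: ip iq => p1 p2 _ /andP[pu _] [q1 q2 _ /andP[qu _]].
have mh : m%:R^-1 / h <= 4^-1 by rewrite ler_pdivrMr // mulrC.
have sl := kT_slide (ltW k0) h0 mi0 mh hx hy pu qu.
have kB : kT kap be (gU R x) (gU R y) <= B0.
  rewrite /B0 /kT ler_pM2l //; apply: powR_anti; rewrite ?mulr_gt0 ?(ltW b0) //.
  by apply: ler_pM => //; exact: ltW.
have kT0 : 0 <= kT kap be (gU R x) (gU R y) by rewrite mulr_ge0 ?powR_ge0 // ltW.
have mh0 : 0 <= m%:R^-1 / h by rewrite divr_ge0 // ltW.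
have e1 : kT kap be (gU R x) (gU R y) * (8 * (m%:R^-1 / h)) <= d / 4.
  apply: (@le_trans _ _ (B0 * (8 * (m%:R^-1 / h)))); first by rewrite ler_wpM2r // mulr_ge0.
  have : B0 * (8 * (d * h / (32 * B0) / h)) = d / 4 by field; rewrite ?gt_eqF.
  move=> <-; rewrite ler_pM2l // ler_pM2l // ler_pM2r ?invr_gt0 //.
set K := kT kap be _ _ in kB kT0 sl e1 *.
set X := kap * _ in sl.
have XB : X <= B.
  apply: le_trans sl _; rewrite /B; apply: ler_pM => //; first by rewrite addr_ge0 // mulr_ge0.
  lra.
have near := adj_near nuN p1 p2 q1 q2 XB hpq.
move: near; rewrite -/X /cdist; set dd := `|hX N _ - _| in dx *.
move: dx; rewrite ler_norml => /andP[dx1 dx2]; rewrite mulrDr mulr1 in sl.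
by rewrite ge_min => /orP[near|near]; lra.
Qed.

Theorem upper_cells (eps dl : R) : 0 < eps -> 0 < dl -> exists N0 : nat, forall N, (N0 <= N)%N ->
  UF (fun m => Pr (@pm R m _) (fun w => (cc UF kap be + 6 * eps) * N%:R <=
    cnt R (fun v w => bigc (@eplus N m) (eps * N%:R) v w) w) <= dl).
Proof.
have [b0 b1] := andP be01.
move=> e0 d0; apply: (@upper R UF UFu UFoo kap be 17 eplus eps dl kap0 b0 b1 _ eplus_sym eplus_far eplus_near e0 d0).
by rewrite ler1n.
Qed.

End Cells.

(** * Giant clusters under injections and row shifts *)

Section GiantMap.
Import Fin.
Variable R : realType.

Lemma giant_mono (V : finType) (e e' : rel V) (s : R) (w : {set V}) :
  (forall x y, e x y -> e' x y) -> giant e s w -> giant e' s w.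
Proof.
move=> h /existsP[v /andP[vw hv]]; apply/existsP; exists v; rewrite vw; apply: le_trans hv _.
rewrite ler_nat; apply: subset_leq_card; apply/subsetP => z; rewrite !inE.
by apply: conn_mono => // x y _ _; exact: h.
Qed.

Lemma giant_up (V W : finType) (f : W -> V) (e : rel V) (s : R) (w : {set V}) : injective f ->
  giant (fun x y => e (f x) (f y)) s (f @^-1: w) -> giant e s w.
Proof.
move=> finj /existsP[v /andP[vw hv]]; apply/existsP; exists (f v); rewrite inE in vw; rewrite vw.
apply: le_trans hv _; rewrite ler_nat -(card_imset _ finj); apply: subset_leq_card.
apply/subsetP => z /imsetP[y]; rewrite !inE => cy ->.
have : connect (gr e (f @: (f @^-1: w))) (f v) (f y) by rewrite (conn_img finj (fun x y => erefl)).
by apply: conn_mono => //; rewrite imset_preim subsetIl.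
Qed.

Lemma giant_down (V W : finType) (f : W -> V) (e : rel V) (s : R) (w : {set V}) : injective f ->
  w \subset f @: [set: W] -> giant e s w -> giant (fun x y => e (f x) (f y)) s (f @^-1: w).
Proof.
move=> finj sub /existsP[v /andP[vw hv]].
have /imsetP[x _ vx] := subsetP sub v vw.
have wE : f @: (f @^-1: w) = w by rewrite imset_preim; apply/setIidPl.
apply/existsP; exists x; rewrite inE -vx vw /=; apply: le_trans hv _; rewrite ler_nat -(card_imset _ finj).
apply: subset_leq_card; apply/subsetP => z; rewrite inE => cz.
have zw : z \in w by have [<- //|ne] := eqVneq v z; case/andP: (conn_in cz ne).
have /imsetP[y _ zy] := subsetP sub z zw; rewrite zy; apply: imset_f; rewrite inE.
by rewrite -(conn_img finj (fun x y => erefl)) wE -vx -zy.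
Qed.

Lemma row_lt m m' s (j : 'I_m') : (m' + s <= m)%N -> (j + s < m)%N.
Proof. by apply: leq_trans; rewrite ltn_add2r. Qed.

Definition raise n m m' s (h : (m' + s <= m)%N) (v : 'I_n * 'I_m') : 'I_n * 'I_m :=
  (v.1, Ordinal (row_lt v.2 h)).

Lemma raise_inj n m m' s (h : (m' + s <= m)%N) : injective (@raise n m m' s h).
Proof. by move=> [i j] [i' j'] [-> /eqP]; rewrite eqn_add2r => /eqP e; congr pair; exact: val_inj. Qed.

(** All rows have the same law, so the rows from s up may stand for those from 2 s up: an edge of
    [e2] is needed in [e1] only after both ends are lowered by s rows. The price is that the 2 s
    bottom rows must be empty. *)
Lemma giant_shift n m m' s (h1 : (m' + s <= m)%N) (h2 : (m' + (s + s) <= m)%N) (e1 e2 : rel ('I_n * 'I_m)) (a : R) :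
  (m = m' + (s + s))%N ->
  (forall x y, e2 (raise h2 x) (raise h2 y) -> e1 (raise h1 x) (raise h1 y)) ->
  Pr (@pm R m _) (fun w => ~~ giant e1 a w) <=
  Pr (@pm R m _) (fun w => ~~ giant e2 a w) +
  mass R m [set v : 'I_n * 'I_m | (v.2 < s + s)%N].
Proof.
move=> mE he; set p := @pm R m _; have hp : prob p by exact: prob_pm.
pose A1 (u : {set 'I_n * 'I_m'}) := ~~ giant (fun x y => e1 (raise h1 x) (raise h1 y)) a u.
pose A2 (u : {set 'I_n * 'I_m'}) := ~~ giant (fun x y => e2 (raise h2 x) (raise h2 y)) a u.
apply: (@le_trans _ _ (Pr p (fun w => A1 (raise h1 @^-1: w)))).
  by apply: Pr_le => // w; apply: contra; apply: giant_up; exact: raise_inj.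
rewrite (Pr_preim (@raise_inj n m m' s h1)).
apply: (@le_trans _ _ (Pr (p \o @raise n m m' s h1) A2)).
  apply: Pr_le => [v|u]; first exact: hp.
  by apply: contra; apply: giant_mono.
have -> : Pr (p \o raise h1 (n:=n)) A2 = Pr (p \o raise h2 (n:=n)) A2 by [].
rewrite -(Pr_preim (@raise_inj n m m' (s + s) h2)).
pose S := [set v : 'I_n * 'I_m | (v.2 < s + s)%N].
apply: le_trans (Pr_le_or (B := fun w => ~~ giant e2 a w) (C := fun w => ~~ vac S w) hp _) _; last first.
  by rewrite lerD2l; exact: hit_le.
move=> w; rewrite -negb_and; apply: contra => /andP[g vS].
apply: giant_down g; first exact: raise_inj.
apply/subsetP => v vw; have vs : (s + s <= v.2)%N.
  rewrite leqNgt; apply/negP => lt; have /eqP/setP/(_ v) := vS.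
  by rewrite !inE vw lt.
have lt : (v.2 - (s + s) < m')%N by have := ltn_ord v.2; lia.
apply/imsetP; exists (v.1, Ordinal lt) => //; case: v {vw} vs lt => i j /= vs lt.
by congr pair; apply: val_inj; rewrite /= subnK.
Qed.
End GiantMap.

(** * Giant clusters made of certain edges *)

Section LowerCells.
Import Fin.
Variables (R : realType) (alpha nu : R).
Hypotheses (al0 : 0 < alpha) (nu0 : 0 < nu) (al1 : alpha <= 1).
Local Notation be := (1 / (2 * alpha)).
Local Notation kap := (nu / pi).
Local Notation tau N := ((nu / N%:R) `^ (2 * alpha)).

Lemma half_decay (z : R) : 0 <= z <= 1 -> (1 + z) `^ (- 2^-1) <= 1 - z / 4.
Proof.
move=> /andP[z0 z1]; set y := _ `^ _; have y0 : 0 <= y by exact: powR_ge0.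
have w0 : 0 < 1 + z by lra.
have yy : y * y * (1 + z) = 1.
  have := powR_halfV w0; have := powR_half w0; rewrite -/y; set q := _ `^ _ => q1 q2.
  by rewrite -{1}q1 mulrACA -{2}[y]mulr1 mulr1 q2 mulr1.
rewrite leNgt; apply/negP => lt.
have a0 : 0 <= 1 - z / 4 by lra.
have h : (1 - z / 4) * (1 - z / 4) < y * y by apply: ltr_pM.
have h2 : (1 - z / 4) * (1 - z / 4) * (1 + z) < 1 by rewrite -[ltRHS]yy ltr_pM2r.
move: h2; apply/negP; rewrite -leNgt.
have -> : (1 - z / 4) * (1 - z / 4) * (1 + z) = 1 + z / 2 * (1 - z) + z * z / 16 * (1 + z) by field.
have : 0 <= z / 2 * (1 - z) by rewrite mulr_ge0; lra.
have : 0 <= z * z / 16 * (1 + z) by rewrite !mulr_ge0 //; lra.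
lra.
Qed.

(* Lowering both levels by sigma = 32 tau beats the boundary correction of [adj_low]. *)
Lemma shift_thr (k b t u u' v v' d : R) : 0 < k -> 2^-1 <= b -> 0 < t -> 32 * t <= u -> u <= 1 -> 32 * t <= u' -> u' <= 1 ->
  u + 32 * t <= v -> u' + 32 * t <= v' -> d <= k * (2 * t) ->
  k * (v * v') `^ (- b) + d <= k * (u * u') `^ (- b) * (1 - 3 * (t / u + t / u')).
Proof.
move=> k0 b2 t0 hu u1 hu' u'1 hv hv' hd.
have u0 : 0 < u by lra.
have u'0 : 0 < u' by lra.
have b0 : 0 <= b by lra.
set w := t / u; set w' := t / u'.
have [w0 w1 wt] : [/\ 0 < w, 32 * w <= 1 & t <= w].
  by split; rewrite /w ?divr_gt0 // ?mulrA ?ler_pdivrMr ?mul1r // ler_pdivlMr // ler_piMr // ltW.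
have [w'0 w'1 w't] : [/\ 0 < w', 32 * w' <= 1 & t <= w'].
  by split; rewrite /w' ?divr_gt0 // ?mulrA ?ler_pdivrMr ?mul1r // ler_pdivlMr // ler_piMr // ltW.
have step x y z : 0 < x -> 0 <= z <= 1 -> x * (1 + z) <= y -> y `^ (- b) <= x `^ (- b) * (1 - z / 4).
  move=> x0 /andP[z0 z1] xy; have z10 : 0 < 1 + z by lra.
  apply: le_trans (powR_anti b0 (mulr_gt0 x0 z10) xy) _.
  rewrite (powRM _ (ltW x0) (ltW z10)) ler_wpM2l ?powR_ge0 //.
  apply: le_trans (half_decay (_ : 0 <= z <= 1)); last by rewrite z0.
  by rewrite ler_powR //; lra.
have s1 := step u v (32 * w) u0 (_ : 0 <= 32 * w <= 1) _.
have {}s1 : v `^ (- b) <= u `^ (- b) * (1 - 32 * w / 4).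
  apply: s1; first by rewrite w1 mulr_ge0 // ltW.
  have -> : u * (1 + 32 * w) = u + 32 * t by rewrite /w; field; rewrite gt_eqF.
  by [].
have s2 := step u' v' (32 * w') u'0 (_ : 0 <= 32 * w' <= 1) _.
have {}s2 : v' `^ (- b) <= u' `^ (- b) * (1 - 32 * w' / 4).
  apply: s2; first by rewrite w'1 mulr_ge0 // ltW.
  have -> : u' * (1 + 32 * w') = u' + 32 * t by rewrite /w'; field; rewrite gt_eqF.
  by [].
have v0 : 0 <= v by lra.
have v'0 : 0 <= v' by lra.
set X := u `^ (- b) in s1 *; set X' := u' `^ (- b) in s2 *.
have X0 : 0 <= X by exact: powR_ge0.
have X'0 : 0 <= X' by exact: powR_ge0.
have ge1 x : 0 < x -> x <= 1 -> 1 <= x `^ (- b).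
  by move=> x0 x1; have := powR_anti b0 x0 x1; rewrite powR1.
rewrite (powRM _ v0 v'0) (powRM _ (ltW u0) (ltW u'0)) -/X -/X'.
have pr : v `^ (- b) * v' `^ (- b) <= X * X' * (1 - 4 * (w + w')).
  apply: (@le_trans _ _ (X * (1 - 32 * w / 4) * (X' * (1 - 32 * w' / 4)))).
    by apply: ler_pM => //; exact: powR_ge0.
  rewrite mulrACA ler_wpM2l ?mulr_ge0 //.
  have : w * w' <= w * 32^-1 by rewrite ler_wpM2l ?(ltW w0) //; lra.
  lra.
have X1 : 1 <= X * X' by rewrite -[1]mulr1 ler_pM // ge1.
have : k * (v `^ (- b) * v' `^ (- b)) <= k * (X * X' * (1 - 4 * (w + w'))) by rewrite ler_pM2l.
have : k * (2 * t) <= k * (X * X' * (w + w')).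
  rewrite ler_pM2l //; apply: (@le_trans _ _ (w + w')); first by lra.
  by rewrite ler_peMl // ltW // addr_gt0.
lra.
Qed.

Variable UF : set_system nat.
Hypotheses (UFu : UltraFilter UF) (UFoo : tails UF).

Lemma mass_bottom N m t : (t <= m)%N -> (0 < m)%N ->
  mass R m [set v : 'I_(N * m) * 'I_m | (v.2 < t)%N] = N%:R * (t%:R / m%:R).
Proof.
move=> tm m0; rewrite mass_rows.
rewrite (eq_bigr (fun j : 'I_m => if (j < t)%N then N%:R / m%:R else 0 : R)); last first.
  move=> j _; case: ifPn => jt.
    rewrite (eq_card (B := predT)); last by move=> i; rewrite !inE jt.
    rewrite cardT -cardE card_ord natrM; field; by rewrite pnatr_eq0 -lt0n.
  by rewrite eq_card0 ?mul0r // => i; rewrite !inE (negbTE jt).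
by rewrite -big_mkcond -(big_ord_widen m (fun=> N%:R / m%:R) tm) sumr_const card_ord -[LHS]mulr_natr mulrAC -mulrA.
Qed.

(** Lowering all heights by s rows, with s / m between 32 tau and 64 tau, turns ideal edges into
    certain ones ([shift_thr]). The expected number of points in the discarded rows is of order N
    tau, that is N^(1 - 2 alpha), and vanishes for alpha > 1/2. *)
Theorem lower_cells_half (eta dl : R) : 2^-1 < alpha -> 0 < eta -> eta <= 1 -> 0 < dl -> 0 < cc UF kap be - eta ->
  exists N0 : nat, forall N, (N0 <= N)%N ->
  UF (fun m => Pr (@pm R m _) (fun w => ~~ giant (@eminus R alpha nu N m) ((cc UF kap be - eta) * N%:R) w) <= dl).
Proof.
move=> al2 eta0 eta1 dl0 ce.
have k0 := kap0 nu0; have [b0 b1] := andP (be01 al0 al2).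
have b2 : 2^-1 <= be.
  by rewrite ler_pdivlMr ?mulr_gt0 // mulrA mulVf // mul1r.
have dl2 : 0 < dl / 2 by rewrite divr_gt0.
have [N1 hN1] : exists N1 : nat, forall N, (N1 <= N)%N ->
    UF (fun m => Pr (@pm R m _) (fun w => ~~ giant (@adj R (kT kap be) (N * m) m) ((cc UF kap be - eta) * N%:R) w) <= dl / 2).
  have [b2'|b2'] := ltP 2^-1 be; first by apply: lower_super => //; rewrite b2'.
  have bE : be = 2^-1 by apply: le_anti; rewrite b2 b2'.
  by rewrite bE in ce *; apply: lower_crit.
have a21 : 0 < 2 * alpha - 1 by move: al2; lra.
have n256 : 0 <= nu * 256 by rewrite mulr_ge0 // ltW.
have [x0 /andP[x00 x01] hx0] := @small_powR_le R (2 * alpha - 1) (nu * 256) (dl / 2) a21 n256 dl2.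
have [x2 /andP[x20 x21] hx2] := @small_powR_le R (2 * alpha) 128 (1 / 2) (ltac:(pstv)) (ltac:(nneg)) (ltac:(lra)).
have [N2 hN2] := nat_large (nu / x0 + nu / x2 + nu + 1).
exists (maxn N1 N2) => N; rewrite geq_max => /andP[NN1 NN2].
have {}hN2 : nu / x0 + nu / x2 + nu + 1 <= N%:R by apply: le_trans hN2 _; rewrite ler_nat.
have z1 : 0 < nu / x0 by rewrite divr_gt0.
have z2 : 0 < nu / x2 by rewrite divr_gt0.
have nuN : nu < N%:R by lra.
have Np : 0 < N%:R :> R by exact: lt_trans nuN.
pose r := nu / N%:R; have r0 : 0 < r by rewrite divr_gt0.
have t0 : 0 < tau N by rewrite powR_gt0.
have r1 : r <= x0.
  have q : nu / x0 <= N%:R by move: nu0; lra.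
  by rewrite ler_pdivrMr // in q; rewrite /r ler_pdivrMr // mulrC.
have r2 : r <= x2.
  have q : nu / x2 <= N%:R by move: nu0; lra.
  by rewrite ler_pdivrMr // in q; rewrite /r ler_pdivrMr // mulrC.
have tN : N%:R * (256 * tau N) <= dl / 2.
  have := hx0 r; rewrite r0 r1 => /(_ isT); apply: le_trans.
  rewrite -/r (_ : 2 * alpha = (2 * alpha - 1) + 1); last by ring.
  rewrite powRD; last by rewrite (gt_eqF r0) implybT.
  rewrite powRr1 ?(ltW r0) // [X in _ <= _ * _ `^ X](_ : _ = 2 * alpha - 1); last by ring.
  have rN : N%:R * r = nu by rewrite /r mulrC divfK // gt_eqF.
  move: (r `^ _) => z; rewrite (_ : N%:R * (256 * (z * r)) = N%:R * r * 256 * z); last by ring.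
  by rewrite rN.
have ts : 128 * tau N <= 1 / 2 by apply: hx2; rewrite r0 r2.
have c1 : 0 < 32 * tau N by pstv.
have c2 : 0 < kap * (2 * tau N) by pstv.
apply: UF_imp (UF_and UFu (hN1 N NN1) (UF_and UFu (UF_inv UFu UFoo c1) (UF_and UFu (UF_inv UFu UFoo c2) (UFoo 1)))) => m [hid [m1 [m2 m0]]].
have mp : 0 < m%:R :> R by rewrite ltr0n.
have mi : 0 <= m%:R^-1 :> R by rewrite invr_ge0 ltW.
pose s := (Num.truncn (32 * tau N * m%:R : R)).+1.
have s1 : 32 * tau N < s%:R / m%:R by rewrite ltr_pdivlMr //; exact: truncnS_gt.
have s2 : s%:R / m%:R <= 64 * tau N.
  apply: (@le_trans _ _ ((32 * tau N * m%:R + 1) / m%:R)).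
    rewrite ler_pM2r ?invr_gt0 // /s -natr1 lerD2r.
    have q : 0 <= 32 * tau N * m%:R by rewrite mulr_ge0 ?(ltW c1) ?(ltW mp).
    by case/andP: (truncn_itv q).
  rewrite mulrDl mulfK ?gt_eqF //; lra.
have ss : (s + s <= m)%N.
  rewrite -(ler_nat R) natrD -[leRHS]mul1r -ler_pdivrMr // mulrDl; lra.
pose m' := (m - (s + s))%N.
have mE : (m = m' + (s + s))%N by rewrite subnK.
have h2 : (m' + (s + s) <= m)%N by rewrite -mE.
have h1 : (m' + s <= m)%N by rewrite [X in (_ <= X)%N]mE addnA leq_addr.
apply: le_trans (@giant_shift R (N * m) m m' s h1 h2 _ (@adj R (kT kap be) (N * m) m) _ mE _) _; last first.
  rewrite (_ : dl = dl / 2 + dl / 2); last by field.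
  apply: lerD => //; rewrite mass_bottom //; apply: le_trans tN; rewrite ler_pM2l // natrD mulrDl; lra.
move=> x y hxy; apply/asboolP => -[r1' th] [r2' th'] ip iq.
have dx := cell_dX ip iq.
case: ip iq => /= p1 p2 _ /andP[pu pu'] [q1 q2 _ /andP[qu qu']].
have n2 : 1 / alpha <= 2%:R by rewrite ler_pdivrMr //; lra.
apply: (adj_low al0 nu0 nuN p1 q1 al1 n2).
have dd : `|hX N th - hX N th'| <= `|gX R (raise h1 x) - gX R (raise h1 y)| + m%:R^-1.
  by move: dx; rewrite ler_distl /= lerBlDr => /andP[].
have XE : `|gX R (raise h1 x) - gX R (raise h1 y)| = `|gX R (raise h2 x) - gX R (raise h2 y)| by [].
have gr v : gU R (raise h2 v) = gU R (raise h1 v) + s%:R / m%:R.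
  by rewrite /gU /= -mulrDl -natrD addSn addnA.
have lo v w : gU R (raise h1 v) - m%:R^-1 <= w -> 32 * tau N <= w.
  move=> hw; apply: le_trans (ltW s1) _; apply: le_trans hw.
  rewrite /gU /= -natr1 mulrDl mul1r addrK ler_pM2r ?invr_gt0 // ler_nat leq_addl //.
apply: le_trans dd _; rewrite XE.
apply: le_trans (lerD hxy m2) _; rewrite /kT.
have v1 := gU_le1 R (raise h1 x); have v2 := gU_le1 R (raise h1 y).
apply: shift_thr => //; rewrite ?gr.
- exact: lo pu.
- exact: le_trans pu' v1.
- exact: lo qu.
- exact: le_trans qu' v2.
- by apply: lerD => //; exact: ltW.
- by apply: lerD => //; exact: ltW.
Qed.

Lemma card_dev N m (eps : R) : (0 < m)%N -> (0 < N)%N -> 0 < eps ->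
  Pr (@pm R m _) (fun w : {set 'I_(N * m) * 'I_m} => (1 + eps) * N%:R <= #|w|%:R) <= 1 / (eps ^+ 2 * N%:R).
Proof.
move=> m0 N0 e0; set p := @pm R m _; have hp : prob p by exact: prob_pm.
have Nr : 0 < N%:R :> R by rewrite ltr0n.
have sM : \sum_v p v = N%:R by rewrite sum_pm grid_mass.
have E1 : Ex p (fun w : {set 'I_(N * m) * 'I_m} => #|w|%:R) = N%:R.
  rewrite -sM; transitivity (Ex p (fun w => \sum_v (v \in w)%:R)).
    apply: eq_Ex => w; rewrite -sum1_card natr_sum big_mkcond; apply: eq_bigr => v _; by case: (v \in w).
  by rewrite Ex_sum; apply: eq_bigr => v _; exact: Pr_in.
apply: (@le_trans _ _ (Pr p (fun w : {set 'I_(N * m) * 'I_m} => eps * N%:R <= `|#|w|%:R - N%:R|))).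
  apply: Pr_le => // w h; apply: le_trans (ler_norm _); rewrite lerBrDr; apply: le_trans h; by rewrite mulrDl mul1r addrC.
have := @chebyshev R _ p (fun w => #|w|%:R) (eps * N%:R) hp (mulr_gt0 e0 Nr); rewrite E1 => h.
apply: le_trans h _; rewrite ler_pdivrMr ?exprn_gt0 ?mulr_gt0 //.
apply: (@le_trans _ _ N%:R); last by rewrite le_eqVlt; apply/orP; left; apply/eqP; field; rewrite ?gt_eqF.
rewrite lerBlDr; apply: le_trans (_ : N%:R * (1 + N%:R) <= _); last by rewrite mulrDr mulr1 -expr2.
have -> : Ex p (fun w : {set 'I_(N * m) * 'I_m} => #|w|%:R ^+ 2) = Ex p (fun w => #|w|%:R * #|w|%:R).
  by apply: eq_Ex => w; rewrite expr2.
by apply: Ex_card2; rewrite ?sM // ltW.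
Qed.

Lemma pow2_between (x : R) : 1 <= x -> exists i, x <= 2 ^+ i <= 2 * x.
Proof.
move=> x1; have ex : exists i, x <= 2 ^+ i :> R.
  exists (Num.truncn x).+1; apply: le_trans (ltW (truncnS_gt x)) _.
  by rewrite -natrX ler_nat ltnW // ltn_expl.
case: (ex_minnP ex) => -[|i] hi min; first by exists 0%N; rewrite hi expr0; lra.
exists i.+1; rewrite hi exprS ler_pM2l //= leNgt; apply/negP => /ltW /min; by rewrite ltnn.
Qed.

Lemma core_thr (k b t u u' I n : R) : 0 < k -> 1 <= b -> 0 < u -> u <= 1 -> 0 < u' -> u' <= I^-1 -> 1 <= I ->
  n * (t / u) <= 1 / 4 -> n * (t / u') <= 1 / 4 ->
  k / 2 * I <= k * (u * u') `^ (- b) * (1 - n * (t / u + t / u')).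
Proof.
move=> k0 b1 u0 u1 u'0 hu' I1 h1 h2.
have I0 : 0 < I by lra.
have b0 : 0 <= b by lra.
have uu : u * u' <= I^-1 by apply: le_trans hu'; rewrite ler_piMl // ltW.
have g : I <= (u * u') `^ (- b).
  apply: le_trans (powR_anti b0 (mulr_gt0 u0 u'0) uu).
  by rewrite -(powR_inv1 (ltW I0)) -powRrM mulN1r opprK -[leLHS]powRr1 ?(ltW I0) // ler_powR.
have h3 : 1 / 2 <= 1 - n * (t / u + t / u') by rewrite mulrDr; lra.
have p0 : 0 <= k * (u * u') `^ (- b) by rewrite mulr_ge0 ?powR_ge0 // ltW.
apply: le_trans (ler_wpM2l p0 h3).
have := ler_wpM2l (ltW k0) g; lra.
Qed.

(* For alpha <= 1/2 the points of height below (nu/N)^alpha / 8 form a clique which almost every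
   point meets: dyadic rows between that height and O(tau) each catch a neighbour with fixed chance. *)
Lemma core_reach (eps : R) : alpha <= 2^-1 -> 0 < eps -> exists N0 : nat, forall N, (N0 <= N)%N ->
  UF (fun m => forall v : 'I_(N * m) * 'I_m, eps <= gU R v ->
    Pr (@pm R m _) (vac [set z | (gU R z < (nu / N%:R) `^ alpha / 4) && eminus alpha nu v z]) <= eps).
Proof.
move=> al2 e0; have k0 := kap0 nu0.
have be1 : 1 <= be by rewrite ler_pdivlMr ?mulr_gt0 // mul1r; move: al2; lra.
pose n := (Num.truncn (1 / alpha)).+1.
have hn : 1 / alpha <= n%:R by exact: ltW (truncnS_gt _).
pose s := kap / 4; have s0 : 0 < s by rewrite divr_gt0.
have [M hM] := nat_large (8 / (s * eps)).
pose K : R := 32 * n.+1%:R * 2 ^+ M.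
have K0 : 0 < K by rewrite !mulr_gt0 ?exprn_gt0.
have Kinv : 0 < eps / (16 * K) by rewrite divr_gt0 // mulr_gt0.
have [x1 /andP[x10 x11] hx1] := @small_powR_le R alpha 1 (eps / (16 * K)) al0 ler01 Kinv.
have [x2 /andP[x20 x21] hx2] := @small_powR_le R alpha (64 * K) 1 al0 (ltac:(nneg)) ltr01.
have [N2 hN2] := nat_large (nu / x1 + nu / x2 + nu + 1 + 8).
exists N2 => N NN2.
have {}hN2 : nu / x1 + nu / x2 + nu + 1 + 8 <= N%:R by apply: le_trans hN2 _; rewrite ler_nat.
have z1 : 0 < nu / x1 by rewrite divr_gt0.
have z2 : 0 < nu / x2 by rewrite divr_gt0.
have nuN : nu < N%:R by move: nu0; lra.
have Np : 0 < N%:R :> R by exact: lt_trans nuN.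
pose r := nu / N%:R; have r0 : 0 < r by rewrite divr_gt0.
have r1 : r <= x1.
  have q : nu / x1 <= N%:R by move: nu0; lra.
  by rewrite ler_pdivrMr // in q; rewrite /r ler_pdivrMr // mulrC.
have r2 : r <= x2.
  have q : nu / x2 <= N%:R by move: nu0; lra.
  by rewrite ler_pdivrMr // in q; rewrite /r ler_pdivrMr // mulrC.
set q := (nu / N%:R) `^ alpha; have q0 : 0 < q by exact: powR_gt0.
have qq : tau N = q * q by rewrite /q -powRD ?(gt_eqF r0) ?implybT //; congr (_ `^ _); ring.
have q1 : q <= eps / (16 * K) by have := hx1 r; rewrite r0 r1 mul1r; apply.
have q2 : 64 * K * q <= 1 by apply: hx2; rewrite r0 r2.
have rq : r <= q * q.
  rewrite -qq -[leLHS]powRr1 ?(ltW r0) //; apply: ger_powR; last by move: al2; lra.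
  by rewrite -/r r0 (le_trans r2).
have n1 : 1 <= n.+1%:R :> R by rewrite ler1n.
have M1 : 1 <= 2 ^+ M :> R by rewrite exprn_ege1 // ler1n.
have K1 : 32 * n.+1%:R <= K by rewrite /K ler_peMr // mulr_ge0.
have K2 : 32 * 2 ^+ M <= K by rewrite /K mulrAC ler_peMr // mulr_ge0 // exprn_ge0.
have q11 : q <= 1 / 64.
  rewrite ler_pdivlMr //; apply: le_trans q2; rewrite [q * _]mulrC ler_pM2r // ler_peMr //.
  by move: K1 n1; lra.
have [i0 /andP[i01 i02]] : exists i, 8 / q <= 2 ^+ i <= 2 * (8 / q).
  by apply: pow2_between; rewrite ler_pdivlMr // mul1r; move: q11; lra.
pose W : R := 2 ^+ (i0 + M).
have W0 : 0 < W by rewrite exprn_gt0.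
have Wq : W * q <= 16 * 2 ^+ M.
  rewrite /W exprD mulrAC ler_pM2r ?exprn_gt0 // -ler_pdivlMr //; move: i02; lra.
have tW : n.+1%:R * (tau N * (4 * W)) <= 1 / 4.
  rewrite qq (_ : n.+1%:R * (q * q * (4 * W)) = 4 * n.+1%:R * q * (W * q)); last by ring.
  apply: (@le_trans _ _ (4 * n.+1%:R * q * (16 * 2 ^+ M))).
    by rewrite ler_wpM2l // !mulr_ge0 // ltW.
  rewrite (_ : 4 * n.+1%:R * q * (16 * 2 ^+ M) = 2 * (K * q)); last by rewrite /K; ring.
  by move: q2; rewrite -mulrA; lra.
have tu : n.+1%:R * (tau N * (2 / eps)) <= 1 / 4.
  rewrite qq; have h : q * (2 / eps) <= 1 / (8 * K).
    rewrite mulrA ler_pdivrMr //; apply: le_trans (ler_wpM2r (ler0n _ 2) q1) _.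
    by rewrite le_eqVlt; apply/orP; left; apply/eqP; field; rewrite gt_eqF.
  rewrite (_ : _ * _ = n.+1%:R * q * (q * (2 / eps))); last by ring.
  apply: (@le_trans _ _ (n.+1%:R * q * (1 / (8 * K)))); first by rewrite ler_wpM2l // mulr_ge0 // ltW.
  rewrite mulrA ler_pdivrMr ?mulr_gt0 // mulr1; apply: (@le_trans _ _ (n.+1%:R * 1)).
    by rewrite ler_wpM2l //; move: q11; lra.
  by move: K1 n1; lra.
have WN : s * W <= N%:R / 16.
  have h1 : s <= nu / 8.
    rewrite /s ler_pdivrMr // ler_pdivrMr ?pi_gt0 //; have := pi_ge2 R; have := nu0.
    by set z := pi; nra.
  apply: (@le_trans _ _ (nu / 8 * W)); first by rewrite ler_pM2r.
  have h2 : 32 * r * W <= 16 / K * 2 ^+ M.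
    apply: (@le_trans _ _ (32 * (q * q) * W)); first by rewrite ler_pM2r // ler_pM2l.
    rewrite (_ : 32 * (q * q) * W = 32 * q * (W * q)); last by ring.
    apply: (@le_trans _ _ (32 * q * (16 * 2 ^+ M))); first by rewrite ler_wpM2l // mulr_ge0 // ltW.
    have : q <= 1 / (64 * K) by rewrite ler_pdivlMr ?mulr_gt0 // mulrC.
    move=> h; apply: le_trans (_ : 32 * (1 / (64 * K)) * (16 * 2 ^+ M) <= _).
    by rewrite ler_wpM2r ?mulr_ge0 ?exprn_ge0 // ler_pM2l.
    rewrite (_ : _ * _ = 8 / K * 2 ^+ M); last by field; rewrite gt_eqF.
    by rewrite ler_wpM2r ?exprn_ge0 // ler_pM2r ?invr_gt0 // ler_nat.
  have h3 : 16 / K * 2 ^+ M <= 1 / 2.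
    by rewrite mulrAC ler_pdivrMr //; move: K2; lra.
  have h4 : nu * W = N%:R * (r * W) by rewrite /r; field; rewrite gt_eqF.
  have h5 : N%:R * (r * W) <= N%:R * (1 / 2).
    rewrite ler_pM2l //; have : 0 < r * W by rewrite mulr_gt0.
    by move: h2 h3; rewrite -mulrA; lra.
  by move: h4 h5; rewrite mulrAC; lra.
have M0 : 0 < M%:R :> R.
  by apply: lt_le_trans hM; rewrite divr_gt0 // mulr_gt0.
have e20 : 0 < eps / 2 by rewrite divr_gt0.
apply: UF_imp (UF_and UFu (UF_inv UFu UFoo e20) (UF_and UFu (UF_inv UFu UFoo s0)
  (UF_and UFu (UF_real UFu UFoo (16 * W + 16 / s)) (UFoo 1)))) => m [m1 [m2 [m3 m0]]] v hv.
have mp : 0 < m%:R :> R by rewrite ltr0n.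
have s16 : 0 < 16 / s by rewrite divr_gt0.
have w16 : 16 * W <= m%:R by move: m3; lra.
have c2 : 16 <= s * m%:R by rewrite mulrC -ler_pdivrMr //; move: m3 W0; lra.
have c3 : 2 * (s * W) * m%:R + 2 <= (N * m)%:R.
  rewrite natrM; have h1 := ler_wpM2r (ltW mp) WN.
  have h2 : 8 <= N%:R * m%:R :> R.
    rewrite -[leLHS]mulr1; apply: ler_pM => //; last by rewrite ler1n.
    by move: hN2 z1 z2 nu0; lra.
  by move: h1 h2; lra.
apply: le_trans (@strips_vac R s _ _ v i0 M _ s0 w16 c2 c3 _) _.
  move=> i iM; apply/subsetP => z; rewrite !inE => /andP[/andP[u1 u2] hx].
  have I2 : 2 ^+ (i0 + i).+1 <= W by rewrite /W ler_weXn2l ?ler1n // -addnS leq_add2l.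
  set I : R := 2 ^+ (i0 + i) in u2 hx *; have I0 : 0 < I by rewrite exprn_gt0.
  have I1 : 1 <= I by rewrite exprn_ege1 // ler1n.
  have I3 : 8 / q <= I by apply: le_trans i01 _; rewrite /I ler_weXn2l ?ler1n // leq_addr.
  rewrite exprS -/I in I2 u1.
  apply/andP; split.
    apply: le_lt_trans u2 _; rewrite invf_plt ?posrE ?divr_gt0 // invf_div; apply: lt_le_trans I3.
    by rewrite ltr_pM2r ?invr_gt0 // ltr_nat.
  apply/asboolP => -[ra th] [rb th'] ip iq; have dx := cell_dX ip iq.
  case: ip iq => /= p1 p2 _ /andP[pu pu'] [p3 p4 _ /andP[pv pv']].
  apply: (adj_low al0 nu0 nuN p1 p3 al1 hn).
  apply: (@le_trans _ _ (kap / 2 * I)).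
    have dd : `|hX N th - hX N th'| <= `|gX R v - gX R z| + m%:R^-1.
    by move: dx; rewrite ler_distl /= lerBlDr => /andP[].
    apply: le_trans dd _; rewrite distrC; apply: le_trans (lerD hx m2) _.
    rewrite (_ : kap / 2 * I = s * I + s * I); last by rewrite /s; move: (kap) => zz; field.
    by rewrite lerD2l ler_peMr // ltW.
  have ulo : eps / 2 <= hU alpha nu N ra by apply: le_trans pu; move: hv m1; lra.
  have u0 : 0 < hU alpha nu N ra by apply: lt_le_trans ulo; rewrite divr_gt0.
  have vlo : (4 * W)^-1 <= hU alpha nu N rb.
    apply: le_trans pv; have m4 : m%:R^-1 <= (16 * W)^-1 by rewrite lef_pV2 ?posrE ?mulr_gt0.
    have g1 : W^-1 <= (2 * I)^-1 by rewrite lef_pV2 ?posrE ?mulr_gt0.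
    move: m4 g1 u1; rewrite !invfM; have : 0 < W^-1 by rewrite invr_gt0.
    by lra.
  have v0 : 0 < hU alpha nu N rb by apply: lt_le_trans vlo; rewrite invr_gt0 mulr_gt0.
  have t0 : 0 <= tau N by exact: powR_ge0.
  apply: core_thr => //.
  - exact: le_trans pu' (gU_le1 _ _).
  - exact: le_trans pv' u2.
  - apply: le_trans tu; rewrite ler_pM2l ?ltr0n // ler_wpM2l //.
    by rewrite -[leRHS]invf_div lef_pV2 ?posrE // divr_gt0.
  - apply: le_trans tW; rewrite ler_pM2l ?ltr0n // ler_wpM2l //.
    by rewrite -[leRHS]invrK lef_pV2 ?posrE // invr_gt0 mulr_gt0.
have sM0 : 0 < s / 8 * M%:R by rewrite mulr_gt0 // divr_gt0.
rewrite -expRM_natl (_ : M%:R * - (s / 8) = - (s / 8 * M%:R)); last by ring.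
apply: le_trans (expN_le sM0) _; rewrite invf_ple ?posrE //.
have se : 0 < s * eps := mulr_gt0 s0 e0.
move: hM; rewrite ler_pdivrMr // => hM.
rewrite -[leLHS]mul1r ler_pdivrMr //; move: hM; lra.
Qed.

(** With c = 1 the upper bound required by [glue_giant] is just the concentration of the number of
    vertices ([card_dev]). *)
Theorem lower_cells_core (eta dl : R) : alpha <= 2^-1 -> 0 < eta -> eta < 1 -> 0 < dl ->
  exists N0 : nat, forall N, (N0 <= N)%N ->
  UF (fun m => Pr (@pm R m _) (fun w => ~~ giant (@eminus R alpha nu N m) ((1 - eta) * N%:R) w) <= dl).
Proof.
move=> al2 eta0 eta1 dl0.
pose eps := Num.min eta (dl * eta / 30).
have eps0 : 0 < eps by rewrite lt_min eta0; pstv.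
have epse : eps <= eta by rewrite ge_min lexx.
have eps1 : eps <= 1 by apply: le_trans (ltW eta1).
have eps30 : 30 * eps / eta <= dl.
  by rewrite ler_pdivrMr // mulrC -ler_pdivlMr // ge_min lexx orbT.
have e4 : 0 < eps / 4 by rewrite divr_gt0.
have [N1 hN1] := core_reach al2 e4.
have half0 : 0 < 2^-1 `^ alpha^-1 :> R by rewrite powR_gt0.
have [N2 hN2] := nat_large (nu / 2^-1 `^ alpha^-1 + 4 / eps + 1 / eps ^+ 4 + nu + 1).
exists (maxn N1 N2) => N; rewrite geq_max => /andP[NN1 NN2].
have {}hN2 : nu / 2^-1 `^ alpha^-1 + 4 / eps + 1 / eps ^+ 4 + nu + 1 <= N%:R by apply: le_trans hN2 _; rewrite ler_nat.
have z1 : 0 < nu / 2^-1 `^ alpha^-1 by rewrite divr_gt0.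
have z2 : 0 < 4 / eps by rewrite divr_gt0.
have z3 : 0 < 1 / eps ^+ 4 by rewrite divr_gt0 // exprn_gt0.
have nuN : nu < N%:R by lra.
have Np : 0 < N%:R :> R by exact: lt_trans nuN.
have Nr : 1 <= N%:R :> R by rewrite ler1n -(ltr0n R).
have N0 : (0 < N)%N by rewrite -(ltr0n R).
have hr : nu / N%:R <= 2^-1 `^ alpha^-1.
  have q : nu / 2^-1 `^ alpha^-1 <= N%:R by move: nu0; lra.
  by rewrite ler_pdivrMr // in q; rewrite ler_pdivrMr // mulrC.
have hN4 : 4 <= eps * N%:R.
  have q : 4 / eps <= N%:R by move: nu0; lra.
  by rewrite ler_pdivrMr // mulrC in q.
apply: UF_imp (UF_and UFu (hN1 N NN1) (UFoo 1)) => m [hcore m0].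
have mp : 0 < m%:R :> R by rewrite ltr0n.
pose p := @pm R m ('I_(N * m) * 'I_m)%type; have hp : prob p by exact: prob_pm.
pose e := @eminus R alpha nu N m.
pose core (z : 'I_(N * m) * 'I_m) := gU R z < (nu / N%:R) `^ alpha / 4.
pose A (v : 'I_(N * m) * 'I_m) (w : {set 'I_(N * m) * 'I_m}) := [exists z in w, core z && e v z].
have sM : \sum_v p v <= N%:R by rewrite sum_pm grid_mass.
have ce : 0 < 1 - eta by lra.
apply: le_trans (glue_giant (A := A) (G := fun=> true) hp sM Nr ler01 eps0 eps1 eta0 (ltW eta1) ce _ _ _ _) eps30.
- rewrite Ex_cnt; apply: le_trans (sum_central m0 (q := 1 - eps / 4 - eps / 4) _ (lexx 0) _ _); last 3 first.
  + by move: eps1; lra.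
  + by move=> v; apply: Pr_ge0.
  + move=> i _ _; rewrite lerBlDr; apply: le_trans (lerD (lexx _) (rows_below m0 (ltW e4))).
    rewrite -mulrDl -big_split /= ler_pdivlMr //.
    have -> : (1 - eps / 4) * m%:R = \sum_(j < m) (1 - eps / 4) by rewrite sumr_const card_ord -[RHS]mulr_natr.
    apply: ler_sum => j _.
    have [lt|ge] := ltP (j.+1%:R / m%:R) (eps / 4).
    by apply: (@le_trans _ _ 1); [move: e4; lra|rewrite lerDr; exact: Pr_ge0].
    rewrite addr0; apply: (@le_trans _ _ (Pr p (fun w => ~~ vac [set z | core z && e (i, j) z] w))).
    by rewrite PrC lerD2l lerN2; apply: hcore.
    apply: Pr_le => // w /set0Pn[z]; rewrite !inE => /andP[zw h]; apply/existsP; exists z.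
    by rewrite in_setU zw orbT.
  rewrite mulr0 subr0; apply: (@lower_mean R N%:R _ 1 eps (2 / m%:R)) => //.
  + exact: ltW.
  + by move: eps1; lra.
  + by move: eps1; lra.
  + apply: (@le_trans _ _ 2); last by move: hN4; lra.
    by rewrite ler_pdivrMr // ler_peMr // ler1n.
  + apply: (@le_trans _ _ 2); first by rewrite ler_pdivrMr // ler_peMr // ler1n.
    have : eps * N%:R <= 1 * N%:R by rewrite ler_pM2r.
    by move: hN4; lra.
- by rewrite (_ : Pr p _ = 0); [rewrite exprn_ge0 // ltW|exact: Ex_cst].
- move=> w v v' _ vw v'w /existsP[z /andP[zw /andP[cz ez]]] /existsP[z' /andP[z'w /andP[cz' ez']]].
  apply: (@connect_trans _ _ z); first by apply: connect1; rewrite /gr vw zw.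
  apply: (@connect_trans _ _ z'); last by apply: connect1; rewrite /gr z'w v'w /= /e eminus_sym.
  apply: connect1; rewrite /gr zw z'w /=; apply/asboolP => -[ra th] [rb th'].
  move=> [p1 p2 _ /andP[_ pu]] [q1 q2 _ /andP[_ qu]].
  have c1 := le_lt_trans pu cz; have c2 := le_lt_trans qu cz'.
  exact: (@adj_core R alpha nu N al0 nu0 nuN ra rb th th' p1 q1 hr c1 c2).
apply: (@le_trans _ _ (Pr p (fun w => (1 + 6 * eps) * N%:R <= #|w|%:R))).
  by apply: Pr_le => // w h; apply: le_trans h (cnt_le_card _ _ _).
apply: le_trans (card_dev m0 N0 (_ : 0 < 6 * eps)) _; first by rewrite mulr_gt0.
rewrite ler_pdivrMr ?mulr_gt0 ?exprn_gt0 ?mulr_gt0 //.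
have : 1 / eps ^+ 4 <= N%:R by move: nu0; lra.
rewrite ler_pdivrMr ?exprn_gt0 // => h.
rewrite (_ : eps ^+ 2 * _ = 36 * (N%:R * eps ^+ 4)); last by ring.
by move: h; lra.
Qed.

End LowerCells.

(** * From Bernoulli samples to uniform subsets *)

Section Slices.
Import Fin.
Variables (R : realType) (V : finType).
Implicit Types (A : {set V} -> bool) (w : {set V}).

Lemma wt_cst (p : R) w : wt (fun _ : V => p) w = p ^+ #|w| * (1 - p) ^+ (#|V| - #|w|).
Proof.
rewrite /wt (bigID (mem w)) /=; congr (_ * _).
  by rewrite (eq_bigr (fun=> p)) ?prodr_const // => v ->.
rewrite (eq_bigr (fun=> 1 - p)); last by move=> v /negbTE ->.
rewrite prodr_const; congr (_ ^+ _); rewrite -(cardsC w) addKn; apply: eq_card => v; by rewrite !inE.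
Qed.

Definition slice A k : nat := #|[set w : {set V} | (#|w| == k) && A w]|.

Lemma slice_compl A k : (slice A k + slice (fun w => ~~ A w) k = 'C(#|V|, k))%N.
Proof.
rewrite -card_draws -(cardsID [set w | A w] [set w : {set V} | #|w| == k]); congr (_ + _)%N; apply: eq_card => w;
  by rewrite !inE // andbC.
Qed.

(** Double counting: a set of size k in [A] together with an outside element is sent, by adding that
    element, injectively to a set of size k + 1 in [A] with a marked element. *)
Lemma slice_up A k : (forall w v, A w -> A (v |: w)) -> (k < #|V|)%N ->
  (slice A k * (#|V| - k) <= slice A k.+1 * k.+1)%N.
Proof.
move=> hA kV.
pose D : {set {set V} * V} := [set x : {set V} * V | [&& #|x.1| == k, A x.1 & x.2 \notin x.1]].
pose D' : {set {set V} * V} := [set x : {set V} * V | [&& #|x.1| == k.+1, A x.1 & x.2 \in x.1]].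
have cD : #|D| = (slice A k * (#|V| - k))%N.
  rewrite -sum1_card (reindex (fun x : {set V} * V => x)) /=; last by exists id.
  rewrite (eq_bigl (fun x : {set V} * V => ((#|x.1| == k) && A x.1) && (x.2 \notin x.1))); last first.
    by move=> x; rewrite inE andbA.
  rewrite -(pair_big_dep (fun w : {set V} => (#|w| == k) && A w) (fun w v => v \notin w) (fun _ _ => 1%N)) /=.
  rewrite (eq_bigr (fun=> (#|V| - k)%N)); last first.
    move=> w /andP[/eqP wk _]; rewrite sum1_card -wk -(cardsC w) addKn; apply: eq_card => v; by rewrite !inE.
  by rewrite sum_nat_const /slice; congr (_ * _)%N; apply: eq_card => w; rewrite inE.
have cD' : #|D'| = (slice A k.+1 * k.+1)%N.
  rewrite -sum1_card (reindex (fun x : {set V} * V => x)) /=; last by exists id.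
  rewrite (eq_bigl (fun x : {set V} * V => ((#|x.1| == k.+1) && A x.1) && (x.2 \in x.1))); last first.
    by move=> x; rewrite inE andbA.
  rewrite -(pair_big_dep (fun w : {set V} => (#|w| == k.+1) && A w) (fun w v => v \in w) (fun _ _ => 1%N)) /=.
  rewrite (eq_bigr (fun=> k.+1)); last by move=> w /andP[/eqP wk _]; rewrite sum1_card wk.
  by rewrite sum_nat_const /slice; congr (_ * _)%N; apply: eq_card => w; rewrite inE.
rewrite -cD -cD'; pose g (x : {set V} * V) := (x.2 |: x.1, x.2).
rewrite -(card_in_imset (f := g)); last first.
  move=> [w v] [w' v']; rewrite !inE /= => /and3P[_ _ h] /and3P[_ _ h'] [e1 e2]; subst v'.
  by congr pair; rewrite -(setU1K h) -(setU1K h') e1.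
apply: subset_leq_card; apply/subsetP => y /imsetP[[w v]]; rewrite !inE /= => /and3P[/eqP wk Aw vw] ->.
by rewrite /= cardsU1 vw wk add1n eqxx setU11 andbT /= hA.
Qed.

Definition frac A k : R := (slice A k)%:R / 'C(#|V|, k)%:R.

Lemma frac_ge0 A k : 0 <= frac A k.
Proof. by rewrite divr_ge0. Qed.

Lemma bin_gt0R k : (k <= #|V|)%N -> 0 < 'C(#|V|, k)%:R :> R.
Proof. by move=> kV; rewrite ltr0n bin_gt0. Qed.

Lemma frac_up A k : (forall w v, A w -> A (v |: w)) -> (k < #|V|)%N -> frac A k <= frac A k.+1.
Proof.
move=> hA kV; have h := slice_up hA kV.
have c0 := bin_gt0R (ltnW kV); have c1 := bin_gt0R kV.
rewrite /frac ler_pdivrMr // mulrAC ler_pdivlMr // -!natrM ler_nat.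
have e : ('C(#|V|, k.+1) * k.+1 = 'C(#|V|, k) * (#|V| - k))%N by rewrite mulnC mul_bin_left mulnC.
rewrite -(leq_pmul2r (ltn0Sn k)).
have -> : (slice A k * 'C(#|V|, k.+1) * k.+1 = 'C(#|V|, k) * (slice A k * (#|V| - k)))%N by rewrite -mulnA e mulnCA.
have -> : (slice A k.+1 * 'C(#|V|, k) * k.+1 = 'C(#|V|, k) * (slice A k.+1 * k.+1))%N.
  by rewrite [(slice A k.+1 * _)%N]mulnC -mulnA.
by rewrite leq_mul2l h orbT.
Qed.

Lemma frac_compl A k : (k <= #|V|)%N -> frac A k = 1 - frac (fun w => ~~ A w) k.
Proof.
move=> kV; have c0 := bin_gt0R kV; rewrite /frac; apply/eqP; rewrite eq_sym subr_eq -mulrDl -natrD slice_compl divff //.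
by rewrite gt_eqF.
Qed.

Lemma frac_incr A k k' : (forall w v, A w -> A (v |: w)) -> (k <= k')%N -> (k' <= #|V|)%N -> frac A k <= frac A k'.
Proof.
move=> hA /subnK <-; elim: (k' - k)%N => [|d IH] // hd.
by apply: le_trans (IH (ltnW hd)) _; apply: frac_up.
Qed.

Lemma frac_decr A k k' : (forall w v, A (v |: w) -> A w) -> (k <= k')%N -> (k' <= #|V|)%N -> frac A k' <= frac A k.
Proof.
move=> hA kk kV; rewrite (frac_compl _ kV) (frac_compl _ (leq_trans kk kV)) lerD2l lerN2.
by apply: frac_incr => // w v; apply: contra; exact: hA.
Qed.

Lemma Pr_slices (p : R) A (I : pred nat) : Pr (fun _ : V => p) (fun w => I #|w| && A w) =
  \sum_(k < #|V|.+1 | I k) p ^+ k * (1 - p) ^+ (#|V| - k) * (slice A k)%:R.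
Proof.
rewrite /Pr /Ex (partition_big (fun w : {set V} => inord #|w| : 'I_#|V|.+1) xpredT) //= [RHS]big_mkcond.
apply: eq_bigr => k _.
have key w : (inord #|w| == k :> 'I_#|V|.+1) = (#|w| == k).
  by rewrite -val_eqE /= inordK // ltnS max_card.
rewrite (eq_bigl (fun w : {set V} => #|w| == k)) //.
rewrite (eq_bigr (fun w => (if I k then p ^+ k * (1 - p) ^+ (#|V| - k) else 0) * (A w)%:R)); last first.
  by move=> w /eqP wk; rewrite wt_cst wk; case: (I k); rewrite /= ?mulr0 ?mul0r.
rewrite -mulr_sumr; case: (I k); last by rewrite mul0r.
congr (_ * _); rewrite -natr_sum; congr (_%:R); rewrite -big_mkcondr sum1dep_card; apply: eq_card => w.
by rewrite !inE.
Qed.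

(** Given its size k a Bernoulli sample is uniform, and on [I], an event of probability at least
    [c], the proportion at size k dominates that at size N. *)
Lemma frac_Pr (p c : R) A (I : pred nat) N : 0 <= p <= 1 -> (N <= #|V|)%N -> 0 < c ->
  (forall k, (k <= #|V|)%N -> I k -> frac A N <= frac A k) ->
  c <= Pr (fun _ : V => p) (fun w => I #|w|) -> frac A N <= c^-1 * Pr (fun _ : V => p) A.
Proof.
move=> /andP[p0 p1] NV c0 hI hc; have hp : prob (fun _ : V => p) by move=> v; rewrite p0.
rewrite mulrC ler_pdivlMr //.
apply: (@le_trans _ _ (frac A N * Pr (fun _ : V => p) (fun w => I #|w| && true))).
  rewrite ler_wpM2l ?frac_ge0 //; apply: le_trans hc _; by apply: Pr_le => // w ->.
apply: (@le_trans _ _ (Pr (fun _ : V => p) (fun w => I #|w| && A w))); last by apply: Pr_le => // w /andP[].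
rewrite !Pr_slices mulr_sumr; apply: ler_sum => k Ik; have kV : (k <= #|V|)%N by rewrite -ltnS.
have c1 := bin_gt0R kV.
have -> : slice (fun=> true) k = 'C(#|V|, k).
  by rewrite -card_draws; apply: eq_card => w; rewrite !inE andbT.
have q0 : 0 <= p ^+ k * (1 - p) ^+ (#|V| - k) by rewrite mulr_ge0 ?exprn_ge0 // subr_ge0.
rewrite mulrCA ler_wpM2l // -ler_pdivlMr //; exact: hI.
Qed.

(* Change of density: AM-GM against the likelihood ratio. *)
Lemma Pr_change (p p' t : R) A : 0 < p < 1 -> 0 <= p' <= 1 -> 0 < t ->
  Pr (fun _ : V => p') A <= t / 2 * (1 + (p' - p) ^+ 2 / (p * (1 - p))) ^+ #|V| + Pr (fun _ : V => p) A / (2 * t).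
Proof.
move=> /andP[p0 p1] /andP[p'0 p'1] t0.
have q0 : 0 < 1 - p by rewrite subr_gt0.
have w0 w : 0 < wt (fun _ : V => p) w by apply: prodr_gt0 => v _; case: (v \in w).
have -> : (1 + (p' - p) ^+ 2 / (p * (1 - p))) ^+ #|V| = \sum_w wt (fun _ : V => p') w ^+ 2 / wt (fun _ : V => p) w.
  transitivity (\prod_(v : V) (p' ^+ 2 / p + (1 - p') ^+ 2 / (1 - p))).
    rewrite prodr_const; congr (_ ^+ _); field; by rewrite ?gt_eqF.
  rewrite (bigA_distr _ _ (fun _ : V => p' ^+ 2 / p) (fun _ => (1 - p') ^+ 2 / (1 - p))).
  by apply: eq_bigr => w _; rewrite /wt -prodrXl -prodf_div; apply: eq_bigr => v _; case: (v \in w).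
have -> : Pr (fun _ : V => p) A / (2 * t) = \sum_w wt (fun _ : V => p) w * (A w)%:R / (2 * t) by rewrite /Pr /Ex mulr_suml.
rewrite mulr_sumr -big_split /Pr /Ex /=; apply: ler_sum => w _.
set a := wt (fun=> p') w; have := w0 w; set b := wt (fun=> p) w => b0.
have h0 : 0 <= t / 2 * (a ^+ 2 / b) by rewrite mulr_ge0 ?divr_ge0 ?sqr_ge0 // ltW.
case: (A w); last by rewrite !mulr0 mul0r addr0.
rewrite !mulr1 -subr_ge0 (_ : _ - a = (t * a - b) ^+ 2 / (2 * t * b)); last by field; rewrite ?gt_eqF.
by rewrite divr_ge0 ?sqr_ge0 // !mulr_ge0 // ltW.
Qed.
Lemma Pr_card_dev (p d : R) : 0 <= p <= 1 -> 0 < d ->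
  Pr (fun _ : V => p) (fun w => d <= `|#|w|%:R - #|V|%:R * p|) <= #|V|%:R * p / d ^+ 2.
Proof.
move=> /andP[p0 p1] d0; have hp : prob (fun _ : V => p) by move=> v; rewrite p0 p1.
set M := #|V|%:R * p.
have sM : \sum_(v : V) p = M by rewrite sumr_const -[LHS]mulr_natl.
have M0 : 0 <= M by rewrite mulr_ge0.
have E1 : Ex (fun _ : V => p) (fun w => #|w|%:R) = M.
  rewrite -sM; transitivity (Ex (fun _ : V => p) (fun w => \sum_v (v \in w)%:R)).
    apply: eq_Ex => w; rewrite -sum1_card natr_sum big_mkcond; apply: eq_bigr => v _; by case: (v \in w).
  by rewrite Ex_sum; apply: eq_bigr => v _; exact: Pr_in.
have := @chebyshev R _ _ (fun w => #|w|%:R) d hp d0; rewrite E1 => h.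
apply: le_trans h _; rewrite ler_pM2r ?invr_gt0 ?exprn_gt0 //.
rewrite lerBlDr; apply: le_trans (_ : M * (1 + M) <= _); last by rewrite mulrDr mulr1 -expr2.
have -> : Ex (fun _ : V => p) (fun w : {set V} => #|w|%:R ^+ 2) = Ex (fun _ : V => p) (fun w => #|w|%:R * #|w|%:R).
  by apply: eq_Ex => w; rewrite expr2.
by apply: Ex_card2; rewrite ?sM.
Qed.

Lemma expR8 (x : R) n : 0 <= x -> x * n%:R <= 8 -> (1 + x) ^+ n <= expR 8.
Proof.
move=> x0 xn; apply: (@le_trans _ _ (expR x ^+ n)).
  by rewrite lerXn2r ?nnegrE ?expR_ge0 ?addr_ge0 // expR_ge1Dx.
by rewrite -expRM_natl ler_expR mulrC.
Qed.

(* Transfer from Bernoulli density N / #|V| to uniform N-subsets, through densities shifted by two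
   standard deviations. *)
Lemma frac_transfer (eps : R) (A : {set V} -> bool) N : 0 < eps ->
  (4 < N)%N -> (2 * N <= #|V|)%N ->
  ((forall w v, A w -> A (v |: w)) \/ (forall w v, A (v |: w) -> A w)) ->
  Pr (fun _ : V => N%:R / #|V|%:R : R) A <= eps * eps / (16 * expR 8) -> frac A N <= eps.
Proof.
have fld (x y z : R) : 0 < x -> 0 < y -> 0 < 1 - x -> (2 * x / y) ^+ 2 / (x * (1 - x)) * z = 4 * (z * x) / (y ^+ 2 * (1 - x)).
  by move=> x0 y0 x1; field; rewrite ?gt_eqF.
move=> e0; pose K : R := expR 8; have K0 : 0 < K by exact: expR_gt0.
pose t := eps / (4 * K); have t0 : 0 < t by rewrite divr_gt0 // mulr_gt0.
move=> N4 NV mono; rewrite -/K (_ : eps * eps / (16 * K) = eps * t / 4); last by rewrite /t; field; rewrite gt_eqF.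
move=> hA.
set n : R := #|V|%:R in hA *; have NR : 4 < N%:R :> R by rewrite ltr_nat.
have NV' : 2 * N%:R <= n by rewrite /n -natrM ler_nat.
have NV1 : (N <= #|V|)%N by apply: leq_trans NV; rewrite leq_pmull.
have n0 : 0 < n by lra.
set p := N%:R / n in hA *; have np : n * p = N%:R by rewrite /p mulrC divfK // gt_eqF.
have p0 : 0 < p by rewrite divr_gt0 //; lra.
have p2 : p <= 1 / 2 by rewrite ler_pdivrMr //; lra.
pose s := Num.sqrt N%:R : R; have s0 : 0 < s by rewrite sqrtr_gt0; lra.
have ss : s ^+ 2 = N%:R by rewrite sqr_sqrtr.
have s2 : 2 < s.
  by rewrite ltNge; apply/negP => h; have : s ^+ 2 <= 2 ^+ 2; [rewrite ler_pXn2r // nnegrE; lra|rewrite ss; lra].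
have bound (p' : R) (I : pred nat) : 0 <= p' <= 1 -> (p' - p) ^+ 2 = (2 * p / s) ^+ 2 ->
    (forall k, (k <= #|V|)%N -> I k -> frac A N <= frac A k) ->
    4^-1 <= Pr (fun _ : V => p') (fun w => I #|w|) -> frac A N <= eps.
  move=> hp' hd hI hc.
  have q0 : 0 < 4^-1 :> R by rewrite invr_gt0.
  apply: le_trans (frac_Pr hp' NV1 q0 hI hc) _; rewrite invrK.
  have p01 : 0 < p < 1 by rewrite p0; lra.
  have h1 := Pr_change A p01 hp' t0; rewrite hd in h1.
  (* The base is 1 + 4 p / (N (1 - p)); multiplied by [#|V|] the increment is 4 / (1 - p), at most 8
     as p <= 1/2. *)
  have h2 : (1 + (2 * p / s) ^+ 2 / (p * (1 - p))) ^+ #|V| <= K.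
    apply: expR8; first by rewrite divr_ge0 ?sqr_ge0 // mulr_ge0 ?(ltW p0) //; lra.
    have p1 : 0 < 1 - p by lra.
    rewrite (fld _ _ _ p0 s0 p1) np ss invfM mulrA mulfK ?gt_eqF //; last by lra.
    rewrite ler_pdivrMr //; lra.
  have h3 : t / 2 * K = eps / 8 by rewrite /t; field; rewrite gt_eqF.
  have h4 : Pr (fun _ : V => p) A / (2 * t) <= eps / 8.
    have tt : 0 < 2 * t by rewrite pmulr_rgt0.
    by rewrite (ler_pdivrMr _ _ tt) (_ : eps / 8 * (2 * t) = eps * t / 4) //; field.
  have h5 : t / 2 * (1 + (2 * p / s) ^+ 2 / (p * (1 - p))) ^+ #|V| <= t / 2 * K.
    by rewrite ler_pM2l // divr_gt0.
  rewrite h3 in h5; have : Pr (fun=> p') A <= eps / 4 by lra.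
  lra.
have sp : 2 * p / s <= p by rewrite ler_pdivrMr // mulrC ler_pM2l //; lra.
have sp0 : 0 < 2 * p / s by rewrite divr_gt0 // mulr_gt0.
have dev (p' : R) : 0 <= p' <= 1 -> p' <= 2 * p -> Pr (fun _ : V => p') (fun w => 2 * s <= `|#|w|%:R - n * p'|) <= 3 / 4.
  move=> hp' h; have d0 : 0 < 2 * s by rewrite mulr_gt0.
  apply: le_trans (Pr_card_dev hp' d0) _; rewrite -/n exprMn ss ler_pdivrMr; last by rewrite mulr_gt0 ?exprn_gt0 //; lra.
  have : n * p' <= n * (2 * p) by rewrite ler_pM2l.
  rewrite mulrCA np; lra.
have nsp : n * (2 * p / s) = 2 * s.
  by rewrite (_ : n * _ = 2 * (n * p) / s); [rewrite np -ss; field; rewrite gt_eqF|ring].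
have ge14 (p' : R) (B : {set V} -> bool) : 0 <= p' <= 1 -> Pr (fun _ : V => p') (fun w => ~~ B w) <= 3 / 4 ->
    4^-1 <= Pr (fun _ : V => p') B.
  by move=> hp' h; move: h; rewrite PrC; lra.
case: mono => mono.
  apply: (bound (p + 2 * p / s) (fun k => N <= k)%N); [lra| | |].
  - by congr (_ ^+ 2); ring.
  - by move=> k kV kN; apply: frac_incr.
  apply: ge14; first lra.
  apply: le_trans (dev (p + 2 * p / s) _ _); [|lra|lra].
  apply: Pr_le => [v|w]; first by lra.
  rewrite -ltnNge -(ltr_nat R) => lt; rewrite distrC; apply: le_trans (ler_norm _).
  rewrite mulrDr np nsp; lra.
apply: (bound (p - 2 * p / s) (fun k => k <= N)%N); [lra| | |].
- by rewrite -[RHS]sqrrN; congr (_ ^+ 2); ring.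
- by move=> k kV kN; apply: frac_decr.
apply: ge14; first lra.
apply: le_trans (dev (p - 2 * p / s) _ _); [|lra|lra].
apply: Pr_le => [v|w]; first by lra.
rewrite -ltnNge -(ltr_nat R) => lt; apply: le_trans (ler_norm _).
rewrite mulrBr np nsp; lra.
Qed.

End Slices.

Local Open Scope classical_set_scope.
Local Open Scope ring_scope.

(** * Probabilities of boxes from the joint distribution function *)

Section BoxLaw.
Variables (R : realType) (d : measure_display) (T : measurableType d) (P : probability T R).

(** Half-lines are replaced by differences one coordinate at a time, each replacement being a
    subtraction of two probabilities already known. The list [s] records the coordinates treated. *)
Lemma box_law (I : finType) (F : I -> R -> set T) (h : I -> R -> R) (lo hi : I -> R) :
  (forall i a, measurable (F i a)) -> (forall i, F i (lo i) `<=` F i (hi i)) ->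
  (forall x, P (\bigcap_(i in [set: I]) F i (x i)) = (\prod_i h i (x i))%:E) ->
  P (\bigcap_(i in [set: I]) (F i (hi i) `\` F i (lo i))) = (\prod_i (h i (hi i) - h i (lo i)))%:E.
Proof.
move=> mF sF PF.
pose A (s : seq I) (x : I -> R) i := if i \in s then F i (hi i) `\` F i (lo i) else F i (x i).
pose H (s : seq I) (x : I -> R) i := if i \in s then h i (hi i) - h i (lo i) else h i (x i).
have mA s x : measurable (\bigcap_(i in [set: I]) A s x i).
  by apply: fin_bigcap_measurable => // i _; rewrite /A; case: ifP => // _; apply: measurableD.
suff key (s : seq I) : uniq s -> forall x, P (\bigcap_(i in [set: I]) A s x i) = (\prod_i H s x i)%:E.
  have := key _ (enum_uniq I) (fun=> 0); rewrite (_ : \bigcap_(i in _) A _ _ i = \bigcap_(i in [set: I]) (F i (hi i) `\` F i (lo i))).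
    by move=> ->; congr (_%:E); apply: eq_bigr => i _; rewrite /H mem_enum.
  by apply: eq_bigcapr => i _; rewrite /A mem_enum.
elim: s => [|i0 s IH] /=.
  by move=> _ x; rewrite (PF x).
move=> /andP[i0s us] x.
pose u (a : R) i := if i == i0 then a else x i.
have other a i : i != i0 -> A (i0 :: s) x i = A s (u a) i.
  by move=> ii; rewrite /A /u inE (negbTE ii).
have E : \bigcap_(i in [set: I]) A (i0 :: s) x i =
    (\bigcap_(i in [set: I]) A s (u (hi i0)) i) `\` (\bigcap_(i in [set: I]) A s (u (lo i0)) i).
  apply/seteqP; split => w /=.
    move=> hw; split.
    move=> i _; have := hw i Logic.I; case: (eqVneq i i0) => [->|ii]; last by rewrite (other (hi i0)).
    by rewrite /A /u inE eqxx (negbTE i0s) => -[].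
    move=> /(_ i0 Logic.I); rewrite /A /u (negbTE i0s) eqxx.
    by have := hw i0 Logic.I; rewrite /A inE eqxx => -[].
  move=> [h1 h2] i _; case: (eqVneq i i0) => [->|ii]; last by rewrite (other (hi i0)) //; exact: h1.
  rewrite /A inE eqxx; split; first by have := h1 i0 Logic.I; rewrite /A /u (negbTE i0s) eqxx.
  move=> h3; apply: h2 => i' _; case: (eqVneq i' i0) => [->|ii']; first by rewrite /A /u (negbTE i0s) eqxx.
  by rewrite -(other (lo i0)) // (other (hi i0)) //; exact: h1.
rewrite E measureD //; last by rewrite (le_lt_trans (probability_le1 _ _)) ?ltry.
rewrite setIidr; last first.
  move=> w /= hw i _; have := hw i Logic.I; case: (eqVneq i i0) => [->|ii].
    by rewrite /A /u (negbTE i0s) eqxx; exact: sF.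
  by rewrite -(other (lo i0)) // (other (hi i0)).
have sub (p p' : \bar R) : p = (\prod_i H s (u (hi i0)) i)%:E -> p' = (\prod_i H s (u (lo i0)) i)%:E ->
    (p - p')%E = (\prod_i H s (u (hi i0)) i - \prod_i H s (u (lo i0)) i)%:E by move=> -> ->.
rewrite (sub _ _ (IH us _) (IH us _)); congr (_%:E).
rewrite [RHS](bigD1 i0) //= [X in X - _](bigD1 i0) //= [X in _ - X](bigD1 i0) //=.
have oth a : \prod_(i | i != i0) H s (u a) i = \prod_(i | i != i0) H (i0 :: s) x i.
  by apply: eq_bigr => i ii; rewrite /H /u inE (negbTE ii).
by rewrite !oth -mulrBl /H /u inE !eqxx (negbTE i0s).
Qed.

Lemma finite_event (I : finType) (b : I -> T -> bool) (Q : {ffun I -> bool} -> bool) :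
  (forall i, measurable_fun setT (b i)) -> measurable [set w | Q [ffun i => b i w]].
Proof.
move=> mb; rewrite (_ : [set w | _] = \bigcup_(g in [set g : {ffun I -> bool} | Q g]) \bigcap_(i in [set: I]) (b i @^-1` [set g i])).
  apply: fin_bigcup_measurable => // g _; apply: fin_bigcap_measurable => // i _.
  by rewrite -[X in measurable X]setTI; apply: mb.
apply/seteqP; split => w /=.
  by move=> h; exists [ffun i => b i w] => // i _ /=; rewrite ffunE.
by move=> [g /= Qg hg]; rewrite (_ : finfun _ = g) //; apply/ffunP => i; rewrite ffunE; exact: hg.
Qed.

(** The pieces are disjoint and of total probability 1, so their complement is null. *)
Lemma cover_bound (F : finType) (C : F -> set T) (B : pred F) (q : R) (E : set T) :
  measurable E -> (forall f, measurable (C f)) -> (forall f g, C f `&` C g !=set0 -> f = g) ->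
  (forall f, P (C f) = q%:E) -> #|F|%:R * q = 1 -> (forall f, ~~ B f -> E `&` C f = set0) ->
  (P E <= (#|B|%:R * q)%:E)%E.
Proof.
move=> mE mC dC PC tot hE.
pose D (A : pred F) f := if A f then C f else set0.
have mD (A : pred F) f : measurable (D A f) by rewrite /D; case: ifP.
have PD (A : pred F) : P (\bigcup_(f in [set: F]) D A f) = (#|A|%:R * q)%:E.
  have fF : finite_set [set: F] by exact: finite_finset.
  have tI : trivIset [set: F] (D A).
    move=> f g _ _ [w []]; rewrite /D; case: ifP => // _ h1; case: ifP => // _ h2.
    by apply: dC; exists w.
  rewrite measure_fin_bigcup // (_ : [set: F] = [set` enum F]); last by apply/seteqP; split => // f _ /=; rewrite mem_enum.
  rewrite -fsbig_seq ?enum_uniq // big_enum /= (eq_bigr (fun f => ((A f)%:R * q)%:E)); last first.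
    by move=> f _; rewrite /D; case: ifP => _; rewrite ?PC ?measure0 ?mul1r ?mul0r.
  rewrite sumEFin -mulr_suml -natr_sum -sum1_card [in RHS]big_mkcond /=; congr ((_%:R * _)%:E).
have mU A : measurable (\bigcup_(f in [set: F]) D A f) by apply: fin_bigcup_measurable.
have -> : (#|B|%:R * q)%:E = (P (\bigcup_(f in [set: F]) D B f) + P (~` \bigcup_(f in [set: F]) D xpredT f))%E.
  by rewrite PD probability_setC // PD (_ : #|xpredT| = #|F|) // tot subee // adde0.
apply: le_trans (measureU2 _ _ _) => //; last exact: measurableC.
apply: le_measure; rewrite ?inE //; first by apply: measurableU => //; exact: measurableC.
move=> w Ew; case: (pselect ((\bigcup_(f in [set: F]) D xpredT f) w)) => [[f _ /= Cw]|]; last by right.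
left; exists f => //; rewrite /D; case: ifP => // /negbT /hE; move=> /seteqP[/(_ w) h _]; exfalso; exact: h.
Qed.

End BoxLaw.

(** * The two largest components *)

Section Components.
Import Fin.
Local Close Scope classical_set_scope.
Variables (R : realType) (T : finType) (e : rel T).
Hypothesis es : symmetric e.

(** [comp_size] counts a classical set; it is read here as the cardinal of a finite set. *)
Lemma comp_sizeE i : comp_size e i = #|[set j | connect e i j]|.
Proof.
rewrite /comp_size; apply: eq_card => j; rewrite in_set.
by apply/idP/idP => [h|h]; [exact: (asboolW h)|exact: asboolT].
Qed.

Lemma comp_size_eq i j : connect e i j -> comp_size e j = comp_size e i.
Proof.
move=> ij; rewrite !comp_sizeE; apply: eq_card => z; rewrite !inE.
by rewrite (same_connect (sym_connect_sym es) ij).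
Qed.

Lemma comp_size_big (s : R) i : s <= (comp_size e i)%:R ->
  [set j | connect e i j] \subset [set j | s <= (comp_size e j)%:R].
Proof. by move=> h; apply/subsetP => j; rewrite !inE => ij; rewrite (comp_size_eq ij). Qed.

Lemma largest_count (s : R) : s <= (largest_comp_size e)%:R ->
  (largest_comp_size e <= #|[set i | (s <= (comp_size e i)%:R)%R]|)%N.
Proof.
have [i _|no] := pickP T; last by rewrite /largest_comp_size big_pred0.
have [|j hj] := @bigop.eq_bigmax T (comp_size e); first by apply/card_gt0P; exists i.
rewrite /largest_comp_size hj => h; rewrite {1}comp_sizeE.
exact/subset_leq_card/comp_size_big.
Qed.

(** The two components are disjoint and consist of counted vertices. An upper bound on the count
    with a lower bound on the largest component thus bounds the second one. *)
Lemma second_count (s : R) : s <= (second_comp_size e)%:R ->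
  (largest_comp_size e + second_comp_size e <= #|[set i | (s <= (comp_size e i)%:R)%R]|)%N.
Proof.
have zero : second_comp_size e = 0%N -> s <= (second_comp_size e)%:R ->
    (largest_comp_size e + second_comp_size e <= #|[set i | (s <= (comp_size e i)%:R)%R]|)%N.
  by move=> -> h; rewrite addn0; apply: largest_count; apply: le_trans h _; rewrite ler_nat.
move: zero; rewrite /second_comp_size; case: pickP => [v /eqP hv|_]; last by apply.
have [i0 hi0|no] := pickP (fun i => ~~ connect e v i); last by rewrite big_pred0 //; apply.
move=> _; have [|j] := @eq_bigmax_cond T [pred i | ~~ connect e v i] (comp_size e).
  by apply/card_gt0P; exists i0.
rewrite inE => vj ->; move=> h.
have hv' : s <= (comp_size e v)%:R by apply: le_trans h _; rewrite ler_nat hv; exact: leq_bigmax.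
rewrite -hv (comp_sizeE v) {1}(comp_sizeE j).
have dj : [set z | connect e v z] :&: [set z | connect e j z] = set0.
  apply/setP => z; rewrite !inE; apply/negP => /andP[vz jz]; move/negP: vj; apply.
  by apply: connect_trans vz _; rewrite (sym_connect_sym es).
rewrite -[X in (X <= _)%N]subn0 -(cards0 T) -dj -cardsU; apply: subset_leq_card.
by rewrite subUset !comp_size_big.
Qed.

End Components.

(** * The true graph between the two cell graphs *)

Section Sandwich.
Import Fin.
Local Close Scope classical_set_scope.
Variables (R : realType) (alpha nu : R) (N m : nat) (pts : 'I_N -> R * R) (f : 'I_N -> 'I_(N * m) * 'I_m).
Hypotheses (finj : injective f) (inC : forall i, in_cell alpha nu (f i) (pts i)).
Local Notation G := (kpkvb_adj nu pts).

Lemma giant_largest (s : R) : giant (@eminus R alpha nu N m) s (f @: setT) -> s <= (largest_comp_size G)%:R.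
Proof.
move=> /existsP[v /andP[/imsetP[i _ ->] hs]]; apply: le_trans hs _; rewrite ler_nat.
apply: (@leq_trans (comp_size G i)); last exact: leq_bigmax.
rewrite comp_sizeE -(card_imset _ finj).
apply: subset_leq_card; apply/subsetP => z; rewrite inE => hz.
have zW : z \in f @: setT.
  by case: (eqVneq (f i) z) => [<-|ne]; [exact: imset_f|case/andP: (conn_in hz ne)].
case/imsetP: zW hz => j _ -> hz; apply: imset_f; rewrite inE; move: hz.
rewrite (@conn_img _ _ f _ (fun x y => eminus alpha nu (f x) (f y)) finj) //.
apply: connect_sub => x y /and3P[_ _ h]; case: (eqVneq x y) => [->|xy]; first exact: connect0.
by apply: connect1; rewrite /kpkvb_adj xy; move: h => /asboolP; apply; exact: inC.
Qed.

Lemma cnt_components (s : R) : nu < N%:R ->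
  #|[set i | s <= (comp_size G i)%:R]|%:R <= cnt R (bigc (@eplus R alpha nu N m) s) (f @: setT).
Proof.
move=> nuN; rewrite /cnt big_imset /=; last by move=> x y _ _; exact: finj.
rewrite -sum1_card natr_sum big_mkcond /=; rewrite [leRHS](eq_bigl xpredT); last by move=> i; rewrite inE.
apply: ler_sum => i _; rewrite inE; case: ifP => // h.
rewrite (_ : bigc _ _ _ _ = true) //; apply/idP; rewrite /bigc; apply: le_trans h _; rewrite ler_nat comp_sizeE -(card_imset _ finj).
apply: subset_leq_card; apply/subsetP => z /imsetP[j]; rewrite !inE => ij ->.
rewrite (@conn_img _ _ f _ (fun x y => eplus alpha nu (f x) (f y)) finj) //.
apply: connect_sub ij => x y /andP[_ h]; apply: connect1; rewrite /gr !inE /eplus nuN /=.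
by apply/asboolP; exists (pts x), (pts y).
Qed.

End Sandwich.

(** * Independent cells against uniform subsets *)

Section Injections.
Import Fin.
Local Close Scope classical_set_scope.
Variables (R : realType) (V : finType).
Implicit Types (A B : {set V} -> bool).

Lemma frac_or A B k : frac R (fun w => A w || B w) k <= frac R A k + frac R B k.
Proof.
rewrite /frac -mulrDl ler_wpM2r ?invr_ge0 // -natrD ler_nat /slice.
apply: leq_trans (subset_leq_card _) (leq_card_setU _ _); apply/subsetP => w; rewrite !inE.
by case: (_ == _); case: (A w).
Qed.

Lemma card_image A N : (#|[set f : {ffun 'I_N -> V} | injectiveb f && A (f @: setT)]| <= slice A N * N`!)%N.
Proof.
pose S := [set w : {set V} | (#|w| == N) && A w].
rewrite -sum1_card (partition_big (fun f : {ffun 'I_N -> V} => f @: setT) (mem S)) /=; last first.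
  move=> f; rewrite !inE => /andP[/injectiveP fi ->]; rewrite andbT card_imset //.
  by rewrite cardsT card_ord.
rewrite /slice -/S -sum_nat_const; apply: leq_sum => W; rewrite inE => /andP[/eqP cW _].
rewrite sum1dep_card -[leqRHS]ffactnn; have := card_inj_ffuns_on 'I_N (mem W).
rewrite cW card_ord => <-; apply: subset_leq_card; apply/subsetP => f; rewrite !inE.
move=> /andP[/andP[fi _] /eqP <-]; rewrite fi andbT; apply/ffun_onP => i; exact: imset_f.
Qed.

Lemma ffact_ge (n N : nat) : (0 < n)%N -> (N <= n)%N ->
  n%:R ^+ N * (1 - N%:R * (N%:R / n%:R)) <= (n ^_ N)%:R :> R.
Proof.
move=> n0 Nn; have nR : 0 < n%:R :> R by rewrite ltr0n.
have NR : N%:R <= n%:R :> R by rewrite ler_nat.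
have x1 : N%:R / n%:R <= 1 :> R by rewrite ler_pdivrMr // mul1r.
apply: le_trans (_ : n%:R ^+ N * (1 - N%:R / n%:R) ^+ N <= _).
  by rewrite ler_pM2l ?exprn_gt0 //; apply: bernoulli_pow => //; rewrite divr_ge0.
rewrite -exprMn ffact_prod natr_prod -[X in _ ^+ X]card_ord -prodr_const; apply: ler_prod => i _.
have iN : (i <= n)%N by apply: leq_trans Nn; apply: ltnW.
rewrite natrB // mulr_ge0 ?subr_ge0 //= mulrBr mulr1 mulrCA divff ?gt_eqF // mulr1 lerB // ler_nat.
exact: ltnW.
Qed.

Definition img (I : finType) (f : I -> V) : {set V} := f @: setT.

(** A set of N cells is the image of N! injections, so injective assignments with image in [A] are
    counted by [frac]; the other assignments are few by the birthday bound [ffact_ge]. *)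
Lemma card_bad A N : (0 < #|V|)%N -> (N <= #|V|)%N ->
  #|[pred f : {ffun 'I_N -> V} | ~~ injectiveb f || A (img f)]|%:R * #|V|%:R^-1 ^+ N
    <= frac R A N + N%:R * (N%:R / #|V|%:R).
Proof.
move=> n0 Nn; set n := #|V| in n0 Nn *; have nR : 0 < n%:R :> R by rewrite ltr0n.
have pn : 0 < n%:R ^+ N :> R by rewrite exprn_gt0.
have tot : (n ^_ N + #|[set f : {ffun 'I_N -> V} | ~~ injectiveb f]| = n ^ N)%N.
  rewrite -{1}(card_ord N) -card_inj_ffuns -[in RHS](card_ord N) -card_ffun -(cardsC [set f : {ffun 'I_N -> V} | injectiveb f]); congr (_ + _)%N.
  by apply: eq_card => f; rewrite !inE.
have totR : (n ^_ N)%:R + #|[set f : {ffun 'I_N -> V} | ~~ injectiveb f]|%:R = n%:R ^+ N :> R by rewrite -natrD tot natrX.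
have h1 := ffact_ge n0 Nn; have h2 := card_image A N.
have cb : 0 < 'C(n, N)%:R :> R by rewrite ltr0n bin_gt0.
have fN : 0 < N`!%:R :> R by rewrite ltr0n fact_gt0.
have ff : 'C(n, N)%:R * N`!%:R = (n ^_ N)%:R :> R by rewrite -natrM bin_ffact.
have h3 : (slice A N * N`!)%:R <= n%:R ^+ N * frac R A N.
  rewrite /frac -/n mulrA ler_pdivlMr // natrM -mulrA [X in _ * X]mulrC ff mulrC ler_wpM2r // -totR.
  by rewrite lerDl.
rewrite exprVn ler_pdivrMr // mulrDl.
apply: le_trans (_ : (#|[set f : {ffun 'I_N -> V} | injectiveb f && A (f @: setT)]| + #|[set f : {ffun 'I_N -> V} | ~~ injectiveb f]|)%:R <= _).
  rewrite ler_nat; apply: leq_trans (subset_leq_card _) (leq_card_setU _ _); apply/subsetP => f; rewrite !inE.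
  by move=> /orP[->|->]; rewrite ?andbT ?orbT ?orbN.
rewrite natrD; move: h2; rewrite -(ler_nat R) => h2.
have e1 : n%:R ^+ N * (1 - N%:R * (N%:R / n%:R)) = n%:R ^+ N - N%:R * (N%:R / n%:R) * n%:R ^+ N :> R by ring.
rewrite e1 in h1; rewrite [frac _ _ _ * _]mulrC; lra.
Qed.

End Injections.

(** * Law of the cells of the N points *)

Section CellLaw.
Variables (R : realType) (alpha nu : R) (N m : nat).
Hypotheses (al0 : 0 < alpha) (nu0 : 0 < nu) (nuN : nu < N%:R) (m0 : (0 < m)%N).
Local Notation Rad := (kpkvb_radius N nu).
Local Notation Z := (rcosh (alpha * Rad) - 1).
Let Rad0 : 0 < Rad. Proof. exact: Rad_gt0. Qed.
Let Z0 : 0 < Z. Proof. by rewrite subr_gt0 rcosh_gt1 // mulr_gt0. Qed.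
Let N0 : 0 < N%:R :> R. Proof. exact: lt_trans nuN. Qed.
Let mR : 0 < m%:R :> R. Proof. by rewrite ltr0n. Qed.
Let pi0 : 0 < @pi R. Proof. exact: pi_gt0. Qed.

(** The quantile of order j / m of the radius; [alev] plays the same role for the angle. *)
Definition rlev (j : nat) : R := rarcosh (1 + j%:R / m%:R * Z) / alpha.
Definition alev (c : nat) : R := 2 * pi * c%:R / (N%:R * m%:R).

Let arg1 j : 1 <= 1 + j%:R / m%:R * Z.
Proof. by rewrite lerDl mulr_ge0 ?divr_ge0 // ltW. Qed.

Lemma rlev_ge0 j : 0 <= rlev j.
Proof. by rewrite divr_ge0 ?rarcosh_ge0 // ltW. Qed.

Lemma rlev_mono j j' : (j <= j')%N -> rlev j <= rlev j'.
Proof.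
move=> jj; rewrite ler_pM2r ?invr_gt0 // rarcosh_le ?rarcosh_ge0 // rarcoshK // lerD2l.
by rewrite ler_wpM2r ?(ltW Z0) // ler_wpM2r ?invr_ge0 // ler_nat.
Qed.

Lemma rlev_hU j : hU alpha nu N (rlev j) = j%:R / m%:R.
Proof.
by rewrite /hU /rlev [alpha * _]mulrC divfK ?gt_eqF // rarcoshK // [1 + _]addrC addrK mulfK // gt_eqF.
Qed.

Lemma rlev_top : rlev m <= Rad.
Proof.
rewrite /rlev divff ?gt_eqF // mul1r addrC subrK ler_pdivrMr //.
have h : 0 <= alpha * Rad by rewrite ltW // mulr_gt0.
by rewrite [Rad * _]mulrC rarcosh_le // rcosh_ge1.
Qed.

Lemma hU_mono r r' : 0 <= r -> r <= r' -> hU alpha nu N r <= hU alpha nu N r'.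
Proof.
move=> r0 rr; rewrite ler_pM2r ?invr_gt0 // lerD2r; apply: rcosh_le; first by rewrite mulr_ge0 // ltW.
by rewrite ler_pM2l.
Qed.

Lemma rlev_cdf j : (j <= m)%N -> radial_cdf alpha Rad (rlev j) = j%:R / m%:R.
Proof.
move=> jm; rewrite /radial_cdf ltNge rlev_ge0 /= ltNge (le_trans (rlev_mono jm) rlev_top) /=.
exact: rlev_hU.
Qed.

Lemma alev_mono c c' : (c <= c')%N -> alev c <= alev c'.
Proof.
move=> cc; rewrite ler_pM2r ?invr_gt0 ?mulr_gt0 // ler_pM2l ?ler_nat //; first exact: mulr_gt0.
Qed.

Lemma alev_hX c : hX N (alev c) = c%:R / m%:R.
Proof. by rewrite /hX /alev; move: (@pi R) pi0 => z z0; field; rewrite !gt_eqF. Qed.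

Lemma alev_cdf c : (c <= N * m)%N -> angle_cdf (alev c) = c%:R / (N%:R * m%:R).
Proof.
move=> cn; have M0 : 0 < N%:R * m%:R :> R by rewrite mulr_gt0.
have p2 : 0 < 2 * pi :> R by exact: mulr_gt0.
rewrite /angle_cdf /alev; case: c cn => [|c] cn; first by rewrite !mulr0 !mul0r lexx.
rewrite leNgt divr_gt0 ?mulr_gt0 //= ltNge ler_pdivrMr // ler_pM2l // -natrM ler_nat cn /=.
by move: (@pi R) pi0 => z z0; field; rewrite !gt_eqF.
Qed.

Variables (d : measure_display) (T : measurableType d) (P : probability T R) (rad ang : 'I_N -> T -> R).
Hypotheses (mrad : forall i, measurable_fun setT (rad i)) (mang : forall i, measurable_fun setT (ang i)).
Hypothesis law : forall a b : 'I_N -> R,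
  P (\bigcap_(i in [set: 'I_N]) ([set w | rad i w <= a i] `&` [set w | ang i w <= b i]))
   = (\prod_(i < N) (radial_cdf alpha Rad (a i) * angle_cdf (b i)))%:E.
Implicit Types f g : {ffun 'I_N -> 'I_(N * m) * 'I_m}.

Definition half (i : 'I_N + 'I_N) (a : R) : set T :=
  match i with inl i => [set w | rad i w <= a] | inr i => [set w | ang i w <= a] end.
Definition lev f s (i : 'I_N + 'I_N) : R :=
  match i with inl i => rlev ((f i).2 + s) | inr i => alev ((f i).1 + s) end.
Definition cell f := \bigcap_(i in [set: 'I_N + 'I_N]) (half i (lev f 1 i) `\` half i (lev f 0 i)).

Lemma measurable_half i a : measurable (half i a).
Proof.
have le (F : T -> R) : measurable_fun setT F -> measurable [set w | F w <= a].
  by move=> mF; have := measurable_fun_le measurableT mF (@measurable_cst _ _ _ _ setT a); rewrite setTI.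
by case: i => i; exact: le.
Qed.

Lemma measurable_cell f : measurable (cell f).
Proof. by apply: fin_bigcap_measurable => // i _; apply: measurableD; exact: measurable_half. Qed.

Lemma cellP f w i : cell f w ->
  (rlev (f i).2 < rad i w <= rlev (f i).2.+1) /\ (alev (f i).1 < ang i w <= alev (f i).1.+1).
Proof.
move=> h; have [/= h1 h2] := h (inl i) Logic.I; have [/= h3 h4] := h (inr i) Logic.I.
move: h1 h2 h3 h4; rewrite !addn0 !addn1 => -> /negP; rewrite -ltNge => -> -> /negP; by rewrite -ltNge => ->.
Qed.

Lemma cell_law f : P (cell f) = (#|{: 'I_(N * m) * 'I_m}|%:R^-1 ^+ N)%:E.
Proof.
pose h (i : 'I_N + 'I_N) (a : R) := match i with inl _ => radial_cdf alpha Rad a | inr _ => angle_cdf a end.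
rewrite (@box_law _ _ _ _ _ half h (lev f 0) (lev f 1)); first last.
- move=> x; rewrite (_ : \bigcap_(i in _) _ = \bigcap_(i in [set: 'I_N]) ([set w | rad i w <= x (inl i)] `&` [set w | ang i w <= x (inr i)])).
    by rewrite law big_sumType /= -big_split.
  apply/seteqP; split => w hw; first by move=> i _; split; [exact: (hw (inl i))|exact: (hw (inr i))].
  by move=> [i|i] _; have [] := hw i Logic.I.
- by move=> [i|i] w /= hw; apply: le_trans hw _; [apply: rlev_mono|apply: alev_mono]; rewrite leq_add2l.
- exact: measurable_half.
congr (_%:E); rewrite big_sumType /= -big_split /= -[X in _ ^+ X]card_ord -prodr_const; apply: eq_bigr => i _.
rewrite !addn0 !addn1 !rlev_cdf ?alev_cdf //; try exact: ltnW.
rewrite card_prod !card_ord !natrM -!natr1; field; by rewrite !gt_eqF.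
Qed.

Lemma cell_disj f g : cell f `&` cell g !=set0 -> f = g.
Proof.
have inj (L : nat -> R) (x : R) j j' : (forall i i', (i <= i')%N -> L i <= L i') ->
    L j < x <= L j.+1 -> L j' < x <= L j'.+1 -> j = j'.
  move=> mono /andP[a b] /andP[a' b']; case: (ltngtP j j') => [jj|jj|//]; have h := mono _ _ jj; exfalso; lra.
move=> [w [hf hg]]; apply/ffunP => i.
have [r1 a1] := cellP i hf; have [r2 a2] := cellP i hg.
have e2 := inj _ _ _ _ rlev_mono r1 r2; have e1 := inj _ _ _ _ alev_mono a1 a2.
by case: (f i) (g i) e1 e2 => [x y] [x' y'] /= /val_inj -> /val_inj ->.
Qed.

Lemma cell_in f w i : cell f w -> in_cell alpha nu (f i) (rad i w, ang i w).
Proof.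
move=> /(cellP i)[/andP[r1 r2] /andP[a1 a2]]; have r0 := rlev_ge0 (f i).2.
have a0 : 0 <= alev (f i).1 by rewrite divr_ge0 ?mulr_ge0 // ltW.
have hXm (x y : R) : x <= y -> hX N x <= hX N y by move=> xy; rewrite ler_pM2r ?invr_gt0 ?mulr_gt0 // ler_pM2l.
have S1 (x : nat) : x.+1%:R / m%:R = x%:R / m%:R + m%:R^-1 :> R by rewrite -natr1 mulrDl mul1r.
have topa : alev (N * m) = 2 * pi by rewrite /alev natrM mulfK // gt_eqF ?mulr_gt0.
split => /=.
- by rewrite (le_lt_trans r0 r1) (le_trans r2) // (le_trans (rlev_mono _) rlev_top).
- by rewrite (le_lt_trans a0 a1) (le_trans a2) // -topa alev_mono.
- by rewrite /gX -S1 -!alev_hX !hXm // ltW.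
rewrite /gU; apply/andP; split; first by rewrite S1 addrK -rlev_hU hU_mono // ltW.
by rewrite -rlev_hU hU_mono // (le_trans r0) // ltW.
Qed.

Lemma measurable_hdist i j : measurable_fun setT (fun w => hdist (rad i w, ang i w) (rad j w, ang j w)).
Proof.
have mexp (F : T -> R) (a : R) : measurable_fun setT F -> measurable_fun setT (fun w => expR (a * F w)).
  by move=> mF; apply: (measurableT_comp (@measurable_expR R)); apply: measurable_funM.
have mc (F : T -> R) : measurable_fun setT F -> measurable_fun setT (fun w => rcosh (F w)).
  move=> mF; rewrite /rcosh; apply: measurable_funM => //.
  apply: measurable_funD; last by under eq_fun do rewrite -mulN1r; exact: mexp.
  by under eq_fun do rewrite -[F _]mul1r; exact: mexp.
have ms (F : T -> R) : measurable_fun setT F -> measurable_fun setT (fun w => rsinh (F w)).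
  move=> mF; rewrite /rsinh; apply: measurable_funM => //.
  apply: measurable_funB; last by under eq_fun do rewrite -mulN1r; exact: mexp.
  by under eq_fun do rewrite -[F _]mul1r; exact: mexp.
have mz : measurable_fun setT (fun w => rcosh (rad i w) * rcosh (rad j w) - rsinh (rad i w) * rsinh (rad j w) * cos (ang i w - ang j w)).
  apply: measurable_funB; first by apply: measurable_funM; exact: mc.
  apply: measurable_funM; first by apply: measurable_funM; exact: ms.
  apply: (measurableT_comp (continuous_measurable_fun (@continuous_cos R))); exact: measurable_funB.
rewrite /hdist /rarcosh /=; apply: (measurableT_comp (@measurable_ln R)).
apply: measurable_funD => //; apply: (measurableT_comp (continuous_measurable_fun (@sqrt_continuous R))).
by apply: measurable_funB => //; exact: measurable_funX.
Qed.

(** The cells of the N points are independent and uniform ([cell_law]), so the probability is at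
    most the proportion of bad assignments of cells. The second term, N^2 over the number N m^2 of
    cells, pays for points sharing a cell. *)
Lemma graph_bound (A : {set 'I_(N * m) * 'I_m} -> bool) (Q : rel 'I_N -> bool) :
  (forall f w, injective f -> (forall i, in_cell alpha nu (f i) (rad i w, ang i w)) ->
    ~~ A (img f) -> ~~ Q (kpkvb_adj nu (fun i => (rad i w, ang i w)))) ->
  let pts w i := (rad i w, ang i w) in
  measurable [set w | Q (kpkvb_adj nu (pts w))] /\
  (P [set w | Q (kpkvb_adj nu (pts w))] <= (frac R A N + N%:R / m%:R ^+ 2)%:E)%E.
Proof.
move=> hQ pts; set E := [set w | _].
have mE : measurable E.
  rewrite /E (_ : [set w | _] = [set w | (fun g : {ffun 'I_N * 'I_N -> bool} => Q (fun i j => g (i, j)))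
    [ffun ij => kpkvb_adj nu (pts w) ij.1 ij.2]]).
    apply: (finite_event (b := fun ij w => kpkvb_adj nu (pts w) ij.1 ij.2) (fun g : {ffun 'I_N * 'I_N -> bool} => Q (fun i j => g (i, j)))) => -[i j]; rewrite /kpkvb_adj /=; case: (i != j) => //=.
    apply: measurable_fun_ler => //; exact: measurable_hdist.
  apply/seteqP; split => w; rewrite /= (_ : (fun i j => _) = kpkvb_adj nu (pts w)) //;
    by apply/funext => i; apply/funext => j; rewrite ffunE.
split => //.
set V := ('I_(N * m) * 'I_m)%type.
have cV : #|{: V}|%:R = N%:R * m%:R ^+ 2 :> R by rewrite card_prod !card_ord !natrM expr2 mulrA.
have NV : (N <= #|{: V}|)%N by rewrite card_prod !card_ord -mulnA leq_pmulr // muln_gt0 m0.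
have V0 : (0 < #|{: V}|)%N by apply: leq_trans NV; rewrite -(ltr0n R).
have c0 : #|{: V}|%:R != 0 :> R by rewrite pnatr_eq0 -lt0n.
pose B : pred {ffun 'I_N -> V} := [pred f : {ffun 'I_N -> V} | ~~ injectiveb f || A (img f)].
apply: le_trans (_ : ((#|B|%:R * #|{: V}|%:R^-1 ^+ N)%:E <= _)%E).
  apply: (cover_bound mE measurable_cell cell_disj cell_law).
    by rewrite card_ffun card_ord natrX -exprMn divff // expr1n.
  move=> f; rewrite /B /= negb_or negbK => /andP[/injectiveP fi nA].
  apply/seteqP; split => // w [Ew Cw]; move: Ew; rewrite /E /=; apply/negP.
  by apply: (hQ f w fi _ nA) => i; exact: cell_in.
rewrite lee_fin; apply: le_trans (card_bad R A V0 NV) _; rewrite lerD2l cV.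
by rewrite le_eqVlt; apply/orP; left; apply/eqP; field; rewrite !gt_eqF.
Qed.

End CellLaw.

(** * Transfer to the random graph *)

Section Limit.
Variables (R : realType) (alpha nu c : R) (UF : set_system nat).
Hypotheses (al0 : 0 < alpha) (nu0 : 0 < nu) (c0 : 0 <= c).
Hypotheses (UFu : UltraFilter UF) (UFoo : tails UF).
Hypothesis HU : forall eps dl : R, 0 < eps -> 0 < dl -> exists N0 : nat, forall N, (N0 <= N)%N ->
  UF (fun m => Pr (@pm R m _) (fun w => (c + 6 * eps) * N%:R <=
    cnt R (fun v w => bigc (@eplus R alpha nu N m) (eps * N%:R) v w) w) <= dl).
Hypothesis HL : forall eta dl : R, 0 < eta -> eta <= 1 -> 0 < dl -> 0 < c - eta ->
  exists N0 : nat, forall N, (N0 <= N)%N ->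
  UF (fun m => Pr (@pm R m _) (fun w => ~~ giant (@eminus R alpha nu N m) ((c - eta) * N%:R) w) <= dl).

Lemma clus_mono (V : finType) (e : rel V) (w : {set V}) v x : (#|clus e w x| <= #|clus e (v |: w)%SET x|)%N.
Proof.
apply: subset_leq_card; apply/fintype.subsetP => z; rewrite !inE.
by apply: conn_mono => //; apply/fintype.subsetP => y yw; rewrite !inE yw orbT.
Qed.

Lemma giant_incr (V : finType) (e : rel V) (s : R) (w : {set V}) v : giant e s w -> giant e s (v |: w)%SET.
Proof.
move=> /existsP[x /andP[xw h]]; apply/existsP; exists x; rewrite !inE xw orbT /=.
by apply: le_trans h _; rewrite ler_nat clus_mono.
Qed.

Lemma cnt_incr (V : finType) (e : rel V) (s : R) (w : {set V}) v :
  cnt R (bigc e s) w <= cnt R (bigc e s) (v |: w)%SET.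
Proof.
rewrite !cntE; apply: ler_sum => x _; rewrite ler_nat !inE.
case: (x \in w) => //=; rewrite orbT /=.
have : bigc e s x w -> bigc e s x (v |: w)%SET by move=> h; apply: le_trans h _; rewrite ler_nat clus_mono.
by case: (bigc e s x w) => // ->.
Qed.

(** Fewer than (c + eps/2) N vertices lie in components of size at least (eps/12) N, and the largest
    component has at least (c - eps/2) N; [largest_count] and [second_count] conclude. *)
Lemma component_bounds (N m : nat) (pts : 'I_N -> R * R) (f : 'I_N -> 'I_(N * m) * 'I_m) (eps eta : R)
    (g := kpkvb_adj nu pts) : nu < N%:R -> 0 < eps -> eta <= eps / 2 ->
  injective f -> (forall i, in_cell alpha nu (f i) (pts i)) ->
  cnt R (bigc (@eplus R alpha nu N m) (eps / 12 * N%:R)) (img f) < (c + 6 * (eps / 12)) * N%:R ->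
  (0 < c - eta -> giant (@eminus R alpha nu N m) ((c - eta) * N%:R) (img f)) ->
  `|(largest_comp_size g)%:R / N%:R - c| <= eps /\ (second_comp_size g)%:R / N%:R <= eps.
Proof.
move=> nuN e0 etaE fi inC hU hL; have n0 : 0 < N%:R :> R by apply: lt_trans nuN.
have gs : symmetric g by move=> x y; rewrite /g /kpkvb_adj eq_sym hdistC.
have := cnt_components fi inC (eps / 12 * N%:R) nuN; rewrite -/g => hc.
have hc' := le_lt_trans hc hU.
have hl : (c - eta) * N%:R <= (largest_comp_size g)%:R.
  case: (ltrP 0 (c - eta)) => h; first by apply: (giant_largest fi inC); exact: hL.
  by apply: le_trans (ler0n _ _); rewrite pmulr_lle0.
have S0 : 0 <= (second_comp_size g)%:R :> R by [].
have cn : 0 <= c * N%:R by rewrite mulr_ge0 // ltW.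
have en : 0 < eps * N%:R by rewrite mulr_gt0.
have etan : eta * N%:R <= eps / 2 * N%:R by rewrite ler_pM2r.
have := @largest_count R _ g gs (eps / 12 * N%:R); have := @second_count R _ g gs (eps / 12 * N%:R).
rewrite -!(ler_nat R) natrD.
move: hc' hl S0; move: (#|_|%:R) => K; move: (largest_comp_size g)%:R (second_comp_size g)%:R => L S hc' hl S0 h2 h1.
have uL : L <= (c + eps) * N%:R.
  case: (lerP (eps / 12 * N%:R) L) => [/h1 h|h]; lra.
have uS : S <= eps * N%:R.
  case: (lerP (eps / 12 * N%:R) S) => [/h2 h|h]; lra.
split; last by rewrite ler_pdivrMr.
rewrite ler_norml lerBlDr ler_pdivrMr // [eps + c]addrC uL andbT lerBrDr ler_pdivlMr //; lra.
Qed.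

Lemma kpkvb_limit (d : measure_display) (T : measurableType d) (P : probability T R)
    (rad ang : forall N : nat, 'I_N -> T -> R) : kpkvb_sample P alpha nu rad ang ->
  forall eps dl : R, 0 < eps -> 0 < dl -> exists N0 : nat, forall N, (N0 <= N)%N ->
   (P [set w | (eps < `|(largest_comp_size (kpkvb_graph nu rad ang N w))%:R / N%:R - c|)%R] <= dl%:E)%E /\
   (P [set w | (eps < (second_comp_size (kpkvb_graph nu rad ang N w))%:R / N%:R)%R] <= dl%:E)%E.
Proof.
move=> hs eps dl e0 dl0.
pose eta := Num.min (eps / 2) 2^-1.
have h20 : 0 < 2^-1 :> R by rewrite invr_gt0.
have eta0 : 0 < eta by rewrite lt_min divr_gt0.
have etaE : eta <= eps / 2 by rewrite ge_min lexx.
have eta1 : eta <= 1 by rewrite ge_min; apply/orP; right; lra.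
pose ds := dl / 4; have ds0 : 0 < ds by rewrite divr_gt0.
pose t := ds * ds / (16 * expR 8); have t0 : 0 < t by rewrite divr_gt0 ?mulr_gt0 ?expR_gt0.
have e12 : 0 < eps / 12 by rewrite divr_gt0.
have [N1 H1] := HU e12 t0.
have [N2 H2] : exists N0 : nat, forall N, (N0 <= N)%N -> UF (fun m => Pr (@pm R m _)
    (fun w => (0 < c - eta) && ~~ giant (@eminus R alpha nu N m) ((c - eta) * N%:R) w) <= t).
  case: (ltrP 0 (c - eta)) => h; first exact: HL.
  exists 0%N => N _; apply: UF_imp (UFoo 0) => m _; rewrite /Pr /= Ex_cst; exact: ltW.
have [N3 hN3] := nat_large nu.
exists (maxn (maxn N1 N2) (maxn N3.+1 5)) => N; rewrite !geq_max => /andP[/andP[hN1 hN2] /andP[hN3' hN5]].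
have nuN : nu < N%:R by apply: le_lt_trans hN3 _; rewrite ltr_nat.
have n0 : 0 < N%:R :> R by apply: lt_trans nuN.
have [n1 hn1] := nat_large (2 * N%:R / dl).
(* Only here is the mesh fixed: one m satisfying both estimates, and so large that points rarely
   share a cell. *)
have [m [[h1 h2] /=]] := UF_ex UFu (UF_and UFu (UF_and UFu (H1 N hN1) (H2 N hN2)) (UFoo (maxn n1 2))).
rewrite geq_max => /andP[hm hm2]; have m0 : (0 < m)%N by apply: leq_trans hm2.
have mR : 0 < m%:R :> R by rewrite ltr0n.
set V := ('I_(N * m) * 'I_m)%type in h1 h2.
have cV : #|{: V}| = (N * (m * m))%N by rewrite card_prod !card_ord mulnA.
have NV : (2 * N <= #|{: V}|)%N by rewrite cV [(2 * N)%N]mulnC leq_mul2l; apply/orP; right; apply: leq_trans hm2 _; rewrite leq_pmulr.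
have pE : (fun _ : V => N%:R / #|{: V}|%:R : R) = @pm R m V.
  by apply/funext => v; rewrite /pm cV !natrM; field; rewrite !gt_eqF.
pose A1 (w : {set V}) := (c + 6 * (eps / 12)) * N%:R <= cnt R (bigc (@eplus R alpha nu N m) (eps / 12 * N%:R)) w.
pose A2 (w : {set V}) := (0 < c - eta) && ~~ giant (@eminus R alpha nu N m) ((c - eta) * N%:R) w.
have f1 : frac R A1 N <= ds.
  apply: frac_transfer => //; last by rewrite pE.
  by left => w v h; apply: le_trans h _; exact: cnt_incr.
have f2 : frac R A2 N <= ds.
  apply: frac_transfer => //; last by rewrite pE.
  right => w v /andP[h hg]; rewrite /A2 h /=; apply: contra hg; exact: giant_incr.
have tail : N%:R / m%:R ^+ 2 <= dl / 2.
  have mm : m%:R <= m%:R ^+ 2 :> R by rewrite expr2 ler_peMr ?(ltW mR) // ler1n.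
  have : 2 * N%:R / dl <= m%:R by apply: le_trans hn1 _; rewrite ler_nat.
  rewrite !ler_pdivrMr ?exprn_gt0 // => h.
  have : dl / 2 * m%:R <= dl / 2 * m%:R ^+ 2 by rewrite ler_pM2l // divr_gt0.
  lra.
have [mrad [mang law]] := hs N nuN.
have key (Q : rel 'I_N -> bool) : (forall g, `|(largest_comp_size g)%:R / N%:R - c| <= eps ->
    (second_comp_size g)%:R / N%:R <= eps -> ~~ Q g) ->
    (P [set w | Q (kpkvb_graph nu rad ang N w)] <= dl%:E)%E.
  move=> hQ; have [|_] := @graph_bound R alpha nu N m al0 nu0 nuN m0 d T P (rad N) (ang N) mrad mang law
    (fun w => A1 w || A2 w) Q.
    move=> f w fi inC; rewrite negb_or => /andP[nA1 nA2].
    have [|h|hl hsc] := component_bounds nuN e0 etaE fi inC; last exact: hQ.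
    by rewrite ltNge.
    by move: nA2; rewrite /A2 h /= negbK.
  move=> h; apply: le_trans h _; rewrite lee_fin; have := frac_or R A1 A2 N; rewrite /ds in f1 f2; lra.
split.
  by apply: (key (fun g => eps < `|(largest_comp_size g)%:R / N%:R - c|)) => g hl _; rewrite -leNgt.
by apply: (key (fun g => eps < (second_comp_size g)%:R / N%:R)) => g _; rewrite -leNgt.
Qed.

End Limit.

(** * Properties of the limit function *)

Section LimitFunction.
Variables (R : realType) (UF : set_system nat).
Hypotheses (UFu : UltraFilter UF) (UFoo : tails UF).
Let pi0 : 0 < @pi R. Proof. exact: pi_gt0. Qed.

Definition clim (alpha nu : R) : R :=
  if alpha <= 2^-1 then 1 else cc UF (nu / pi) (1 / (2 * alpha)).
Definition nucrit : R := sup [set nu : R | 0 < nu /\ clim 1 nu = 0].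

Let kpos (nu : R) : 0 < nu -> 0 < nu / pi. Proof. by move=> h; rewrite divr_gt0. Qed.

Lemma clim_cc (alpha nu : R) : 2^-1 < alpha -> clim alpha nu = cc UF (nu / pi) (1 / (2 * alpha)).
Proof. by move=> h; rewrite /clim leNgt h. Qed.

Lemma clim1 (nu : R) : clim 1 nu = cc UF (nu / pi) 2^-1.
Proof. by rewrite clim_cc ?mulr1 ?div1r // invf_lt1 // ltr1n. Qed.

Lemma clim_ge0 (alpha nu : R) : 0 <= clim alpha nu.
Proof. by rewrite /clim; case: ifP => // _; exact: cc_ge0. Qed.

Lemma exponent_lt1 (alpha : R) : 2^-1 < alpha -> 0 < 1 / (2 * alpha) < 1.
Proof. by move=> h; rewrite divr_gt0 ?mulr_gt0 // ?ltr_pdivrMr ?mulr_gt0 //; lra. Qed.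

Lemma exponent_half (alpha : R) : 0 < alpha -> (2^-1 < 1 / (2 * alpha)) = (alpha < 1).
Proof.
move=> a0; rewrite ltr_pdivlMr ?mulr_gt0 //; apply/idP/idP; lra.
Qed.

Lemma clim_sub (alpha nu : R) : 1 < alpha -> 0 < nu -> clim alpha nu = 0.
Proof.
move=> a1 n0; rewrite clim_cc; last by lra.
by apply: cc_sub => //; [exact: kpos|rewrite divr_gt0 ?mulr_gt0 // ?ltr_pdivrMr ?mulr_gt0 //; lra].
Qed.

Lemma clim_super (alpha nu : R) : 0 < alpha -> alpha < 1 -> 0 < nu -> 0 < clim alpha nu.
Proof.
move=> a0 a1 n0; rewrite /clim; case: ifP => // _; apply: cc_pos => //; first exact: kpos.
by rewrite exponent_half.
Qed.

Lemma clim1_mono (nu nu' : R) : 0 < nu -> nu <= nu' -> clim 1 nu <= clim 1 nu'.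
Proof.
move=> n0 h; rewrite !clim1; apply: cc_mono => //; apply/andP; split; first exact/ltW/kpos.
by rewrite ler_pM2r ?invr_gt0.
Qed.

Lemma clim_small : clim 1 (pi / 200) = 0.
Proof.
have e : pi / 200 / pi = 1 / 200 :> R by rewrite mulrAC divff ?gt_eqF.
by rewrite clim1 e; apply: cc_small => //; rewrite divr_gt0.
Qed.

Lemma nucrit_sup : has_sup [set nu : R | 0 < nu /\ clim 1 nu = 0].
Proof.
split.
  by exists (pi / 200); split; [rewrite divr_gt0|exact: clim_small].
exists (512 * 256 * pi) => nu [n0 h]; rewrite leNgt; apply/negP => lt.
have := cc_large UFu UFoo (lexx (256 : R)) (k := nu / pi); rewrite -clim1 h ltxx => k; suff: false by [].
by apply: k; rewrite ler_pdivlMr // ltW.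
Qed.

Lemma nucrit_gt0 : 0 < nucrit.
Proof.
apply: (@lt_le_trans _ _ (pi / 200)); first by rewrite divr_gt0.
by apply: sup_upper_bound nucrit_sup _ _; split; [rewrite divr_gt0|exact: clim_small].
Qed.

Lemma below_nucrit (nu : R) : 0 < nu -> nu < nucrit -> clim 1 nu = 0.
Proof.
move=> n0 lt; have [nu' [n0' z] lt'] := sup_gt nucrit_sup.1 lt.
by apply/eqP; rewrite eq_le clim_ge0 andbT -z clim1_mono // ltW.
Qed.

Lemma above_nucrit (nu : R) : nucrit < nu -> 0 < clim 1 nu.
Proof.
move=> lt; rewrite lt_neqAle clim_ge0 andbT; apply/negP => /eqP z.
have n0 := lt_trans nucrit_gt0 lt.
by have := sup_upper_bound nucrit_sup (conj n0 (esym z)); rewrite leNgt lt.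
Qed.

Lemma clim_eq1 (alpha nu : R) : 0 < alpha -> 0 < nu -> clim alpha nu = 1 <-> alpha <= 2^-1.
Proof.
move=> a0 n0; split => [|h]; last by rewrite /clim h.
case: (lerP alpha 2^-1) => // h; rewrite clim_cc // => e.
by have := cc_lt1 UFu UFoo (kpos n0) (exponent_lt1 h); rewrite e ltxx.
Qed.

Lemma parameter_dist (alpha alpha' nu nu' s : R) : 2^-1 < alpha -> 2^-1 < alpha' ->
  `|alpha' - alpha| <= s / 2 -> `|nu' - nu| <= s / 2 ->
  `|nu' / pi - nu / pi| <= s /\ `|1 / (2 * alpha') - 1 / (2 * alpha)| <= s.
Proof.
move=> a0 a0' ha hn; have s0 : 0 <= s by move: (le_trans (normr_ge0 _) hn); rewrite pmulr_lge0 // invr_gt0.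
have p2 : 2 <= pi :> R := pi_ge2 R.
have ap : 0 < alpha by lra.
have ap' : 0 < alpha' by lra.
split.
  rewrite -mulrBl normrM normfV (gtr0_norm pi0) ler_pdivrMr //; apply: le_trans hn _.
  rewrite ler_wpM2l //; lra.
have -> : 1 / (2 * alpha') - 1 / (2 * alpha) = (alpha - alpha') / (2 * alpha * alpha') by field; rewrite !gt_eqF.
rewrite normrM normfV distrC [X in _ / X]gtr0_norm ?mulr_gt0 // ler_pdivrMr ?mulr_gt0 //.
apply: le_trans ha _; rewrite ler_wpM2l //; apply: le_trans (_ : 1 * 2^-1 <= _); first by rewrite mul1r.
by apply: ler_pM; lra.
Qed.

(** For alpha > 1/2, upper semicontinuity is [cc_usc]. Lower semicontinuity is [cc_lsc] if alpha <
    1, and for alpha >= 1 it is trivial, since the function vanishes at the remaining points of the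
    domain. *)
Lemma clim_continuous (alpha nu e : R) : 0 < alpha -> 0 < nu -> ~ (alpha = 1 /\ nucrit <= nu) -> 0 < e ->
  exists2 s, 0 < s & forall alpha' nu', `|alpha' - alpha| < s -> `|nu' - nu| < s ->
    `|clim alpha nu - clim alpha' nu'| <= e.
Proof.
move=> a0 n0 ex e0.
have h20 : 0 < 2^-1 :> R by rewrite invr_gt0.
have dist (x y : R) : x - e <= y -> y <= x + e -> `|x - y| <= e by move=> *; rewrite ler_norml; apply/andP; split; lra.
case: (ltgtP alpha 2^-1) => ha.
- exists (2^-1 - alpha); first by rewrite subr_gt0.
  move=> al nu' h _; have hl : al <= 2^-1 by have := ler_norm (al - alpha); lra.
  by rewrite /clim hl (ltW ha) subrr normr0 ltW.
- have ba := exponent_lt1 ha.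
  have [s1 s10 us] := cc_usc UFu UFoo (kpos n0) ba e0.
  have [s2 s20 ls] : exists2 s, 0 < s & forall k' b', `|k' - nu / pi| <= s -> `|b' - 1 / (2 * alpha)| <= s ->
    cc UF (nu / pi) (1 / (2 * alpha)) - e <= cc UF k' b'.
    case: (ltrP alpha 1) => a1.
    by apply: cc_lsc => //; [exact: kpos|rewrite exponent_half // a1; case/andP: ba].
    exists 1 => // k' b' _ _; rewrite -clim_cc // (_ : clim alpha nu = 0).
    by apply: le_trans (cc_ge0 UFu UFoo _ _); lra.
    move: a1; rewrite le_eqVlt => /orP[/eqP a1|]; last by move=> a1; exact: clim_sub.
    rewrite -a1; apply: below_nucrit => //; rewrite ltNge; apply/negP => h; apply: ex; split => //.
  pose s := Num.min (alpha - 2^-1) (Num.min (s1 / 2) (s2 / 2)).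
  exists s; first by rewrite !lt_min subr_gt0 ha !divr_gt0.
  move=> al nu'; rewrite !lt_min => /andP[h1 /andP[h2 h3]] /andP[_ /andP[h4 h5]].
  have al' : 2^-1 < al by move: h1; rewrite ltr_norml => /andP[]; lra.
  rewrite !clim_cc //.
  have [k1 b1] := parameter_dist ha al' (ltW h2) (ltW h4).
  have [k2 b2] := parameter_dist ha al' (ltW h3) (ltW h5).
  have u := us _ _ k1 b1; have l := ls _ _ k2 b2.
  exact: dist.
(* At alpha = 1/2, [cc_near1] is applied with nu / 2, which lies below every nearby nu';
   monotonicity in nu carries the bound over. *)
have [b0 b01 near1] := cc_near1 UFu UFoo (kpos (divr_gt0 n0 (ltr0n _ 2) : 0 < nu / 2)) e0.
pose b := Num.max b0 2^-1; have bh : 2^-1 <= b by rewrite le_max lexx orbT.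
have b1 : b < 1 by rewrite gt_max b01; lra.
have bp : 0 < b by lra.
have sp : 0 < (b^-1 - 1) / 2 by rewrite divr_gt0 // subr_gt0 invf_gt1.
exists (Num.min ((b^-1 - 1) / 2) (nu / 2)); first by rewrite lt_min sp divr_gt0.
move=> al nu'; rewrite !lt_min => /andP[h1 _] /andP[_ h2].
have -> : clim alpha nu = 1 by rewrite /clim ha lexx.
rewrite /clim; case: (lerP al 2^-1) => hal; first by rewrite subrr normr0 ltW.
have ap : 0 < 2 * al by lra.
have /andP[bl0 bl1] := exponent_lt1 hal.
have bb : b < 1 / (2 * al).
  rewrite ltr_pdivlMr // -ltr_pdivlMl // mulr1; have := ler_norm (al - alpha); rewrite ha in h1 *; lra.
have nn : nu / 2 <= nu' by move: h2; rewrite ltr_norml => /andP[]; lra.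
have := near1 (1 / (2 * al)) (le_lt_trans _ bb) bl1; rewrite le_max lexx => /(_ isT) nr.
have mo : cc UF (nu / 2 / pi) (1 / (2 * al)) <= cc UF (nu' / pi) (1 / (2 * al)).
  apply: cc_mono => //; apply/andP; split; first by rewrite ltW // !divr_gt0.
  by rewrite ler_pM2r ?invr_gt0.
have le1 := cc_le1 UFu UFoo (nu' / pi) (1 / (2 * al)).
by apply: dist; [exact: le_trans nr mo|apply: le_trans le1 _; rewrite lerDl ltW].
Qed.

(** For alpha <= 1/2 the upper bound only concerns the total number of points, as c = 1; for alpha >
    1 the lower bound is void, as c = 0. *)
Lemma clim_limit (alpha nu : R) : 0 < alpha -> 0 < nu ->
  forall (d : measure_display) (T : measurableType d) (P : probability T R)
    (rad ang : forall N : nat, 'I_N -> T -> R), kpkvb_sample P alpha nu rad ang ->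
  forall eps dl : R, 0 < eps -> 0 < dl -> exists N0 : nat, forall N, (N0 <= N)%N ->
   (P [set w | (eps < `|(largest_comp_size (kpkvb_graph nu rad ang N w))%:R / N%:R - clim alpha nu|)%R] <= dl%:E)%E /\
   (P [set w | (eps < (second_comp_size (kpkvb_graph nu rad ang N w))%:R / N%:R)%R] <= dl%:E)%E.
Proof.
move=> a0 n0 d T P rad ang; apply: (kpkvb_limit a0 n0 (clim_ge0 _ _) UFu UFoo).
  case: (lerP alpha 2^-1) => ha; last by rewrite clim_cc //; exact: upper_cells.
  move=> eps dl e0 dl0; have e6 : 0 < 6 * eps by rewrite mulr_gt0.
  have q0 : 0 < (6 * eps) ^+ 2 by rewrite exprn_gt0.
  have [N0 hN0] := nat_large ((6 * eps) ^- 2 / dl).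
  exists N0.+1 => N hN; have Np : (0 < N)%N by apply: leq_trans hN.
  apply: UF_imp (UFoo 1) => m m0; apply: le_trans (_ : _ <= 1 / ((6 * eps) ^+ 2 * N%:R)) _.
    apply: le_trans _ (card_dev m0 Np e6); apply: Pr_le; first exact: prob_pm.
    by move=> w h; rewrite /clim ha in h; apply: le_trans h _; exact: cnt_le_card.
  rewrite ler_pdivrMr ?mulr_gt0 ?ltr0n //; have NN : N0%:R <= N%:R :> R by rewrite ler_nat ltnW.
  have := le_trans hN0 NN; rewrite ler_pdivrMr // -[_ ^- 2]mul1r ler_pdivrMr //.
  by rewrite (_ : dl * ((6 * eps) ^+ 2 * N%:R) = N%:R * dl * (6 * eps) ^+ 2) //; ring.
move=> eta dl e0 e1 dl0; case: (lerP alpha 2^-1) => ha.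
  rewrite {1}/clim ha => lt; have := @lower_cells_core R alpha nu a0 n0 _ UF UFu UFoo eta dl ha e0 _ dl0.
  by rewrite /clim ha; apply; lra.
case: (lerP alpha 1) => a1; last by rewrite clim_sub //; lra.
by rewrite clim_cc // => lt; exact: lower_cells_half.
Qed.

End LimitFunction.

Lemma cvg_probability (R : realType) (d : measure_display) (T : measurableType d) (P : probability T R) (E : nat -> set T) :
  (forall dl : R, 0 < dl -> exists N0 : nat, forall N, (N0 <= N)%N -> (P (E N) <= dl%:E)%E) ->
  (fun N => P (E N)) @ \oo --> 0%E.
Proof.
move=> h; have fin N (dl : R) : (P (E N) <= dl%:E)%E -> P (E N) \is a fin_num.
  by move=> hN; rewrite ge0_fin_numE ?measure_ge0 // (le_lt_trans hN) ?ltry.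
apply/fine_cvgP; split.
  by have [N0 hN0] := h 1 ltr01; exists N0 => // N /= hN; apply: fin (hN0 N hN).
apply/cvgrPdist_le => e e0; have [N0 hN0] := h e e0; exists N0 => // N /= hN.
have hP := hN0 N hN; have fN := fin _ _ hP.
by rewrite sub0r normrN ger0_norm ?fine_ge0 ?measure_ge0 // -lee_fin fineK.
Qed.

Theorem theorem1p2 (R : realType) :
  exists (c : R -> R -> R) (nuc : R),
    0 < nuc /\
    (* convergence in probability of |C_(1)|/N to c and |C_(2)|/N to 0 *)
    (forall alpha nu : R, 0 < alpha -> 0 < nu ->
    forall (d : measure_display) (T : measurableType d) (P : probability T R)
    (rad ang : forall N : nat, 'I_N -> T -> R),
    kpkvb_sample P alpha nu rad ang ->
    forall eps : R, 0 < eps ->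
    ((fun N : nat => P [set w | eps <
    `| (largest_comp_size (kpkvb_graph nu rad ang N w))%:R / N%:R
    - c alpha nu |]) @ \oo --> 0%E) /\
    ((fun N : nat => P [set w | eps <
    (second_comp_size (kpkvb_graph nu rad ang N w))%:R / N%:R])
    @ \oo --> 0%E)) /\
    (* (i) *)
    (forall alpha nu : R, 1 < alpha -> 0 < nu -> c alpha nu = 0) /\
    (* (ii) *)
    (forall alpha nu : R, 0 < alpha -> alpha < 1 -> 0 < nu -> 0 < c alpha nu) /\
    (* (iii) *)
    (forall nu : R, 0 < nu -> nu < nuc -> c 1 nu = 0) /\
    (forall nu : R, nuc < nu -> 0 < c 1 nu) /\
    (* (iv) *)
    (forall alpha nu : R, 0 < alpha -> 0 < nu -> (c alpha nu = 1 <-> alpha <= 2^-1)) /\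
    (* (v) *)
    {within [set p : R * R | 0 < p.1 /\ 0 < p.2 /\ ~ (p.1 = 1 /\ nuc <= p.2)],
    continuous (fun p : R * R => c p.1 p.2)} /\
    (forall nu : R, nuc < nu ->
    ~ ((fun p : R * R => c p.1 p.2) @
    within [set p : R * R | 0 < p.1 /\ 0 < p.2] (nbhs ((1 : R), nu))
    --> c 1 nu)) /\
    (* (vi) *)
    (forall alpha1 alpha2 nu : R, 2^-1 < alpha1 -> alpha1 < alpha2 -> alpha2 < 1 ->
    0 < nu -> c alpha2 nu < c alpha1 nu) /\
    (forall alpha nu1 nu2 : R, 2^-1 < alpha -> alpha < 1 -> 0 < nu1 -> nu1 < nu2 ->
    c alpha nu1 < c alpha nu2) /\
    (forall nu1 nu2 : R, nuc < nu1 -> nu1 < nu2 -> c 1 nu1 < c 1 nu2).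
Proof.
(* One ultrafilter refining the filter at infinity serves all parameters, so that comparisons
   between values of c take place at a common mesh. *)
have [UF [UFu UFs]] := @ultraFilterLemma nat \oo _.
have UFoo m0 : UF (fun m => (m0 <= m)%N) by apply: UFs; exact: nbhs_infty_ge.
exists (clim UF), (nucrit R UF).
have nuc0 := nucrit_gt0 R UFu UFoo.
have pin (x y : R) : x < y -> x / pi < y / pi by move=> h; rewrite ltr_pM2r ?invr_gt0 ?pi_gt0.
split; first by [].
split.
  move=> alpha nu a0 n0 d T P rad ang hs eps e0; have lim := clim_limit UFu UFoo a0 n0 hs e0.
  by split; apply: cvg_probability => dl dl0; have [N0 hN0] := lim dl dl0; exists N0 => N /hN0[].
split; first by move=> alpha nu; exact: clim_sub.
split; first by move=> alpha nu; exact: clim_super.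
split; first by move=> nu; exact: below_nucrit.
split; first by move=> nu; exact: above_nucrit.
split; first by move=> alpha nu; exact: clim_eq1.
split.
  apply/subspace_continuousP => -[alpha nu] [/= a0 [n0 ex]].
  apply/cvgrPdist_le => e e0; have [s s0 hs] := clim_continuous UFu UFoo a0 n0 ex e0.
  rewrite near_withinE; apply/nbhs_ballP; exists s => // -[al nu'] [/= h1 h2] _.
  by apply: hs; rewrite distrC.
split.
  (* Every neighbourhood of (1, nu) contains a point (1 + s/2, nu), where the function is 0, whereas
     it is positive at (1, nu). *)
  move=> nu lt /cvgrPdist_lt/(_ _ (above_nucrit UFu UFoo lt)); rewrite near_withinE => /nbhs_ballP[s /= s0 hs].
  have n0 := lt_trans nuc0 lt.
  have b : ball ((1 : R), nu) s (1 + s / 2, nu).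
    split; rewrite /= /ball /= ?subrr ?normr0 // opprD addrA subrr sub0r normrN gtr0_norm ?divr_gt0 //; lra.
  have dom : 0 < 1 + s / 2 by rewrite addr_gt0 // divr_gt0.
  have c0 := above_nucrit UFu UFoo lt; have al1 : 1 < 1 + s / 2 by rewrite ltrDl divr_gt0.
  by have /= := hs _ b (conj dom n0); rewrite (clim_sub UFu UFoo al1 n0) subr0 gtr0_norm // ltxx.
split.
  move=> a1 a2 nu h1 h2 h3 n0; have a10 : 0 < a1 by lra.
  have h1' : 2^-1 < a2 by lra.
  have lt : 1 / (2 * a2) < 1 / (2 * a1).
    by rewrite !div1r ltf_pV2 ?posrE ?mulr_gt0 ?ltr_pM2l // (lt_trans a10).
  have /andP[p1 p2] := exponent_lt1 h1; have /andP[q1 q2] := exponent_lt1 h1'.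
  have k0 : 0 < nu / pi by rewrite divr_gt0 ?pi_gt0.
  rewrite !clim_cc //; apply: (cc_strict UFu UFoo) => //; rewrite ?k0 ?lexx ?q1 ?(ltW lt) ?lt ?orbT //.
  by apply: cc_pos => //; rewrite exponent_half // (lt_trans a10).
split.
  move=> al n1 n2 h1 h2 h3 h4; have /andP[p1 p2] := exponent_lt1 h1.
  have k0 : 0 < n1 / pi by rewrite divr_gt0 ?pi_gt0.
  have lt := pin _ _ h4; rewrite !clim_cc //.
  apply: (cc_strict UFu UFoo) => //; rewrite ?k0 ?lexx ?p1 ?(ltW lt) ?lt //.
  by apply: cc_pos => //; rewrite exponent_half //; lra.
move=> n1 n2 h3 h4; have n10 := lt_trans nuc0 h3.
have k0 : 0 < n1 / pi by rewrite divr_gt0 ?pi_gt0.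
have lt := pin _ _ h4; have c0 := above_nucrit UFu UFoo h3; rewrite clim1 in c0.
rewrite !clim1; apply: (cc_strict UFu UFoo) => //; rewrite ?k0 ?lexx ?(ltW lt) ?lt //.
  by rewrite andbT invr_gt0.
by rewrite invf_lt1 // ltr1n.
Qed.
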